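(* Let $\sigma$ be a surface tension on a convex polygon $N$ with $\mathscr G=\emptyset$ (so $\det D^2\sigma=1$ in $N^\circ$), and let $\mathscr P\cup\mathscr Q=\{p_1,\dots,p_m\}$, listed counter-clockwise along $\partial N$. Let $W=L_\sigma(N^\circ)$ and let $\psi:\mathbb D\to W$ be a Riemann map. Then $U:=L_\sigma^{-1}\circ\psi$ is a harmonic homeomorphism of $\mathbb D$ onto $N^\circ$, and $$U(\zeta)=\sum_{j=1}^m p_j\,\omega(\zeta;I_j),\qquad \zeta\in\mathbb D,$$ where $I_1,\dots,I_m\subset\partial\mathbb D$ are pairwise disjoint open arcs whose closures cover $\partial\mathbb D$ and $\omega(\zeta;I)$ is the harmonic measure of $I$ in $\mathbb D$ at $\zeta$.
   Context: Surface tension: $N\subset\mathbb R^2\cong\mathbb C$ compact convex polygon with corners $\mathscr P$; $L:\partial N\to\mathbb R$ continuous, piecewise affine, admitting a convex extension; $\sigma$ the unique bounded convex solution of $\det D^2\sigma=1$ in $N^\circ$, $\sigma=L$ on $\partial N$ (here no gas points). $\mathscr Q$ = points of $\partial N\setminus\mathscr P$ where $L$ is not differentiable along $\partial N$. Lewy transform: $L_\sigma(z)=z+\nabla\sigma(z)$ for $z\in N^\circ$; it is a homeomorphism of $N^\circ$ onto a simply connected domain $W$. $\mathbb D$ is the unit disc. *)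

(* Defs.v *)
From Stdlib Require Import Reals List Lia.
From Coquelicot Require Import Coquelicot.
Open Scope R_scope.

Definition cross (u w : C) : R := fst u * snd w - snd u * fst w.

(** A convex polygon given by its corners [v 0, ..., v (n-1)] listed
    counter-clockwise: every other corner lies strictly to the left of the
    directed line through consecutive corners. *)
Definition nxt (n i : nat) : nat := (S i) mod n.

Definition convex_polygon (n : nat) (v : nat -> C) : Prop :=
  (3 <= n)%nat /\
  forall i j, (i < n)%nat -> (j < n)%nat -> j <> i -> j <> nxt n i ->
    0 < cross (Cminus (v (nxt n i)) (v i)) (Cminus (v j) (v i)).

(** N = intersection of the closed left half planes of the edges (= convex hull). *)
Definition polyN (n : nat) (v : nat -> C) (z : C) : Prop :=
  forall i, (i < n)%nat -> 0 <= cross (Cminus (v (nxt n i)) (v i)) (Cminus z (v i)).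

Definition polyInt (n : nat) (v : nat -> C) (z : C) : Prop :=
  forall i, (i < n)%nat -> 0 < cross (Cminus (v (nxt n i)) (v i)) (Cminus z (v i)).

Definition polyBd (n : nat) (v : nat -> C) (z : C) : Prop :=
  polyN n v z /\ ~ polyInt n v z.

Definition edge (n : nat) (v : nat -> C) (i : nat) (t : R) : C :=
  Cplus (v i) (Cmult (RtoC t) (Cminus (v (nxt n i)) (v i))).

Definition piecewise_affine_bd (n : nat) (v : nat -> C) (L : C -> R) : Prop :=
  forall i, (i < n)%nat ->
    exists (k : nat) (ts : nat -> R),
      ts O = 0 /\ ts k = 1 /\
      (forall j, (j < k)%nat -> ts j < ts (S j)) /\
      (forall j, (j < k)%nat -> exists a b : R,
          forall s, ts j <= s <= ts (S j) -> L (edge n v i s) = a + b * s).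

Definition convex_on (S : C -> Prop) (f : C -> R) : Prop :=
  forall x y t, S x -> S y -> 0 <= t <= 1 ->
    f (Cplus (Cmult (RtoC t) x) (Cmult (RtoC (1 - t)) y))
      <= t * f x + (1 - t) * f y.

Definition is_corner (n : nat) (v : nat -> C) (z : C) : Prop :=
  exists i, (i < n)%nat /\ z = v i.

Definition is_Q (n : nat) (v : nat -> C) (L : C -> R) (z : C) : Prop :=
  exists i t, (i < n)%nat /\ 0 < t < 1 /\ z = edge n v i t /\
    ~ ex_derive (fun s => L (edge n v i s)) t.

Definition dx (f : C -> R) (z : C) : R := Derive (fun t => f (t, snd z)) (fst z).
Definition dy (f : C -> R) (z : C) : R := Derive (fun t => f (fst z, t)) (snd z).

Definition has_partials (f : C -> R) (z : C) : Prop :=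
  ex_derive (fun t => f (t, snd z)) (fst z) /\ ex_derive (fun t => f (fst z, t)) (snd z).

Definition C2_on (D : C -> Prop) (f : C -> R) : Prop :=
  forall z, D z ->
    has_partials f z /\ has_partials (dx f) z /\ has_partials (dy f) z /\
    continuous f z /\ continuous (dx f) z /\ continuous (dy f) z /\
    continuous (dx (dx f)) z /\ continuous (dy (dx f)) z /\
    continuous (dx (dy f)) z /\ continuous (dy (dy f)) z.

Definition harmonic_on (D : C -> Prop) (u : C -> R) : Prop :=
  C2_on D u /\ forall z, D z -> dx (dx u) z + dy (dy u) z = 0.

Definition lewy (sigma : C -> R) (z : C) : C :=
  (fst z + dx sigma z, snd z + dy sigma z).

Definition unit_disc (z : C) : Prop := Cmod z < 1.

Definition expi (t : R) : C := (cos t, sin t).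

Definition open_arc (a b : R) (z : C) : Prop := exists t, a < t < b /\ z = expi t.
Definition closed_arc (a b : R) (z : C) : Prop := exists t, a <= t <= b /\ z = expi t.

(** harmonic measure in D at zeta of the arc {e^{it} : a < t < b}
    (Poisson integral of its indicator) *)
Definition harm_measure (zeta : C) (a b : R) : R :=
  / (2 * PI) * RInt (fun t => (1 - Cmod zeta ^ 2) / (Cmod (Cminus (expi t) zeta)) ^ 2) a b.

Definition rsum (m : nat) (f : nat -> R) : R :=
  fold_right Rplus 0 (map f (seq 0 m)).

Definition holomorphic_on (D : C -> Prop) (f : C -> C) : Prop :=
  forall z, D z -> ex_derive (K := C_AbsRing) (V := C_NormedModule) f z.

(* Main.v *)
Require Import Defs.
From Stdlib Require Import Reals List Lra Lia ClassicalEpsilon ZArith Permutation.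
From Coquelicot Require Import Coquelicot.
Open Scope R_scope.

(** Write [G = grad sigma].  Since [det D^2 sigma = 1], in the coordinate [psi = U + G(U)] the function
    [conj (U - G(U))] is holomorphic, so [U] is harmonic, the harmonic conjugate of the component of [U] across an
    edge being the component of [G(U)] along it.

    Where the boundary data are affine, a quadratic barrier shows that the normal slope of [sigma] is infinite.
    So, for [w] far along the normal direction, the minimiser of [|z|^2/2 + sigma - <w, z>] is interior, hence
    solves [z + G(z) = w], and tends to the given boundary point; Borel-Caratheodory estimates along this path show
    that [V = U^-1] has a limit on the circle there, locally constant along the edge.  Each affine piece of the
    boundary is thus collapsed to one point of the circle; away from these finitely many points [U] has boundary
    limits in [P u Q], and Poisson's formula represents [U] by the harmonic measures of the arcs between them.

    Conversely each [p k] is the value on some arc: otherwise [V] would tend to a single point of the circle at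
    [p k], near which only the two adjacent arcs count.  At a corner both edge functionals then vanish on the value
    of an adjacent arc, which is therefore the corner itself; at a kink [U] would approach the edge at linear speed,
    so that the tangential slope, being a harmonic conjugate, would be continuous across the kink.  Counting arcs,
    the correspondence between arcs and points [p k] is a bijection. *)

(** The domain [W] is unbounded and nothing is known beforehand about its boundary, so boundary
    values of [psi] cannot be quoted; limits are sought on the side of the polygon, for [V], where
    convexity of [sigma] gives explicit control. What makes the path land is summability: Harnack's
    inequality bounds [1 - |V|] by a multiple of the height above the edge, the heights along the
    path are controlled by the increments of a bounded monotone function, and Borel-Caratheodory
    bounds a step of [V] by [1 - |V|]. Limits of [U] follow by compactness: at a point of the circle
    hit by no affine piece the cluster values of [U] lie in a finite set, and connectedness leaves
    one of them. This alone does not exclude that two affine pieces collapse to the same circle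
    point, or that one [p k] is the value on two arcs. Since every piece starts at exactly one
    [p j], there are at most [m] exceptional points, hence at most [m] arcs; once all [m] values are
    known to occur, both accidents are excluded together. *)

Lemma Ceq (z w : C) : fst z = fst w -> snd z = snd w -> z = w.
Proof. destruct z, w; simpl; intros; subst; reflexivity. Qed.

Lemma Cmod_le_sum (z : C) : Cmod z <= Rabs (fst z) + Rabs (snd z).
Proof.
  replace z with ((RtoC (fst z)) + (Ci * RtoC (snd z)))%C at 1
    by (apply Ceq; simpl; ring).
  eapply Rle_trans; [apply Cmod_triangle|].
  rewrite Cmod_mult, Cmod_Ci, !Cmod_R; lra.
Qed.

Lemma fst_le_Cmod (z : C) : Rabs (fst z) <= Cmod z.
Proof. eapply Rle_trans; [apply Rmax_l|apply Rmax_Cmod]. Qed.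

Lemma snd_le_Cmod (z : C) : Rabs (snd z) <= Cmod z.
Proof. eapply Rle_trans; [apply Rmax_r|apply Rmax_Cmod]. Qed.

Lemma Cmod_sqr (z : C) : Cmod z ^ 2 = fst z ^ 2 + snd z ^ 2.
Proof. apply Cmod2_alt. Qed.

Lemma Cmod_minus_sym (z w : C) : Cmod (z - w) = Cmod (w - z).
Proof. rewrite <- Cmod_opp. f_equal. ring. Qed.

Lemma Cmod_dist_triangle (x y z : C) : Cmod (x - z) <= Cmod (x - y) + Cmod (y - z).
Proof. replace (x - z)%C with ((x - y) + (y - z))%C by ring. apply Cmod_triangle. Qed.

Lemma Cmod_triangle_sub (x y : C) : Cmod x - Cmod y <= Cmod (x - y).
Proof.
  pose proof (Cmod_triangle (x - y) y). replace (x - y + y)%C with x in H by ring. lra.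
Qed.

Lemma Cmod_expi (t : R) : Cmod (expi t) = 1.
Proof.
  assert (H : Cmod (expi t) ^ 2 = 1).
  { rewrite Cmod_sqr; simpl. pose proof (sin2_cos2 t). unfold Rsqr in H. lra. }
  pose proof (Cmod_ge_0 (expi t)). nra.
Qed.

Lemma expi_neq0 (t : R) : expi t <> 0%C.
Proof. intros H. pose proof (Cmod_expi t). rewrite H, Cmod_0 in H0. lra. Qed.

Lemma Cminus_neq0 (a b : C) : Cmod b < Cmod a -> (a - b)%C <> 0%C.
Proof.
  intros H E. replace a with ((a - b) + b)%C in H by ring.
  rewrite E, Cplus_0_l in H. lra.
Qed.

(** ** Limits and complex derivatives *)

(** The point [c] is not excluded: inside [D] the definition forces [l = f c] and is continuity
    relative to [D]; outside [D] it is a boundary limit, the case of [U] on the circle and of [V] on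
    the boundary of the polygon. *)
Definition ctends (D : C -> Prop) (f : C -> C) (c l : C) : Prop :=
  forall eps, 0 < eps -> exists del, 0 < del /\
    forall z, D z -> Cmod (z - c) < del -> Cmod (f z - l) < eps.

Definition ccont (f : C -> C) (z : C) : Prop := ctends (fun _ => True) f z (f z).

Lemma ctends_const D a c : ctends D (fun _ => a) c a.
Proof. intros e He. exists 1. split; [lra|]. intros. replace (a - a)%C with (RtoC 0) by ring. rewrite Cmod_0. exact He. Qed.

Lemma ctends_id D c : ctends D (fun z => z) c c.
Proof. intros e He. exists e. auto. Qed.

Lemma ctends_plus D f g c a b :
  ctends D f c a -> ctends D g c b -> ctends D (fun z => f z + g z)%C c (a + b)%C.
Proof.
  intros Hf Hg e He.
  destruct (Hf (e/2)) as [d1 [Hd1 H1]]; [lra|]. destruct (Hg (e/2)) as [d2 [Hd2 H2]]; [lra|].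
  exists (Rmin d1 d2). split; [apply Rmin_pos; lra|]. intros z Hz Hzc.
  pose proof (Rmin_l d1 d2); pose proof (Rmin_r d1 d2).
  specialize (H1 z Hz ltac:(lra)). specialize (H2 z Hz ltac:(lra)).
  replace (f z + g z - (a + b))%C with ((f z - a) + (g z - b))%C by ring.
  pose proof (Cmod_triangle (f z - a) (g z - b)). lra.
Qed.

Lemma ctends_mult D f g c a b :
  ctends D f c a -> ctends D g c b -> ctends D (fun z => f z * g z)%C c (a * b)%C.
Proof.
  intros Hf Hg e He.
  set (M := Cmod a + Cmod b + 1).
  pose proof (Cmod_ge_0 a). pose proof (Cmod_ge_0 b).
  assert (HM : 0 < M) by (unfold M; lra).
  set (e1 := Rmin 1 (e / (2 * M))).
  assert (He1 : 0 < e1) by (apply Rmin_pos; [lra|apply Rdiv_lt_0_compat; lra]).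
  destruct (Hf e1 He1) as [d1 [Hd1 H1]]. destruct (Hg e1 He1) as [d2 [Hd2 H2]].
  exists (Rmin d1 d2). split; [apply Rmin_pos; lra|]. intros z Hz Hzc.
  pose proof (Rmin_l d1 d2); pose proof (Rmin_r d1 d2).
  specialize (H1 z Hz ltac:(lra)). specialize (H2 z Hz ltac:(lra)).
  replace (f z * g z - a * b)%C with ((f z - a) * (g z - b) + (f z - a) * b + a * (g z - b))%C by ring.
  pose proof (Cmod_triangle ((f z - a) * (g z - b) + (f z - a) * b) (a * (g z - b))).
  pose proof (Cmod_triangle ((f z - a) * (g z - b)) ((f z - a) * b)).
  rewrite !Cmod_mult in *.
  pose proof (Cmod_ge_0 (f z - a)). pose proof (Cmod_ge_0 (g z - b)).
  pose proof (Rmin_l 1 (e / (2*M))) as L1. pose proof (Rmin_r 1 (e / (2*M))) as L2.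
  fold e1 in L1, L2.
  assert (e1 * (2 * M) <= e).
  { apply Rle_trans with (e / (2*M) * (2 * M)); [apply Rmult_le_compat_r; lra|right; field; lra]. }
  unfold M in *. nra.
Qed.

Lemma ctends_inv D f (c a : C) :
  a <> 0%C -> ctends D f c a -> ctends D (fun z => / f z)%C c (/ a)%C.
Proof.
  intros Ha Hf e He.
  pose proof (proj1 (Cmod_gt_0 a) Ha) as Ha'.
  set (m := Cmod a) in *.
  set (e1 := Rmin (m/2) (e * m * m / 4)).
  assert (0 < e * m * m) by (apply Rmult_lt_0_compat; [apply Rmult_lt_0_compat|]; lra).
  assert (He1 : 0 < e1) by (apply Rmin_pos; lra).
  destruct (Hf e1 He1) as [d1 [Hd1 H1]].
  exists d1. split; [lra|]. intros z Hz Hzc. specialize (H1 z Hz Hzc).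
  pose proof (Rmin_l (m/2) (e*m*m/4)) as L1. pose proof (Rmin_r (m/2) (e*m*m/4)) as L2.
  fold e1 in L1, L2.
  pose proof (Cmod_triangle_sub a (f z)) as L3. rewrite Cmod_minus_sym in L3. fold m in L3.
  assert (Hfz : f z <> 0%C) by (apply Cmod_gt_0; lra).
  replace (/ f z - / a)%C with (- (f z - a) * (/ f z * / a))%C by (field; auto).
  rewrite Cmod_mult, Cmod_opp, Cmod_mult, !Cmod_inv by auto. fold m.
  set (p := Cmod (f z)) in *.
  assert (/ p <= 2 / m).
  { unfold Rdiv. replace (2 * / m) with (/ (m / 2)) by (field; lra). apply Rinv_le_contravar; lra. }
  assert (0 < / p) by (apply Rinv_0_lt_compat; lra).
  assert (0 < / m) by (apply Rinv_0_lt_compat; lra).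
  apply Rlt_le_trans with (e * m * m / 4 * (/ p * / m)).
  - apply Rmult_lt_compat_r; [apply Rmult_lt_0_compat; lra|lra].
  - apply Rle_trans with (e * m * m / 4 * (2 / m * / m)).
    + apply Rmult_le_compat_l; [lra|]. apply Rmult_le_compat_r; lra.
    + replace (e * m * m / 4 * (2 / m * / m)) with (e/2) by (field; lra). lra.
Qed.

Lemma ctends_comp D E f g c a b :
  (forall z, D z -> E (g z)) -> ctends D g c a -> ctends E f a b -> ctends D (fun z => f (g z)) c b.
Proof.
  intros HDE Hg Hf e He. destruct (Hf e He) as [d [Hd H]]. destruct (Hg d Hd) as [d' [Hd' H']].
  exists d'. split; auto.
Qed.

Lemma ctends_ext_loc D f g c l r : 0 < r ->
  (forall z, D z -> Cmod (z - c) < r -> f z = g z) -> ctends D f c l -> ctends D g c l.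
Proof.
  intros Hr Heq Hf e He. destruct (Hf e He) as [d [Hd H]].
  exists (Rmin d r). split; [apply Rmin_pos; lra|]. intros z Dz Hz.
  pose proof (Rmin_l d r). pose proof (Rmin_r d r).
  rewrite <- Heq; [apply H|..]; auto; lra.
Qed.

(* Caratheodory's form: the difference quotient extends continuously by [l]. *)
Definition cder (F : C -> C) (z l : C) : Prop :=
  exists Q : C -> C, Q z = l /\ ccont Q z /\ forall u, F u = (F z + Q u * (u - z))%C.

(** The factorisation in [cder] is demanded at every [u]; off the ball the difference quotient
    supplies it, and continuity of the slope function at [z] does not see the change. *)
Lemma cder_loc F z l r Q : 0 < r -> Q z = l -> ccont Q z ->
  (forall u, Cmod (u - z) < r -> F u = (F z + Q u * (u - z))%C) -> cder F z l.
Proof.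
  intros Hr HQ Hc Hu.
  exists (fun u => if Rlt_dec (Cmod (u - z)) r then Q u else ((F u - F z) / (u - z))%C).
  assert (Z : Cmod (z - z) < r) by (replace (z - z)%C with (RtoC 0) by ring; rewrite Cmod_0; lra).
  split; [|split].
  - destruct (Rlt_dec _ r); [auto|lra].
  - unfold ccont. destruct (Rlt_dec (Cmod (z - z)) r) as [_|]; [|lra].
    apply ctends_ext_loc with (f := Q) (r := r); auto.
    intros u _ Hu'. destruct (Rlt_dec _ r); [auto|lra].
  - intros u. destruct (Rlt_dec _ r); [auto|].
    field. intros E. apply n. rewrite E, Cmod_0. exact Hr.
Qed.

Lemma cder_eps F z l :
  cder F z l <-> (forall eps, 0 < eps -> exists del, 0 < del /\ forall u, Cmod (u - z) < del ->
     Cmod (F u - F z - l * (u - z)) <= eps * Cmod (u - z)).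
Proof.
  split.
  - intros [Q [HQ [Hc Hu]]] e He. destruct (Hc e He) as [d [Hd H]]. exists d. split; auto.
    intros u Hz. rewrite (Hu u). replace (F z + Q u * (u - z) - F z - l * (u - z))%C with ((Q u - l) * (u - z))%C by ring.
    rewrite Cmod_mult. apply Rmult_le_compat_r; [apply Cmod_ge_0|]. rewrite <- HQ. left. apply H; auto.
  - intros H.
    exists (fun u => if Req_EM_T (Cmod (u - z)) 0 then l else ((F u - F z) / (u - z))%C).
    assert (Z : Cmod (z - z) = 0) by (replace (z - z)%C with (RtoC 0) by ring; apply Cmod_0).
    split; [|split].
    + destruct (Req_EM_T _ 0); [auto|lra].
    + unfold ccont. destruct (Req_EM_T (Cmod (z - z)) 0) as [_|]; [|lra].
      intros e He. destruct (H (e/2)) as [d [Hd H']]; [lra|]. exists d. split; auto.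
      intros u _ Hu. destruct (Req_EM_T _ 0).
      { replace (l - l)%C with (RtoC 0) by ring. rewrite Cmod_0. auto. }
      specialize (H' u Hu).
      assert (Hn : (u - z)%C <> 0%C) by (intros E; apply n; rewrite E; apply Cmod_0).
      replace ((F u - F z) / (u - z) - l)%C with ((F u - F z - l * (u - z)) / (u - z))%C by (field; auto).
      rewrite Cmod_div by auto. apply (proj1 (Cmod_gt_0 _)) in Hn.
      apply Rle_lt_trans with (e/2); [|lra].
      apply Rmult_le_reg_r with (Cmod (u - z)); [auto|]. unfold Rdiv. rewrite Rmult_assoc, Rinv_l by lra. lra.
    + intros u. destruct (Req_EM_T _ 0).
      * apply Cmod_eq_0 in e. assert (u = z) by (replace u with ((u - z) + z)%C by ring; rewrite e; ring).
        subst; ring.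
      * field. intros E. apply n. rewrite E. apply Cmod_0.
Qed.

Lemma cder_cont F z l : cder F z l -> ccont F z.
Proof.
  intros [Q [HQ [Hc Hu]]]. unfold ccont.
  apply ctends_ext_loc with (f := fun u => (F z + Q u * (u - z))%C) (r := 1); [lra|auto|].
  assert (E : ctends (fun _ => True) (fun u => (F z + Q u * (u + - z))%C) z (F z + Q z * (z + - z))%C).
  2:{ replace (F z + Q z * (z + - z))%C with (F z) in E by ring. exact E. }
  apply ctends_plus; [apply ctends_const|]. apply ctends_mult; auto.
  apply ctends_plus; [apply ctends_id|apply ctends_const].
Qed.

Lemma cder_const a z : cder (fun _ => a) z 0%C.
Proof. exists (fun _ => 0%C). split; [auto|split]. apply ctends_const. intros; ring. Qed.

Lemma cder_id z : cder (fun u => u) z 1%C.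
Proof. exists (fun _ => 1%C). split; [auto|split]. apply ctends_const. intros; ring. Qed.

Lemma cder_plus F G z a b : cder F z a -> cder G z b -> cder (fun u => F u + G u)%C z (a + b)%C.
Proof.
  intros [Q [HQ [Hc Hu]]] [Q' [HQ' [Hc' Hu']]].
  exists (fun u => Q u + Q' u)%C. split; [congruence|split].
  - apply ctends_plus; auto.
  - intros u. rewrite (Hu u), (Hu' u). ring.
Qed.

Lemma cder_mult F G z a b :
  cder F z a -> cder G z b -> cder (fun u => F u * G u)%C z (a * G z + F z * b)%C.
Proof.
  intros HF [Q' [HQ' [Hc' Hu']]]. pose proof (cder_cont _ _ _ HF) as HFc.
  destruct HF as [Q [HQ [Hc Hu]]].
  exists (fun u => Q u * G z + F u * Q' u)%C. split; [congruence|split].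
  - apply ctends_plus; apply ctends_mult; auto. apply ctends_const.
  - intros u. rewrite (Hu' u). rewrite (Hu u). ring.
Qed.

Lemma cder_scal F z a c : cder F z a -> cder (fun u => c * F u)%C z (c * a)%C.
Proof.
  intros H. pose proof (cder_mult _ _ _ _ _ (cder_const c z) H) as H'. simpl in H'.
  replace (c * a)%C with (0 * F z + c * a)%C by ring. exact H'.
Qed.

Lemma cder_comp F G z a b : cder F (G z) a -> cder G z b -> cder (fun u => F (G u)) z (a * b)%C.
Proof.
  intros [Q [HQ [Hc Hu]]] HG. pose proof (cder_cont _ _ _ HG) as HGc.
  destruct HG as [Q' [HQ' [Hc' Hu']]].
  exists (fun u => Q (G u) * Q' u)%C. split; [congruence|split].
  - apply ctends_mult; auto. eapply ctends_comp; [|exact HGc|exact Hc]; auto.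
  - intros u. rewrite (Hu (G u)), (Hu' u) at 1. ring_simplify. rewrite (Hu' u). ring.
Qed.

Lemma cder_ext_loc F G z a r : 0 < r -> (forall u, Cmod (u - z) < r -> F u = G u) ->
  cder F z a -> cder G z a.
Proof.
  intros Hr Heq [Q [HQ [Hc Hu]]]. apply cder_loc with (r := r) (Q := Q); auto.
  intros u H. rewrite <- Heq by auto. rewrite <- Heq; auto.
  replace (z - z)%C with (RtoC 0) by ring. rewrite Cmod_0. exact Hr.
Qed.

Lemma cder_Cinv (z : C) : z <> 0%C -> cder (fun u => / u)%C z (- / (z * z))%C.
Proof.
  intros Hz. pose proof (proj1 (Cmod_gt_0 z) Hz) as Hz'.
  apply cder_loc with (r := Cmod z) (Q := fun u => (- (/ u * / z))%C); auto.
  - field; auto.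
  - unfold ccont.
    apply ctends_ext_loc with (f := fun u => (-(1) * (/ u * / z))%C) (r := 1); [lra|intros; ring|].
    replace (- (/ z * / z))%C with (-(1) * (/ z * / z))%C by ring.
    cbv beta. apply ctends_mult; [apply ctends_const|]. apply ctends_mult; [|apply ctends_const].
    apply ctends_inv; auto. apply ctends_id.
  - intros u Hu. assert (u <> 0%C).
    { apply Cmod_gt_0. pose proof (Cmod_triangle_sub z u). rewrite Cmod_minus_sym in H. lra. }
    field; auto.
Qed.

Lemma cder_inv (F : C -> C) (z a : C) : F z <> 0%C -> cder F z a -> cder (fun u => / F u)%C z (- / (F z * F z) * a)%C.
Proof. intros H HF. apply (cder_comp (fun u => / u)%C F); auto. apply cder_Cinv; auto. Qed.

Lemma cder_unique F z a b : cder F z a -> cder F z b -> a = b.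
Proof.
  intros Ha Hb. rewrite cder_eps in Ha, Hb.
  destruct (Req_dec (Cmod (a - b)) 0) as [E|E].
  { apply Cmod_eq_0 in E. replace a with ((a - b) + b)%C by ring. rewrite E; ring. }
  exfalso. pose proof (Cmod_ge_0 (a - b)).
  set (e := Cmod (a - b) / 3).
  destruct (Ha e) as [d1 [Hd1 H1]]; [unfold e; lra|]. destruct (Hb e) as [d2 [Hd2 H2]]; [unfold e; lra|].
  set (h := Rmin d1 d2 / 2). assert (Hm : 0 < Rmin d1 d2) by (apply Rmin_pos; auto).
  pose proof (Rmin_l d1 d2). pose proof (Rmin_r d1 d2).
  assert (Hh : Cmod (z + RtoC h - z) = h).
  { replace (z + RtoC h - z)%C with (RtoC h) by ring. rewrite Cmod_R. apply Rabs_pos_eq. unfold h; lra. }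
  specialize (H1 (z + RtoC h)%C). specialize (H2 (z + RtoC h)%C). rewrite Hh in H1, H2.
  specialize (H1 ltac:(unfold h; lra)). specialize (H2 ltac:(unfold h; lra)).
  assert (Cmod ((a - b) * RtoC h) <= 2 * e * h).
  { replace ((a - b) * RtoC h)%C with
      ((F (z + RtoC h) - F z - b * (z + RtoC h - z)) - (F (z + RtoC h) - F z - a * (z + RtoC h - z)))%C by ring.
    unfold Cminus at 1. eapply Rle_trans; [apply Cmod_triangle|]. rewrite Cmod_opp. lra. }
  rewrite Cmod_mult, Cmod_R, Rabs_pos_eq in H4 by (unfold h; lra).
  assert (0 < h) by (unfold h; lra). unfold e in *. nra.
Qed.

Lemma ex_derive_cder (F : C -> C) (z : C) :
  ex_derive (K := C_AbsRing) (V := C_NormedModule) F z -> exists l, cder F z l.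
Proof.
  intros [l [_ H]]. exists l. apply cder_eps. intros e He.
  specialize (H z (fun P HP => HP) (mkposreal e He)).
  destruct H as [d Hd]. exists d. split; [apply cond_pos|]. intros u Hu.
  specialize (Hd u Hu). simpl in Hd.
  change (Cmod (F u - F z - (u - z) * l) <= e * Cmod (u - z)) in Hd.
  replace (l * (u - z))%C with ((u - z) * l)%C by ring. exact Hd.
Qed.

(** ** Integrals of complex-valued functions of a real variable *)

Lemma continuous_eps (f : R -> R) (t : R) :
  continuous f t <-> (forall eps, 0 < eps -> exists del, 0 < del /\
    forall s, Rabs (s - t) < del -> Rabs (f s - f t) < eps).
Proof.
  split.
  - intros H e He. apply filterlim_locally with (eps := mkposreal e He) in H.
    destruct H as [d Hd]. exists d. split; [apply cond_pos|]. intros s Hs. apply (Hd s). exact Hs.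
  - intros H. apply filterlim_locally. intros [e He]. destruct (H e He) as [d [Hd H']].
    exists (mkposreal d Hd). intros s Hs. apply H'. exact Hs.
Qed.

(** Componentwise, like [cint], so that real Riemann integration applies to each coordinate;
    [pcont_eps] recovers the metric form. *)
Definition pcont (f : R -> C) (t : R) : Prop :=
  continuous (fun s => fst (f s)) t /\ continuous (fun s => snd (f s)) t.

Definition pder (f : R -> C) (t : R) (l : C) : Prop :=
  is_derive (fun s => fst (f s)) t (fst l) /\ is_derive (fun s => snd (f s)) t (snd l).

Lemma pcont_eps (f : R -> C) (t : R) :
  pcont f t <-> (forall eps, 0 < eps -> exists del, 0 < del /\
    forall s, Rabs (s - t) < del -> Cmod (f s - f t) < eps).
Proof.
  split.
  - intros [H1 H2] e He. rewrite continuous_eps in H1, H2.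
    destruct (H1 (e/2)) as [d1 [Hd1 K1]]; [lra|]. destruct (H2 (e/2)) as [d2 [Hd2 K2]]; [lra|].
    exists (Rmin d1 d2). split; [apply Rmin_pos; auto|]. intros s Hs.
    pose proof (Rmin_l d1 d2). pose proof (Rmin_r d1 d2).
    specialize (K1 s ltac:(lra)). specialize (K2 s ltac:(lra)).
    eapply Rle_lt_trans; [apply Cmod_le_sum|]. simpl.
    unfold Rminus in K1, K2. lra.
  - intros H. split; apply continuous_eps; intros e He; destruct (H e He) as [d [Hd K]];
      exists d; (split; [auto|]); intros s Hs; specialize (K s Hs);
      eapply Rle_lt_trans; try exact K.
    + apply (fst_le_Cmod (f s - f t)).
    + apply (snd_le_Cmod (f s - f t)).
Qed.

Lemma pcont_const (c : C) t : pcont (fun _ => c) t.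
Proof. split; apply continuous_const. Qed.

Lemma pcont_plus f g t : pcont f t -> pcont g t -> pcont (fun s => f s + g s)%C t.
Proof.
  intros [H1 H2] [H3 H4]. split; simpl.
  - apply (continuous_plus (fun s => fst (f s)) (fun s => fst (g s))); auto.
  - apply (continuous_plus (fun s => snd (f s)) (fun s => snd (g s))); auto.
Qed.

Lemma pcont_mult f g t : pcont f t -> pcont g t -> pcont (fun s => f s * g s)%C t.
Proof.
  intros [H1 H2] [H3 H4]. split; simpl.
  - apply (continuous_minus (fun s => fst (f s) * fst (g s)) (fun s => snd (f s) * snd (g s)));
      apply (continuous_mult (K := R_AbsRing)); auto.
  - apply (continuous_plus (fun s => fst (f s) * snd (g s)) (fun s => snd (f s) * fst (g s)));
      apply (continuous_mult (K := R_AbsRing)); auto.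
Qed.

Lemma pcont_comp (K : C -> C) (f : R -> C) t : ccont K (f t) -> pcont f t -> pcont (fun s => K (f s)) t.
Proof.
  intros HK Hf. rewrite pcont_eps in *. intros e He. destruct (HK e He) as [d [Hd H]].
  destruct (Hf d Hd) as [d' [Hd' H']]. exists d'. auto.
Qed.

Lemma pcont_expi t : pcont expi t.
Proof. split; simpl; [apply continuous_cos|apply continuous_sin]. Qed.

Lemma pder_cont f t l : pder f t l -> pcont f t.
Proof.
  intros [H1 H2].
  split; apply (ex_derive_continuous (K := R_AbsRing) (V := R_NormedModule)); eexists; eassumption.
Qed.

Lemma pder_const (c : C) t : pder (fun _ => c) t 0%C.
Proof. split; apply (is_derive_const (K := R_AbsRing) (V := R_NormedModule)). Qed.

Lemma pder_plus f g t a b : pder f t a -> pder g t b -> pder (fun s => f s + g s)%C t (a + b)%C.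
Proof.
  intros [H1 H2] [H3 H4]. split; simpl.
  - apply (is_derive_plus (fun s => fst (f s)) (fun s => fst (g s))); auto.
  - apply (is_derive_plus (fun s => snd (f s)) (fun s => snd (g s))); auto.
Qed.

Lemma pder_mult f g t a b :
  pder f t a -> pder g t b -> pder (fun s => f s * g s)%C t (a * g t + f t * b)%C.
Proof.
  intros [H1 H2] [H3 H4]. split; simpl.
  - replace (fst a * fst (g t) - snd a * snd (g t) + (fst (f t) * fst b - snd (f t) * snd b)) with
      ((fst a * fst (g t) + fst (f t) * fst b) - (snd a * snd (g t) + snd (f t) * snd b)) by ring.
    apply (is_derive_minus (fun s => fst (f s) * fst (g s)) (fun s => snd (f s) * snd (g s)));
      apply (is_derive_mult (K := R_AbsRing)); auto; apply Rmult_comm.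
  - replace (fst a * snd (g t) + snd a * fst (g t) + (fst (f t) * snd b + snd (f t) * fst b)) with
      ((fst a * snd (g t) + fst (f t) * snd b) + (snd a * fst (g t) + snd (f t) * fst b)) by ring.
    apply (is_derive_plus (fun s => fst (f s) * snd (g s)) (fun s => snd (f s) * fst (g s)));
      apply (is_derive_mult (K := R_AbsRing)); auto; apply Rmult_comm.
Qed.

Definition cint (f : R -> C) (a b : R) : C :=
  (RInt (fun t => fst (f t)) a b, RInt (fun t => snd (f t)) a b).

Definition pcont_on (f : R -> C) (a b : R) : Prop := forall t, a <= t <= b -> pcont f t.

Lemma pcont_on_ex f a b : a <= b -> pcont_on f a b ->
  ex_RInt (fun t => fst (f t)) a b /\ ex_RInt (fun t => snd (f t)) a b.
Proof.
  intros Hab H. split; apply (ex_RInt_continuous (V := R_CompleteNormedModule));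
    intros z; rewrite Rmin_left, Rmax_right by auto; intros Hz; apply (H z Hz).
Qed.

Lemma cint_ext f g a b : a <= b -> (forall t, a < t < b -> f t = g t) -> cint f a b = cint g a b.
Proof.
  intros Hab H. unfold cint. f_equal; apply RInt_ext; rewrite Rmin_left, Rmax_right by auto;
    intros t Ht; rewrite H; auto.
Qed.

Lemma cint_plus f g a b : a <= b -> pcont_on f a b -> pcont_on g a b ->
  cint (fun t => f t + g t)%C a b = (cint f a b + cint g a b)%C.
Proof.
  intros Hab Hf Hg. destruct (pcont_on_ex f a b Hab Hf). destruct (pcont_on_ex g a b Hab Hg).
  apply Ceq; simpl.
  - apply (RInt_plus (fun t => fst (f t)) (fun t => fst (g t))); auto.
  - apply (RInt_plus (fun t => snd (f t)) (fun t => snd (g t))); auto.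
Qed.

Lemma cint_scal (c : C) f a b : a <= b -> pcont_on f a b ->
  cint (fun t => c * f t)%C a b = (c * cint f a b)%C.
Proof.
  intros Hab Hf. destruct (pcont_on_ex f a b Hab Hf) as [E1 E2].
  assert (S : forall (k : R) (h : R -> R), ex_RInt h a b -> RInt (fun t => k * h t) a b = k * RInt h a b).
  { intros k h Hh. apply (RInt_scal (V := R_CompleteNormedModule) h a b k Hh). }
  assert (X : forall (k : R) (h : R -> R), ex_RInt h a b -> ex_RInt (fun t => k * h t) a b).
  { intros k h Hh. apply (ex_RInt_scal (V := R_NormedModule) h a b k Hh). }
  apply Ceq; simpl.
  - rewrite <- (S _ _ E1), <- (S _ _ E2).
    apply (RInt_minus (V := R_CompleteNormedModule) (fun t => fst c * fst (f t)) (fun t => snd c * snd (f t))); auto.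
  - rewrite <- (S _ _ E1), <- (S _ _ E2).
    apply (RInt_plus (V := R_CompleteNormedModule) (fun t => fst c * snd (f t)) (fun t => snd c * fst (f t))); auto.
Qed.

Lemma cint_minus f g a b : a <= b -> pcont_on f a b -> pcont_on g a b ->
  cint (fun t => f t - g t)%C a b = (cint f a b - cint g a b)%C.
Proof.
  intros Hab Hf Hg.
  assert (Hm : pcont_on (fun t => -(1) * g t)%C a b).
  { intros t Ht. apply pcont_mult; [apply pcont_const|auto]. }
  replace (cint f a b - cint g a b)%C with (cint f a b + - (1) * cint g a b)%C by ring.
  rewrite <- cint_scal, <- cint_plus by auto. apply cint_ext; auto. intros; ring.
Qed.

Lemma cint_Chasles f a b c : a <= b -> b <= c -> pcont_on f a c ->
  cint f a c = (cint f a b + cint f b c)%C.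
Proof.
  intros Hab Hbc Hf.
  destruct (pcont_on_ex f a b) as [A1 A2]; [auto|intros t Ht; apply Hf; lra|].
  destruct (pcont_on_ex f b c) as [B1 B2]; [auto|intros t Ht; apply Hf; lra|].
  symmetry. apply Ceq; simpl.
  - apply (RInt_Chasles (V := R_CompleteNormedModule) (fun t => fst (f t))); auto.
  - apply (RInt_Chasles (V := R_CompleteNormedModule) (fun t => snd (f t))); auto.
Qed.

(** The factor 2 is the price of estimating the two components separately. *)
Lemma cint_bound f a b M : a <= b -> pcont_on f a b -> (forall t, a <= t <= b -> Cmod (f t) <= M) ->
  Cmod (cint f a b) <= 2 * M * (b - a).
Proof.
  intros Hab Hf HM. destruct (pcont_on_ex f a b Hab Hf).
  eapply Rle_trans; [apply Cmod_le_sum|]. simpl.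
  assert (Rabs (RInt (fun t => fst (f t)) a b) <= (b - a) * M).
  { apply abs_RInt_le_const; auto. intros t Ht. eapply Rle_trans; [apply fst_le_Cmod|auto]. }
  assert (Rabs (RInt (fun t => snd (f t)) a b) <= (b - a) * M).
  { apply abs_RInt_le_const; auto. intros t Ht. eapply Rle_trans; [apply snd_le_Cmod|auto]. }
  lra.
Qed.

Lemma cint_deriv f df a b : a <= b -> (forall t, a <= t <= b -> pder f t (df t)) -> pcont_on df a b ->
  cint df a b = (f b - f a)%C.
Proof.
  intros Hab Hd Hc. apply Ceq; simpl; apply is_RInt_unique.
  - apply (is_RInt_derive (V := R_CompleteNormedModule) (fun t => fst (f t)) (fun t => fst (df t)));
      rewrite Rmin_left, Rmax_right by auto; intros t Ht; [apply Hd|apply Hc]; auto.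
  - apply (is_RInt_derive (V := R_CompleteNormedModule) (fun t => snd (f t)) (fun t => snd (df t)));
      rewrite Rmin_left, Rmax_right by auto; intros t Ht; [apply Hd|apply Hc]; auto.
Qed.

Lemma cint_const (c : C) a b : cint (fun _ => c) a b = (c * RtoC (b - a))%C.
Proof.
  unfold cint. rewrite !RInt_const. apply Ceq; simpl; unfold scal; simpl; unfold mult; simpl; ring.
Qed.

(** ** Goursat's lemma for a parametrised rectangle *)

Section Goursat.
Variables (K : C -> C) (G Gs Gt : R -> R -> C) (a0 b0 c0 d0 M : R).
Definition in_rect (a b c d s t : R) : Prop := a <= s <= b /\ c <= t <= d.
Hypothesis HK : forall s t, in_rect a0 b0 c0 d0 s t -> exists l, cder K (G s t) l.
Hypothesis HGs : forall s t, in_rect a0 b0 c0 d0 s t -> pder (fun s => G s t) s (Gs s t).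
Hypothesis HGt : forall s t, in_rect a0 b0 c0 d0 s t -> pder (fun t => G s t) t (Gt s t).
Hypothesis HGsc : forall s t, in_rect a0 b0 c0 d0 s t -> pcont (fun s => Gs s t) s.
Hypothesis HGtc : forall s t, in_rect a0 b0 c0 d0 s t -> pcont (fun t => Gt s t) t.
Hypothesis HGsM : forall s t, in_rect a0 b0 c0 d0 s t -> Cmod (Gs s t) <= M.
Hypothesis HGtM : forall s t, in_rect a0 b0 c0 d0 s t -> Cmod (Gt s t) <= M.
Hypothesis HGL : forall s t s' t', in_rect a0 b0 c0 d0 s t -> in_rect a0 b0 c0 d0 s' t' ->
  Cmod (G s t - G s' t') <= M * (Rabs (s - s') + Rabs (t - t')).
Hypothesis HM : 0 < M.

(** Boundary integral over the image of a parameter rectangle under [G]. Since [G] may identify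
    points, the rectangle can be wrapped around an annulus, two of its sides then cancelling. *)
Definition loop (k : C -> C) (a b c d : R) : C :=
  (cint (fun s => k (G s c) * Gs s c) a b + cint (fun t => k (G b t) * Gt b t) c d
   - cint (fun s => k (G s d) * Gs s d) a b - cint (fun t => k (G a t) * Gt a t) c d)%C.

Definition sub_rect (a b c d : R) : Prop := a0 <= a /\ a <= b /\ b <= b0 /\ c0 <= c /\ c <= d /\ d <= d0.

Definition nice (k : C -> C) : Prop := forall s t, in_rect a0 b0 c0 d0 s t -> ccont k (G s t).

Lemma pcont_on_s k a b c d t : nice k -> sub_rect a b c d -> c <= t <= d ->
  pcont_on (fun s => k (G s t) * Gs s t)%C a b.
Proof.
  intros Hk [? [? [? [? [? ?]]]]] Ht s Hs.
  assert (I : in_rect a0 b0 c0 d0 s t) by (split; lra).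
  apply pcont_mult; auto. apply pcont_comp; auto. eapply pder_cont; eauto.
Qed.

Lemma pcont_on_t k a b c d s : nice k -> sub_rect a b c d -> a <= s <= b ->
  pcont_on (fun t => k (G s t) * Gt s t)%C c d.
Proof.
  intros Hk [? [? [? [? [? ?]]]]] Hs t Ht.
  assert (I : in_rect a0 b0 c0 d0 s t) by (split; lra).
  apply pcont_mult; auto. apply pcont_comp; auto. eapply pder_cont; eauto.
Qed.

Lemma loop_split_s k a m b c d : nice k -> sub_rect a b c d -> a <= m <= b ->
  loop k a b c d = (loop k a m c d + loop k m b c d)%C.
Proof.
  intros Hk HR Hm. unfold loop. pose proof HR as [? [? [? [? [? ?]]]]].
  rewrite (cint_Chasles (fun s => k (G s c) * Gs s c)%C a m b) by (try (eapply pcont_on_s; eauto); lra).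
  rewrite (cint_Chasles (fun s => k (G s d) * Gs s d)%C a m b) by (try (eapply pcont_on_s; eauto); lra).
  ring.
Qed.

Lemma loop_split_t k a b c m d : nice k -> sub_rect a b c d -> c <= m <= d ->
  loop k a b c d = (loop k a b c m + loop k a b m d)%C.
Proof.
  intros Hk HR Hm. unfold loop. pose proof HR as [? [? [? [? [? ?]]]]].
  rewrite (cint_Chasles (fun t => k (G b t) * Gt b t)%C c m d) by (try (eapply pcont_on_t; eauto); lra).
  rewrite (cint_Chasles (fun t => k (G a t) * Gt a t)%C c m d) by (try (eapply pcont_on_t; eauto); lra).
  ring.
Qed.

Lemma loop_minus k1 k2 a b c d : nice k1 -> nice k2 -> sub_rect a b c d ->
  loop (fun u => k1 u - k2 u)%C a b c d = (loop k1 a b c d - loop k2 a b c d)%C.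
Proof.
  intros H1 H2 HR. unfold loop. pose proof HR as [? [? [? [? [? ?]]]]].
  assert (CS : forall t, c <= t <= d -> cint (fun s => (k1 (G s t) - k2 (G s t)) * Gs s t)%C a b =
    (cint (fun s => k1 (G s t) * Gs s t) a b - cint (fun s => k2 (G s t) * Gs s t) a b)%C).
  { intros t Ht. rewrite <- cint_minus; [apply cint_ext; auto; intros; ring|auto|..];
      apply (pcont_on_s _ a b c d); auto. }
  assert (CT : forall s, a <= s <= b -> cint (fun t => (k1 (G s t) - k2 (G s t)) * Gt s t)%C c d =
    (cint (fun t => k1 (G s t) * Gt s t) c d - cint (fun t => k2 (G s t) * Gt s t) c d)%C).
  { intros s Hs. rewrite <- cint_minus; [apply cint_ext; auto; intros; ring|auto|..];
      apply (pcont_on_t _ a b c d); auto. }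
  rewrite (CS c), (CS d), (CT a), (CT b) by lra.
  ring.
Qed.

Lemma loop_bound k a b c d B : nice k -> sub_rect a b c d ->
  (forall s t, in_rect a b c d s t -> Cmod (k (G s t)) <= B) ->
  Cmod (loop k a b c d) <= 4 * B * M * ((b - a) + (d - c)).
Proof.
  intros Hk HR HB. pose proof HR as [? [? [? [? [? ?]]]]]. unfold loop.
  assert (S : forall t, c <= t <= d -> Cmod (cint (fun s => k (G s t) * Gs s t) a b)%C <= 2 * (B * M) * (b - a)).
  { intros t Ht. apply cint_bound; [auto|eapply pcont_on_s; eauto|]. intros s Hs. rewrite Cmod_mult.
    apply Rmult_le_compat; try apply Cmod_ge_0; [apply HB; split; lra|apply HGsM; split; lra]. }
  assert (T : forall s, a <= s <= b -> Cmod (cint (fun t => k (G s t) * Gt s t) c d)%C <= 2 * (B * M) * (d - c)).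
  { intros s Hs. apply cint_bound; [auto|eapply pcont_on_t; eauto|]. intros t Ht. rewrite Cmod_mult.
    apply Rmult_le_compat; try apply Cmod_ge_0; [apply HB; split; lra|apply HGtM; split; lra]. }
  set (x1 := cint (fun s => k (G s c) * Gs s c)%C a b). set (x2 := cint (fun t => k (G b t) * Gt b t)%C c d).
  set (x3 := cint (fun s => k (G s d) * Gs s d)%C a b). set (x4 := cint (fun t => k (G a t) * Gt a t)%C c d).
  pose proof (S c ltac:(lra)) as S1. pose proof (S d ltac:(lra)) as S2.
  pose proof (T a ltac:(lra)) as T1. pose proof (T b ltac:(lra)) as T2.
  fold x1 in S1. fold x3 in S2. fold x4 in T1. fold x2 in T2.
  pose proof (Cmod_triangle (x1 + x2 + - x3) (- x4)) as U1.
  pose proof (Cmod_triangle (x1 + x2) (- x3)) as U2.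
  pose proof (Cmod_triangle x1 x2) as U3. rewrite Cmod_opp in U1, U2.
  unfold Cminus. lra.
Qed.

(** The integrand has the explicit primitive [P], and the four differences of [P] between the
    vertices cancel. *)
Lemma loop_affine (k0 l u0 : C) a b c d : sub_rect a b c d ->
  loop (fun u => k0 + l * (u - u0))%C a b c d = 0%C.
Proof.
  intros HR. pose proof HR as [? [? [? [? [? ?]]]]]. unfold loop.
  set (P := fun u => (k0 * u + l / 2 * ((u - u0) * (u - u0)))%C).
  assert (N : nice (fun u => k0 + l * (u - u0))%C).
  { intros s t _. apply (cder_cont _ _ (0 + l * (1 + 0))%C).
    apply cder_plus; [apply cder_const|]. apply cder_scal.
    apply (cder_plus (fun u => u) (fun _ => - u0)%C); [apply cder_id|apply cder_const]. }
  assert (D : forall (g : R -> C) t l', pder g t l' ->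
     pder (fun t => P (g t)) t ((k0 + l * (g t - u0)) * l')%C).
  { intros g t l' Hg. unfold P.
    replace ((k0 + l * (g t - u0)) * l')%C with
      ((0 * g t + k0 * l') + (0 * ((g t + - u0) * (g t + - u0)) +
        l / 2 * ((l' + 0) * (g t + - u0) + (g t + - u0) * (l' + 0))))%C
      by (field; intros E; apply (f_equal fst) in E; simpl in E; lra).
    apply pder_plus; (apply pder_mult; [apply pder_const|]); auto.
    apply pder_mult; apply pder_plus; auto; apply pder_const. }
  assert (CS : forall t, c <= t <= d ->
    cint (fun s => (k0 + l * (G s t - u0)) * Gs s t)%C a b = (P (G b t) - P (G a t))%C).
  { intros t Ht. apply (cint_deriv (fun s => P (G s t))); [auto| |].
    - intros s Hs. apply (D (fun s => G s t)). apply HGs. split; lra.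
    - apply (pcont_on_s (fun u => k0 + l * (u - u0))%C a b c d t N HR Ht). }
  assert (CT : forall s, a <= s <= b ->
    cint (fun t => (k0 + l * (G s t - u0)) * Gt s t)%C c d = (P (G s d) - P (G s c))%C).
  { intros s Hs. apply (cint_deriv (fun t => P (G s t))); [auto| |].
    - intros t Ht. apply (D (fun t => G s t)). apply HGt. split; lra.
    - apply (pcont_on_t (fun u => k0 + l * (u - u0))%C a b c d s N HR Hs). }
  rewrite (CS c), (CS d), (CT a), (CT b) by lra.
  ring.
Qed.

Lemma niceK : nice K.
Proof. intros s t H. destruct (HK s t H) as [l Hl]. eapply cder_cont; eauto. Qed.

Definition big (N : R) (q : R * R * (R * R)) : Prop :=
  let '((a, b), (c, d)) := q in sub_rect a b c d /\ N <= Cmod (loop K a b c d).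

Definition quarter (q q' : R * R * (R * R)) : Prop :=
  let '((a, b), (c, d)) := q in let '((a', b'), (c', d')) := q' in
  a <= a' /\ b' <= b /\ c <= c' /\ d' <= d /\ b' - a' = (b - a) / 2 /\ d' - c' = (d - c) / 2.

(** Halving first in [s] and then in [t]: each time one of the two halves keeps at least half of the
    modulus of the loop integral. *)
Lemma quarter_step N q : big N q -> exists q', quarter q q' /\ big (N / 4) q'.
Proof.
  destruct q as [[a b] [c d]]. intros [HR HN]. pose proof HR as [? [? [? [? [? ?]]]]].
  set (m := (a + b) / 2). set (n := (c + d) / 2).
  assert (A : exists a' b', a <= a' /\ b' <= b /\ b' - a' = (b - a) / 2 /\ N / 2 <= Cmod (loop K a' b' c d)).
  { rewrite (loop_split_s K a m b c d) in HN by (auto using niceK; unfold m; lra).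
    pose proof (Cmod_triangle (loop K a m c d) (loop K m b c d)).
    destruct (Rle_dec (N / 2) (Cmod (loop K a m c d))).
    - exists a, m. unfold m in *. repeat split; try lra.
    - exists m, b. unfold m in *. repeat split; try lra. }
  destruct A as [a' [b' [A1 [A2 [A3 A4]]]]].
  assert (HR' : sub_rect a' b' c d) by (repeat split; lra).
  assert (B : exists c' d', c <= c' /\ d' <= d /\ d' - c' = (d - c) / 2 /\ N / 4 <= Cmod (loop K a' b' c' d')).
  { rewrite (loop_split_t K a' b' c n d) in A4 by (auto using niceK; unfold n; lra).
    pose proof (Cmod_triangle (loop K a' b' c n) (loop K a' b' n d)).
    destruct (Rle_dec (N / 4) (Cmod (loop K a' b' c n))).
    - exists c, n. unfold n in *. repeat split; try lra.
    - exists n, d. unfold n in *. repeat split; try lra. }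
  destruct B as [c' [d' [B1 [B2 [B3 B4]]]]].
  exists ((a', b'), (c', d')). split; [unfold quarter; repeat split; lra|].
  split; [repeat split; lra|lra].
Qed.

Lemma nested_limit (l r : nat -> R) :
  (forall n, l n <= l (S n)) -> (forall n, r (S n) <= r n) -> (forall n, l n <= r n) ->
  exists x, forall n, l n <= x <= r n.
Proof.
  intros Hl Hr Hlr.
  assert (Ml : forall n k, l n <= l (n + k)%nat).
  { intros n k. induction k; [rewrite Nat.add_0_r; lra|].
    rewrite Nat.add_succ_r. specialize (Hl (n + k)%nat). lra. }
  assert (Mr : forall n k, r (n + k)%nat <= r n).
  { intros n k. induction k; [rewrite Nat.add_0_r; lra|].
    rewrite Nat.add_succ_r. specialize (Hr (n + k)%nat). lra. }
  assert (A : forall n k, l n <= r k).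
  { intros n k. specialize (Ml n k). specialize (Mr k n). rewrite Nat.add_comm in Mr.
    specialize (Hlr (n + k)%nat). lra. }
  destruct (completeness (fun x => exists n, x = l n)) as [x [Hx1 Hx2]].
  - exists (r 0%nat). intros y [n ->]. apply A.
  - exists (l 0%nat). exists 0%nat. auto.
  - exists x. intros n. split.
    + apply Hx1. exists n; auto.
    + apply Hx2. intros y [k ->]. apply A.
Qed.

Lemma goursat : a0 <= b0 -> c0 <= d0 -> loop K a0 b0 c0 d0 = 0%C.
Proof.
  intros Hab Hcd.
  destruct (Req_dec (Cmod (loop K a0 b0 c0 d0)) 0) as [E|E]; [apply Cmod_eq_0; exact E|].
  exfalso.
  set (N := Cmod (loop K a0 b0 c0 d0)) in *.
  assert (HN : 0 < N) by (pose proof (Cmod_ge_0 (loop K a0 b0 c0 d0)); unfold N in *; lra).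
  (* The lower bound is carried along with the rectangle, so that passing to the next quarter is a
     map from one type to itself and can be iterated. *)
  assert (step : forall (p : {x : R * (R * R * (R * R)) | big (fst x) (snd x)}),
     exists p' : {x : R * (R * R * (R * R)) | big (fst x) (snd x)},
       quarter (snd (proj1_sig p)) (snd (proj1_sig p')) /\ fst (proj1_sig p') = fst (proj1_sig p) / 4).
  { intros [[n q] Hq]. destruct (quarter_step _ _ Hq) as [q' [Q1 Q2]].
    exists (exist _ (n / 4, q') Q2). simpl. auto. }
  set (next := fun p => proj1_sig (constructive_indefinite_description _ (step p))).
  assert (start : big N ((a0, b0), (c0, d0))).
  { split; [repeat split; lra|unfold N; lra]. }
  set (seq := nat_rect (fun _ => {x : R * (R * R * (R * R)) | big (fst x) (snd x)})
     (exist _ (N, ((a0, b0), (c0, d0))) start) (fun _ p => next p)).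
  assert (Hnext : forall n, quarter (snd (proj1_sig (seq n))) (snd (proj1_sig (seq (S n)))) /\
      fst (proj1_sig (seq (S n))) = fst (proj1_sig (seq n)) / 4).
  { intros n. simpl. unfold next. destruct (constructive_indefinite_description _ _) as [p' Hp']. exact Hp'. }
  set (A := fun n => fst (fst (snd (proj1_sig (seq n))))). set (B := fun n => snd (fst (snd (proj1_sig (seq n))))).
  set (Cc := fun n => fst (snd (snd (proj1_sig (seq n))))). set (Dd := fun n => snd (snd (snd (proj1_sig (seq n))))).
  assert (Hq : forall n, A n <= A (S n) /\ B (S n) <= B n /\ Cc n <= Cc (S n) /\ Dd (S n) <= Dd n /\
      B (S n) - A (S n) = (B n - A n) / 2 /\ Dd (S n) - Cc (S n) = (Dd n - Cc n) / 2).
  { intros n. destruct (Hnext n) as [Q _]. unfold A, B, Cc, Dd.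
    destruct (snd (proj1_sig (seq n))) as [[? ?] [? ?]].
    destruct (snd (proj1_sig (seq (S n)))) as [[? ?] [? ?]]. exact Q. }
  assert (Hb : forall n, sub_rect (A n) (B n) (Cc n) (Dd n) /\ fst (proj1_sig (seq n)) <= Cmod (loop K (A n) (B n) (Cc n) (Dd n))).
  { intros n. unfold A, B, Cc, Dd. destruct (seq n) as [[x [[? ?] [? ?]]] Hx]. exact Hx. }
  assert (Hsz : forall n, B n - A n = (b0 - a0) / 2 ^ n /\ Dd n - Cc n = (d0 - c0) / 2 ^ n).
  { induction n; [unfold A, B, Cc, Dd; simpl; lra|].
    destruct (Hq n) as [_ [_ [_ [_ [Q1 Q2]]]]]. destruct IHn as [I1 I2]. rewrite Q1, Q2, I1, I2.
    assert (2 ^ n <> 0) by (apply pow_nonzero; lra).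
    split; simpl; field; auto. }
  assert (HNn : forall n, fst (proj1_sig (seq n)) = N / (2 ^ n * 2 ^ n)).
  { induction n; [simpl; field|].
    destruct (Hnext n) as [_ Q]. rewrite Q, IHn.
    assert (2 ^ n <> 0) by (apply pow_nonzero; lra). simpl; field; auto. }
  destruct (nested_limit A B) as [x Hx]; [intros n; apply Hq|intros n; apply Hq|intros n; apply (Hb n)|].
  destruct (nested_limit Cc Dd) as [y Hy]; [intros n; apply Hq|intros n; apply Hq|intros n; apply (Hb n)|].
  assert (Hxy : in_rect a0 b0 c0 d0 x y).
  { specialize (Hx 0%nat). specialize (Hy 0%nat). unfold A, B, Cc, Dd in *; simpl in *. split; lra. }
  destruct (HK x y Hxy) as [l Hl]. pose proof Hl as Hl'. rewrite cder_eps in Hl'.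
  set (T := (b0 - a0) + (d0 - c0)).
  assert (HT : 0 <= T) by (unfold T; lra).
  (* After subtraction of the affine approximation the loop integral over the [n]-th rectangle is at
     most [4 e M^2 T^2 / 4^n]; this [e] makes it less than [N / 4^n]. Writing [T + 1] covers the
     degenerate case [T = 0]. *)
  set (e := N / (8 * M * M * (T + 1) * (T + 1))).
  assert (HMT : 0 < M * M * (T + 1) * (T + 1)) by (repeat apply Rmult_lt_0_compat; lra).
  assert (He : 0 < e) by (apply Rdiv_lt_0_compat; lra).
  destruct (Hl' e He) as [del [Hdel Hd]].
  assert (exists n, M * (T / 2 ^ n) < del) as [n Hn].
  { destruct (pow_lt_1_zero (1/2) ltac:(rewrite Rabs_pos_eq; lra) (del / (M * (T + 1)))) as [n Hn].
    { apply Rdiv_lt_0_compat; auto. apply Rmult_lt_0_compat; lra. }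
    exists n. specialize (Hn n (Nat.le_refl n)).
    rewrite Rabs_pos_eq in Hn by (apply pow_le; lra).
    replace (1/2) with (/2) in Hn by field. rewrite pow_inv in Hn.
    assert (P : 0 < / 2 ^ n) by (apply Rinv_0_lt_compat, pow_lt; lra).
    apply Rmult_lt_compat_r with (r := M * (T + 1)) in Hn; [|apply Rmult_lt_0_compat; lra].
    replace (del / (M * (T + 1)) * (M * (T + 1))) with del in Hn by (field; lra).
    unfold Rdiv. apply Rle_lt_trans with (2 := Hn).
    replace (M * (T * / 2 ^ n)) with (/ 2 ^ n * (M * T)) by ring.
    apply Rmult_le_compat_l; [lra|]. apply Rmult_le_compat_l; lra. }
  destruct (Hb n) as [HR HBn]. rewrite HNn in HBn. destruct (Hsz n) as [S1 S2].
  set (z0 := G x y) in *.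
  assert (NA : nice (fun u => K z0 + l * (u - z0))%C).
  { intros s t _. apply (cder_cont _ _ (0 + l * (1 + 0))%C).
    apply cder_plus; [apply cder_const|]. apply cder_scal.
    apply (cder_plus (fun u => u) (fun _ => - z0)%C); [apply cder_id|apply cder_const]. }
  pose proof (loop_minus K (fun u => K z0 + l * (u - z0))%C _ _ _ _ niceK NA HR) as HL.
  rewrite (loop_affine _ _ _ _ _ _ _ HR) in HL.
  set (r := T / 2 ^ n) in *.
  assert (P : 0 < 2 ^ n) by (apply pow_lt; lra).
  assert (HB : Cmod (loop K (A n) (B n) (Cc n) (Dd n)) <= 4 * (e * (M * r)) * M * r).
  { replace (loop K (A n) (B n) (Cc n) (Dd n)) with
      (loop (fun u : C => K u - (K z0 + l * (u - z0))) (A n) (B n) (Cc n) (Dd n))%C by (rewrite HL; ring).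
    replace r with ((B n - A n) + (Dd n - Cc n)) at 2 by (rewrite S1, S2; unfold r, T; field; lra).
    apply loop_bound; auto.
    - intros s t Hst. apply (ctends_plus (fun _ => True) K (fun u => - (K z0 + l * (u - z0)))%C).
      + apply niceK; auto.
      + apply (ctends_ext_loc _ (fun u => -(1) * (K z0 + l * (u - z0)))%C _ _ _ 1); [lra|intros; ring|].
        replace (- (K z0 + l * (G s t - z0)))%C with (-(1) * (K z0 + l * (G s t - z0)))%C by ring.
        apply ctends_mult; [apply ctends_const|]. apply NA; auto.
    - intros s t [Hs Ht].
      assert (D1 : Cmod (G s t - z0) <= M * r).
      { unfold z0. eapply Rle_trans; [apply HGL; auto|].
        - destruct HR as [? [? [? [? [? ?]]]]]. split; lra.
        - apply Rmult_le_compat_l; [lra|].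
          replace r with ((B n - A n) + (Dd n - Cc n)) by (rewrite S1, S2; unfold r, T; field; lra).
          specialize (Hx n). specialize (Hy n). apply Rplus_le_compat; apply Rabs_le; lra. }
      specialize (Hd (G s t)). replace (K (G s t) - (K z0 + l * (G s t - z0)))%C with
        (K (G s t) - K z0 - l * (G s t - z0))%C by ring.
      eapply Rle_trans; [apply Hd; lra|]. apply Rmult_le_compat_l; lra. }
  assert (HF : N / (2 ^ n * 2 ^ n) <= 4 * (e * (M * r)) * M * r) by lra.
  assert (N <= 4 * e * M * M * T * T).
  { apply Rmult_le_reg_r with (/ (2 ^ n * 2 ^ n)); [apply Rinv_0_lt_compat, Rmult_lt_0_compat; auto|].
    apply Rle_trans with (1 := HF). right. unfold r. field. lra. }
  assert (8 * e * M * M * ((T + 1) * (T + 1)) = N) by (unfold e; field; lra).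
  assert (0 < e * M * M) by (apply Rmult_lt_0_compat; [apply Rmult_lt_0_compat|]; lra).
  assert (T * T <= (T + 1) * (T + 1)) by nra.
  nra.
Qed.
End Goursat.

(** ** Cauchy's formula on the unit circle *)

Lemma Cmod_scal_R (r : R) (z : C) : Cmod (RtoC r * z) = Rabs r * Cmod z.
Proof. rewrite Cmod_mult, Cmod_R. reflexivity. Qed.

Lemma real_lipschitz (f df : R -> R) (M x y : R) :
  (forall t, is_derive f t (df t)) -> (forall t, Rabs (df t) <= M) ->
  Rabs (f x - f y) <= M * Rabs (x - y).
Proof.
  intros Hd HM. destruct (MVT_gen f y x df) as [c [_ Hc]].
  - intros t _. apply Hd.
  - intros t _. apply continuity_pt_filterlim.
    apply (ex_derive_continuous (K := R_AbsRing) (V := R_NormedModule)). eexists; apply Hd.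
  - rewrite Hc, Rabs_mult. apply Rmult_le_compat_r; [apply Rabs_pos|auto].
Qed.

Lemma expi_lipschitz (t s : R) : Cmod (expi t - expi s) <= 2 * Rabs (t - s).
Proof.
  eapply Rle_trans; [apply Cmod_le_sum|]. simpl.
  assert (Rabs (cos t - cos s) <= 1 * Rabs (t - s)).
  { apply (real_lipschitz cos (fun t => - sin t)); [intros; apply is_derive_cos|].
    intros x. rewrite Rabs_Ropp. apply Rabs_le, SIN_bound. }
  assert (Rabs (sin t - sin s) <= 1 * Rabs (t - s)).
  { apply (real_lipschitz sin cos); [intros; apply is_derive_sin|].
    intros x. apply Rabs_le, COS_bound. }
  unfold Rminus in *. lra.
Qed.

Lemma expi_2PI (t : R) : expi (t + 2 * PI) = expi t.
Proof.
  apply Ceq; cbn [expi fst snd].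
  - rewrite cos_plus, cos_2PI, sin_2PI. ring.
  - rewrite sin_plus, cos_2PI, sin_2PI. ring.
Qed.

Lemma expi_period_Z (k : Z) (t : R) : expi (t + IZR k * (2 * PI)) = expi t.
Proof.
  assert (Hn : forall j s, expi (s + INR j * (2 * PI)) = expi s).
  { induction j; intros s; [f_equal; simpl; ring|]. rewrite S_INR.
    replace (s + (INR j + 1) * (2 * PI)) with (s + INR j * (2 * PI) + 2 * PI) by ring. rewrite expi_2PI. apply IHj. }
  destruct (Z.le_gt_cases 0 k) as [Hk|Hk].
  - rewrite <- (Z2Nat.id k), <- INR_IZR_INZ by lia. apply Hn.
  - rewrite <- (Hn (Z.to_nat (- k))). rewrite INR_IZR_INZ, Z2Nat.id, opp_IZR by lia. f_equal. ring.
Qed.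

Lemma expi_reduce (t a : R) : exists s, a <= s < a + 2 * PI /\ expi s = expi t.
Proof.
  pose proof PI_RGT_0. set (x := (t - a) / (2 * PI)). destruct (archimed x) as [A1 A2].
  exists (t + IZR (1 - up x) * (2 * PI)). split; [|apply expi_period_Z].
  assert (E : x * (2 * PI) = t - a) by (unfold x; field; lra).
  rewrite minus_IZR. split.
  - assert ((IZR (up x) - x) * (2 * PI) <= 1 * (2 * PI)) by (apply Rmult_le_compat_r; lra). lra.
  - assert (0 < (IZR (up x) - x) * (2 * PI)) by (apply Rmult_lt_0_compat; lra). lra.
Qed.

Lemma pcont_inv (f : R -> C) t : f t <> 0%C -> pcont f t -> pcont (fun s => / f s)%C t.
Proof.
  intros Hf H. apply (pcont_comp (fun u => / u)%C); auto.
  eapply cder_cont. apply cder_Cinv; auto.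
Qed.

Lemma pcont_minus f g t : pcont f t -> pcont g t -> pcont (fun s => f s - g s)%C t.
Proof.
  intros Hf Hg. apply pcont_plus; auto. apply (pcont_comp (fun u => - u)%C); auto.
  apply (ctends_ext_loc _ (fun u => -(1) * u)%C _ _ _ 1); [lra|intros; ring|].
  replace (- g t)%C with (- (1) * g t)%C by ring.
  apply ctends_mult; [apply ctends_const|apply ctends_id].
Qed.

Lemma pcont_Cmod f t : pcont f t -> continuous (fun s => Cmod (f s)) t.
Proof.
  intros H. rewrite pcont_eps in H. apply continuous_eps. intros e He.
  destruct (H e He) as [d [Hd H']]. exists d. split; auto. intros s Hs. specialize (H' s Hs).
  pose proof (Cmod_triangle_sub (f s) (f t)). pose proof (Cmod_triangle_sub (f t) (f s)).
  rewrite Cmod_minus_sym in H1. apply Rabs_def1; lra.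
Qed.

Lemma pcont_bounded f a b : a <= b -> pcont_on f a b -> exists B, 0 < B /\ forall t, a <= t <= b -> Cmod (f t) <= B.
Proof.
  intros Hab H. destruct (continuity_ab_maj (fun s => Cmod (f s)) a b Hab) as [m [Hm _]].
  - intros t Ht. apply continuity_pt_filterlim. apply pcont_Cmod, H, Ht.
  - exists (Cmod (f m) + 1). pose proof (Cmod_ge_0 (f m)). split; [lra|].
    intros t Ht. specialize (Hm t Ht). lra.
Qed.

Definition hol (rad : R) (F : C -> C) : Prop := forall z, Cmod z < rad -> exists l, cder F z l.

Lemma hol_cont rad F z : hol rad F -> Cmod z < rad -> ccont F z.
Proof. intros H Hz. destruct (H z Hz) as [l Hl]. eapply cder_cont; eauto. Qed.

Lemma hol_scaled r F : 0 < r -> hol 1 F -> hol (/ r) (fun u => F (RtoC r * u))%C.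
Proof.
  intros Hr HF z Hz.
  destruct (HF (RtoC r * z)%C) as [l Hl].
  { rewrite Cmod_scal_R, Rabs_pos_eq by lra. apply Rmult_lt_reg_l with (/ r); [apply Rinv_0_lt_compat; auto|].
    rewrite <- Rmult_assoc, Rinv_l by lra. lra. }
  exists (l * (RtoC r * 1))%C. apply (cder_comp F); auto. apply cder_scal, cder_id.
Qed.

Lemma pcont_circle rad F t : 1 < rad -> hol rad F -> pcont (fun t => F (expi t)) t.
Proof.
  intros HR HF. apply pcont_comp; [|apply pcont_expi]. eapply hol_cont; eauto. rewrite Cmod_expi; auto.
Qed.

Lemma expi_minus_neq0 t z : Cmod z < 1 -> (expi t - z)%C <> 0%C.
Proof. intros Hz. apply Cminus_neq0. rewrite Cmod_expi. auto. Qed.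

Lemma pcont_cauchy_kernel z t : Cmod z < 1 -> pcont (fun t => / (expi t - z))%C t.
Proof.
  intros Hz. apply pcont_inv; [apply expi_minus_neq0; auto|].
  apply pcont_minus; [apply pcont_expi|apply pcont_const].
Qed.

(** [G] deforms the small circle about [z] ([s = 0]) linearly into the unit circle ([s = 1]) without
    meeting [z]. Goursat's lemma applies to [F u / (u - z)], and the sides [t = a] and
    [t = a + 2 PI] cancel by periodicity. *)
Lemma cauchy_small_circle rad F z a rho : 1 < rad -> hol rad F -> Cmod z < 1 -> 0 < rho < 1 - Cmod z ->
  cint (fun t => F (expi t) * (expi t * / (expi t - z)))%C a (a + 2 * PI) =
  cint (fun t => F (z + RtoC rho * expi t))%C a (a + 2 * PI).
Proof.
  intros HR HF Hz Hrho. pose proof PI_RGT_0. pose proof (Cmod_ge_0 z).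
  set (K := fun u => (F u * / (u - z))%C).
  set (G := fun s t => (RtoC (1 - s) * z + RtoC (rho + s * (1 - rho)) * expi t)%C).
  set (Gs := fun (s t : R) => (-(1) * z + RtoC (1 - rho) * expi t)%C).
  set (Gt := fun (s t : R) => (RtoC (rho + s * (1 - rho)) * (Ci * expi t))%C).
  assert (HGm : forall s t, in_rect 0 1 a (a + 2 * PI) s t -> Cmod (G s t) < rad /\ (G s t - z)%C <> 0%C).
  { intros s t [Hs Ht]. split.
    - apply Rle_lt_trans with 1; auto. unfold G. eapply Rle_trans; [apply Cmod_triangle|].
      rewrite !Cmod_scal_R, Cmod_expi, !Rabs_pos_eq by nra. nra.
    - unfold G. replace (RtoC (1 - s) * z + RtoC (rho + s * (1 - rho)) * expi t - z)%C with
        (RtoC (rho + s * (1 - rho)) * expi t - RtoC s * z)%C by (rewrite RtoC_minus; ring).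
      apply Cminus_neq0. rewrite !Cmod_scal_R, Cmod_expi, !Rabs_pos_eq by nra. nra. }
  assert (L : loop G Gs Gt K 0 1 a (a + 2 * PI) = 0%C).
  { apply goursat with (M := 2); try lra.
    - intros s t Hst. destruct (HGm s t Hst) as [H1 H2]. destruct (HF _ H1) as [l Hl].
      eexists. apply cder_mult; [exact Hl|]. apply (cder_inv (fun u => u - z)%C); auto.
      apply (cder_plus (fun u => u) (fun _ => - z)%C); [apply cder_id|apply cder_const].
    - intros s t _. unfold G, Gs. split; simpl; auto_derive; auto; ring.
    - intros s t _. unfold G, Gt. split; simpl; auto_derive; auto; ring.
    - intros s t _. apply pcont_const.
    - intros s t _. apply pcont_mult; [apply pcont_const|]. apply pcont_mult; [apply pcont_const|apply pcont_expi].
    - intros s t Hst. unfold Gs. eapply Rle_trans; [apply Cmod_triangle|].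
      rewrite Cmod_scal_R, Cmod_mult, Cmod_m1, Cmod_expi, Rabs_pos_eq by lra. lra.
    - intros s t [Hs Ht]. unfold Gt. rewrite Cmod_scal_R, Cmod_mult, Cmod_Ci, Cmod_expi, Rabs_pos_eq by nra. nra.
    - intros s t s' t' [Hs Ht] [Hs' Ht']. unfold G.
      replace (RtoC (1 - s) * z + RtoC (rho + s * (1 - rho)) * expi t -
         (RtoC (1 - s') * z + RtoC (rho + s' * (1 - rho)) * expi t'))%C with
        (RtoC (s' - s) * z + RtoC ((s - s') * (1 - rho)) * expi t' + RtoC (rho + s * (1 - rho)) * (expi t - expi t'))%C
        by (apply Ceq; simpl; ring).
      eapply Rle_trans; [apply Cmod_triangle|]. eapply Rle_trans; [apply Rplus_le_compat_r, Cmod_triangle|].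
      rewrite !Cmod_scal_R, Cmod_expi, Rabs_mult, (Rabs_minus_sym s' s).
      rewrite (Rabs_pos_eq (1 - rho)) by lra. rewrite (Rabs_pos_eq (rho + s * (1 - rho))) by nra.
      pose proof (expi_lipschitz t t'). pose proof (Rabs_pos (s - s')). pose proof (Rabs_pos (t - t')).
      pose proof (Cmod_ge_0 (expi t - expi t')).
      assert ((rho + s * (1 - rho)) * Cmod (expi t - expi t') <= 1 * (2 * Rabs (t - t'))).
      { apply Rmult_le_compat; nra. }
      assert (Rabs (s - s') * Cmod z <= Rabs (s - s') * 1) by (apply Rmult_le_compat_l; lra).
      nra. }
  unfold loop in L.
  assert (E1 : cint (fun s => K (G s (a + 2 * PI)%R) * Gs s (a + 2 * PI)%R)%C 0 1 =
               cint (fun s => K (G s a) * Gs s a)%C 0 1).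
  { apply cint_ext; [lra|]. intros s _. unfold G, Gs. rewrite expi_2PI. reflexivity. }
  assert (C1 : pcont_on (fun t => F (expi t) * (expi t * / (expi t - z)))%C a (a + 2 * PI)).
  { intros t _. apply pcont_mult; [eapply pcont_circle; eauto|]. apply pcont_mult; [apply pcont_expi|].
    apply pcont_cauchy_kernel; auto. }
  assert (C2 : pcont_on (fun t => F (z + RtoC rho * expi t))%C a (a + 2 * PI)).
  { intros t _. apply (pcont_comp F (fun t => z + RtoC rho * expi t)%C).
    - eapply hol_cont; eauto. eapply Rle_lt_trans; [apply Cmod_triangle|].
      rewrite Cmod_scal_R, Cmod_expi, Rabs_pos_eq by lra. lra.
    - apply pcont_plus; [apply pcont_const|]. apply pcont_mult; [apply pcont_const|apply pcont_expi]. }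
  assert (E2 : cint (fun t => K (G 1 t) * Gt 1 t)%C a (a + 2 * PI) =
     (Ci * cint (fun t => F (expi t) * (expi t * / (expi t - z))) a (a + 2 * PI))%C).
  { rewrite <- cint_scal by (auto; lra). apply cint_ext; [lra|]. intros t _. unfold K, G, Gt.
    replace (RtoC (1 - 1) * z + RtoC (rho + 1 * (1 - rho)) * expi t)%C with (expi t)
      by (apply Ceq; simpl; ring).
    replace (RtoC (rho + 1 * (1 - rho))) with (RtoC 1) by (f_equal; ring). ring. }
  assert (E3 : cint (fun t => K (G 0 t) * Gt 0 t)%C a (a + 2 * PI) =
     (Ci * cint (fun t => F (z + RtoC rho * expi t)) a (a + 2 * PI))%C).
  { rewrite <- cint_scal by (auto; lra). apply cint_ext; [lra|]. intros t _. unfold K, G, Gt.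
    replace (RtoC (1 - 0) * z + RtoC (rho + 0 * (1 - rho)) * expi t)%C with (z + RtoC rho * expi t)%C
      by (apply Ceq; simpl; ring).
    replace (RtoC (rho + 0 * (1 - rho))) with (RtoC rho) by (f_equal; ring).
    field. replace (z + RtoC rho * expi t - z)%C with (RtoC rho * expi t)%C by ring.
    apply Cmult_neq_0; [|apply expi_neq0]. intros E. apply RtoC_inj in E. lra. }
  rewrite E1, E2, E3 in L.
  assert (Ci <> 0%C) by (intros E; apply (f_equal snd) in E; simpl in E; lra).
  set (w := cint _ 0 1) in L. set (y := cint (fun t => F (z + RtoC rho * expi t))%C _ _) in *.
  set (x := cint (fun t => F (expi t) * (expi t * / (expi t - z)))%C a (a + 2 * PI)) in *.
  assert (L' : (Ci * (x - y))%C = 0%C) by (rewrite <- L; ring). clear L; rename L' into L.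
  assert (x - y = 0)%C.
  { replace (x - y)%C with (/ Ci * (Ci * (x - y)))%C by (field; auto). rewrite L. ring. }
  replace x with ((x - y) + y)%C by ring. rewrite H2. ring.
Qed.

(** In [cauchy_small_circle] the left side does not depend on [rho], while the right side tends to
    [2 PI F(z)] as [rho] shrinks. The starting angle [a] is kept free because the arcs of the final
    decomposition begin at an arbitrary angle. *)
Lemma cauchy_formula rad F z a : 1 < rad -> hol rad F -> Cmod z < 1 ->
  cint (fun t => F (expi t) * (expi t * / (expi t - z)))%C a (a + 2 * PI) = (RtoC (2 * PI) * F z)%C.
Proof.
  intros HR HF Hz. pose proof PI_RGT_0. pose proof (Cmod_ge_0 z).
  set (x := cint _ _ _).
  destruct (Req_dec (Cmod (x - RtoC (2 * PI) * F z)) 0) as [E|E].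
  { apply Cmod_eq_0 in E. replace x with ((x - RtoC (2 * PI) * F z) + RtoC (2 * PI) * F z)%C by ring. rewrite E. ring. }
  exfalso. pose proof (Cmod_ge_0 (x - RtoC (2 * PI) * F z)) as Hp.
  set (e := Cmod (x - RtoC (2 * PI) * F z)) in *.
  destruct (hol_cont rad F z HF ltac:(lra) (e / (8 * PI))) as [d [Hd Hc]].
  { apply Rdiv_lt_0_compat; lra. }
  set (rho := Rmin d (1 - Cmod z) / 2).
  assert (0 < Rmin d (1 - Cmod z)) by (apply Rmin_pos; lra).
  pose proof (Rmin_l d (1 - Cmod z)). pose proof (Rmin_r d (1 - Cmod z)).
  assert (Hrho : 0 < rho < 1 - Cmod z) by (unfold rho; lra).
  assert (Hx : x = cint (fun t => F (z + RtoC rho * expi t))%C a (a + 2 * PI)) by (apply (cauchy_small_circle rad); auto).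
  assert (C2 : pcont_on (fun t => F (z + RtoC rho * expi t))%C a (a + 2 * PI)).
  { intros t _. apply (pcont_comp F (fun t => z + RtoC rho * expi t)%C).
    - eapply hol_cont; eauto. eapply Rle_lt_trans; [apply Cmod_triangle|].
      rewrite Cmod_scal_R, Cmod_expi, Rabs_pos_eq by lra. lra.
    - apply pcont_plus; [apply pcont_const|]. apply pcont_mult; [apply pcont_const|apply pcont_expi]. }
  assert (Hy : (x - RtoC (2 * PI) * F z)%C = cint (fun t => F (z + RtoC rho * expi t) - F z)%C a (a + 2 * PI)).
  { rewrite cint_minus; [|lra|auto|intros t _; apply pcont_const]. rewrite <- Hx, cint_const. f_equal.
    replace (a + 2 * PI - a) with (2 * PI) by ring. ring. }
  assert (e <= 2 * (e / (8 * PI)) * (a + 2 * PI - a)).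
  { unfold e at 1. rewrite Hy. apply cint_bound; [lra| |].
    - intros t Ht. apply pcont_minus; [apply C2; auto|apply pcont_const].
    - intros t _. left. apply Hc; auto. replace (z + RtoC rho * expi t - z)%C with (RtoC rho * expi t)%C by ring.
      rewrite Cmod_scal_R, Cmod_expi, Rabs_pos_eq by lra. unfold rho; lra. }
  replace (2 * (e / (8 * PI)) * (a + 2 * PI - a)) with (e / 2) in H4 by (field; lra). lra.
Qed.

(** ** The derivative of a holomorphic function is holomorphic *)

(** Differentiation under the integral sign, with a uniform quadratic remainder as hypothesis: for
    the Cauchy kernels below this remainder is an explicit algebraic expression. *)
Lemma cder_cint (k : C -> R -> C) (k' : R -> C) z a b r B : 0 < r -> a <= b ->
  (forall u, Cmod (u - z) < r -> pcont_on (k u) a b) -> pcont_on k' a b ->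
  (forall u t, Cmod (u - z) < r -> a <= t <= b ->
     Cmod (k u t - k z t - (u - z) * k' t) <= B * (Cmod (u - z) * Cmod (u - z))) ->
  cder (fun u => cint (k u) a b) z (cint k' a b).
Proof.
  intros Hr Hab Hk Hk' HB. apply cder_eps. intros e He.
  assert (HB0 : 0 <= Rabs B) by apply Rabs_pos.
  set (M := 2 * Rabs B * (b - a) + 1).
  assert (HM : 0 < M) by (unfold M; nra).
  exists (Rmin r (e / M)). split; [apply Rmin_pos; auto; apply Rdiv_lt_0_compat; auto|].
  intros u Hu. pose proof (Rmin_l r (e / M)). pose proof (Rmin_r r (e / M)).
  assert (Z : Cmod (z - z) < r) by (replace (z - z)%C with (RtoC 0) by ring; rewrite Cmod_0; lra).
  assert (E : (cint (k u) a b - cint (k z) a b - cint k' a b * (u - z))%C =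
     cint (fun t => k u t - k z t - (u - z) * k' t)%C a b).
  { rewrite (cint_minus (fun t => k u t - k z t)%C (fun t => (u - z) * k' t)%C); auto.
    - rewrite cint_minus, cint_scal; auto; try (apply Hk; lra). ring.
    - intros t Ht. apply pcont_minus; apply Hk; auto; lra.
    - intros t Ht. apply pcont_mult; [apply pcont_const|auto]. }
  rewrite E. eapply Rle_trans.
  - apply cint_bound with (M := Rabs B * (Cmod (u - z) * Cmod (u - z))); auto.
    + intros t Ht. apply pcont_minus; [apply pcont_minus; apply Hk; auto; lra|].
      apply pcont_mult; [apply pcont_const|auto].
    + intros t Ht. eapply Rle_trans; [apply HB; auto; lra|]. apply Rmult_le_compat_r; [|apply Rle_abs].
      apply Rmult_le_pos; apply Cmod_ge_0.
  - pose proof (Cmod_ge_0 (u - z)).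
    assert (Cmod (u - z) * M <= e).
    { apply Rle_trans with (e / M * M); [apply Rmult_le_compat_r; lra|right; field; lra]. }
    unfold M in *. nra.
Qed.

Lemma cauchy_kernel_lower z u t : Cmod z < 1 -> Cmod (u - z) < (1 - Cmod z) / 2 ->
  Cmod u < 1 /\ (1 - Cmod z) / 2 <= Cmod (expi t - u) <= 2.
Proof.
  intros Hz Hu. pose proof (Cmod_triangle_sub u z).
  assert (Cmod u < 1) by lra. split; [auto|].
  pose proof (Cmod_triangle_sub (expi t) u). rewrite Cmod_expi in H1. split; [lra|].
  unfold Cminus. eapply Rle_trans; [apply Cmod_triangle|]. rewrite Cmod_opp, Cmod_expi. lra.
Qed.

Lemma Rinv_pow_bound (p q : R) : 0 < q -> q <= p -> / p <= / q.
Proof. intros. apply Rinv_le_contravar; lra. Qed.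

Lemma cauchy_int_der (phi : R -> C) z a b : a <= b -> pcont_on phi a b -> Cmod z < 1 ->
  cder (fun u => cint (fun t => phi t * / (expi t - u)) a b)%C z
    (cint (fun t => phi t * (/ (expi t - z) * / (expi t - z))) a b)%C.
Proof.
  intros Hab Hphi Hz. destruct (pcont_bounded phi a b Hab Hphi) as [B [HB0 HB]].
  set (r := (1 - Cmod z) / 2). assert (Hr : 0 < r) by (unfold r; lra).
  apply cder_cint with (r := r) (B := B * (/ r * / r * / r)); auto.
  - intros u Hu t Ht. destruct (cauchy_kernel_lower z u t Hz Hu).
    apply pcont_mult; auto. apply pcont_cauchy_kernel; auto.
  - intros t Ht. apply pcont_mult; auto. apply pcont_mult; apply pcont_cauchy_kernel; auto.
  - intros u t Hu Ht. destruct (cauchy_kernel_lower z u t Hz Hu) as [U1 [U2 U3]].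
    destruct (cauchy_kernel_lower z z t Hz) as [V1 [V2 V3]].
    { replace (z - z)%C with (RtoC 0) by ring. rewrite Cmod_0. exact Hr. }
    fold r in U2, V2.
    pose proof (expi_minus_neq0 t u U1). pose proof (expi_minus_neq0 t z V1).
    replace (phi t * / (expi t - u) - phi t * / (expi t - z) - (u - z) * (phi t * (/ (expi t - z) * / (expi t - z))))%C
      with (phi t * (/ (expi t - u) * / (expi t - z) * / (expi t - z)) * ((u - z) * (u - z)))%C by (field; auto).
    rewrite !Cmod_mult, !Cmod_inv by auto.
    apply Rmult_le_compat_r; [apply Rmult_le_pos; apply Cmod_ge_0|].
    assert (P : forall p, r <= p -> 0 <= / p) by (intros; left; apply Rinv_0_lt_compat; lra).
    apply Rmult_le_compat; [apply Cmod_ge_0|repeat apply Rmult_le_pos; auto|auto|].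
    apply Rmult_le_compat; [repeat apply Rmult_le_pos; auto|auto| |apply Rinv_pow_bound; auto].
    apply Rmult_le_compat; auto; apply Rinv_pow_bound; auto.
Qed.

Lemma cauchy_int_der2 (phi : R -> C) z a b : a <= b -> pcont_on phi a b -> Cmod z < 1 -> exists l,
  cder (fun u => cint (fun t => phi t * (/ (expi t - u) * / (expi t - u))) a b)%C z l.
Proof.
  intros Hab Hphi Hz. destruct (pcont_bounded phi a b Hab Hphi) as [B [HB0 HB]].
  set (r := (1 - Cmod z) / 2). assert (Hr : 0 < r) by (unfold r; lra).
  exists (cint (fun t => phi t * (2 * (/ (expi t - z) * / (expi t - z) * / (expi t - z)))) a b)%C.
  apply cder_cint with (r := r) (B := B * (8 * (/ r * / r * (/ r * / r * / r)))); auto.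
  - intros u Hu t Ht. destruct (cauchy_kernel_lower z u t Hz Hu).
    apply pcont_mult; auto. apply pcont_mult; apply pcont_cauchy_kernel; auto.
  - intros t Ht. apply pcont_mult; auto. apply pcont_mult; [apply pcont_const|].
    apply pcont_mult; [apply pcont_mult|]; apply pcont_cauchy_kernel; auto.
  - intros u t Hu Ht. destruct (cauchy_kernel_lower z u t Hz Hu) as [U1 [U2 U3]].
    destruct (cauchy_kernel_lower z z t Hz) as [V1 [V2 V3]].
    { replace (z - z)%C with (RtoC 0) by ring. rewrite Cmod_0. exact Hr. }
    fold r in U2, V2.
    pose proof (expi_minus_neq0 t u U1). pose proof (expi_minus_neq0 t z V1).
    replace (phi t * (/ (expi t - u) * / (expi t - u)) - phi t * (/ (expi t - z) * / (expi t - z)) -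
       (u - z) * (phi t * (2 * (/ (expi t - z) * / (expi t - z) * / (expi t - z)))))%C
      with (phi t * (((expi t - z) + 2 * (expi t - u)) * (/ (expi t - u) * / (expi t - u) *
         (/ (expi t - z) * / (expi t - z) * / (expi t - z)))) * ((u - z) * (u - z)))%C by (field; auto).
    rewrite !Cmod_mult, !Cmod_inv by auto.
    apply Rmult_le_compat_r; [apply Rmult_le_pos; apply Cmod_ge_0|].
    assert (P : forall p, r <= p -> 0 <= / p) by (intros; left; apply Rinv_0_lt_compat; lra).
    apply Rmult_le_compat; [apply Cmod_ge_0|repeat apply Rmult_le_pos; auto; apply Cmod_ge_0|auto|].
    apply Rmult_le_compat; [apply Cmod_ge_0|repeat apply Rmult_le_pos; auto| |].
    + eapply Rle_trans; [apply Cmod_triangle|]. rewrite Cmod_mult, Cmod_R, Rabs_pos_eq by lra. lra.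
    + apply Rmult_le_compat; [repeat apply Rmult_le_pos; auto|repeat apply Rmult_le_pos; auto| |].
      * apply Rmult_le_compat; auto; apply Rinv_pow_bound; auto.
      * apply Rmult_le_compat; [repeat apply Rmult_le_pos; auto|auto| |apply Rinv_pow_bound; auto].
        apply Rmult_le_compat; auto; apply Rinv_pow_bound; auto.
Qed.

Definition cderiv (F : C -> C) (z : C) : C := epsilon (inhabits (RtoC 0)) (fun l => cder F z l).

Lemma cderiv_spec rad F z : hol rad F -> Cmod z < rad -> cder F z (cderiv F z).
Proof. intros H Hz. unfold cderiv. apply epsilon_spec. apply H. auto. Qed.

(** Cauchy's formula on a circle of radius [r] between [|z0|] and 1, rescaled to the unit circle,
    writes [F] near [z0] as a Cauchy integral, and such an integral can be differentiated twice. *)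
Lemma hol_cderiv F : hol 1 F -> hol 1 (cderiv F).
Proof.
  intros HF z0 Hz0. pose proof (Cmod_ge_0 z0). pose proof PI_RGT_0.
  set (r := (1 + Cmod z0) / 2). assert (Hr : 0 < r < 1) by (unfold r; lra).
  pose proof (hol_scaled r F ltac:(lra) HF) as HFr.
  assert (Hir : 1 < / r) by (rewrite <- Rinv_1; apply Rinv_lt_contravar; lra).
  set (phi := fun t => (F (RtoC r * expi t) * expi t)%C).
  assert (Hphi : pcont_on phi 0 (0 + 2 * PI)).
  { intros t _. apply pcont_mult; [|apply pcont_expi]. apply (pcont_circle (/ r) (fun u => F (RtoC r * u))%C); auto. }
  assert (HrC : RtoC r <> 0%C) by (intros E; apply RtoC_inj in E; lra).
  assert (HpC : RtoC (2 * PI) <> 0%C) by (intros E; apply RtoC_inj in E; lra).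
  set (c := (/ RtoC (2 * PI))%C). set (q := (/ RtoC r)%C).
  set (G2 := fun u => cint (fun t => phi t * (/ (expi t - u) * / (expi t - u)))%C 0 (0 + 2 * PI)).
  assert (Hq : forall z, Cmod z < r -> Cmod (q * z) < 1).
  { intros z Hz. unfold q. rewrite Cmod_mult, Cmod_inv, Cmod_R, Rabs_pos_eq by (auto; lra).
    apply Rmult_lt_reg_l with r; [lra|]. rewrite <- Rmult_assoc, Rinv_r by lra. lra. }
  assert (Hnear : forall z, Cmod z < r -> cder F z (c * (G2 (q * z) * (q * 1)))%C).
  { intros z Hz.
    apply (cder_ext_loc (fun u => c * cint (fun t => phi t * / (expi t - q * u)) 0 (0 + 2 * PI))%C _ _ _ (r - Cmod z)); [lra| |].
    - intros u Hu. assert (Hu' : Cmod u < r) by (pose proof (Cmod_triangle_sub u z); lra).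
      pose proof (cauchy_formula (/ r) _ (q * u)%C 0 Hir HFr (Hq u Hu')) as HC. cbv beta in HC.
      replace (RtoC r * (q * u))%C with u in HC by (unfold q; field; auto).
      replace (F u) with (c * (RtoC (2 * PI) * F u))%C by (unfold c; field; auto).
      rewrite <- HC. f_equal. apply cint_ext; [lra|]. intros t _. unfold phi. ring.
    - apply cder_scal. apply (cder_comp (fun u => cint (fun t => phi t * / (expi t - u))%C 0 (0 + 2 * PI))).
      + apply cauchy_int_der; auto. lra.
      + apply cder_scal, cder_id. }
  assert (Hz : Cmod z0 < r) by (unfold r; lra).
  destruct (cauchy_int_der2 phi (q * z0) 0 (0 + 2 * PI) ltac:(lra) Hphi (Hq _ Hz)) as [l Hl].
  exists (c * ((q * 1) * (l * (q * 1))))%C.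
  apply (cder_ext_loc (fun z => c * ((q * 1) * G2 (q * z)))%C _ _ _ (r - Cmod z0)); [lra| |].
  - intros u Hu. assert (Hu' : Cmod u < r) by (pose proof (Cmod_triangle_sub u z0); lra).
    apply (cder_unique F u); [|apply (cderiv_spec 1); auto; lra].
    replace (c * (q * 1 * G2 (q * u)))%C with (c * (G2 (q * u) * (q * 1)))%C by ring. auto.
  - apply cder_scal, cder_scal. apply (cder_comp G2); auto. apply cder_scal, cder_id.
Qed.

(** ** Poisson's formula and its consequences *)

Definition poisson_ker (zeta : C) (t : R) : R := (1 - Cmod zeta ^ 2) / (Cmod (expi t - zeta)) ^ 2.

Lemma RInt_ext_R (f g : R -> R) a b : (forall t, f t = g t) -> RInt f a b = RInt g a b.
Proof. intros H. apply RInt_ext. intros; apply H. Qed.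

Lemma poisson_ker_pos zeta t : Cmod zeta < 1 -> 0 < poisson_ker zeta t.
Proof.
  intros H. pose proof (Cmod_ge_0 zeta). unfold poisson_ker. apply Rdiv_lt_0_compat; [nra|].
  apply pow_lt. apply Cmod_gt_0. apply expi_minus_neq0; auto.
Qed.

Lemma poisson_ker_cont zeta t : Cmod zeta < 1 -> continuous (poisson_ker zeta) t.
Proof.
  intros H. unfold poisson_ker, Rdiv. apply (continuous_mult (K := R_AbsRing)); [apply continuous_const|].
  apply continuous_comp.
  - simpl. assert (Hc : continuous (fun s => Cmod (expi s - zeta)%C) t).
    { apply pcont_Cmod. apply pcont_minus; [apply pcont_expi|apply pcont_const]. }
    apply (continuous_mult (K := R_AbsRing)); auto.
    apply (continuous_mult (K := R_AbsRing)); auto. apply continuous_const.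
  - apply continuous_Rinv. apply pow_nonzero. apply Rgt_not_eq.
    apply Cmod_gt_0. apply expi_minus_neq0; auto.
Qed.

Lemma poisson_ker_lower zeta t : Cmod zeta < 1 -> (1 - Cmod zeta) / 2 <= poisson_ker zeta t.
Proof.
  intros H. pose proof (Cmod_ge_0 zeta). unfold poisson_ker.
  assert (H1 : 0 < Cmod (expi t - zeta)) by (apply Cmod_gt_0; apply expi_minus_neq0; auto).
  assert (H2 : Cmod (expi t - zeta) <= 1 + Cmod zeta).
  { unfold Cminus. eapply Rle_trans; [apply Cmod_triangle|]. rewrite Cmod_opp, Cmod_expi. lra. }
  apply Rmult_le_reg_r with (Cmod (expi t - zeta) ^ 2); [apply pow_lt; auto|].
  replace ((1 - Cmod zeta ^ 2) / Cmod (expi t - zeta) ^ 2 * Cmod (expi t - zeta) ^ 2) with (1 - Cmod zeta ^ 2)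
    by (field; lra).
  apply Rle_trans with ((1 - Cmod zeta) / 2 * (1 + Cmod zeta) ^ 2).
  - apply Rmult_le_compat_l; [lra|]. apply pow_incr; lra.
  - assert (0 <= (1 - Cmod zeta) * (1 + Cmod zeta) * (1 - Cmod zeta)) by (repeat apply Rmult_le_pos; lra). nra.
Qed.

(** Cauchy's formula at [zeta] for [F (r u) (1 - |zeta|^2) / (1 - Cconj zeta u)]: the extra factor
    equals 1 at [u = zeta], and on the unit circle it turns the Cauchy kernel into the Poisson
    kernel. The radius [r < 1] is there because [F] lives on the open disc only. *)
Lemma poisson_hol F zeta r a : hol 1 F -> Cmod zeta < 1 -> 0 < r < 1 ->
  cint (fun t => RtoC (poisson_ker zeta t) * F (RtoC r * expi t))%C a (a + 2 * PI) = (RtoC (2 * PI) * F (RtoC r * zeta))%C.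
Proof.
  intros HF Hz Hr. pose proof (Cmod_ge_0 zeta). pose proof PI_RGT_0.
  set (m := Rmax r (Cmod zeta)).
  assert (Hm1 : r <= m) by apply Rmax_l. assert (Hm2 : Cmod zeta <= m) by apply Rmax_r.
  assert (Hm3 : m < 1) by (apply Rmax_lub_lt; lra).
  assert (Hrad : 1 < / m) by (rewrite <- Rinv_1; apply Rinv_lt_contravar; lra).
  assert (Hu1 : forall u x, 0 <= x <= m -> Cmod u < / m -> x * Cmod u < 1).
  { intros u x Hx Hu. pose proof (Cmod_ge_0 u).
    apply Rle_lt_trans with (m * Cmod u); [apply Rmult_le_compat_r; lra|].
    apply Rmult_lt_reg_l with (/ m); [apply Rinv_0_lt_compat; lra|].
    rewrite <- Rmult_assoc, Rinv_l by lra. lra. }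
  assert (Hden : forall u, Cmod u < / m -> (1 - Cconj zeta * u)%C <> 0%C).
  { intros u Hu. apply Cminus_neq0. rewrite Cmod_1, Cmod_mult, Cmod_conj. apply Hu1; auto; lra. }
  set (K := fun u => (F (RtoC r * u) * (RtoC (1 - Cmod zeta ^ 2) * / (1 - Cconj zeta * u)))%C).
  assert (HK : hol (/ m) K).
  { intros u Hu. destruct (HF (RtoC r * u)%C) as [l Hl].
    { rewrite Cmod_scal_R, Rabs_pos_eq by lra. apply Hu1; auto; lra. }
    eexists. apply cder_mult.
    - apply (cder_comp F); [exact Hl|]. apply cder_scal, cder_id.
    - apply cder_scal. apply (cder_inv (fun u => 1 - Cconj zeta * u)%C); [apply Hden; auto|].
      apply (cder_plus (fun _ => 1%C) (fun u => - (Cconj zeta * u))%C); [apply cder_const|].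
      apply (cder_ext_loc (fun u => - Cconj zeta * u)%C _ _ _ 1); [lra|intros; ring|].
      apply cder_scal, cder_id. }
  pose proof (cauchy_formula (/ m) K zeta a Hrad HK Hz) as HC.
  assert (HZ : RtoC (1 - Cmod zeta ^ 2) = (1 - Cconj zeta * zeta)%C).
  { rewrite RtoC_minus, Cmod2_conj. ring. }
  assert (Hzm : Cmod zeta < / m) by lra.
  replace (K zeta) with (F (RtoC r * zeta))%C in HC.
  2:{ unfold K. rewrite HZ. field. apply Hden; auto. }
  rewrite <- HC. apply cint_ext; [lra|]. intros t _. unfold K.
  assert (HE : RtoC (poisson_ker zeta t) = (RtoC (1 - Cmod zeta ^ 2) * / (1 - Cconj zeta * expi t) * (expi t * / (expi t - zeta)))%C).
  { assert (H1 : (expi t - zeta)%C <> 0%C) by (apply expi_minus_neq0; auto).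
    assert (H2 : (1 - Cconj zeta * expi t)%C <> 0%C) by (apply Hden; rewrite Cmod_expi; auto).
    unfold poisson_ker, Rdiv. rewrite RtoC_mult, RtoC_inv.
    2:{ apply pow_nonzero. apply Rgt_not_eq, Cmod_gt_0. auto. }
    rewrite (Cmod2_conj (expi t - zeta)), Cminus_conj.
    assert (H3 : (expi t * Cconj (expi t))%C = 1%C).
    { rewrite <- Cmod2_conj, Cmod_expi. f_equal. ring. }
    assert (H4 : (Cconj (expi t) - Cconj zeta)%C <> 0%C).
    { rewrite <- Cminus_conj. intros E. apply H1. rewrite <- (Cconj_conj (expi t - zeta)), E.
      apply Ceq; simpl; ring. }
    replace (1 - Cconj zeta * expi t)%C with (expi t * (Cconj (expi t) - Cconj zeta))%C
      by (transitivity (expi t * Cconj (expi t) - Cconj zeta * expi t)%C; [ring|rewrite H3; reflexivity]).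
    field. repeat split; auto using expi_neq0. }
  rewrite HE. ring.
Qed.

Lemma poisson_re F zeta r a : hol 1 F -> Cmod zeta < 1 -> 0 < r < 1 ->
  RInt (fun t => poisson_ker zeta t * fst (F (RtoC r * expi t)%C)) a (a + 2 * PI) = 2 * PI * fst (F (RtoC r * zeta)%C).
Proof.
  intros HF Hz Hr. pose proof PI_RGT_0. pose proof (f_equal fst (poisson_hol F zeta r a HF Hz Hr)) as H'.
  simpl in H'. rewrite Rmult_0_l, Rminus_0_r in H'. rewrite <- H'. apply RInt_ext. intros t _. simpl. ring.
Qed.

Lemma hol_const (c : C) rad : hol rad (fun _ => c).
Proof. intros z _. eexists. apply cder_const. Qed.

Lemma pcont_inner_circle F r t : hol 1 F -> 0 < r < 1 -> pcont (fun t => F (RtoC r * expi t)%C) t.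
Proof.
  intros HF Hr. apply (pcont_comp F (fun t => RtoC r * expi t)%C).
  - eapply hol_cont; eauto. rewrite Cmod_scal_R, Cmod_expi, Rabs_pos_eq by lra. lra.
  - apply pcont_mult; [apply pcont_const|apply pcont_expi].
Qed.

Lemma ex_RInt_cont (f : R -> R) a b : (forall t, continuous f t) -> ex_RInt f a b.
Proof. intros H. apply (ex_RInt_continuous (V := R_CompleteNormedModule)). auto. Qed.

Lemma continuous_Rmult (f g : R -> R) t : continuous f t -> continuous g t -> continuous (fun s => f s * g s) t.
Proof. intros. apply (continuous_mult (K := R_AbsRing)); auto. Qed.

Lemma Cmod_0_lt_1 : Cmod (RtoC 0) < 1.
Proof. rewrite Cmod_0; lra. Qed.

Lemma poisson_ker_0 t : poisson_ker (RtoC 0) t = 1.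
Proof.
  unfold poisson_ker. replace (expi t - 0)%C with (expi t) by ring. rewrite Cmod_expi, Cmod_0. field.
Qed.

Lemma mean_value_re F r a : hol 1 F -> 0 < r < 1 ->
  RInt (fun t => fst (F (RtoC r * expi t)%C)) a (a + 2 * PI) = 2 * PI * fst (F 0%C).
Proof.
  intros HF Hr. pose proof (poisson_re F (RtoC 0) r a HF Cmod_0_lt_1 Hr) as H.
  replace (RtoC r * RtoC 0)%C with (RtoC 0) in H by ring. rewrite <- H.
  apply RInt_ext. intros t _. rewrite poisson_ker_0. simpl; ring.
Qed.

(** Poisson's formula on the circle of radius [r = (1 + |zeta|) / 2], where the kernel is at least
    [(1 - |zeta|) / 4], combined with the mean value property at the centre. *)
Lemma harnack F zeta : hol 1 F -> (forall z, Cmod z < 1 -> 0 <= fst (F z)) -> Cmod zeta < 1 ->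
  fst (F 0%C) * (1 - Cmod zeta) / 4 <= fst (F zeta).
Proof.
  intros HF Hpos Hz. pose proof (Cmod_ge_0 zeta). pose proof PI_RGT_0.
  set (r := (1 + Cmod zeta) / 2). assert (Hr : 0 < r < 1) by (unfold r; lra).
  assert (HrC : RtoC r <> 0%C) by (intros E; apply RtoC_inj in E; lra).
  set (z := (/ RtoC r * zeta)%C).
  assert (Hzm : Cmod z = Cmod zeta / r).
  { unfold z. rewrite Cmod_mult, Cmod_inv, Cmod_R, Rabs_pos_eq by (auto; lra). field; lra. }
  assert (Hz1 : (1 - Cmod zeta) / 2 <= 1 - Cmod z).
  { rewrite Hzm. replace (1 - Cmod zeta / r) with ((1 - Cmod zeta) / 2 * / r) by (unfold r; field; lra).
    rewrite <- (Rmult_1_r ((1 - Cmod zeta) / 2)) at 1. apply Rmult_le_compat_l; [lra|].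
    rewrite <- Rinv_1. apply Rinv_le_contravar; lra. }
  pose proof (poisson_re F z r 0 HF ltac:(lra) Hr) as HP.
  replace (RtoC r * z)%C with zeta in HP by (unfold z; field; auto).
  pose proof (mean_value_re F r 0 HF Hr) as HM.
  assert (HL : RInt (fun t => (1 - Cmod z) / 2 * fst (F (RtoC r * expi t)%C)) 0 (0 + 2 * PI) <=
     RInt (fun t => poisson_ker z t * fst (F (RtoC r * expi t)%C)) 0 (0 + 2 * PI)).
  { assert (Hc : forall t, continuous (fun t => fst (F (RtoC r * expi t)%C)) t) by (intros t; exact (proj1 (pcont_inner_circle F r t HF Hr))).
    apply RInt_le; [lra| | |].
    - apply ex_RInt_cont. intros t. apply continuous_Rmult; auto. apply continuous_const.
    - apply ex_RInt_cont. intros t. apply continuous_Rmult; auto. apply poisson_ker_cont. lra.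
    - intros t _. apply Rmult_le_compat_r; [|apply poisson_ker_lower; lra]. apply Hpos.
      rewrite Cmod_scal_R, Cmod_expi, Rabs_pos_eq by lra. lra. }
  rewrite HP in HL.
  assert (HS : RInt (fun t => (1 - Cmod z) / 2 * fst (F (RtoC r * expi t)%C)) 0 (0 + 2 * PI) = (1 - Cmod z) / 2 * (2 * PI * fst (F 0%C))).
  { rewrite <- HM. apply (RInt_scal (V := R_CompleteNormedModule)). apply ex_RInt_cont.
    intros t; exact (proj1 (pcont_inner_circle F r t HF Hr)). }
  rewrite HS in HL.
  assert (HF0 : 0 <= fst (F 0%C)) by (apply Hpos; apply Cmod_0_lt_1).
  apply Rle_trans with ((1 - Cmod z) / 2 * fst (F 0%C)).
  - apply Rle_trans with ((1 - Cmod zeta) / 2 / 2 * fst (F 0%C)); [right; field|].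
    apply Rmult_le_compat_r; auto. lra.
  - apply Rmult_le_reg_l with (2 * PI); [lra|]. lra.
Qed.

(** Multiplying by the conjugate of [F 0] turns [|F 0|^2] into the real part of an average, which is
    estimated as one real integral and thus without the factor 2 of [cint_bound]. *)
Lemma max_center rad F M : 1 < rad -> hol rad F -> (forall t, Cmod (F (expi t)) <= M) -> Cmod (F 0%C) <= M.
Proof.
  intros Hrad HF HM. pose proof PI_RGT_0.
  destruct (Req_dec (Cmod (F 0%C)) 0) as [E|E].
  { rewrite E. eapply Rle_trans; [apply Cmod_ge_0|apply (HM 0)]. }
  assert (Hp : 0 < Cmod (F 0%C)) by (pose proof (Cmod_ge_0 (F 0%C)); lra).
  set (c := Cconj (F 0%C)).
  pose proof (cauchy_formula rad (fun u => c * F u)%C 0%C 0 Hrad) as HC. cbv beta in HC.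
  assert (HcF : hol rad (fun u => c * F u)%C).
  { intros u Hu. destruct (HF u Hu) as [l Hl]. eexists. apply cder_scal; eauto. }
  specialize (HC HcF Cmod_0_lt_1).
  rewrite (cint_ext _ (fun t => c * F (expi t))%C) in HC.
  2: lra.
  2:{ intros t _. field. replace (expi t - 0)%C with (expi t) by ring. apply expi_neq0. }
  apply (f_equal fst) in HC.
  replace (c * F 0%C)%C with (RtoC (Cmod (F 0%C) ^ 2)) in HC by (rewrite Cmod2_conj; unfold c; ring).
  unfold cint in HC. cbn [fst] in HC.
  assert (HR : RInt (fun t => fst (c * F (expi t))%C) 0 (0 + 2 * PI) <= RInt (fun _ => Cmod (F 0%C) * M) 0 (0 + 2 * PI)).
  { apply RInt_le; [lra| | |].
    - apply ex_RInt_cont. intros t. exact (proj1 (pcont_circle rad (fun u => c * F u)%C t Hrad HcF)).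
    - apply ex_RInt_cont. intros t. apply continuous_const.
    - intros t _. eapply Rle_trans; [apply Rle_abs|]. eapply Rle_trans; [apply fst_le_Cmod|].
      rewrite Cmod_mult. unfold c. rewrite Cmod_conj. apply Rmult_le_compat_l; [lra|auto]. }
  rewrite HC, RInt_const in HR. unfold scal in HR; simpl in HR; unfold mult in HR; simpl in HR.
  apply Rmult_le_reg_l with (2 * PI * Cmod (F 0%C)); [nra|]. nra.
Qed.

(* Adding to Cauchy's formula for [F] its (vanishing) counterpart for the conjugate of [F]
   replaces [F] by twice its real part, whose integral is controlled by [Re (F 0)]. *)
Lemma borel_caratheodory F z : hol 1 F -> (forall u, Cmod u < 1 -> 0 <= fst (F u)) -> Cmod z <= 1 / 4 ->
  Cmod (F z - F 0%C) <= 16 * Cmod z * fst (F 0%C).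
Proof.
  intros HF Hpos Hz4. pose proof (Cmod_ge_0 z). pose proof PI_RGT_0.
  (* On the circle of radius 1/2 the point [z] is rescaled to [y], of modulus at most 1/2, which
     keeps the kernel below [2 |y|]. *)
  set (y := (2 * z)%C).
  assert (Hy : Cmod y = 2 * Cmod z) by (unfold y; rewrite Cmod_scal_R, Rabs_pos_eq; lra).
  set (G := fun u => F (RtoC (1/2) * u)%C).
  assert (HG : hol (/ (1/2)) G) by (apply hol_scaled; auto; lra).
  assert (Hrad : 1 < / (1/2)) by lra.
  assert (Hy1 : Cmod y < 1) by lra.
  pose proof (cauchy_formula _ G y 0 Hrad HG Hy1) as C1.
  pose proof (cauchy_formula _ G 0%C 0 Hrad HG Cmod_0_lt_1) as C0.
  assert (Hden : forall u, Cmod u < / (1/2) -> (1 - Cconj y * u)%C <> 0%C).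
  { intros u Hu. apply Cminus_neq0. rewrite Cmod_1, Cmod_mult, Cmod_conj. pose proof (Cmod_ge_0 u). nra. }
  (* On the unit circle the conjugate of [y / (e^it - y)] is [Cconj y e^it / (1 - Cconj y e^it)],
     which extends holomorphically into the disc and vanishes at 0; hence the integral is zero. *)
  assert (C2 : cint (fun t => G (expi t) * (Cconj y * expi t * / (1 - Cconj y * expi t)))%C 0 (0 + 2 * PI) = 0%C).
  { set (K := fun u => (G u * (Cconj y * u * / (1 - Cconj y * u)))%C).
    assert (HK : hol (/ (1/2)) K).
    { intros u Hu. destruct (HG u Hu) as [l Hl]. eexists. apply cder_mult; [exact Hl|].
      apply cder_mult; [apply cder_scal, cder_id|]. apply (cder_inv (fun u => 1 - Cconj y * u)%C); [apply Hden; auto|].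
      apply (cder_plus (fun _ => 1%C) (fun u => - (Cconj y * u))%C); [apply cder_const|].
      apply (cder_ext_loc (fun u => - Cconj y * u)%C _ _ _ 1); [lra|intros; ring|].
      apply cder_scal, cder_id. }
    pose proof (cauchy_formula _ K 0%C 0 Hrad HK Cmod_0_lt_1) as CK.
    replace (RtoC (2 * PI) * K 0)%C with (RtoC 0) in CK by (unfold K; ring).
    rewrite <- CK. apply cint_ext; [lra|]. intros t _. unfold K.
    assert (expi t <> 0%C) by apply expi_neq0.
    assert ((1 - Cconj y * expi t)%C <> 0%C) by (apply Hden; rewrite Cmod_expi; lra).
    field. auto. }
  set (k := fun t => (y * / (expi t - y))%C).
  assert (Hk : forall t, Cmod (k t) <= 2 * Cmod y).
  { intros t. unfold k. rewrite Cmod_mult, Cmod_inv by (apply expi_minus_neq0; auto).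
    rewrite Rmult_comm. apply Rmult_le_compat_r; [apply Cmod_ge_0|].
    replace 2 with (/ (1/2)) by field. apply Rinv_le_contravar; [lra|].
    pose proof (Cmod_triangle_sub (expi t) y). rewrite Cmod_expi in H1. lra. }
  assert (rcG : forall t, pcont (fun t => G (expi t)) t) by (intros; eapply pcont_circle; eauto).
  assert (rck : forall t, pcont k t).
  { intros t. apply pcont_mult; [apply pcont_const|apply pcont_cauchy_kernel; auto]. }
  assert (A1 : cint (fun t => k t * G (expi t))%C 0 (0 + 2 * PI) = (RtoC (2 * PI) * (G y - G 0%C))%C).
  { replace (RtoC (2 * PI) * (G y - G 0%C))%C with (RtoC (2 * PI) * G y - RtoC (2 * PI) * G 0%C)%C by ring.
    rewrite <- C1, <- C0, <- cint_minus; try lra.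
    - apply cint_ext; [lra|]. intros t _. unfold k. field. split; [|apply expi_minus_neq0; auto].
      replace (expi t - 0)%C with (expi t) by ring. apply expi_neq0.
    - intros t _. apply pcont_mult; auto. apply pcont_mult; [apply pcont_expi|apply pcont_cauchy_kernel; auto].
    - intros t _. apply pcont_mult; auto. apply pcont_mult; [apply pcont_expi|apply pcont_cauchy_kernel; auto].
      apply Cmod_0_lt_1. }
  assert (A2 : cint (fun t => Cconj (k t) * G (expi t))%C 0 (0 + 2 * PI) = 0%C).
  { rewrite <- C2. apply cint_ext; [lra|]. intros t _. unfold k.
    assert (H3 : (expi t * Cconj (expi t))%C = 1%C).
    { rewrite <- Cmod2_conj, Cmod_expi. f_equal. ring. }
    rewrite Cmult_conj, Cinv_conj, Cminus_conj by (apply expi_minus_neq0; auto).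
    assert ((1 - Cconj y * expi t)%C <> 0%C) by (apply Hden; rewrite Cmod_expi; lra).
    assert (HD : (1 - Cconj y * expi t)%C = (expi t * (Cconj (expi t) - Cconj y))%C).
    { transitivity (expi t * Cconj (expi t) - Cconj y * expi t)%C; [rewrite H3; reflexivity|ring]. }
    assert (H4 : (Cconj (expi t) - Cconj y)%C <> 0%C).
    { intros E. apply H1. rewrite HD, E. ring. }
    rewrite HD. assert (expi t <> 0%C) by apply expi_neq0.
    transitivity (Cconj y * / (Cconj (expi t) - Cconj y) * G (expi t))%C; [ring|field; auto]. }
  set (u := fun t => fst (G (expi t))).
  assert (Hu0 : forall t, 0 <= u t).
  { intros t. apply Hpos. rewrite Cmod_scal_R, Cmod_expi, Rabs_pos_eq; lra. }
  assert (cu : forall t, continuous u t) by (intros t; exact (proj1 (rcG t))).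
  assert (A3 : (cint (fun t => RtoC (2 * u t) * k t) 0 (0 + 2 * PI))%C = (RtoC (2 * PI) * (G y - G 0%C))%C).
  { rewrite <- A1. replace (cint (fun t => k t * G (expi t))%C 0 (0 + 2 * PI)) with
      (cint (fun t => k t * G (expi t))%C 0 (0 + 2 * PI) + Cconj (cint (fun t => Cconj (k t) * G (expi t))%C 0 (0 + 2 * PI)))%C.
    2:{ rewrite A2. apply Ceq; simpl; ring. }
    assert (EC : Cconj (cint (fun t => Cconj (k t) * G (expi t))%C 0 (0 + 2 * PI)) = cint (fun t => k t * Cconj (G (expi t)))%C 0 (0 + 2 * PI)).
    { unfold cint. apply Ceq; simpl.
      - apply RInt_ext_R; intros; ring.
      - assert (RO : forall h a b, ex_RInt h a b -> RInt (fun t => - h t) a b = - RInt h a b).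
        { intros h a b Hh. apply (RInt_opp (V := R_CompleteNormedModule) h a b Hh). }
        rewrite <- RO.
        + apply RInt_ext_R; intros; ring.
        + apply ex_RInt_cont. intros t.
          apply (continuous_plus (fun t => fst (k t) * snd (G (expi t))) (fun t => - snd (k t) * fst (G (expi t))));
          apply continuous_Rmult.
          * exact (proj1 (rck t)).
          * exact (proj2 (rcG t)).
          * apply (continuous_opp (fun t => snd (k t))). exact (proj2 (rck t)).
          * exact (proj1 (rcG t)). }
    rewrite EC, <- cint_plus; [|lra|intros t _; apply pcont_mult; auto|].
    - apply cint_ext; [lra|]. intros t _. unfold u. apply Ceq; simpl; ring.
    - intros t _. apply pcont_mult; auto. destruct (rcG t). split; simpl; auto.
      apply (continuous_opp (fun t => snd (G (expi t)))). auto. }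
  assert (MV : RInt u 0 (0 + 2 * PI) = 2 * PI * fst (F 0%C)) by (apply (mean_value_re F (1/2) 0 HF); lra).
  assert (HB : forall (h : R -> R), (forall t, continuous h t) -> (forall t, Rabs (h t) <= 2 * Cmod y) ->
     Rabs (RInt (fun t => 2 * u t * h t) 0 (0 + 2 * PI)) <= 4 * Cmod y * (2 * PI * fst (F 0%C))).
  { intros h Hh1 Hh2. rewrite <- MV.
    assert (ES : 4 * Cmod y * RInt u 0 (0 + 2 * PI) = RInt (fun t => 4 * Cmod y * u t) 0 (0 + 2 * PI)).
    { symmetry. apply (RInt_scal (V := R_CompleteNormedModule)). apply ex_RInt_cont; auto. }
    rewrite ES. eapply Rle_trans; [apply abs_RInt_le; [lra|]|].
    - apply ex_RInt_cont. intros t. apply continuous_Rmult; auto. apply continuous_Rmult; auto. apply continuous_const.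
    - apply RInt_le; [lra| | |].
      + apply ex_RInt_cont. intros t. apply (continuous_comp (fun t => 2 * u t * h t) Rabs).
        * apply continuous_Rmult; auto. apply continuous_Rmult; auto. apply continuous_const.
        * apply continuous_Rabs.
      + apply ex_RInt_cont. intros t. apply continuous_Rmult; auto. apply continuous_const.
      + intros t _. rewrite !Rabs_mult, (Rabs_pos_eq (u t)), (Rabs_pos_eq 2) by (auto; lra).
        specialize (Hh2 t). specialize (Hu0 t). nra. }
  assert (HF0 : 0 <= fst (F 0%C)) by (apply Hpos; apply Cmod_0_lt_1).
  assert (HFin : 2 * PI * Cmod (G y - G 0%C) <= 8 * Cmod y * (2 * PI * fst (F 0%C))).
  { replace (2 * PI * Cmod (G y - G 0%C)) with (Cmod (RtoC (2 * PI) * (G y - G 0%C)))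
      by (rewrite Cmod_scal_R, Rabs_pos_eq; lra).
    rewrite <- A3. eapply Rle_trans; [apply Cmod_le_sum|]. unfold cint. cbn [fst snd].
    rewrite (RInt_ext _ (fun t => 2 * u t * fst (k t))) by (intros; simpl; ring).
    rewrite (RInt_ext (fun t => snd (RtoC (2 * u t) * k t)%C) (fun t => 2 * u t * snd (k t))) by (intros; simpl; ring).
    pose proof (HB (fun t => fst (k t)) (fun t => proj1 (rck t)) ltac:(intros t; exact (Rle_trans _ _ _ (fst_le_Cmod (k t)) (Hk t)))).
    pose proof (HB (fun t => snd (k t)) (fun t => proj2 (rck t)) ltac:(intros t; exact (Rle_trans _ _ _ (snd_le_Cmod (k t)) (Hk t)))).
    lra. }
  unfold G in HFin.
  replace (RtoC (1/2) * y)%C with z in HFin.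
  2:{ unfold y. apply Ceq; simpl; field. }
  replace (RtoC (1/2) * 0)%C with (RtoC 0) in HFin by ring.
  rewrite Hy in HFin.
  apply Rmult_le_reg_l with (2 * PI); [lra|]. nra.
Qed.

(** ** Mean value inequality along segments *)

Lemma is_derive_eps (f : R -> R) (t l : R) :
  (forall eps, 0 < eps -> exists del, 0 < del /\ forall s, Rabs (s - t) < del ->
     Rabs (f s - f t - l * (s - t)) <= eps * Rabs (s - t)) -> is_derive f t l.
Proof.
  intros H. apply is_derive_Reals. intros e He. destruct (H (e / 2)) as [d [Hd H']]; [lra|].
  exists (mkposreal d Hd). intros h Hh0 Hh. simpl in Hh.
  specialize (H' (t + h)). replace (t + h - t) with h in H' by ring. specialize (H' Hh).
  assert (0 < Rabs h) by (apply Rabs_pos_lt; auto).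
  replace ((f (t + h) - f t) / h - l) with ((f (t + h) - f t - l * h) / h) by (field; auto).
  unfold Rdiv. rewrite Rabs_mult, Rabs_inv.
  apply Rle_lt_trans with (e / 2 * Rabs h * / Rabs h).
  - apply Rmult_le_compat_r; [left; apply Rinv_0_lt_compat; auto|auto].
  - replace (e / 2 * Rabs h * / Rabs h) with (e / 2) by (field; lra). lra.
Qed.

Lemma is_derive_eps_inv (f : R -> R) (t l : R) : is_derive f t l ->
  forall eps, 0 < eps -> exists del, 0 < del /\ forall s, Rabs (s - t) < del ->
     Rabs (f s - f t - l * (s - t)) <= eps * Rabs (s - t).
Proof.
  intros H e He. apply is_derive_Reals in H. destruct (H e He) as [d H'].
  exists d. split; [apply cond_pos|]. intros s Hs.
  destruct (Req_dec s t) as [->|Hne].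
  { replace (f t - f t - l * (t - t)) with 0 by ring. rewrite Rabs_R0. apply Rmult_le_pos; [lra|apply Rabs_pos]. }
  assert (Hst : s - t <> 0) by lra.
  specialize (H' (s - t) Hst Hs). replace (t + (s - t)) with s in H' by ring.
  replace (f s - f t - l * (s - t)) with (((f s - f t) / (s - t) - l) * (s - t)) by (field; auto).
  rewrite Rabs_mult. apply Rmult_le_compat_r; [apply Rabs_pos|lra].
Qed.

Lemma cder_line F (a h : C) t l : cder F (a + RtoC t * h)%C l -> pder (fun s => F (a + RtoC s * h)%C) t (l * h)%C.
Proof.
  intros H. rewrite cder_eps in H.
  assert (E : forall eps, 0 < eps -> exists del, 0 < del /\ forall s, Rabs (s - t) < del ->
     Cmod (F (a + RtoC s * h) - F (a + RtoC t * h) - l * h * RtoC (s - t))%C <= eps * Rabs (s - t)).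
  { intros e He. pose proof (Cmod_ge_0 h) as Hh.
    destruct (H (e / (Cmod h + 1))) as [d [Hd H']]; [apply Rdiv_lt_0_compat; lra|].
    exists (d / (Cmod h + 1)). split; [apply Rdiv_lt_0_compat; lra|]. intros s Hs.
    specialize (H' (a + RtoC s * h)%C).
    replace (a + RtoC s * h - (a + RtoC t * h))%C with (RtoC (s - t) * h)%C in H' by (rewrite RtoC_minus; ring).
    rewrite Cmod_scal_R in H'. pose proof (Rabs_pos (s - t)).
    assert (Rabs (s - t) * (Cmod h + 1) < d).
    { apply Rlt_le_trans with (d / (Cmod h + 1) * (Cmod h + 1)); [apply Rmult_lt_compat_r; lra|right; field; lra]. }
    specialize (H' ltac:(nra)).
    replace (l * h * RtoC (s - t))%C with (l * (RtoC (s - t) * h))%C by ring.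
    eapply Rle_trans; [exact H'|].
    replace (e * Rabs (s - t)) with (e / (Cmod h + 1) * (Rabs (s - t) * (Cmod h + 1))) by (field; lra).
    apply Rmult_le_compat_l; [left; apply Rdiv_lt_0_compat; lra|]. nra. }
  split; apply is_derive_eps; intros e He; destruct (E e He) as [d [Hd H']]; exists d; (split; [auto|]);
    intros s Hs; specialize (H' s Hs); (eapply Rle_trans; [|exact H']).
  - eapply Rle_trans; [|apply fst_le_Cmod]. right. f_equal. simpl. ring.
  - eapply Rle_trans; [|apply snd_le_Cmod]. right. f_equal. simpl. ring.
Qed.

Lemma real_mvt_bound (f df : R -> R) (M a b : R) : a <= b ->
  (forall t, a <= t <= b -> is_derive f t (df t)) -> (forall t, a <= t <= b -> Rabs (df t) <= M) ->
  Rabs (f b - f a) <= M * (b - a).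
Proof.
  intros Hab Hd HM. destruct (MVT_gen f a b df) as [c [Hc1 Hc2]];
    rewrite ?Rmin_left, ?Rmax_right in * by auto.
  - intros t Ht. apply Hd. lra.
  - intros t Ht. apply continuity_pt_filterlim.
    apply (ex_derive_continuous (K := R_AbsRing) (V := R_NormedModule)). eexists; apply Hd; auto.
  - rewrite Hc2, Rabs_mult, (Rabs_pos_eq (b - a)) by lra. apply Rmult_le_compat_r; [lra|auto].
Qed.

Lemma cder_mvt F F' (a z : C) M :
  (forall t, 0 <= t <= 1 -> cder F (a + RtoC t * (z - a))%C (F' (a + RtoC t * (z - a))%C)) ->
  (forall t, 0 <= t <= 1 -> Cmod (F' (a + RtoC t * (z - a))%C) <= M) ->
  Cmod (F z - F a) <= 2 * M * Cmod (z - a).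
Proof.
  intros Hd HM.
  assert (Hr : forall t, 0 <= t <= 1 -> pder (fun s => F (a + RtoC s * (z - a))%C) t (F' (a + RtoC t * (z - a)) * (z - a))%C).
  { intros t Ht. apply cder_line. auto. }
  assert (HB : forall t, 0 <= t <= 1 -> Cmod (F' (a + RtoC t * (z - a)) * (z - a))%C <= M * Cmod (z - a)).
  { intros t Ht. rewrite Cmod_mult. apply Rmult_le_compat_r; [apply Cmod_ge_0|auto]. }
  assert (E1 : F z = F (a + RtoC 1 * (z - a))%C) by (f_equal; ring).
  assert (E0 : F a = F (a + RtoC 0 * (z - a))%C) by (f_equal; ring).
  rewrite E1, E0.
  eapply Rle_trans; [apply Cmod_le_sum|].
  pose proof (real_mvt_bound (fun s => fst (F (a + RtoC s * (z - a))%C)) _ (M * Cmod (z - a)) 0 1 ltac:(lra)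
    (fun t Ht => proj1 (Hr t Ht)) ltac:(intros t Ht; eapply Rle_trans; [apply fst_le_Cmod|auto])) as H1.
  pose proof (real_mvt_bound (fun s => snd (F (a + RtoC s * (z - a))%C)) _ (M * Cmod (z - a)) 0 1 ltac:(lra)
    (fun t Ht => proj2 (Hr t Ht)) ltac:(intros t Ht; eapply Rle_trans; [apply snd_le_Cmod|auto])) as H2.
  cbv beta in H1, H2. set (X := F (a + RtoC 1 * (z - a))%C) in *. set (Y := F (a + RtoC 0 * (z - a))%C) in *.
  change (Rabs (fst X - fst Y) + Rabs (snd X - snd Y) <= 2 * M * Cmod (z - a)).
  lra.
Qed.

Lemma segment_dist (a z c : C) r t : 0 <= t <= 1 -> Cmod (a - c) < r -> Cmod (z - c) < r ->
  Cmod (a + RtoC t * (z - a) - c)%C < r.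
Proof.
  intros Ht Ha Hz.
  replace (a + RtoC t * (z - a) - c)%C with (RtoC (1 - t) * (a - c) + RtoC t * (z - c))%C
    by (rewrite RtoC_minus; ring).
  eapply Rle_lt_trans; [apply Cmod_triangle|]. rewrite !Cmod_scal_R, !Rabs_pos_eq by lra.
  destruct (Rle_lt_dec t 0). { assert (Ht0 : t = 0) by lra. subst t. rewrite Rminus_0_r, Rmult_1_l, Rmult_0_l. lra. }
  apply Rlt_le_trans with ((1 - t) * r + t * r); [|lra].
  apply Rplus_le_lt_compat; [apply Rmult_le_compat_l; lra|apply Rmult_lt_compat_l; lra].
Qed.

Lemma Cminus_diag (z : C) : (z - z)%C = RtoC 0.
Proof. ring. Qed.

Lemma disc_segment (a z : C) t : 0 <= t <= 1 -> Cmod a < 1 -> Cmod z < 1 -> Cmod (a + RtoC t * (z - a))%C < 1.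
Proof.
  intros Ht Ha Hz. pose proof (segment_dist a z 0%C 1 t Ht) as H.
  replace (a - 0)%C with a in H by ring. replace (z - 0)%C with z in H by ring.
  replace (a + RtoC t * (z - a) - 0)%C with (a + RtoC t * (z - a))%C in H by ring. auto.
Qed.

(** ** Univalent functions on the disc *)

Section Univalent.
Variable psi : C -> C.
Hypothesis Hhol : hol 1 psi.
Hypothesis Hinj : forall z1 z2, Cmod z1 < 1 -> Cmod z2 < 1 -> psi z1 = psi z2 -> z1 = z2.

Lemma disc_ball z0 u rho : Cmod z0 < 1 -> 0 < rho -> rho * Cmod u < 1 - Cmod z0 -> Cmod (z0 + RtoC rho * u)%C < 1.
Proof.
  intros. eapply Rle_lt_trans; [apply Cmod_triangle|]. rewrite Cmod_scal_R, Rabs_pos_eq by lra. lra.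
Qed.

(** Injectivity keeps [psi] away from [psi z0] at each point of the circle, and compactness makes
    this uniform. *)
Lemma circle_lower z0 rho : Cmod z0 < 1 -> 0 < rho < 1 - Cmod z0 ->
  exists m, 0 < m /\ forall t, m <= Cmod (psi (z0 + RtoC rho * expi t) - psi z0)%C.
Proof.
  intros Hz0 Hrho. pose proof PI_RGT_0.
  assert (Hin : forall t, Cmod (z0 + RtoC rho * expi t)%C < 1).
  { intros t. apply disc_ball; auto; rewrite ?Cmod_expi; lra. }
  assert (Hc : forall t, continuous (fun t => Cmod (psi (z0 + RtoC rho * expi t) - psi z0)%C) t).
  { intros t. apply pcont_Cmod. apply pcont_minus; [|apply pcont_const].
    apply (pcont_comp psi (fun t => z0 + RtoC rho * expi t)%C).
    - eapply hol_cont; eauto.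
    - apply pcont_plus; [apply pcont_const|apply pcont_mult; [apply pcont_const|apply pcont_expi]]. }
  destruct (continuity_ab_min (fun t => Cmod (psi (z0 + RtoC rho * expi t) - psi z0)%C) (-PI) PI ltac:(lra)) as [m [Hm Hm']].
  { intros t _. apply continuity_pt_filterlim. apply Hc. }
  exists (Cmod (psi (z0 + RtoC rho * expi m) - psi z0)%C). split.
  - apply Cmod_gt_0. intros E.
    assert (E' : psi (z0 + RtoC rho * expi m)%C = psi z0) by (replace (psi z0) with (psi z0 + 0)%C by ring; rewrite <- E; ring).
    apply Hinj in E'; auto. apply (f_equal (fun z => z - z0)%C) in E'.
    replace (z0 + RtoC rho * expi m - z0)%C with (RtoC rho * expi m)%C in E' by ring. rewrite Cminus_diag in E'.
    apply (f_equal Cmod) in E'. rewrite Cmod_scal_R, Cmod_expi, Cmod_0, Rabs_pos_eq in E' by lra. lra.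
  - intros t.
    destruct (expi_reduce t (- PI)) as [s [Hs Es]]. rewrite <- Es. apply (Hm s). lra.
Qed.

(** If [psi] omitted a value [w] close to [psi z0], then [1 / (psi - w)] would be holomorphic,
    bounded by [2 / m] on the circle but larger than that at its centre. *)
Lemma univalent_open z0 rho : Cmod z0 < 1 -> 0 < rho -> exists del, 0 < del /\
  forall w, Cmod (w - psi z0) < del -> exists z, Cmod z < 1 /\ Cmod (z - z0) < rho /\ psi z = w.
Proof.
  intros Hz0 Hrho.
  set (r := Rmin rho (1 - Cmod z0) / 2).
  assert (Hm : 0 < Rmin rho (1 - Cmod z0)) by (apply Rmin_pos; lra).
  pose proof (Rmin_l rho (1 - Cmod z0)). pose proof (Rmin_r rho (1 - Cmod z0)).
  destruct (circle_lower z0 r Hz0) as [m [Hm0 Hmin]]; [unfold r; lra|].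
  exists (m / 2). split; [lra|]. intros w Hw.
  destruct (classic (exists z, Cmod z < 1 /\ Cmod (z - z0) < rho /\ psi z = w)) as [|Hno]; [auto|exfalso].
  assert (Hin : forall u, Cmod u < 2 -> Cmod (z0 + RtoC r * u)%C < 1 /\ Cmod (z0 + RtoC r * u - z0)%C < rho).
  { intros u Hu. pose proof (Cmod_ge_0 u). split.
    - apply disc_ball; auto; unfold r; nra.
    - replace (z0 + RtoC r * u - z0)%C with (RtoC r * u)%C by ring.
      rewrite Cmod_scal_R, Rabs_pos_eq by (unfold r; lra). unfold r; nra. }
  assert (Hne : forall u, Cmod u < 2 -> (psi (z0 + RtoC r * u) - w)%C <> 0%C).
  { intros u Hu E. apply Hno. exists (z0 + RtoC r * u)%C. destruct (Hin u Hu). repeat split; auto.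
    replace w with (w + 0)%C by ring. rewrite <- E. ring. }
  set (F := fun u => (/ (psi (z0 + RtoC r * u) - w))%C).
  assert (HF : hol 2 F).
  { intros u Hu. destruct (Hhol _ (proj1 (Hin u Hu))) as [l Hl]. eexists.
    apply (cder_inv (fun u => psi (z0 + RtoC r * u) - w)%C); [apply Hne; auto|].
    apply (cder_plus (fun u => psi (z0 + RtoC r * u))%C (fun _ => - w)%C); [|apply cder_const].
    apply (cder_comp psi (fun u => z0 + RtoC r * u)%C); [exact Hl|].
    apply (cder_plus (fun _ => z0) (fun u => RtoC r * u)%C); [apply cder_const|apply cder_scal, cder_id]. }
  assert (HB : Cmod (F 0%C) <= / (m / 2)).
  { apply (max_center 2); [lra|auto|]. intros t. unfold F. rewrite Cmod_inv by (apply Hne; rewrite Cmod_expi; lra).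
    apply Rinv_le_contravar; [lra|].
    pose proof (Cmod_triangle_sub (psi (z0 + RtoC r * expi t) - psi z0) (w - psi z0)).
    replace (psi (z0 + RtoC r * expi t) - psi z0 - (w - psi z0))%C with (psi (z0 + RtoC r * expi t) - w)%C in H1 by ring.
    specialize (Hmin t). lra. }
  unfold F in HB. replace (z0 + RtoC r * 0)%C with z0 in HB by ring.
  assert (Hw0 : (psi z0 - w)%C <> 0%C).
  { specialize (Hne 0%C). replace (z0 + RtoC r * 0)%C with z0 in Hne by ring. apply Hne. rewrite Cmod_0; lra. }
  rewrite Cmod_inv in HB by auto. rewrite Cmod_minus_sym in Hw.
  assert (/ (m / 2) < / Cmod (psi z0 - w)).
  { apply Rinv_lt_contravar; [|auto]. apply Rmult_lt_0_compat; [|lra]. apply Cmod_gt_0; auto. }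
  lra.
Qed.

(** The mean value bound is applied to the second-order remainder [E], whose derivative is the
    first-order remainder of [cderiv psi]. *)
Lemma taylor2 a : Cmod a < 1 -> forall eps, 0 < eps -> exists del, 0 < del /\ forall z, Cmod (z - a) < del ->
  Cmod z < 1 /\
  Cmod (psi z - psi a - cderiv psi a * (z - a) - cderiv (cderiv psi) a / 2 * ((z - a) * (z - a)))%C <= eps * (Cmod (z - a) * Cmod (z - a)).
Proof.
  intros Ha e He.
  pose proof (cderiv_spec 1 (cderiv psi) a (hol_cderiv _ Hhol) Ha) as H2. rewrite cder_eps in H2.
  destruct (H2 (e / 2)) as [d [Hd H]]; [lra|].
  exists (Rmin d (1 - Cmod a)). split; [apply Rmin_pos; lra|]. intros z Hz.
  pose proof (Rmin_l d (1 - Cmod a)). pose proof (Rmin_r d (1 - Cmod a)).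
  assert (Hz1 : Cmod z < 1) by (pose proof (Cmod_triangle_sub z a); lra).
  split; [auto|].
  set (E := fun u => (psi u + (- cderiv psi a * (u - a) + - (cderiv (cderiv psi) a / 2) * ((u - a) * (u - a))))%C).
  set (E' := fun u => (cderiv psi u + (- cderiv psi a * (1 + 0) + - (cderiv (cderiv psi) a / 2) * ((1 + 0) * (u - a) + (u - a) * (1 + 0))))%C).
  assert (Hseg : forall t, 0 <= t <= 1 -> Cmod (a + RtoC t * (z - a))%C < 1) by (intros; apply disc_segment; auto).
  pose proof (cder_mvt E E' a z (e / 2 * Cmod (z - a))) as HM.
  replace (psi z - psi a - cderiv psi a * (z - a) - cderiv (cderiv psi) a / 2 * ((z - a) * (z - a)))%C with (E z - E a)%C
    by (unfold E; ring).
  replace (e * (Cmod (z - a) * Cmod (z - a))) with (2 * (e / 2 * Cmod (z - a)) * Cmod (z - a)) by field.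
  apply HM.
  - intros t Ht. unfold E, E'. set (u := (a + RtoC t * (z - a))%C).
    assert (Hua : cder (fun u => u - a)%C u (1 + 0)%C).
    { apply (cder_plus (fun u => u) (fun _ => - a)%C); [apply cder_id|apply cder_const]. }
    apply cder_plus; [apply (cderiv_spec 1); auto; apply Hseg; auto|].
    apply (cder_plus (fun u => - cderiv psi a * (u - a))%C (fun u => - (cderiv (cderiv psi) a / 2) * ((u - a) * (u - a)))%C).
    + apply (cder_scal (fun u => u - a)%C); auto.
    + apply (cder_scal (fun u => (u - a) * (u - a))%C).
      apply (cder_mult (fun u => u - a)%C (fun u => u - a)%C); auto.
  - intros t Ht. set (u := (a + RtoC t * (z - a))%C).
    assert (Hu : (u - a)%C = (RtoC t * (z - a))%C) by (unfold u; ring).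
    assert (Hum : Cmod (u - a) <= Cmod (z - a)).
    { rewrite Hu, Cmod_scal_R, Rabs_pos_eq by lra. pose proof (Cmod_ge_0 (z - a)). nra. }
    specialize (H u ltac:(lra)). unfold E'.
    replace (cderiv psi u + (- cderiv psi a * (1 + 0) + - (cderiv (cderiv psi) a / 2) * ((1 + 0) * (u - a) + (u - a) * (1 + 0))))%C with
      (cderiv psi u - cderiv psi a - cderiv (cderiv psi) a * (u - a))%C
      by (field; intros E0; apply RtoC_inj in E0; lra).
    eapply Rle_trans; [exact H|]. apply Rmult_le_compat_l; lra.
Qed.

(** Otherwise [psi] would be constant along a short segment issuing from [z0], against
    injectivity. *)
Lemma univalent_der_near z0 r : Cmod z0 < 1 -> 0 < r -> exists a, Cmod a < 1 /\ Cmod (a - z0) < r /\ cderiv psi a <> 0%C.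
Proof.
  intros Hz0 Hr. destruct (classic (exists a, Cmod a < 1 /\ Cmod (a - z0) < r /\ cderiv psi a <> 0%C)) as [|Hno]; [auto|exfalso].
  set (h := Rmin r (1 - Cmod z0) / 2).
  assert (Hm : 0 < Rmin r (1 - Cmod z0)) by (apply Rmin_pos; lra).
  pose proof (Rmin_l r (1 - Cmod z0)). pose proof (Rmin_r r (1 - Cmod z0)).
  set (z := (z0 + RtoC h)%C).
  assert (Hzz : (z - z0)%C = RtoC h) by (unfold z; ring).
  assert (Hh : Cmod (RtoC h) = h) by (rewrite Cmod_R, Rabs_pos_eq; unfold h; lra).
  assert (Hz1 : Cmod z < 1).
  { unfold z. eapply Rle_lt_trans; [apply Cmod_triangle|]. rewrite Hh. unfold h; lra. }
  assert (psi z = psi z0).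
  { assert (HM : Cmod (psi z - psi z0) <= 2 * 0 * Cmod (z - z0)).
    { apply (cder_mvt psi (cderiv psi)).
      - intros t Ht. apply (cderiv_spec 1); auto. apply disc_segment; auto.
      - intros t Ht. right. replace (cderiv psi (z0 + RtoC t * (z - z0))%C) with (RtoC 0); [apply Cmod_0|].
        destruct (classic (cderiv psi (z0 + RtoC t * (z - z0))%C = RtoC 0)) as [E|E]; [auto|exfalso].
        apply Hno. exists (z0 + RtoC t * (z - z0))%C. repeat split; auto.
        + apply disc_segment; auto.
        + apply segment_dist; auto.
          * rewrite Cminus_diag, Cmod_0; auto.
          * rewrite Hzz, Hh. unfold h; lra. }
    pose proof (Cmod_ge_0 (psi z - psi z0)).
    assert (E : Cmod (psi z - psi z0) = 0) by lra. apply Cmod_eq_0 in E.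
    replace (psi z0) with (psi z0 + 0)%C by ring. rewrite <- E. ring. }
  apply Hinj in H1; auto. rewrite H1, Cminus_diag in Hzz. apply RtoC_inj in Hzz. unfold h in Hzz. lra.
Qed.

(* At a point [a] near [z0] with [psi' a <> 0] the function [(z - a) / (psi z - psi a)] is holomorphic and
   nowhere singular, so its value at [z0] is bounded by its size on a fixed circle; if [psi' z0 = 0]
   this value blows up as [a] tends to [z0]. *)
Lemma univalent_der_neq0 z0 : Cmod z0 < 1 -> cderiv psi z0 <> 0%C.
Proof.
  intros Hz0 E.
  set (rho := (1 - Cmod z0) / 4).
  assert (Hrho : 0 < rho < 1 - Cmod z0) by (unfold rho; lra).
  destruct (circle_lower z0 rho Hz0 Hrho) as [m [Hm Hmin]].
  destruct (hol_cont 1 psi z0 Hhol Hz0 (m / 2)) as [d1 [Hd1 Hc]]; [lra|].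
  pose proof (cderiv_spec 1 psi z0 Hhol Hz0) as HD. rewrite E, cder_eps in HD.
  (* The circle will give [|1 / q z0| <= 4 rho / m], whereas this choice of slope gives
     [|1 / q z0| >= 16 rho / m]. *)
  destruct (HD (m / (16 * rho))) as [d2 [Hd2 HD2]]; [apply Rdiv_lt_0_compat; lra|].
  set (r := Rmin d1 (Rmin d2 rho)).
  assert (Hr : 0 < r) by (apply Rmin_pos; [auto|apply Rmin_pos; lra]).
  assert (Hr1 : r <= d1) by apply Rmin_l.
  assert (Hr2 : r <= d2) by (eapply Rle_trans; [apply Rmin_r|apply Rmin_l]).
  assert (Hr3 : r <= rho) by (eapply Rle_trans; [apply Rmin_r|apply Rmin_r]).
  destruct (univalent_der_near z0 r Hz0 Hr) as [a [Ha1 [Ha2 Ha3]]].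
  assert (Haz : a <> z0) by (intros ->; auto).
  assert (Haz' : 0 < Cmod (a - z0)).
  { apply Cmod_gt_0. intros E0. apply Haz. replace z0 with (z0 + 0)%C by ring. rewrite <- E0. ring. }
  set (q := fun z => if Req_EM_T (Cmod (z - a)) 0 then cderiv psi a else ((psi z - psi a) / (z - a))%C).
  assert (Hq : forall z, Cmod (z - a) <> 0 -> q z = ((psi z - psi a) / (z - a))%C).
  { intros z Hz. unfold q. destruct (Req_EM_T _ 0); [contradiction|auto]. }
  assert (Hqa : q a = cderiv psi a).
  { unfold q. destruct (Req_EM_T _ 0) as [|n]; [auto|]. exfalso; apply n. rewrite Cminus_diag, Cmod_0; auto. }
  assert (Hne : forall z, Cmod (z - a) <> 0 -> (z - a)%C <> 0%C).
  { intros z Hz E0. apply Hz. rewrite E0. apply Cmod_0. }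
  assert (Heq : forall z, Cmod (z - a) = 0 -> z = a).
  { intros z Hz. apply Cmod_eq_0 in Hz. replace a with (a + 0)%C by ring. rewrite <- Hz. ring. }
  assert (Hq0 : forall z, Cmod z < 1 -> q z <> 0%C).
  { intros z Hz. destruct (Req_EM_T (Cmod (z - a)) 0) as [e|n].
    - rewrite (Heq z e), Hqa. auto.
    - rewrite (Hq z n). intros E0. apply n. assert (psi z = psi a).
      { replace (psi a) with (psi a + (z - a) * 0)%C by ring. rewrite <- E0. field. apply Hne; auto. }
      apply Hinj in H; auto. rewrite H, Cminus_diag, Cmod_0; auto. }
  assert (Hqh : hol 1 q).
  { intros z Hz. destruct (Req_EM_T (Cmod (z - a)) 0) as [e|n].
    - rewrite (Heq z e). exists (cderiv (cderiv psi) a / 2)%C. apply cder_eps. intros e1 He1.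
      destruct (taylor2 a Ha1 e1 He1) as [d [Hd HT]]. exists d. split; [auto|]. intros u Hu.
      destruct (HT u Hu) as [_ HT']. rewrite Hqa.
      destruct (Req_EM_T (Cmod (u - a)) 0) as [e2|n2].
      + rewrite (Heq u e2), Hqa, !Cminus_diag, Cmult_0_r, Cminus_diag, Cmod_0. lra.
      + rewrite (Hq u n2). pose proof (Cmod_ge_0 (u - a)).
        apply Rmult_le_reg_r with (Cmod (u - a)); [lra|]. rewrite <- Cmod_mult.
        replace (((psi u - psi a) / (u - a) - cderiv psi a - cderiv (cderiv psi) a / 2 * (u - a)) * (u - a))%C with
          (psi u - psi a - cderiv psi a * (u - a) - cderiv (cderiv psi) a / 2 * ((u - a) * (u - a)))%C
          by (field; apply Hne; auto).
        lra.
    - destruct (Hhol z Hz) as [l Hl]. eexists.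
      apply (cder_ext_loc (fun u => (psi u - psi a) * / (u - a))%C _ _ _ (Cmod (z - a))).
      + pose proof (Cmod_ge_0 (z - a)). lra.
      + intros u Hu. symmetry. apply Hq. intros E0. rewrite (Heq u E0), Cmod_minus_sym in Hu. lra.
      + apply cder_mult.
        * apply (cder_plus psi (fun _ => - psi a)%C); [exact Hl|apply cder_const].
        * apply (cder_inv (fun u => u - a)%C); [apply Hne; auto|].
          apply (cder_plus (fun u => u) (fun _ => - a)%C); [apply cder_id|apply cder_const]. }
  assert (Hin : forall u, Cmod u < 2 -> Cmod (z0 + RtoC rho * u)%C < 1).
  { intros u Hu. pose proof (Cmod_ge_0 u). apply disc_ball; auto; unfold rho in *; nra. }
  set (F := fun u => (/ q (z0 + RtoC rho * u))%C).
  assert (HF : hol 2 F).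
  { intros u Hu. destruct (Hqh _ (Hin u Hu)) as [l Hl]. eexists.
    apply (cder_inv (fun u => q (z0 + RtoC rho * u))%C); [apply Hq0; auto|].
    apply (cder_comp q (fun u => z0 + RtoC rho * u)%C); [exact Hl|].
    apply (cder_plus (fun _ => z0) (fun u => RtoC rho * u)%C); [apply cder_const|apply cder_scal, cder_id]. }
  assert (HB : Cmod (F 0%C) <= 4 * rho / m).
  { apply (max_center 2); [lra|auto|]. intros t. unfold F.
    assert (Hs : Cmod (z0 + RtoC rho * expi t - z0) = rho).
    { replace (z0 + RtoC rho * expi t - z0)%C with (RtoC rho * expi t)%C by ring.
      rewrite Cmod_scal_R, Cmod_expi, Rabs_pos_eq by lra. lra. }
    set (z := (z0 + RtoC rho * expi t)%C) in *.
    assert (Hz : Cmod z < 1) by (apply Hin; rewrite Cmod_expi; lra).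
    pose proof (Cmod_dist_triangle z z0 a) as T1. rewrite (Cmod_minus_sym z0 a) in T1.
    pose proof (Cmod_dist_triangle z a z0) as T2.
    assert (Hza : 0 < Cmod (z - a)) by lra.
    rewrite Cmod_inv, Hq by (try apply Hq0; auto; lra).
    rewrite Cmod_div by (apply Hne; lra).
    specialize (Hmin t). fold z in Hmin. specialize (Hc a I ltac:(lra)).
    pose proof (Cmod_dist_triangle (psi z) (psi a) (psi z0)) as T3.
    assert (Hp : m / 2 <= Cmod (psi z - psi a)) by lra.
    replace (/ (Cmod (psi z - psi a) / Cmod (z - a))) with (Cmod (z - a) * / Cmod (psi z - psi a)) by (field; lra).
    replace (4 * rho / m) with (2 * rho * / (m / 2)) by (field; lra).
    apply Rmult_le_compat; [lra|left; apply Rinv_0_lt_compat; lra|lra|apply Rinv_le_contravar; lra]. }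
  unfold F in HB. replace (z0 + RtoC rho * 0)%C with z0 in HB by ring.
  rewrite Cmod_inv in HB by (apply Hq0; auto).
  assert (Hza : Cmod (z0 - a) <> 0) by (rewrite Cmod_minus_sym; lra).
  assert (Hpp : 0 < Cmod (q z0)) by (apply Cmod_gt_0, Hq0; auto).
  rewrite (Hq z0 Hza), Cmod_div in HB, Hpp by (apply Hne; auto).
  specialize (HD2 a ltac:(lra)). replace (psi a - psi z0 - 0 * (a - z0))%C with (psi a - psi z0)%C in HD2 by ring.
  rewrite (Cmod_minus_sym (psi a)) in HD2. rewrite (Cmod_minus_sym a z0) in *.
  set (p := Cmod (psi z0 - psi a)) in *. set (s := Cmod (z0 - a)) in *.
  assert (p / s <= m / (16 * rho)).
  { apply Rmult_le_reg_r with s; [auto|]. unfold Rdiv at 1. rewrite Rmult_assoc, Rinv_l, Rmult_1_r by lra. auto. }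
  assert (16 * rho / m <= / (p / s)).
  { replace (16 * rho / m) with (/ (m / (16 * rho))) by (field; lra). apply Rinv_le_contravar; auto. }
  assert (0 < rho / m) by (apply Rdiv_lt_0_compat; lra).
  unfold Rdiv in *. lra.
Qed.

(** In Caratheodory's form the inverse has the slope function [/ Q (f w)]: openness of [psi] makes
    [f] continuous, and the nonvanishing derivative keeps [Q] away from 0 near [z0]. *)
Lemma univalent_inverse_der (f : C -> C) z0 : Cmod z0 < 1 -> f (psi z0) = z0 ->
  (forall z, Cmod z < 1 -> f (psi z) = z) -> cder f (psi z0) (/ cderiv psi z0)%C.
Proof.
  intros Hz0 Hf0 Hf.
  destruct (cderiv_spec 1 psi z0 Hhol Hz0) as [Q [HQ [Hc Hu]]].
  pose proof (univalent_der_neq0 z0 Hz0) as Hd.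
  assert (Hfc : ccont f (psi z0)).
  { intros e He. destruct (univalent_open z0 e Hz0 He) as [d [Hd' H]]. exists d. split; [auto|].
    intros w _ Hw. destruct (H w Hw) as [z [H1 [H2 H3]]]. rewrite Hf0, <- H3, Hf; auto. }
  destruct (Hc (Cmod (cderiv psi z0))) as [d [Hd' H]].
  { apply Cmod_gt_0; auto. }
  assert (HQ0 : forall z, Cmod (z - z0) < d -> Q z <> 0%C).
  { intros z Hz E. specialize (H z I Hz). rewrite HQ, E in H.
    replace (0 - cderiv psi z0)%C with (- cderiv psi z0)%C in H by ring. rewrite Cmod_opp in H. lra. }
  destruct (univalent_open z0 d Hz0 Hd') as [r [Hr Hop]].
  apply cder_loc with (r := r) (Q := fun w => (/ Q (f w))%C); auto.
  - rewrite Hf0, HQ. auto.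
  - unfold ccont. rewrite Hf0. rewrite HQ. apply ctends_inv; auto.
    rewrite <- HQ. apply (ctends_comp _ (fun _ => True) Q f _ z0); auto.
    unfold ccont in Hfc. rewrite Hf0 in Hfc. exact Hfc.
  - intros w Hw. destruct (Hop w Hw) as [z [H1 [H2 H3]]]. rewrite Hf0, <- H3, Hf by auto.
    rewrite (Hu z). field. auto.
Qed.
End Univalent.

(** ** Harmonicity of real parts of holomorphic functions *)

Definition cR (f : C -> R) (z : C) : Prop :=
  forall eps, 0 < eps -> exists del, 0 < del /\ forall u, Cmod (u - z) < del -> Rabs (f u - f z) < eps.

Lemma continuous_cR (f : C -> R) z : continuous f z <-> cR f z.
Proof.
  split.
  - intros H e He. apply filterlim_locally with (eps := mkposreal e He) in H.
    destruct H as [d Hd]. exists d. split; [apply cond_pos|]. intros u Hu.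
    apply (Hd u). split.
    + eapply Rle_lt_trans; [apply (fst_le_Cmod (u - z))|exact Hu].
    + eapply Rle_lt_trans; [apply (snd_le_Cmod (u - z))|exact Hu].
  - intros H. apply filterlim_locally. intros [e He]. destruct (H e He) as [d [Hd H']].
    assert (Hd2 : 0 < d / 2) by lra.
    exists (mkposreal (d/2) Hd2). intros u [H1 H2]. apply H'.
    eapply Rle_lt_trans; [apply Cmod_le_sum|].
    change (Rabs (fst u - fst z) < d / 2) in H1. change (Rabs (snd u - snd z) < d / 2) in H2.
    change (Rabs (fst u - fst z) + Rabs (snd u - snd z) < d). lra.
Qed.

Lemma continuous_on_cR (D : C -> Prop) (f : C -> R) : continuous_on D f <->
  (forall z, D z -> forall eps, 0 < eps -> exists del, 0 < del /\ forall u, D u -> Cmod (u - z) < del -> Rabs (f u - f z) < eps).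
Proof.
  split.
  - intros H z Dz e He. specialize (H z Dz). apply filterlim_locally with (eps := mkposreal e He) in H.
    destruct H as [d Hd]. exists d. split; [apply cond_pos|]. intros u Du Hu.
    apply (Hd u); [|exact Du]. split.
    + eapply Rle_lt_trans; [apply (fst_le_Cmod (u - z))|exact Hu].
    + eapply Rle_lt_trans; [apply (snd_le_Cmod (u - z))|exact Hu].
  - intros H z Dz. apply filterlim_locally. intros [e He]. destruct (H z Dz e He) as [d [Hd H']].
    assert (Hd2 : 0 < d / 2) by lra.
    exists (mkposreal (d/2) Hd2). intros u [H1 H2] Du. apply H'; auto.
    eapply Rle_lt_trans; [apply Cmod_le_sum|].
    change (Rabs (fst u - fst z) < d / 2) in H1. change (Rabs (snd u - snd z) < d / 2) in H2.
    change (Rabs (fst u - fst z) + Rabs (snd u - snd z) < d). lra.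
Qed.

Definition re_hol (u : C -> R) (F : C -> C) : Prop := hol 1 F /\ forall z, Cmod z < 1 -> u z = fst (F z).

Lemma re_hol_partials u F z : re_hol u F -> Cmod z < 1 ->
  is_derive (fun t => u (t, snd z)) (fst z) (fst (cderiv F z)) /\
  is_derive (fun t => u (fst z, t)) (snd z) (fst (Ci * cderiv F z)%C).
Proof.
  intros [HF Hu] Hz. pose proof (cderiv_spec 1 F z HF Hz) as HD.
  assert (N : forall s t, Cmod (s, t) < 1 -> u (s, t) = fst (F (s, t))) by auto.
  split.
  - assert (Ez : z = ((0, snd z) + RtoC (fst z) * 1)%C) by (apply Ceq; simpl; ring).
    rewrite Ez in HD. apply cder_line in HD. rewrite <- Ez in HD.
    replace (cderiv F z * 1)%C with (cderiv F z) in HD by ring.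
    assert (Es : forall s : R, ((0, snd z) + RtoC s * 1)%C = (s, snd z)) by (intros; apply Ceq; simpl; ring).
    assert (Es' : forall s : R, (s, snd z) = (z + RtoC (s - fst z))%C) by (intros; apply Ceq; simpl; ring).
    apply (is_derive_ext_loc (fun s => fst (F ((0, snd z) + RtoC s * 1)%C))); [|exact (proj1 HD)].
    assert (Hp : 0 < 1 - Cmod z) by lra. exists (mkposreal _ Hp). intros s Hs.
    change (Rabs (s - fst z) < 1 - Cmod z) in Hs.
    rewrite Es. symmetry. apply N. rewrite (Es' s).
    eapply Rle_lt_trans; [apply Cmod_triangle|]. rewrite Cmod_R. lra.
  - assert (Ez : z = ((fst z, 0) + RtoC (snd z) * Ci)%C) by (apply Ceq; simpl; ring).
    rewrite Ez in HD. apply cder_line in HD. rewrite <- Ez in HD.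
    replace (cderiv F z * Ci)%C with (Ci * cderiv F z)%C in HD by ring.
    assert (Es : forall s : R, ((fst z, 0) + RtoC s * Ci)%C = (fst z, s)) by (intros; apply Ceq; simpl; ring).
    assert (Es' : forall s : R, (fst z, s) = (z + RtoC (s - snd z) * Ci)%C) by (intros; apply Ceq; simpl; ring).
    apply (is_derive_ext_loc (fun s => fst (F ((fst z, 0) + RtoC s * Ci)%C))); [|exact (proj1 HD)].
    assert (Hp : 0 < 1 - Cmod z) by lra. exists (mkposreal _ Hp). intros s Hs.
    change (Rabs (s - snd z) < 1 - Cmod z) in Hs.
    rewrite Es. symmetry. apply N. rewrite (Es' s).
    eapply Rle_lt_trans; [apply Cmod_triangle|]. rewrite Cmod_mult, Cmod_Ci, Cmod_R. lra.
Qed.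

Lemma hol_scal rad (c : C) F : hol rad F -> hol rad (fun z => c * F z)%C.
Proof. intros H z Hz. destruct (H z Hz) as [l Hl]. eexists. apply cder_scal; eauto. Qed.

Lemma hol_plus rad F1 F2 : hol rad F1 -> hol rad F2 -> hol rad (fun z => F1 z + F2 z)%C.
Proof.
  intros H1 H2 z Hz. destruct (H1 z Hz) as [l1 Hl1]. destruct (H2 z Hz) as [l2 Hl2].
  eexists. apply cder_plus; eauto.
Qed.

(** Partial derivatives of a real part are again real parts of holomorphic functions, so that all
    regularity demanded by [C2_on] comes from iterating this lemma and the next. *)
Lemma re_hol_dx u F : re_hol u F -> re_hol (dx u) (cderiv F).
Proof.
  intros H. split; [apply hol_cderiv, H|]. intros z Hz. apply is_derive_unique. apply (re_hol_partials u F z H Hz).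
Qed.

Lemma re_hol_dy u F : re_hol u F -> re_hol (dy u) (fun z => Ci * cderiv F z)%C.
Proof.
  intros H. split; [apply hol_scal, hol_cderiv, H|]. intros z Hz. apply is_derive_unique. apply (re_hol_partials u F z H Hz).
Qed.

Lemma re_hol_has_partials u F z : re_hol u F -> Cmod z < 1 -> has_partials u z.
Proof. intros H Hz. destruct (re_hol_partials u F z H Hz). split; eexists; eauto. Qed.

Lemma re_hol_cont u F z : re_hol u F -> Cmod z < 1 -> continuous u z.
Proof.
  intros [HF Hu] Hz. apply continuous_cR. intros e He.
  destruct (hol_cont 1 F z HF Hz e He) as [d [Hd H]].
  exists (Rmin d (1 - Cmod z)). split; [apply Rmin_pos; lra|]. intros w Hw.
  pose proof (Rmin_l d (1 - Cmod z)). pose proof (Rmin_r d (1 - Cmod z)).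
  pose proof (Cmod_triangle_sub w z). rewrite !Hu by lra.
  eapply Rle_lt_trans; [apply (fst_le_Cmod (F w - F z))|]. apply H; auto. lra.
Qed.

Lemma harmonic_re u F : re_hol u F -> harmonic_on unit_disc u.
Proof.
  intros H. pose proof (re_hol_dx _ _ H) as Hx. pose proof (re_hol_dy _ _ H) as Hy.
  pose proof (re_hol_dx _ _ Hx) as Hxx. pose proof (re_hol_dy _ _ Hx) as Hxy.
  pose proof (re_hol_dx _ _ Hy) as Hyx. pose proof (re_hol_dy _ _ Hy) as Hyy.
  split.
  - intros z Hz. repeat split;
      try (exact (proj1 (re_hol_has_partials _ _ z H Hz))); try (exact (proj2 (re_hol_has_partials _ _ z H Hz)));
      try (exact (proj1 (re_hol_has_partials _ _ z Hx Hz))); try (exact (proj2 (re_hol_has_partials _ _ z Hx Hz)));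
      try (exact (proj1 (re_hol_has_partials _ _ z Hy Hz))); try (exact (proj2 (re_hol_has_partials _ _ z Hy Hz)));
      eapply re_hol_cont; eauto.
  - intros z Hz. rewrite (proj2 Hxx z Hz), (proj2 Hyy z Hz).
    assert (E : cderiv (fun z => Ci * cderiv F z)%C z = (Ci * cderiv (cderiv F) z)%C).
    { apply (cder_unique (fun z => Ci * cderiv F z)%C z).
      - apply (cderiv_spec 1); auto. apply hol_scal, hol_cderiv, H.
      - apply cder_scal. apply (cderiv_spec 1); auto. apply hol_cderiv, H. }
    rewrite E. simpl. ring.
Qed.

(** ** Total differentials *)

Definition rdiff (f : C -> R) (z : C) (a b : R) : Prop :=
  forall eps, 0 < eps -> exists del, 0 < del /\ forall u, Cmod (u - z) < del ->
    Rabs (f u - f z - a * (fst u - fst z) - b * (snd u - snd z)) <= eps * Cmod (u - z).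

Lemma mvt_le (f : R -> R) (a x eps l : R) :
  (forall t, Rmin a x <= t <= Rmax a x -> ex_derive f t) ->
  (forall t, Rmin a x <= t <= Rmax a x -> Rabs (Derive f t - l) <= eps) ->
  Rabs (f x - f a - l * (x - a)) <= eps * Rabs (x - a).
Proof.
  intros Hd He. destruct (MVT_gen f a x (Derive f)) as [c [Hc1 Hc2]].
  - intros t Ht. apply Derive_correct. apply Hd. lra.
  - intros t Ht. apply continuity_pt_filterlim.
    apply (ex_derive_continuous (K := R_AbsRing) (V := R_NormedModule)). auto.
  - rewrite Hc2. replace (Derive f c * (x - a) - l * (x - a)) with ((Derive f c - l) * (x - a)) by ring.
    rewrite Rabs_mult. apply Rmult_le_compat_r; [apply Rabs_pos|auto].
Qed.

Lemma between_dist (a x t : R) : Rmin a x <= t <= Rmax a x -> Rabs (t - a) <= Rabs (x - a).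
Proof.
  unfold Rmin, Rmax. destruct (Rle_dec a x); intros Ht.
  - rewrite !Rabs_pos_eq; lra.
  - rewrite !Rabs_left1; lra.
Qed.

Lemma partials_rdiff (f : C -> R) z r : 0 < r -> (forall u, Cmod (u - z) < r -> has_partials f u) ->
  cR (dx f) z -> cR (dy f) z -> rdiff f z (dx f z) (dy f z).
Proof.
  intros Hr Hp Hx Hy e He.
  destruct (Hx (e / 2)) as [d1 [Hd1 H1]]; [lra|]. destruct (Hy (e / 2)) as [d2 [Hd2 H2]]; [lra|].
  set (d := Rmin r (Rmin d1 d2) / 2).
  assert (Hm : 0 < Rmin r (Rmin d1 d2)) by (repeat apply Rmin_pos; auto).
  assert (M1 : Rmin r (Rmin d1 d2) <= r) by apply Rmin_l.
  assert (M2 : Rmin r (Rmin d1 d2) <= d1) by (eapply Rle_trans; [apply Rmin_r|apply Rmin_l]).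
  assert (M3 : Rmin r (Rmin d1 d2) <= d2) by (eapply Rle_trans; [apply Rmin_r|apply Rmin_r]).
  exists d. split; [unfold d; lra|]. intros u Hu.
  pose proof (fst_le_Cmod (u - z)) as F1. pose proof (snd_le_Cmod (u - z)) as F2.
  change (Rabs (fst u - fst z) <= Cmod (u - z)) in F1. change (Rabs (snd u - snd z) <= Cmod (u - z)) in F2.
  assert (K1 : forall t, Rmin (fst z) (fst u) <= t <= Rmax (fst z) (fst u) -> Cmod ((t, snd u) - z) < 2 * d).
  { intros t Ht. apply between_dist in Ht. eapply Rle_lt_trans; [apply Cmod_le_sum|].
    change (Rabs (t - fst z) + Rabs (snd u - snd z) < 2 * d). lra. }
  assert (K2 : forall t, Rmin (snd z) (snd u) <= t <= Rmax (snd z) (snd u) -> Cmod ((fst z, t) - z) < 2 * d).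
  { intros t Ht. apply between_dist in Ht. eapply Rle_lt_trans; [apply Cmod_le_sum|].
    change (Rabs (fst z - fst z) + Rabs (t - snd z) < 2 * d). rewrite Rminus_diag, Rabs_R0. pose proof (Cmod_ge_0 (u - z)). lra. }
  pose proof (mvt_le (fun t => f (t, snd u)) (fst z) (fst u) (e / 2) (dx f z)) as A1.
  pose proof (mvt_le (fun t => f (fst z, t)) (snd z) (snd u) (e / 2) (dy f z)) as A2.
  assert (Edd : 2 * d = Rmin r (Rmin d1 d2)) by (unfold d; field).
  rewrite Edd in K1, K2.
  assert (B1 : forall t, Rmin (fst z) (fst u) <= t <= Rmax (fst z) (fst u) -> ex_derive (fun t => f (t, snd u)) t).
  { intros t Ht. specialize (K1 t Ht). exact (proj1 (Hp (t, snd u) ltac:(lra))). }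
  assert (B2 : forall t, Rmin (snd z) (snd u) <= t <= Rmax (snd z) (snd u) -> ex_derive (fun t => f (fst z, t)) t).
  { intros t Ht. specialize (K2 t Ht). exact (proj2 (Hp (fst z, t) ltac:(lra))). }
  specialize (A1 B1). specialize (A2 B2).
  specialize (A1 ltac:(intros t Ht; specialize (K1 t Ht); left; apply (H1 (t, snd u)); lra)).
  specialize (A2 ltac:(intros t Ht; specialize (K2 t Ht); left; apply (H2 (fst z, t)); lra)).
  cbv beta in A1, A2.
  replace (f (fst u, snd u)) with (f u) in A1 by (destruct u; auto).
  replace (f (fst z, snd z)) with (f z) in A2 by (destruct z; auto).
  replace (f u - f z - dx f z * (fst u - fst z) - dy f z * (snd u - snd z)) with
    ((f u - f (fst z, snd u) - dx f z * (fst u - fst z)) + (f (fst z, snd u) - f z - dy f z * (snd u - snd z))) by ring.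
  eapply Rle_trans; [apply Rabs_triang|].
  assert (e / 2 * Rabs (fst u - fst z) <= e / 2 * Cmod (u - z)) by (apply Rmult_le_compat_l; lra).
  assert (e / 2 * Rabs (snd u - snd z) <= e / 2 * Cmod (u - z)) by (apply Rmult_le_compat_l; lra).
  lra.
Qed.

Definition dot (a b : C) : R := fst a * fst b + snd a * snd b.

Lemma dot_le (a b : C) : Rabs (dot a b) <= Cmod a * Cmod b.
Proof.
  replace (dot a b) with (fst (a * Cconj b)%C) by (unfold dot; simpl; ring).
  eapply Rle_trans; [apply fst_le_Cmod|]. rewrite Cmod_mult, Cmod_conj. lra.
Qed.

Lemma dot_self (a : C) : dot a a = Cmod a ^ 2.
Proof. rewrite Cmod_sqr. unfold dot. ring. Qed.

(** ** The surface tension in the interior *)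

Section Surface.
Variables (N N0 : C -> Prop) (sigma : C -> R).
Hypothesis HN0N : forall z, N0 z -> N z.
Hypothesis HN0open : forall z, N0 z -> exists r, 0 < r /\ forall u, Cmod (u - z) < r -> N0 u.
Hypothesis Hconv : convex_on N sigma.
Hypothesis HC2 : C2_on N0 sigma.
Hypothesis HMA : forall z, N0 z ->
     dx (dx sigma) z * dy (dy sigma) z - dy (dx sigma) z * dx (dy sigma) z = 1.

Definition gradient (z : C) : C := (dx sigma z, dy sigma z).

Lemma sigma_rdiff z : N0 z -> rdiff sigma z (dx sigma z) (dy sigma z).
Proof.
  intros Hz. destruct (HN0open z Hz) as [r [Hr HB]]. destruct (HC2 z Hz) as (P1 & P2 & P3 & c0 & c1 & c2 & _).
  apply (partials_rdiff sigma z r); auto; try (apply continuous_cR; auto).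
  intros u Hu. apply (HC2 u (HB u Hu)).
Qed.

Lemma dx_rdiff z : N0 z -> rdiff (dx sigma) z (dx (dx sigma) z) (dy (dx sigma) z).
Proof.
  intros Hz. destruct (HN0open z Hz) as [r [Hr HB]]. destruct (HC2 z Hz) as (P1 & P2 & P3 & c0 & c1 & c2 & c3 & c4 & c5 & c6).
  apply (partials_rdiff (dx sigma) z r); auto; try (apply continuous_cR; auto).
  intros u Hu. apply (HC2 u (HB u Hu)).
Qed.

Lemma dy_rdiff z : N0 z -> rdiff (dy sigma) z (dx (dy sigma) z) (dy (dy sigma) z).
Proof.
  intros Hz. destruct (HN0open z Hz) as [r [Hr HB]]. destruct (HC2 z Hz) as (P1 & P2 & P3 & c0 & c1 & c2 & c3 & c4 & c5 & c6).
  apply (partials_rdiff (dy sigma) z r); auto; try (apply continuous_cR; auto).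
  intros u Hu. apply (HC2 u (HB u Hu)).
Qed.

Lemma hessian_sym z : N0 z -> dx (dy sigma) z = dy (dx sigma) z.
Proof.
  intros Hz. destruct (HN0open z Hz) as [r [Hr HB]].
  destruct (HC2 z Hz) as (P1 & P2 & P3 & c0 & c1 & c2 & c3 & c4 & c5 & c6).
  assert (C2D : forall f : C -> R, continuous f z -> continuity_2d_pt (fun a b => f (a, b)) (fst z) (snd z)).
  { intros f Hf e. rewrite continuous_cR in Hf. destruct (Hf e (cond_pos e)) as [d [Hd H]].
    assert (Hd2 : 0 < d / 2) by lra.
    exists (mkposreal _ Hd2). intros a b Ha Hb. simpl in Ha, Hb.
    replace (f (fst z, snd z)) with (f z) by (destruct z; auto). apply H.
    eapply Rle_lt_trans; [apply Cmod_le_sum|]. change (Rabs (a - fst z) + Rabs (b - snd z) < d). lra. }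
  apply (Schwarz (fun a b => sigma (a, b)) (fst z) (snd z)).
  - assert (Hd2 : 0 < r / 2) by lra.
    exists (mkposreal _ Hd2). intros a b Ha Hb. simpl in Ha, Hb.
    assert (Hab : N0 (a, b)).
    { apply HB. eapply Rle_lt_trans; [apply Cmod_le_sum|]. change (Rabs (a - fst z) + Rabs (b - snd z) < r). lra. }
    destruct (HC2 _ Hab) as ((Q1 & Q2) & (Q3 & Q4) & (Q5 & Q6) & _). repeat split.
    + exact Q1.
    + exact Q2.
    + exact Q5.
    + exact Q4.
  - apply (C2D (dx (dy sigma))). auto.
  - apply (C2D (dy (dx sigma))). auto.
Qed.

Lemma sigma_combination z z' t : N z -> N z' -> 0 <= t <= 1 ->
  sigma (z + RtoC t * (z' - z))%C <= sigma z + t * (sigma z' - sigma z).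
Proof.
  intros Hz Hz' Ht. pose proof (Hconv z' z t Hz' Hz Ht) as H.
  replace (z + RtoC t * (z' - z))%C with (RtoC t * z' + RtoC (1 - t) * z)%C by (rewrite RtoC_minus; ring). lra.
Qed.

Lemma small_step d (x : R) : 0 < d -> 0 <= x -> exists t, 0 < t <= 1 /\ t * x < d.
Proof.
  intros Hd Hx. exists (Rmin 1 (d / (x + 1))).
  assert (0 < d / (x + 1)) by (apply Rdiv_lt_0_compat; lra).
  assert (0 < Rmin 1 (d / (x + 1))) by (apply Rmin_pos; lra).
  pose proof (Rmin_l 1 (d / (x + 1))). pose proof (Rmin_r 1 (d / (x + 1))). split; [lra|].
  apply Rle_lt_trans with (d / (x + 1) * x); [apply Rmult_le_compat_r; lra|].
  apply Rlt_le_trans with (d / (x + 1) * (x + 1)); [apply Rmult_lt_compat_l; lra|right; field; lra].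
Qed.

Lemma gradient_ineq z z' : N0 z -> N z' -> sigma z + dot (gradient z) (z' - z) <= sigma z'.
Proof.
  intros Hz Hz'. apply le_epsilon. intros e He.
  pose proof (Cmod_ge_0 (z' - z)) as Hp.
  destruct (sigma_rdiff z Hz (e / (Cmod (z' - z) + 1))) as [d [Hd H]]; [apply Rdiv_lt_0_compat; lra|].
  destruct (small_step d (Cmod (z' - z)) Hd Hp) as [t [Ht Htd]].
  specialize (H (z + RtoC t * (z' - z))%C).
  replace (z + RtoC t * (z' - z) - z)%C with (RtoC t * (z' - z))%C in H by ring.
  rewrite Cmod_scal_R, Rabs_pos_eq in H by lra. specialize (H Htd).
  pose proof (sigma_combination z z' t (HN0N z Hz) Hz' ltac:(lra)) as HS.
  set (y := sigma (z + RtoC t * (z' - z))%C) in *.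
  assert (E1 : fst (z + RtoC t * (z' - z))%C - fst z = t * fst (z' - z)%C) by (simpl; ring).
  assert (E2 : snd (z + RtoC t * (z' - z))%C - snd z = t * snd (z' - z)%C) by (simpl; ring).
  rewrite E1, E2 in H. apply Rabs_le_between in H. destruct H as [H _].
  assert (HX : e / (Cmod (z' - z) + 1) * (t * Cmod (z' - z)) <= e * t).
  { replace (e * t) with (e / (Cmod (z' - z) + 1) * (t * (Cmod (z' - z) + 1))) by (field; lra).
    apply Rmult_le_compat_l; [left; apply Rdiv_lt_0_compat; lra|]. nra. }
  apply Rmult_le_reg_l with t; [lra|]. unfold dot, gradient. cbn [fst snd] in *. nra.
Qed.

Lemma grad_monotone z z' : N0 z -> N0 z' -> 0 <= dot (gradient z' - gradient z) (z' - z).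
Proof.
  intros Hz Hz'. pose proof (gradient_ineq z z' Hz (HN0N _ Hz')). pose proof (gradient_ineq z' z Hz' (HN0N _ Hz)).
  unfold dot, gradient in *. simpl in *. lra.
Qed.

Lemma lewy_grad z : lewy sigma z = (z + gradient z)%C.
Proof. reflexivity. Qed.

(** By monotonicity of the gradient the inner product of the increments of [lewy sigma] and of [z]
    is at least [|z' - z|^2]; Cauchy-Schwarz does the rest. *)
Lemma lewy_expand z z' : N0 z -> N0 z' -> Cmod (z' - z) <= Cmod (lewy sigma z' - lewy sigma z).
Proof.
  intros Hz Hz'. pose proof (grad_monotone z z' Hz Hz') as HM. rewrite !lewy_grad.
  pose proof (dot_le (z' + gradient z' - (z + gradient z)) (z' - z)) as HD.
  assert (E : dot (z' + gradient z' - (z + gradient z)) (z' - z) = Cmod (z' - z) ^ 2 + dot (gradient z' - gradient z) (z' - z)).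
  { rewrite <- dot_self. unfold dot. simpl. ring. }
  rewrite E in HD. pose proof (Cmod_ge_0 (z' - z)) as Hp.
  destruct (Req_dec (Cmod (z' - z)) 0) as [E0|E0]; [rewrite E0; apply Cmod_ge_0|].
  apply Rmult_le_reg_r with (Cmod (z' - z)); [lra|].
  pose proof (Rle_abs (Cmod (z' - z) ^ 2 + dot (gradient z' - gradient z) (z' - z))). nra.
Qed.

Lemma lewy_inj z z' : N0 z -> N0 z' -> lewy sigma z = lewy sigma z' -> z = z'.
Proof.
  intros Hz Hz' E. pose proof (lewy_expand z z' Hz Hz') as H. rewrite E, Cminus_diag, Cmod_0 in H.
  pose proof (Cmod_ge_0 (z' - z)). assert (E0 : Cmod (z' - z) = 0) by lra. apply Cmod_eq_0 in E0.
  replace z' with (z + (z' - z))%C by ring. rewrite E0. ring.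
Qed.

Lemma hessian_diag_nonneg z : N0 z -> 0 <= dx (dx sigma) z /\ 0 <= dy (dy sigma) z.
Proof.
  intros Hz. destruct (HN0open z Hz) as [r [Hr HB]]. split; apply le_epsilon; intros e He.
  - destruct (dx_rdiff z Hz e He) as [d [Hd H]].
    set (t := Rmin r d / 2). assert (0 < Rmin r d) by (apply Rmin_pos; auto).
    pose proof (Rmin_l r d). pose proof (Rmin_r r d).
    assert (Ht : Cmod (z + RtoC t - z) = t).
    { replace (z + RtoC t - z)%C with (RtoC t) by ring. rewrite Cmod_R, Rabs_pos_eq; unfold t; lra. }
    specialize (H (z + RtoC t)%C). rewrite Ht in H. specialize (H ltac:(unfold t; lra)).
    pose proof (grad_monotone z (z + RtoC t)%C Hz ltac:(apply HB; rewrite Ht; unfold t; lra)) as HM.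
    assert (Htp : 0 < t) by (unfold t; lra).
    set (X := dx sigma (z + RtoC t)%C) in *.
    assert (HM' : 0 <= (X - dx sigma z) * t).
    { eapply Rle_trans; [exact HM|]. right. unfold dot, gradient, X. simpl. ring. }
    rewrite Rabs_le_between in H. destruct H as [_ H].
    match type of H with ?y <= _ => assert (Hy : y = X - dx sigma z - dx (dx sigma) z * t) by (simpl; ring) end.
    rewrite Hy in H. assert (0 <= X - dx sigma z) by nra. nra.
  - destruct (dy_rdiff z Hz e He) as [d [Hd H]].
    set (t := Rmin r d / 2). assert (0 < Rmin r d) by (apply Rmin_pos; auto).
    pose proof (Rmin_l r d). pose proof (Rmin_r r d).
    assert (Ht : Cmod (z + RtoC t * Ci - z) = t).
    { replace (z + RtoC t * Ci - z)%C with (RtoC t * Ci)%C by ring.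
      rewrite Cmod_scal_R, Cmod_Ci, Rabs_pos_eq; unfold t; lra. }
    specialize (H (z + RtoC t * Ci)%C). rewrite Ht in H. specialize (H ltac:(unfold t; lra)).
    pose proof (grad_monotone z (z + RtoC t * Ci)%C Hz ltac:(apply HB; rewrite Ht; unfold t; lra)) as HM.
    assert (Htp : 0 < t) by (unfold t; lra).
    set (X := dy sigma (z + RtoC t * Ci)%C) in *.
    assert (HM' : 0 <= (X - dy sigma z) * t).
    { eapply Rle_trans; [exact HM|]. right. unfold dot, gradient, X. simpl. ring. }
    rewrite Rabs_le_between in H. destruct H as [_ H].
    match type of H with ?y <= _ => assert (Hy : y = X - dy sigma z - dy (dy sigma) z * t) by (simpl; ring) end.
    rewrite Hy in H. assert (0 <= X - dy sigma z) by nra. nra.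
Qed.

Definition hessian (z h : C) : C :=
  (dx (dx sigma) z * fst h + dy (dx sigma) z * snd h, dy (dx sigma) z * fst h + dy (dy sigma) z * snd h).

Lemma grad_diff z : N0 z -> forall eps, 0 < eps -> exists del, 0 < del /\ forall u, Cmod (u - z) < del ->
  Cmod (gradient u - gradient z - hessian z (u - z)) <= eps * Cmod (u - z).
Proof.
  intros Hz e He. destruct (dx_rdiff z Hz (e / 2)) as [d1 [Hd1 H1]]; [lra|].
  destruct (dy_rdiff z Hz (e / 2)) as [d2 [Hd2 H2]]; [lra|]. rewrite (hessian_sym z Hz) in H2.
  exists (Rmin d1 d2). split; [apply Rmin_pos; auto|]. intros u Hu.
  pose proof (Rmin_l d1 d2). pose proof (Rmin_r d1 d2).
  specialize (H1 u ltac:(lra)). specialize (H2 u ltac:(lra)).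
  eapply Rle_trans; [apply Cmod_le_sum|]. unfold gradient, hessian. simpl.
  match goal with |- Rabs ?x + Rabs ?y <= _ =>
    replace x with (dx sigma u - dx sigma z - dx (dx sigma) z * (fst u - fst z) - dy (dx sigma) z * (snd u - snd z)) by ring;
    replace y with (dy sigma u - dy sigma z - dy (dx sigma) z * (fst u - fst z) - dy (dy sigma) z * (snd u - snd z)) by ring
  end. lra.
Qed.

(* With [A] the Hessian, [det A = 1] gives [I - A = S (I + A)] with
   [S = (adj A - A) / (2 + tr A)] symmetric and traceless, i.e. conjugate-linear. *)
Lemma conj_lewy_dual_der (U psi : C -> C) zeta0 l r : 0 < r ->
  (forall zeta, Cmod (zeta - zeta0) < r -> N0 (U zeta) /\ lewy sigma (U zeta) = psi zeta) ->
  cder psi zeta0 l -> exists l', cder (fun zeta => Cconj (U zeta - gradient (U zeta))) zeta0 l'.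
Proof.
  intros Hr HU Hpsi.
  assert (H0 : Cmod (zeta0 - zeta0) < r) by (rewrite Cminus_diag, Cmod_0; auto).
  set (z0 := U zeta0). assert (Hz0 : N0 z0) by (apply HU; auto).
  set (a := dx (dx sigma) z0). set (b := dy (dx sigma) z0). set (c := dy (dy sigma) z0).
  destruct (hessian_diag_nonneg z0 Hz0) as [Ha Hc]. fold a in Ha. fold c in Hc.
  assert (Hdet : a * c - b * b = 1).
  { pose proof (HMA z0 Hz0) as HM. rewrite (hessian_sym z0 Hz0) in HM. exact HM. }
  (* The complex form of [S]: [S h] is the conjugate of [height * h], so the conjugated dual has
     derivative [height * l]. *)
  set (height := ((c - a) / (2 + a + c), 2 * b / (2 + a + c)) : C).
  exists (height * l)%C. apply cder_eps. intros e He.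
  set (M := Cmod l + 1). set (K := 1 + Cmod height).
  pose proof (Cmod_ge_0 l). pose proof (Cmod_ge_0 height).
  assert (HM : 0 < M) by (unfold M; lra). assert (HK : 0 < K) by (unfold K; lra).
  set (e1 := e / (2 * K * M)). assert (He1 : 0 < e1).
  { apply Rdiv_lt_0_compat; auto. apply Rmult_lt_0_compat; lra. }
  destruct (grad_diff z0 Hz0 e1 He1) as [d1 [Hd1 G1]].
  rewrite cder_eps in Hpsi.
  destruct (Hpsi 1) as [d2 [Hd2 G2]]; [lra|].
  set (e3 := e / (2 * K)). assert (He3 : 0 < e3) by (apply Rdiv_lt_0_compat; lra).
  destruct (Hpsi e3 He3) as [d3 [Hd3 G3]].
  assert (Hdm : 0 < d1 / M) by (apply Rdiv_lt_0_compat; auto).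
  set (d := Rmin (Rmin r (d1 / M)) (Rmin d2 d3)).
  assert (D1 : d <= r) by (eapply Rle_trans; [apply Rmin_l|apply Rmin_l]).
  assert (D2 : d <= d1 / M) by (eapply Rle_trans; [apply Rmin_l|apply Rmin_r]).
  assert (D3 : d <= d2) by (eapply Rle_trans; [apply Rmin_r|apply Rmin_l]).
  assert (D4 : d <= d3) by (eapply Rle_trans; [apply Rmin_r|apply Rmin_r]).
  exists d. split; [repeat apply Rmin_pos; auto|]. intros zeta Hz.
  destruct (HU zeta ltac:(lra)) as [Hu HL]. destruct (HU zeta0 H0) as [_ HL0]. fold z0 in HL0.
  set (u := U zeta) in *. set (D := Cmod (zeta - zeta0)) in *.
  set (dw := (psi zeta - psi zeta0)%C).
  assert (Hdw : dw = ((u - z0) + (gradient u - gradient z0))%C).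
  { unfold dw. rewrite <- HL, <- HL0, !lewy_grad. ring. }
  (* Expansiveness of the Lewy transform bounds the increment of [U] by that of [psi]; in this way
     [U] enters without any assumption of smoothness. *)
  assert (Hle : Cmod (u - z0) <= Cmod dw).
  { unfold dw. rewrite <- HL, <- HL0. apply lewy_expand; auto. }
  assert (Hdw2 : Cmod dw <= M * D).
  { specialize (G2 zeta ltac:(fold D; lra)). fold dw in G2. fold D in G2.
    pose proof (Cmod_triangle_sub dw (l * (zeta - zeta0))) as T. rewrite Cmod_mult in T. fold D in T.
    unfold M. lra. }
  assert (Hu1 : Cmod (u - z0) < d1).
  { apply Rle_lt_trans with (M * D); [lra|]. apply Rlt_le_trans with (M * (d1 / M)).
    - apply Rmult_lt_compat_l; lra.
    - right. field. lra. }
  specialize (G1 u Hu1). set (er := (gradient u - gradient z0 - hessian z0 (u - z0))%C) in *.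
  specialize (G3 zeta ltac:(fold D; lra)). fold dw in G3. fold D in G3.
  assert (HD : 0 <= D) by apply Cmod_ge_0.
  fold z0.
  assert (E : (Cconj (u - gradient u) - Cconj (z0 - gradient z0) - height * l * (zeta - zeta0))%C =
     ((- Cconj er - height * er) + height * (dw - l * (zeta - zeta0)))%C).
  { assert (E1 : (Cconj (u - gradient u) - Cconj (z0 - gradient z0))%C = (- Cconj er - height * er + height * dw)%C).
    { rewrite Hdw. unfold er, hessian. fold a b c.
      set (p := fst (u - z0)%C). set (q := snd (u - z0)%C).
      assert (Hp : fst u = p + fst z0) by (unfold p; simpl; ring).
      assert (Hq : snd u = q + snd z0) by (unfold q; simpl; ring).
      apply Ceq; simpl; rewrite Hp, Hq; field_simplify_eq; try lra; replace (b ^ 2) with (a * c - 1) by lra; ring. }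
    rewrite E1. ring. }
  rewrite E.
  assert (Her : Cmod er <= e1 * (M * D)).
  { eapply Rle_trans; [exact G1|]. apply Rmult_le_compat_l; lra. }
  assert (T1 : Cmod (- Cconj er - height * er) <= K * Cmod er).
  { unfold Cminus. eapply Rle_trans; [apply Cmod_triangle|]. rewrite !Cmod_opp, Cmod_conj, Cmod_mult. unfold K. lra. }
  eapply Rle_trans; [apply Cmod_triangle|]. rewrite (Cmod_mult height).
  assert (T2 : Cmod height * Cmod (dw - l * (zeta - zeta0)) <= K * (e3 * D)).
  { apply Rmult_le_compat; [auto|apply Cmod_ge_0|unfold K; lra|auto]. }
  assert (T3 : K * Cmod er <= K * (e1 * (M * D))) by (apply Rmult_le_compat_l; lra).
  replace (e * D) with (K * (e1 * (M * D)) + K * (e3 * D)) by (unfold e1, e3; field; lra). lra.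
Qed.

End Surface.

(** ** Compactness in the plane *)

Lemma choice_nat {T : Type} (P : nat -> T -> Prop) : (forall n, exists x, P n x) -> exists f, forall n, P n (f n).
Proof.
  intros H. exists (fun n => proj1_sig (constructive_indefinite_description _ (H n))).
  intros n. apply proj2_sig.
Qed.

Lemma bolzano_R (x : nat -> R) M : (forall n, Rabs (x n) <= M) ->
  exists l, forall eps, 0 < eps -> forall k, exists n, (k <= n)%nat /\ Rabs (x n - l) < eps.
Proof.
  intros H. destruct (Bolzano_Weierstrass x (fun y => - M <= y <= M) (compact_P3 (- M) M)) as [l Hl].
  { intros n. apply Rabs_le_between, H. }
  exists l. intros e He k. destruct (Hl (disc l (mkposreal e He)) k) as [n [Hn1 Hn2]].
  { exists (mkposreal e He). intros y Hy. exact Hy. }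
  exists n. split; auto.
Qed.

Lemma inv_nat_small eps : 0 < eps -> exists k, forall n, (k <= n)%nat -> / (INR n + 1) < eps.
Proof.
  intros He. destruct (archimed_cor1 eps He) as [k [Hk1 Hk2]]. exists k. intros n Hn.
  apply Rle_lt_trans with (2 := Hk1). apply Rinv_le_contravar; [apply lt_0_INR; auto|].
  apply le_INR in Hn. lra.
Qed.

(** Bolzano-Weierstrass for chosen points satisfying [P n]. Keeping [P n z] in the conclusion lets
    arguments by contradiction carry along what failed at stage [n]. *)
Lemma cluster_point (P : nat -> C -> Prop) M : (forall n, exists z, P n z /\ Cmod z <= M) ->
  exists l, forall eps, 0 < eps -> forall k, exists n z, (k <= n)%nat /\ P n z /\ Cmod (z - l) < eps.
Proof.
  intros H. destruct (choice_nat _ H) as [z Hz].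
  destruct (bolzano_R (fun n => fst (z n)) M) as [lx Hlx].
  { intros n. eapply Rle_trans; [apply fst_le_Cmod|apply Hz]. }
  destruct (choice_nat (fun k n => (k <= n)%nat /\ Rabs (fst (z n) - lx) < / (INR k + 1))) as [phi Hphi].
  { intros k. apply Hlx. apply Rinv_0_lt_compat. pose proof (pos_INR k). lra. }
  destruct (bolzano_R (fun n => snd (z (phi n))) M) as [ly Hly].
  { intros n. eapply Rle_trans; [apply snd_le_Cmod|apply Hz]. }
  exists (lx, ly). intros e He k.
  destruct (inv_nat_small (e / 2)) as [k1 Hk1]; [lra|].
  destruct (Hly (e / 2) ltac:(lra) (max k k1)) as [n [Hn1 Hn2]].
  destruct (Hphi n) as [Hp1 Hp2]. specialize (Hk1 n ltac:(lia)).
  exists (phi n), (z (phi n)). split; [lia|]. split; [apply Hz|].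
  eapply Rle_lt_trans; [apply Cmod_le_sum|].
  change (Rabs (fst (z (phi n)) - lx) + Rabs (snd (z (phi n)) - ly) < e). lra.
Qed.

Lemma extreme_value (K : C -> Prop) (f : C -> R) M z0 : K z0 ->
  (forall z, K z -> Cmod z <= M) ->
  (forall l, (forall eps, 0 < eps -> exists z, K z /\ Cmod (z - l) < eps) -> K l) ->
  (forall z, K z -> forall eps, 0 < eps -> exists del, 0 < del /\ forall u, K u -> Cmod (u - z) < del -> Rabs (f u - f z) < eps) ->
  exists z, K z /\ forall u, K u -> f z <= f u.
Proof.
  intros Hz0 HM Hcl Hf.
  assert (Hb : exists B, forall z, K z -> B <= f z).
  { destruct (classic (exists B, forall z, K z -> B <= f z)) as [|Hno]; [auto|exfalso].
    destruct (cluster_point (fun n z => K z /\ f z < - INR n) M) as [l Hl].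
    { intros n. destruct (classic (exists z, K z /\ f z < - INR n)) as [[z [Kz Hz]]|Hn].
      - exists z. auto.
      - exfalso. apply Hno. exists (- INR n). intros z Kz. apply Rnot_lt_le. intros Hlt. apply Hn. exists z; auto. }
    assert (Kl : K l).
    { apply Hcl. intros e He. destruct (Hl e He 0%nat) as [n [z [_ [[Kz _] Hz]]]]. exists z; auto. }
    destruct (Hf l Kl 1) as [d [Hd H]]; [lra|].
    destruct (nfloor_ex (Rabs (f l) + 1)) as [k Hk]; [pose proof (Rabs_pos (f l)); lra|].
    destruct (Hl d Hd (S k)) as [n [z [Hn [[Kz Hfz] Hz]]]].
    specialize (H z Kz Hz). apply Rabs_def2 in H. apply le_INR in Hn. rewrite S_INR in Hn.
    pose proof (Rle_abs (- f l)). rewrite Rabs_Ropp in H0. lra. }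
  destruct Hb as [B HB].
  destruct (completeness (fun y => exists z, K z /\ y = - f z)) as [m [Hm1 Hm2]].
  { exists (- B). intros y [z [Kz ->]]. specialize (HB z Kz). lra. }
  { exists (- f z0), z0. auto. }
  destruct (cluster_point (fun n z => K z /\ - f z > m - / (INR n + 1)) M) as [l Hl].
  { intros n. assert (Hp : 0 < / (INR n + 1)) by (apply Rinv_0_lt_compat; pose proof (pos_INR n); lra).
    destruct (classic (exists z, K z /\ - f z > m - / (INR n + 1))) as [[z [Kz Hz]]|Hn].
    - exists z; auto.
    - exfalso. assert (m <= m - / (INR n + 1)); [|lra]. apply Hm2. intros y [z [Kz ->]].
      apply Rnot_lt_le. intros Hlt. apply Hn. exists z. split; auto. }
  assert (Kl : K l).
  { apply Hcl. intros e He. destruct (Hl e He 0%nat) as [n [z [_ [[Kz _] Hz]]]]. exists z; auto. }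
  exists l. split; [auto|]. intros u Ku.
  assert (- f u <= m) by (apply Hm1; exists u; auto).
  apply Rnot_lt_le. intros Hlt.
  destruct (Hf l Kl ((f l - f u) / 2)) as [d [Hd H']]; [lra|].
  destruct (inv_nat_small ((f l - f u) / 2)) as [k Hk]; [lra|].
  destruct (Hl d Hd k) as [n [z [Hn [[Kz Hfz] Hz]]]].
  specialize (H' z Kz Hz). apply Rabs_def2 in H'. specialize (Hk n Hn). lra.
Qed.

(** ** Finite sums *)

Lemma rsum_S m f : rsum (S m) f = rsum m f + f m.
Proof.
  unfold rsum. rewrite seq_S, map_app, fold_right_app. simpl.
  generalize (map f (seq 0 m)). induction l; simpl; [ring|]. rewrite IHl. ring.
Qed.

Lemma rsum_ext m f g : (forall j, (j < m)%nat -> f j = g j) -> rsum m f = rsum m g.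
Proof.
  induction m; intros H; [reflexivity|]. rewrite !rsum_S, IHm, H by auto. reflexivity.
Qed.

Lemma rsum_plus m f g : rsum m (fun j => f j + g j) = rsum m f + rsum m g.
Proof. induction m; [unfold rsum; simpl; ring|]. rewrite !rsum_S, IHm. ring. Qed.

Lemma rsum_scal m c f : rsum m (fun j => c * f j) = c * rsum m f.
Proof. induction m; [unfold rsum; simpl; ring|]. rewrite !rsum_S, IHm. ring. Qed.

Lemma rsum_nonneg m f : (forall j, (j < m)%nat -> 0 <= f j) -> 0 <= rsum m f.
Proof.
  induction m; intros H; [unfold rsum; simpl; lra|]. rewrite !rsum_S.
  assert (0 <= f m) by auto. assert (0 <= rsum m f) by auto. lra.
Qed.

Lemma rsum_term_le m f k : (forall j, (j < m)%nat -> 0 <= f j) -> (k < m)%nat -> f k <= rsum m f.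
Proof.
  induction m; intros H Hk; [lia|]. rewrite rsum_S.
  destruct (Nat.eq_dec k m) as [->|].
  - assert (0 <= rsum m f) by (apply rsum_nonneg; auto). lra.
  - assert (f k <= rsum m f) by (apply IHm; [auto|lia]). assert (0 <= f m) by auto. lra.
Qed.

(** ** Convex polygons *)

Lemma cross_le (a b : C) : Rabs (cross a b) <= Cmod a * Cmod b.
Proof.
  replace (cross a b) with (snd (Cconj a * b)%C) by (unfold cross; simpl; ring).
  eapply Rle_trans; [apply snd_le_Cmod|]. rewrite Cmod_mult, Cmod_conj. lra.
Qed.

Lemma finite_min (n : nat) (P : nat -> R -> Prop) :
  (forall i r r', P i r -> 0 < r' <= r -> P i r') ->
  (forall i, (i < n)%nat -> exists r, 0 < r /\ P i r) ->
  exists r, 0 < r /\ forall i, (i < n)%nat -> P i r.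
Proof.
  intros Hmono. induction n; intros H.
  - exists 1. split; [lra|]. intros; lia.
  - destruct IHn as [r1 [Hr1 H1]]; [intros; apply H; lia|].
    destruct (H n) as [r2 [Hr2 H2]]; [lia|].
    assert (0 < Rmin r1 r2) by (apply Rmin_pos; auto).
    exists (Rmin r1 r2). split; [auto|]. intros i Hi.
    destruct (Nat.eq_dec i n) as [->|].
    + apply (Hmono n r2); auto. split; [auto|apply Rmin_r].
    + apply (Hmono i r1); [apply H1; lia|]. split; [auto|apply Rmin_l].
Qed.

Section Polygon.
Variables (n : nat) (v : nat -> C).
Hypothesis Hpoly : convex_polygon n v.

Definition side (i : nat) : C := (v (nxt n i) - v i)%C.
(** Signed distance to the line of edge [i], positive on the inner side, times the length of the
    edge. *)
Definition height (i : nat) (z : C) : R := cross (side i) (z - v i)%C.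

Lemma nxt_cases i : (i < n)%nat -> (S i < n /\ nxt n i = S i)%nat \/ (S i = n /\ nxt n i = 0)%nat.
Proof.
  intros Hi. unfold nxt. destruct (Nat.eq_dec (S i) n) as [E|E].
  - right. split; [auto|]. rewrite E. apply Nat.Div0.mod_same.
  - left. split; [lia|]. apply Nat.mod_small. lia.
Qed.

Lemma n_ge_3 : (3 <= n)%nat.
Proof. apply Hpoly. Qed.

Lemma nxt_lt i : (i < n)%nat -> (nxt n i < n)%nat.
Proof. intros Hi. pose proof n_ge_3. destruct (nxt_cases i Hi) as [[? ->]|[? ->]]; lia. Qed.

Lemma nxt_neq i : (i < n)%nat -> nxt n i <> i.
Proof. intros Hi. pose proof n_ge_3. destruct (nxt_cases i Hi) as [[? ->]|[? ->]]; lia. Qed.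

Lemma nxt_nxt_neq i : (i < n)%nat -> nxt n (nxt n i) <> i.
Proof.
  intros Hi. pose proof n_ge_3. pose proof (nxt_lt i Hi) as Hj.
  destruct (nxt_cases _ Hj) as [[? E]|[? E]]; rewrite E;
  destruct (nxt_cases i Hi) as [[? ?]|[? ?]]; lia.
Qed.

Lemma nxt_inj i j : (i < n)%nat -> (j < n)%nat -> nxt n i = nxt n j -> i = j.
Proof.
  intros Hi Hj. destruct (nxt_cases i Hi) as [[? ->]|[? ->]]; destruct (nxt_cases j Hj) as [[? ->]|[? ->]]; lia.
Qed.

Lemma prev_ex i : (i < n)%nat -> exists k, (k < n)%nat /\ nxt n k = i.
Proof.
  intros Hi. pose proof n_ge_3. destruct (Nat.eq_dec i 0) as [->|].
  - exists (n - 1)%nat. split; [lia|]. destruct (nxt_cases (n - 1)) as [[? ?]|[? ?]]; lia.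
  - exists (i - 1)%nat. split; [lia|]. destruct (nxt_cases (i - 1)) as [[? ?]|[? ?]]; lia.
Qed.

Lemma height_affine i z z' t : height i (z + RtoC t * (z' - z))%C = height i z + t * (height i z' - height i z).
Proof. unfold height, cross. simpl. ring. Qed.

Lemma height_diff i z z' : height i z' - height i z = cross (side i) (z' - z)%C.
Proof. unfold height, cross. simpl. ring. Qed.

Lemma height_lip i z z' : Rabs (height i z' - height i z) <= Cmod (side i) * Cmod (z' - z).
Proof. rewrite height_diff. apply cross_le. Qed.

Lemma height_cont i z : forall eps, 0 < eps -> exists del, 0 < del /\ forall u, Cmod (u - z) < del -> Rabs (height i u - height i z) < eps.
Proof.
  intros e He. pose proof (Cmod_ge_0 (side i)). exists (e / (Cmod (side i) + 1)). split; [apply Rdiv_lt_0_compat; lra|].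
  intros u Hu. eapply Rle_lt_trans; [apply height_lip|].
  pose proof (Cmod_ge_0 (u - z)).
  apply Rle_lt_trans with ((Cmod (side i) + 1) * Cmod (u - z)); [apply Rmult_le_compat_r; lra|].
  apply Rlt_le_trans with ((Cmod (side i) + 1) * (e / (Cmod (side i) + 1))); [apply Rmult_lt_compat_l; lra|right; field; lra].
Qed.

Lemma height_start i : height i (v i) = 0.
Proof. unfold height, cross. simpl. ring. Qed.

Lemma height_end i : height i (v (nxt n i)) = 0.
Proof. unfold height, side, cross. simpl. ring. Qed.

Lemma height_vertex_pos i j : (i < n)%nat -> (j < n)%nat -> j <> i -> j <> nxt n i -> 0 < height i (v j).
Proof. intros. apply Hpoly; auto. Qed.

Lemma height_vertex_nonneg i j : (i < n)%nat -> (j < n)%nat -> 0 <= height i (v j).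
Proof.
  intros Hi Hj. destruct (Nat.eq_dec j i) as [->|]; [rewrite height_start; lra|].
  destruct (Nat.eq_dec j (nxt n i)) as [->|]; [rewrite height_end; lra|].
  left. apply height_vertex_pos; auto.
Qed.

Lemma side_neq0 i : (i < n)%nat -> 0 < Cmod (side i).
Proof.
  intros Hi. apply Cmod_gt_0. intros E.
  pose proof (height_vertex_pos i (nxt n (nxt n i)) Hi (nxt_lt _ (nxt_lt _ Hi)) (nxt_nxt_neq _ Hi) (nxt_neq _ (nxt_lt _ Hi))) as H.
  unfold height in H. rewrite E in H. unfold cross in H. simpl in H. lra.
Qed.

Lemma polyInt_N z : polyInt n v z -> polyN n v z.
Proof. intros H i Hi. left. apply H. auto. Qed.

Lemma height_pos_near i z : 0 < height i z -> exists r, 0 < r /\ forall u, Cmod (u - z) < r -> 0 < height i u.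
Proof.
  intros H. destruct (height_cont i z (height i z) H) as [d [Hd Hc]]. exists d. split; [auto|].
  intros u Hu. specialize (Hc u Hu). apply Rabs_def2 in Hc. lra.
Qed.

Lemma polyInt_open z : polyInt n v z -> exists r, 0 < r /\ forall u, Cmod (u - z) < r -> polyInt n v u.
Proof.
  intros H. destruct (finite_min n (fun i r => forall u, Cmod (u - z) < r -> 0 < height i u)) as [r [Hr Hu]].
  - intros i r r' H1 H2 u Hu. apply H1. lra.
  - intros i Hi. apply height_pos_near. apply H. auto.
  - exists r. split; [auto|]. intros u Hu' i Hi. apply (Hu i Hi u Hu').
Qed.

Lemma polyInt_convex z z' t : polyInt n v z -> polyInt n v z' -> 0 <= t <= 1 -> polyInt n v (z + RtoC t * (z' - z))%C.
Proof.
  intros Hz Hz' Ht i Hi. specialize (Hz i Hi). specialize (Hz' i Hi).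
  change (0 < height i z) in Hz. change (0 < height i z') in Hz'. change (0 < height i (z + RtoC t * (z' - z))%C).
  rewrite height_affine. destruct (Rle_lt_dec t (1/2)); nra.
Qed.

Lemma polyN_closed l : (forall eps, 0 < eps -> exists z, polyN n v z /\ Cmod (z - l) < eps) -> polyN n v l.
Proof.
  intros H i Hi. change (0 <= height i l). apply Rnot_lt_le. intros Hlt.
  destruct (height_cont i l (- height i l)) as [d [Hd Hc]]; [lra|].
  destruct (H d Hd) as [z [Hz Hzl]]. specialize (Hc z Hzl). apply Rabs_def2 in Hc.
  specialize (Hz i Hi). change (0 <= height i z) in Hz. lra.
Qed.

Lemma rsum_shift (f : nat -> R) : rsum n (fun i => f (nxt n i)) = rsum n f.
Proof.
  pose proof n_ge_3. destruct n as [|m]; [lia|].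
  assert (A : rsum (S m) (fun i => f (nxt (S m) i)) = rsum m (fun i => f (S i)) + f 0%nat).
  { rewrite rsum_S. f_equal.
    - apply rsum_ext. intros j Hj. unfold nxt. rewrite Nat.mod_small by lia. auto.
    - unfold nxt. rewrite Nat.Div0.mod_same. auto. }
  rewrite A. clear. assert (B : forall k, rsum k (fun i => f (S i)) + f 0%nat = rsum (S k) f).
  { induction k; [unfold rsum; simpl; ring|]. rewrite rsum_S. rewrite (rsum_S (S k)). lra. }
  apply B.
Qed.

(* The functionals [height i] have constant sum (twice the area), hence each of them is bounded on the polygon. *)
Lemma height_sum z : rsum n (fun i => height i z) = rsum n (fun i => height i 0%C).
Proof.
  assert (E : rsum n (fun i => height i z) = rsum n (fun i => height i 0%C + (snd z * fst (side i) + - fst z * snd (side i)))).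
  { apply rsum_ext. intros j _. unfold height, cross. simpl. ring. }
  rewrite E, !rsum_plus, !rsum_scal.
  assert (T1 : rsum n (fun i => fst (side i)) = 0).
  { rewrite (rsum_ext n _ (fun i => fst (v (nxt n i)) + -1 * fst (v i))) by (intros; simpl; ring).
    rewrite rsum_plus, rsum_scal, (rsum_shift (fun i => fst (v i))). ring. }
  assert (T2 : rsum n (fun i => snd (side i)) = 0).
  { rewrite (rsum_ext n _ (fun i => snd (v (nxt n i)) + -1 * snd (v i))) by (intros; simpl; ring).
    rewrite rsum_plus, rsum_scal, (rsum_shift (fun i => snd (v i))). ring. }
  rewrite T1, T2. ring.
Qed.

(** Two consecutive height functionals have independent linear parts and so serve as coordinates of
    the plane; each is nonnegative and at most the constant sum [S0]. The identity [E] is Cramer's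
    rule. *)
Lemma polyN_bounded : exists M, forall z, polyN n v z -> Cmod z <= M.
Proof.
  pose proof n_ge_3 as Hn. set (S0 := rsum n (fun i => height i 0%C)).
  assert (K : forall z i, polyN n v z -> (i < n)%nat -> 0 <= height i z <= S0).
  { intros z i Hz Hi. split; [apply Hz; auto|]. unfold S0. rewrite <- (height_sum z).
    apply (rsum_term_le n (fun i => height i z)); auto. }
  assert (H0 : (0 < n)%nat) by lia. set (j := nxt n 0). assert (Hj : (j < n)%nat) by (apply nxt_lt; auto).
  assert (Hd : 0 < cross (side 0) (side j)).
  { pose proof (height_vertex_pos 0 (nxt n j) H0 (nxt_lt _ Hj) (nxt_nxt_neq _ H0) (nxt_neq _ Hj)) as H.
    unfold height in H. unfold side at 2. replace (v (nxt n j) - v 0%nat)%C with ((v (nxt n j) - v j) + side 0)%C in H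
      by (unfold side; fold j; ring).
    unfold cross in *. simpl in *. lra. }
  set (D := cross (side 0) (side j)) in *.
  set (A := Cmod (side 0) + Cmod (side j)).
  set (B := Rabs (height 0 0%C) + Rabs (height j 0%C) + S0).
  exists (Cmod (side 0) * B / D + Cmod (side j) * B / D).
  intros z Hz. pose proof (K z 0%nat Hz H0) as K0. pose proof (K z j Hz Hj) as K1.
  assert (E : (RtoC D * z)%C = (RtoC (height 0 z - height 0 0%C) * side j - RtoC (height j z - height j 0%C) * side 0)%C).
  { rewrite !height_diff. unfold D, cross. apply Ceq; simpl; ring. }
  assert (HB : forall i, i = 0%nat \/ i = j -> Rabs (height i z - height i 0%C) <= B).
  { pose proof (Rabs_pos (height 0 0%C)). pose proof (Rabs_pos (height j 0%C)).
    intros i [-> | ->]; (eapply Rle_trans; [apply Rabs_triang|]); rewrite Rabs_Ropp, Rabs_pos_eq by lra; unfold B; lra. }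
  apply Rmult_le_reg_l with D; [auto|].
  replace (D * (Cmod (side 0) * B / D + Cmod (side j) * B / D)) with (B * Cmod (side j) + B * Cmod (side 0)) by (field; lra).
  replace (D * Cmod z) with (Cmod (RtoC D * z)) by (rewrite Cmod_scal_R, Rabs_pos_eq; lra).
  rewrite E. unfold Cminus at 1. eapply Rle_trans; [apply Cmod_triangle|].
  rewrite Cmod_opp, !Cmod_scal_R. apply Rplus_le_compat; (apply Rmult_le_compat_r; [apply Cmod_ge_0|auto]).
Qed.

Lemma edge_side i s : edge n v i s = (v i + RtoC s * side i)%C.
Proof. reflexivity. Qed.

Lemma edge_dist i s s' : Cmod (edge n v i s - edge n v i s') = Rabs (s - s') * Cmod (side i).
Proof.
  rewrite !edge_side. replace (v i + RtoC s * side i - (v i + RtoC s' * side i))%C with (RtoC (s - s') * side i)%C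
    by (rewrite RtoC_minus; ring). apply Cmod_scal_R.
Qed.

Lemma height_edge j i s : height j (edge n v i s) = (1 - s) * height j (v i) + s * height j (v (nxt n i)).
Proof.
  change (edge n v i s) with (v i + RtoC s * (v (nxt n i) - v i))%C. rewrite height_affine. ring.
Qed.

Lemma height_edge_self i s : height i (edge n v i s) = 0.
Proof. rewrite height_edge, height_start, height_end. ring. Qed.

Lemma height_edge_pos j i s : (i < n)%nat -> (j < n)%nat -> j <> i -> 0 < s < 1 -> 0 < height j (edge n v i s).
Proof.
  intros Hi Hj Hne Hs. rewrite height_edge.
  pose proof (height_vertex_nonneg j i Hj Hi) as A1. pose proof (height_vertex_nonneg j (nxt n i) Hj (nxt_lt i Hi)) as A2.
  destruct (Nat.eq_dec i (nxt n j)) as [E|E].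
  - assert (0 < height j (v (nxt n i))).
    { apply height_vertex_pos; auto using nxt_lt.
      - rewrite E. apply nxt_nxt_neq; auto.
      - intros E2. apply nxt_inj in E2; auto. }
    nra.
  - assert (0 < height j (v i)) by (apply height_vertex_pos; auto). nra.
Qed.

Lemma edge_N i s : (i < n)%nat -> 0 <= s <= 1 -> polyN n v (edge n v i s).
Proof.
  intros Hi Hs j Hj. change (0 <= height j (edge n v i s)). rewrite height_edge.
  pose proof (height_vertex_nonneg j i Hj Hi). pose proof (height_vertex_nonneg j (nxt n i) Hj (nxt_lt i Hi)). nra.
Qed.

Lemma edge_bd i s : (i < n)%nat -> 0 <= s <= 1 -> polyBd n v (edge n v i s).
Proof.
  intros Hi Hs. split; [apply edge_N; auto|]. intros H. specialize (H i Hi).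
  change (0 < height i (edge n v i s)) in H. rewrite height_edge_self in H. lra.
Qed.

(** Coordinates adapted to edge [i], in units of its length: [x] runs along the edge, [y] along the
    inward normal. *)
Definition frame (i : nat) (x y : R) : C := (edge n v i x + RtoC y * (Ci * side i))%C.

Lemma frame_0 i x : frame i x 0 = edge n v i x.
Proof. unfold frame. ring. Qed.

Lemma height_pt i x y : height i (frame i x y) = y * Cmod (side i) ^ 2.
Proof.
  replace (height i (frame i x y)) with (height i (edge n v i x) + y * (Cmod (side i) ^ 2)).
  - rewrite height_edge_self. ring.
  - rewrite Cmod_sqr. unfold frame, height, cross. simpl. ring.
Qed.

Lemma frame_dist i x y x' y' : Cmod (frame i x y - frame i x' y') <= (Rabs (x - x') + Rabs (y - y')) * Cmod (side i).
Proof.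
  unfold frame. rewrite !edge_side.
  replace (v i + RtoC x * side i + RtoC y * (Ci * side i) - (v i + RtoC x' * side i + RtoC y' * (Ci * side i)))%C with
    (RtoC (x - x') * side i + RtoC (y - y') * (Ci * side i))%C by (rewrite !RtoC_minus; ring).
  eapply Rle_trans; [apply Cmod_triangle|]. rewrite !Cmod_scal_R, Cmod_mult, Cmod_Ci. lra.
Qed.

Lemma frame_surj i z : (i < n)%nat -> exists x y, z = frame i x y /\
  forall x', Rabs (x - x') * Cmod (side i) <= Cmod (z - edge n v i x').
Proof.
  intros Hi. pose proof (side_neq0 i Hi) as Ht. pose proof (Cmod_sqr (side i)) as Hsq.
  set (T := Cmod (side i)) in *.
  exists (dot (side i) (z - v i) / T ^ 2), (height i z / T ^ 2). split.
  - unfold frame. rewrite edge_side. unfold dot, height, cross. rewrite Hsq.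
    apply Ceq; simpl; field; simpl in Hsq; nra.
  - intros x'. apply Rmult_le_reg_r with T; [auto|].
    replace (Rabs (dot (side i) (z - v i) / T ^ 2 - x') * T * T) with (Rabs (dot (side i) (z - edge n v i x')%C)).
    + rewrite Rmult_comm. apply dot_le.
    + replace (dot (side i) (z - edge n v i x')%C) with ((dot (side i) (z - v i) / T ^ 2 - x') * (T * T)).
      * rewrite Rabs_mult, (Rabs_pos_eq (T * T)) by nra. ring.
      * rewrite edge_side. replace (dot (side i) (z - (v i + RtoC x' * side i))%C) with
          (dot (side i) (z - v i)%C - x' * (fst (side i) ^ 2 + snd (side i) ^ 2)) by (unfold dot; simpl; ring).
        rewrite <- Hsq. field. lra.
Qed.

Lemma edge_nbhd i s : (i < n)%nat -> 0 < s < 1 -> exists r, 0 < r /\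
  forall z, Cmod (z - edge n v i s) < r -> forall j, (j < n)%nat -> j <> i -> 0 < height j z.
Proof.
  intros Hi Hs.
  destruct (finite_min n (fun j r => forall z, Cmod (z - edge n v i s) < r -> j <> i -> 0 < height j z)) as [r [Hr H]].
  - intros j r r' H1 H2 z Hz. apply H1. lra.
  - intros j Hj. destruct (Nat.eq_dec j i) as [->|Hne].
    + exists 1. split; [lra|]. intros; contradiction.
    + destruct (height_pos_near j (edge n v i s)) as [r [Hr H]]; [apply height_edge_pos; auto|].
      exists r. auto.
  - exists r. split; [auto|]. intros z Hz j Hj Hne. apply (H j Hj z Hz Hne).
Qed.

Lemma polyBd_edge z : polyBd n v z -> exists i x, (i < n)%nat /\ 0 <= x <= 1 /\ z = edge n v i x.
Proof.
  intros [HN HI].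
  assert (Hex : exists i, (i < n)%nat /\ height i z = 0).
  { destruct (classic (exists i, (i < n)%nat /\ height i z = 0)) as [|Hno]; [auto|exfalso].
    apply HI. intros i Hi. specialize (HN i Hi). change (0 <= height i z) in HN. change (0 < height i z).
    destruct HN as [|E]; [auto|]. exfalso. apply Hno. exists i. auto. }
  destruct Hex as [i [Hi Hk]]. exists i.
  destruct (frame_surj i z Hi) as [x [y [Hz _]]]. exists x.
  assert (Hy : y = 0).
  { rewrite Hz, height_pt in Hk. pose proof (side_neq0 i Hi) as Ht.
    apply Rmult_integral in Hk. destruct Hk as [|Hk]; [auto|]. exfalso.
    apply (pow_nonzero (Cmod (side i)) 2) in Hk; [auto|lra]. }
  rewrite Hy, frame_0 in Hz. split; [auto|]. split; [|auto].
  (* The two neighbouring edges confine the abscissa: the height over the previous edge vanishes at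
     [v i] and grows along edge [i], which gives [0 <= x]; the next edge gives [x <= 1]. *)
  destruct (prev_ex i Hi) as [k [Hk1 Hk2]].
  pose proof (HN k Hk1) as Nk. change (0 <= height k z) in Nk. rewrite Hz, height_edge in Nk.
  rewrite <- Hk2 in Nk at 1. rewrite height_end in Nk.
  assert (P1 : 0 < height k (v (nxt n i))).
  { apply height_vertex_pos; auto using nxt_lt.
    - rewrite <- Hk2. apply nxt_nxt_neq; auto.
    - rewrite Hk2. apply nxt_neq; auto. }
  pose proof (HN (nxt n i) (nxt_lt i Hi)) as Nj. change (0 <= height (nxt n i) z) in Nj.
  rewrite Hz, height_edge, height_start in Nj.
  assert (P2 : 0 < height (nxt n i) (v i)).
  { apply height_vertex_pos; auto using nxt_lt.
    - intros E. apply (nxt_neq i Hi). auto.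
    - intros E. apply (nxt_nxt_neq i Hi). auto. }
  nra.
Qed.

(** With the half-open range of parameters a corner belongs only to the edge that starts there. The
    proof separates points by heights: over a different edge the height of an inner edge point is
    positive. *)
Lemma edge_param_unique i i' t t' : (i < n)%nat -> (i' < n)%nat -> 0 <= t < 1 -> 0 <= t' < 1 ->
  edge n v i t = edge n v i' t' -> i = i' /\ t = t'.
Proof.
  assert (V : forall a b, (a < n)%nat -> (b < n)%nat -> v a = v b -> a = b).
  { intros a b Ha Hb E. destruct (Nat.eq_dec a b) as [|Hne]; [auto|exfalso].
    destruct (Nat.eq_dec a (nxt n b)) as [E2|E2].
    - pose proof (height_vertex_pos a b Ha Hb) as P. rewrite <- E, height_start in P.
      assert (0 < 0); [apply P; auto|lra]. rewrite E2. intros E3. apply (nxt_nxt_neq b Hb). auto.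
    - pose proof (height_vertex_pos b a Hb Ha Hne E2) as P. rewrite E, height_start in P. lra. }
  intros Hi Hi' Ht Ht' E.
  assert (Ei : i = i').
  { destruct (Nat.eq_dec i i') as [|Hne]; [auto|exfalso].
    destruct (Rle_lt_dec t 0) as [T0|T0].
    - assert (T : t = 0) by lra. subst t.
      destruct (Rle_lt_dec t' 0) as [T1|T1].
      + assert (T : t' = 0) by lra. subst t'. apply Hne. apply V; auto.
        rewrite !edge_side in E. rewrite !Cmult_0_l, !Cplus_0_r in E. exact E.
      + pose proof (height_edge_pos i i' t' Hi' Hi Hne ltac:(lra)) as P. rewrite <- E, height_edge_self in P. lra.
    - pose proof (height_edge_pos i' i t Hi Hi' ltac:(auto) ltac:(lra)) as P. rewrite E, height_edge_self in P. lra. }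
  split; [auto|]. subst i'.
  pose proof (edge_dist i t t') as D. rewrite E, Cminus_diag, Cmod_0 in D.
  pose proof (side_neq0 i Hi). symmetry in D. apply Rmult_integral in D. destruct D as [D|D]; [|lra].
  apply Rabs_eq_0 in D. lra.
Qed.
End Polygon.

(** ** Angles *)

Lemma expi_inj (t s : R) : Rabs (t - s) < 2 * PI -> expi t = expi s -> t = s.
Proof.
  intros H E.
  assert (Hc : cos (t - s) = 1).
  { rewrite cos_minus. pose proof (f_equal fst E) as E1. pose proof (f_equal snd E) as E2. simpl in E1, E2.
    rewrite E1, E2. pose proof (sin2_cos2 s). unfold Rsqr in H0. lra. }
  assert (Hs : sin ((t - s) / 2) = 0).
  { replace (t - s) with (2 * ((t - s) / 2)) in Hc by field. rewrite cos_2a_sin in Hc. nra. }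
  destruct (Rtotal_order t s) as [Hlt|[|Hlt]]; [exfalso|auto|exfalso].
  - apply Rabs_def2 in H. assert (0 < sin (- ((t - s) / 2))) by (apply sin_gt_0; lra). rewrite sin_neg in H0. lra.
  - apply Rabs_def2 in H. assert (0 < sin ((t - s) / 2)) by (apply sin_gt_0; lra). lra.
Qed.

Lemma expi_arg (c : C) (a : R) : Cmod c = 1 -> exists t, a <= t < a + 2 * PI /\ c = expi t.
Proof.
  intros Hc. assert (Hsq : fst c ^ 2 + snd c ^ 2 = 1) by (rewrite <- Cmod_sqr, Hc; ring).
  assert (Hx : -1 <= fst c <= 1) by nra.
  assert (Hs : sin (acos (fst c)) = Rabs (snd c)).
  { rewrite sin_acos by auto. replace (1 - (fst c)²) with ((snd c)²) by (unfold Rsqr; lra). apply sqrt_Rsqr_abs. }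
  assert (Hex : exists t, c = expi t).
  { destruct (Rle_lt_dec 0 (snd c)).
    - exists (acos (fst c)). apply Ceq; simpl; [rewrite cos_acos; auto|rewrite Hs, Rabs_pos_eq; auto].
    - exists (- acos (fst c)). apply Ceq; simpl.
      + rewrite cos_neg, cos_acos; auto.
      + rewrite sin_neg, Hs, Rabs_left by auto. ring. }
  destruct Hex as [t Ht]. destruct (expi_reduce t a) as [s [Hsr Es]]. exists s. split; [auto|congruence].
Qed.

(** Repetitions are merged, since distinct affine pieces may a priori collapse to the same circle
    point; therefore only [d <= length l]. *)
Lemma sort_reals (l : list R) : exists (d : nat) (t : nat -> R), (d <= length l)%nat /\
  (forall i, (S i < d)%nat -> t i < t (S i)) /\ (forall x, In x l <-> exists i, (i < d)%nat /\ x = t i).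
Proof.
  remember (length l) as k eqn:Hk. assert (Hle : (length l <= k)%nat) by lia. clear Hk.
  revert l Hle. induction k; intros l Hle.
  - destruct l; [|simpl in Hle; lia]. exists 0%nat, (fun _ => 0). split; [lia|]. split; [lia|].
    intros x. split; [intros []|intros [i [Hi _]]; lia].
  - destruct l as [|a l']; [exists 0%nat, (fun _ => 0); split; [lia|]; split; [lia|]; intros x; split; [intros []|intros [i [Hi _]]; lia]|].
    set (l := a :: l') in *.
    assert (HM : exists M, In M l /\ forall x, In x l -> x <= M).
    { unfold l. clear. revert a. induction l' as [|b l' IH]; intros a.
      - exists a. split; [left; auto|]. intros x [->|[]]. lra.
      - destruct (IH b) as [M [HM1 HM2]]. destruct (Rle_lt_dec a M).
        + exists M. split; [right; auto|]. intros x [->|Hx]; auto.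
        + exists a. split; [left; auto|]. intros x [->|Hx]; [lra|]. specialize (HM2 x Hx). lra. }
    destruct HM as [M [HM1 HM2]].
    assert (Hlen : (length (remove Req_dec_T M l) < length l)%nat) by (apply remove_length_lt; auto).
    destruct (IHk (remove Req_dec_T M l)) as [d [t [Hd [Hinc Hin]]]]; [lia|].
    exists (S d), (fun i => if Nat.eq_dec i d then M else t i). split; [lia|]. split.
    + intros i Hi. destruct (Nat.eq_dec i d); [lia|]. destruct (Nat.eq_dec (S i) d) as [E|E].
      * assert (Hti : In (t i) (remove Req_dec_T M l)) by (apply Hin; exists i; split; [lia|auto]).
        apply in_remove in Hti. destruct Hti as [H1 H2]. specialize (HM2 _ H1). lra.
      * apply Hinc. lia.
    + intros x. split.
      * intros Hx. destruct (Req_dec_T x M) as [->|Hne].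
        -- exists d. split; [lia|]. destruct (Nat.eq_dec d d); [auto|contradiction].
        -- assert (Hx' : In x (remove Req_dec_T M l)) by (apply in_in_remove; auto).
           apply Hin in Hx'. destruct Hx' as [i [Hi ->]]. exists i. split; [lia|].
           destruct (Nat.eq_dec i d); [lia|auto].
      * intros [i [Hi ->]]. destruct (Nat.eq_dec i d); [auto|].
        assert (In (t i) (remove Req_dec_T M l)) by (apply Hin; exists i; split; [lia|auto]).
        apply in_remove in H. apply H.
Qed.

Lemma rsum_perm m (jf : nat -> nat) (g : nat -> R) : Permutation (map jf (seq 0 m)) (seq 0 m) ->
  rsum m (fun i => g (jf i)) = rsum m g.
Proof.
  intros HP. unfold rsum. rewrite <- (map_map jf g).
  assert (G : forall l l' : list R, Permutation l l' -> fold_right Rplus 0 l = fold_right Rplus 0 l').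
  { intros l l' H. induction H; simpl; lra. }
  apply G, Permutation_map, HP.
Qed.

Lemma rsum_small (k : nat) (D : C -> Prop) (c : C) (f : nat -> C -> R) :
  (forall i, (i < k)%nat -> forall eps, 0 < eps -> exists del, 0 < del /\ forall z, D z -> Cmod (z - c) < del -> Rabs (f i z) < eps) ->
  forall eps, 0 < eps -> exists del, 0 < del /\ forall z, D z -> Cmod (z - c) < del -> Rabs (rsum k (fun i => f i z)) < eps.
Proof.
  induction k; intros H eps He.
  - exists 1. split; [lra|]. intros. unfold rsum. simpl. rewrite Rabs_R0. auto.
  - destruct (IHk ltac:(intros; apply H; auto) (eps / 2)) as [d1 [Hd1 H1]]; [lra|].
    destruct (H k ltac:(lia) (eps / 2)) as [d2 [Hd2 H2]]; [lra|].
    exists (Rmin d1 d2). split; [apply Rmin_pos; auto|]. intros z Dz Hz.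
    pose proof (Rmin_l d1 d2). pose proof (Rmin_r d1 d2).
    rewrite rsum_S. eapply Rle_lt_trans; [apply Rabs_triang|].
    specialize (H1 z Dz ltac:(lra)). specialize (H2 z Dz ltac:(lra)). lra.
Qed.

(** ** Poisson integrals of piecewise constant boundary values *)

Lemma poisson_ker_upper zeta t : Cmod zeta < 1 -> poisson_ker zeta t <= 2 / (1 - Cmod zeta).
Proof.
  intros H. pose proof (Cmod_ge_0 zeta). unfold poisson_ker.
  assert (H1 : 1 - Cmod zeta <= Cmod (expi t - zeta)).
  { pose proof (Cmod_triangle_sub (expi t) zeta). rewrite Cmod_expi in H1. auto. }
  set (y := Cmod (expi t - zeta)) in *. set (x := Cmod zeta) in *.
  assert (Hy : 0 < y ^ 2) by (apply pow_lt; lra).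
  apply Rmult_le_reg_r with (y ^ 2); [auto|]. unfold Rdiv at 1. rewrite Rmult_assoc, Rinv_l, Rmult_1_r by lra.
  apply Rle_trans with (2 / (1 - x) * (1 - x) ^ 2).
  - replace (2 / (1 - x) * (1 - x) ^ 2) with (2 * (1 - x)) by (field; lra). nra.
  - apply Rmult_le_compat_l; [left; apply Rdiv_lt_0_compat; lra|]. apply pow_incr. lra.
Qed.

Definition arc_limit (u : C -> R) (a b P : R) : Prop := forall x, a < x < b -> forall eps, 0 < eps ->
  exists del, 0 < del /\ forall z, Cmod z < 1 -> Cmod (z - expi x) < del -> Rabs (u z - P) < eps.

(** The limits in [arc_limit] are unrestricted, not merely radial, so a failure of uniformity on a
    compact subarc would accumulate at one of its points and contradict the limit there. *)
Lemma arc_limit_uniform u a b P a' b' : arc_limit u a b P -> a < a' -> b' < b -> forall eps, 0 < eps ->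
  exists del, 0 < del /\ forall r x, 1 - del < r < 1 -> 0 < r -> a' <= x <= b' -> Rabs (u (RtoC r * expi x)%C - P) < eps.
Proof.
  intros Hl Ha Hb eps He.
  destruct (classic (exists del, 0 < del /\ forall r x, 1 - del < r < 1 -> 0 < r -> a' <= x <= b' -> Rabs (u (RtoC r * expi x)%C - P) < eps))
    as [|Hno]; [auto|exfalso].
  assert (Hk : forall k : nat, exists rx : R * R, 1 - / (INR k + 1) < fst rx < 1 /\ 0 < fst rx /\ a' <= snd rx <= b' /\
    eps <= Rabs (u (RtoC (fst rx) * expi (snd rx))%C - P)).
  { intros k. apply not_all_not_ex. intros Hall. apply Hno. exists (/ (INR k + 1)). pose proof (pos_INR k).
    split; [apply Rinv_0_lt_compat; lra|]. intros r x Hr Hr0 Hx. apply Rnot_le_lt. intros Hle. apply (Hall (r, x)). auto. }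
  destruct (choice_nat _ Hk) as [s Hs].
  destruct (bolzano_R (fun k => snd (s k)) (Rabs a' + Rabs b')) as [x Hx].
  { intros k. destruct (Hs k) as [_ [_ [H _]]]. apply Rabs_le.
    pose proof (Rle_abs a'). pose proof (Rle_abs b'). pose proof (Rle_abs (- a')). pose proof (Rle_abs (- b')).
    rewrite Rabs_Ropp in *. pose proof (Rabs_pos a'). pose proof (Rabs_pos b'). lra. }
  assert (Hxr : a' <= x <= b').
  { split; apply le_epsilon; intros e He'; destruct (Hx e He' 0%nat) as [k [_ H]]; destruct (Hs k) as [_ [_ [H' _]]];
      apply Rabs_def2 in H; lra. }
  destruct (Hl x ltac:(lra) eps He) as [d [Hd H]].
  destruct (inv_nat_small (d / 2)) as [k0 Hk0]; [lra|].
  destruct (Hx (d / 4) ltac:(lra) k0) as [k [Hkk Hxk]]. specialize (Hk0 k Hkk).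
  destruct (Hs k) as [H1 [H2 [H3 H4]]]. set (r := fst (s k)) in *. set (y := snd (s k)) in *.
  assert (Rabs (u (RtoC r * expi y)%C - P) < eps); [|lra].
  apply H.
  - rewrite Cmod_scal_R, Cmod_expi, Rabs_pos_eq; lra.
  - replace (RtoC r * expi y - expi x)%C with (RtoC (r - 1) * expi y + (expi y - expi x))%C by (rewrite RtoC_minus; ring).
    eapply Rle_lt_trans; [apply Cmod_triangle|]. rewrite Cmod_scal_R, Cmod_expi, Rabs_left by lra.
    pose proof (expi_lipschitz y x). lra.
Qed.

Section PiecewisePoisson.
Variables (F : C -> C) (B : R).
Hypothesis HF : hol 1 F.
Hypothesis HB : forall z, Cmod z < 1 -> Rabs (fst (F z)) <= B.

Lemma poisson_integrand_cont zeta r P x : Cmod zeta < 1 -> 0 < r < 1 ->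
  continuous (fun x => poisson_ker zeta x * (fst (F (RtoC r * expi x)%C) - P)) x.
Proof.
  intros Hz Hr. apply continuous_Rmult; [apply poisson_ker_cont; auto|].
  apply (continuous_minus (fun x => fst (F (RtoC r * expi x)%C)) (fun _ => P)); [|apply continuous_const].
  exact (proj1 (pcont_inner_circle F r x HF Hr)).
Qed.

(** Near the two ends of the arc only boundedness is available: pieces of length [eta] are cut off,
    where the integrand is at most [K], and on the rest the convergence is uniform. *)
Lemma arc_integral_limit zeta a b P : Cmod zeta < 1 -> a < b -> arc_limit (fun z => fst (F z)) a b P ->
  forall eps, 0 < eps -> exists del, 0 < del /\ forall r, 1 - del < r < 1 -> 0 < r ->
    Rabs (RInt (fun x => poisson_ker zeta x * fst (F (RtoC r * expi x)%C)) a b - P * RInt (poisson_ker zeta) a b) < eps.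
Proof.
  intros Hz Hab Hl eps He.
  set (M := 2 / (1 - Cmod zeta)). assert (HM : 0 < M) by (apply Rdiv_lt_0_compat; lra).
  assert (HB0 : 0 <= B) by (eapply Rle_trans; [apply Rabs_pos|apply (HB 0%C Cmod_0_lt_1)]).
  pose proof (Rabs_pos P) as HP0.
  set (K := M * (B + Rabs P) + 1). assert (HK : 0 < K) by (unfold K; nra).
  set (eta := Rmin ((b - a) / 4) (eps / (8 * K))).
  assert (Heta : 0 < eta) by (apply Rmin_pos; [lra|apply Rdiv_lt_0_compat; lra]).
  assert (Et1 : eta <= (b - a) / 4) by apply Rmin_l. assert (Et2 : eta <= eps / (8 * K)) by apply Rmin_r.
  assert (Het : K * eta <= eps / 8).
  { apply Rle_trans with (K * (eps / (8 * K))); [apply Rmult_le_compat_l; lra|right; field; lra]. }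
  set (e2 := eps / (4 * M * (b - a))).
  assert (He2 : 0 < e2) by (apply Rdiv_lt_0_compat; [auto|apply Rmult_lt_0_compat; [apply Rmult_lt_0_compat|]; lra]).
  destruct (arc_limit_uniform _ a b P (a + eta) (b - eta) Hl ltac:(lra) ltac:(lra) e2 He2) as [del [Hdel Hu]].
  exists del. split; [auto|]. intros r Hr Hr0.
  set (w := fun x => poisson_ker zeta x * (fst (F (RtoC r * expi x)%C) - P)).
  assert (Hw : forall x, continuous w x) by (intros x; apply poisson_integrand_cont; auto; lra).
  assert (Hex : forall x y, ex_RInt w x y) by (intros; apply ex_RInt_cont; auto).
  assert (Hrx : forall x, Cmod (RtoC r * expi x)%C < 1) by (intros x; rewrite Cmod_scal_R, Cmod_expi, Rabs_pos_eq; lra).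
  assert (E : RInt (fun x => poisson_ker zeta x * fst (F (RtoC r * expi x)%C)) a b - P * RInt (poisson_ker zeta) a b = RInt w a b).
  { assert (X1 : ex_RInt (poisson_ker zeta) a b) by (apply ex_RInt_cont; intros; apply poisson_ker_cont; auto).
    assert (ES : RInt (fun x => P * poisson_ker zeta x) a b = P * RInt (poisson_ker zeta) a b)
      by (apply (RInt_scal (V := R_CompleteNormedModule)); auto).
    rewrite <- ES. symmetry.
    transitivity (RInt (fun x => poisson_ker zeta x * fst (F (RtoC r * expi x)%C) - P * poisson_ker zeta x) a b);
      [apply RInt_ext_R; intros; unfold w; ring|].
    apply (RInt_minus (V := R_CompleteNormedModule) (fun x => poisson_ker zeta x * fst (F (RtoC r * expi x)%C)) (fun x => P * poisson_ker zeta x)).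
    - apply ex_RInt_cont. intros x. apply continuous_Rmult; [apply poisson_ker_cont; auto|].
      exact (proj1 (pcont_inner_circle F r x HF ltac:(lra))).
    - apply (ex_RInt_scal (V := R_NormedModule)). auto. }
  rewrite E.
  assert (C1 : RInt w a b = RInt w a (a + eta) + RInt w (a + eta) (b - eta) + RInt w (b - eta) b).
  { pose proof (RInt_Chasles (V := R_CompleteNormedModule) w a (a + eta) (b - eta) (Hex _ _) (Hex _ _)) as Q1.
    pose proof (RInt_Chasles (V := R_CompleteNormedModule) w a (b - eta) b (Hex _ _) (Hex _ _)) as Q2.
    change (RInt w a (a + eta) + RInt w (a + eta) (b - eta) = RInt w a (b - eta)) in Q1.
    change (RInt w a (b - eta) + RInt w (b - eta) b = RInt w a b) in Q2. lra. }
  assert (HwK : forall x, Rabs (w x) <= K).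
  { intros x. unfold w. rewrite Rabs_mult, (Rabs_pos_eq (poisson_ker zeta x)) by (left; apply poisson_ker_pos; auto).
    pose proof (poisson_ker_upper zeta x Hz). fold M in H. pose proof (poisson_ker_pos zeta x Hz). pose proof (HB _ (Hrx x)).
    assert (Rabs (fst (F (RtoC r * expi x)%C) - P) <= B + Rabs P).
    { eapply Rle_trans; [apply Rabs_triang|]. rewrite Rabs_Ropp. lra. }
    apply Rle_trans with (M * (B + Rabs P)); [|unfold K; lra].
    apply Rmult_le_compat; try lra. apply Rabs_pos. }
  assert (B1 : Rabs (RInt w a (a + eta)) <= (a + eta - a) * K) by (apply abs_RInt_le_const; [lra|auto|auto]).
  assert (B2 : Rabs (RInt w (b - eta) b) <= (b - (b - eta)) * K) by (apply abs_RInt_le_const; [lra|auto|auto]).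
  assert (B3 : Rabs (RInt w (a + eta) (b - eta)) <= (b - eta - (a + eta)) * (M * e2)).
  { apply abs_RInt_le_const; [lra|auto|]. intros x Hx. unfold w.
    rewrite Rabs_mult, (Rabs_pos_eq (poisson_ker zeta x)) by (left; apply poisson_ker_pos; auto).
    pose proof (poisson_ker_upper zeta x Hz). fold M in H. pose proof (poisson_ker_pos zeta x Hz). pose proof (Hu r x Hr Hr0 Hx).
    apply Rmult_le_compat; try lra. apply Rabs_pos. }
  assert (B4 : (b - eta - (a + eta)) * (M * e2) <= eps / 4).
  { apply Rle_trans with ((b - a) * (M * e2)); [apply Rmult_le_compat_r; [apply Rmult_le_pos; lra|lra]|].
    right. unfold e2. field. lra. }
  rewrite C1. eapply Rle_lt_trans; [apply Rabs_triang|]. pose proof (Rabs_triang (RInt w a (a + eta)) (RInt w (a + eta) (b - eta))).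
  lra.
Qed.

(** Poisson's formula on the circle of radius [r], then [r] tends to 1: one side by continuity of
    [F] at [zeta], the other arc by arc. *)
Lemma poisson_piecewise zeta (d : nat) (t P : nat -> R) : Cmod zeta < 1 ->
  (forall i, (i < d)%nat -> t i < t (S i)) -> t d = t 0%nat + 2 * PI ->
  (forall i, (i < d)%nat -> arc_limit (fun z => fst (F z)) (t i) (t (S i)) (P i)) ->
  fst (F zeta) = rsum d (fun i => P i * harm_measure zeta (t i) (t (S i))).
Proof.
  intros Hz Hinc Hper Hlim. pose proof PI_RGT_0.
  assert (Hk : forall k, (k <= d)%nat -> forall eps, 0 < eps -> exists del, 0 < del /\ forall r, 1 - del < r < 1 -> 0 < r ->
    Rabs (RInt (fun x => poisson_ker zeta x * fst (F (RtoC r * expi x)%C)) (t 0%nat) (t k) - rsum k (fun i => P i * RInt (poisson_ker zeta) (t i) (t (S i)))) < eps).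
  { induction k; intros Hkd eps He.
    - exists 1. split; [lra|]. intros r _ _. rewrite RInt_point. unfold rsum, zero. simpl. rewrite Rminus_0_r, Rabs_R0. auto.
    - destruct (IHk ltac:(lia) (eps / 2)) as [d1 [Hd1 H1]]; [lra|].
      destruct (arc_integral_limit zeta (t k) (t (S k)) (P k) Hz (Hinc k ltac:(lia)) (Hlim k ltac:(lia)) (eps / 2)) as [d2 [Hd2 H2]]; [lra|].
      exists (Rmin d1 d2). split; [apply Rmin_pos; auto|]. intros r Hr Hr0.
      pose proof (Rmin_l d1 d2). pose proof (Rmin_r d1 d2).
      specialize (H1 r ltac:(lra) Hr0). specialize (H2 r ltac:(lra) Hr0).
      assert (Hex : forall x y, ex_RInt (fun x => poisson_ker zeta x * fst (F (RtoC r * expi x)%C)) x y).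
      { intros. apply ex_RInt_cont. intros s. apply continuous_Rmult; [apply poisson_ker_cont; auto|].
        exact (proj1 (pcont_inner_circle F r s HF ltac:(lra))). }
      pose proof (RInt_Chasles (V := R_CompleteNormedModule) _ (t 0%nat) (t k) (t (S k)) (Hex _ _) (Hex _ _)) as Q.
      rewrite <- Q. rewrite rsum_S. unfold plus; simpl.
      apply Rabs_def2 in H1. apply Rabs_def2 in H2. apply Rabs_def1; lra. }
  assert (E : 2 * PI * fst (F zeta) = rsum d (fun i => P i * RInt (poisson_ker zeta) (t i) (t (S i)))).
  { apply Rminus_diag_uniq. apply Rabs_eq_0. apply Rle_antisym; [|apply Rabs_pos]. apply le_epsilon. intros e He.
    destruct (Hk d (Nat.le_refl d) (e / 2)) as [d1 [Hd1 H1]]; [lra|].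
    destruct (hol_cont 1 F zeta HF Hz (e / (4 * PI))) as [d2 [Hd2 H2]]; [apply Rdiv_lt_0_compat; lra|].
    set (h := Rmin (Rmin d1 d2) 1 / 2). assert (Hm : 0 < Rmin (Rmin d1 d2) 1) by (repeat apply Rmin_pos; lra).
    pose proof (Rmin_r (Rmin d1 d2) 1).
    pose proof (Rle_trans _ _ _ (Rmin_l (Rmin d1 d2) 1) (Rmin_l d1 d2)).
    pose proof (Rle_trans _ _ _ (Rmin_l (Rmin d1 d2) 1) (Rmin_r d1 d2)).
    set (r := 1 - h). assert (Hr : 0 < r < 1) by (unfold r, h; lra).
    specialize (H1 r ltac:(unfold r, h in *; lra) ltac:(lra)). rewrite Hper in H1.
    rewrite (poisson_re F zeta r (t 0%nat) HF Hz Hr) in H1.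
    specialize (H2 (RtoC r * zeta)%C I).
    replace (RtoC r * zeta - zeta)%C with (RtoC (- h) * zeta)%C in H2 by (unfold r; rewrite RtoC_minus, RtoC_opp; ring).
    pose proof (Cmod_ge_0 zeta).
    assert (Hlt : Cmod (RtoC (- h) * zeta)%C < d2).
    { rewrite Cmod_scal_R, Rabs_Ropp, Rabs_pos_eq by (unfold h; lra). unfold h in *. nra. }
    specialize (H2 Hlt). pose proof (fst_le_Cmod (F (RtoC r * zeta) - F zeta)%C) as H7.
    change (fst (F (RtoC r * zeta)%C - F zeta)%C) with (fst (F (RtoC r * zeta)%C) - fst (F zeta)) in H7.
    assert (H8 : 2 * PI * Rabs (fst (F (RtoC r * zeta)%C) - fst (F zeta)) <= e / 2).
    { apply Rle_trans with (2 * PI * (e / (4 * PI))); [apply Rmult_le_compat_l; lra|right; field; lra]. }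
    rewrite Rplus_0_l. set (Sm := rsum d _) in *. set (x := fst (F (RtoC r * zeta)%C)) in *. set (y := fst (F zeta)) in *.
    replace (2 * PI * y - Sm) with ((2 * PI * x - Sm) - 2 * PI * (x - y)) by ring.
    eapply Rle_trans; [apply Rabs_triang|]. rewrite Rabs_Ropp, Rabs_mult, (Rabs_pos_eq (2 * PI)) by lra. lra. }
  apply Rmult_eq_reg_l with (2 * PI); [|lra]. rewrite E, <- rsum_scal. apply rsum_ext. intros i _.
  change (harm_measure zeta (t i) (t (S i))) with (/ (2 * PI) * RInt (poisson_ker zeta) (t i) (t (S i))). field. lra.
Qed.
End PiecewisePoisson.

(** * The surface tension near boundary points where its boundary values are affine *)

Section Tension.
Variables (n : nat) (v : nat -> C).
Hypothesis Hpoly : convex_polygon n v.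
Variable sigma : C -> R.
Hypothesis Hsconv : convex_on (polyN n v) sigma.
Hypothesis Hscont : continuous_on (polyN n v) sigma.
Hypothesis HsC2 : C2_on (polyInt n v) sigma.
Hypothesis HsMA : forall z, polyInt n v z ->
     dx (dx sigma) z * dy (dy sigma) z - dy (dx sigma) z * dx (dy sigma) z = 1.

Local Notation N := (polyN n v).
Local Notation N0 := (polyInt n v).
Local Notation tau := (side n v).
Local Notation ht := (height n v).
Local Notation pt := (frame n v).
Local Notation edge := (edge n v).
Local Notation grad := (gradient sigma).
Local Notation hess := (hessian sigma).

Lemma grad_ineq z z' : N0 z -> N z' -> sigma z + dot (grad z) (z' - z) <= sigma z'.
Proof. apply (gradient_ineq N N0 sigma); auto using polyInt_N. intros; apply polyInt_open; auto. Qed.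

Lemma sigma_cont z : N z -> forall eps, 0 < eps -> exists del, 0 < del /\
  forall u, N u -> Cmod (u - z) < del -> Rabs (sigma u - sigma z) < eps.
Proof. intros Hz. apply (proj1 (continuous_on_cR N sigma) Hscont z Hz). Qed.

Lemma sigma_diff z : N0 z -> rdiff sigma z (dx sigma z) (dy sigma z).
Proof. apply (sigma_rdiff N0 sigma); auto. intros; apply polyInt_open; auto. Qed.

Lemma gradient_diff z : N0 z -> forall eps, 0 < eps -> exists del, 0 < del /\ forall u, Cmod (u - z) < del ->
  Cmod (grad u - grad z - hess z (u - z)) <= eps * Cmod (u - z).
Proof. apply (grad_diff N0 sigma); auto. intros; apply polyInt_open; auto. Qed.

Lemma dot_scal_r a b t : dot a (RtoC t * b) = t * dot a b.
Proof. unfold dot. simpl. ring. Qed.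
Lemma dot_height i z z' : dot (Ci * tau i) (z' - z) = ht i z' - ht i z.
Proof. rewrite height_diff. unfold dot, cross. simpl. ring. Qed.

Lemma sigma_line_der z h t : N0 (z + RtoC t * h)%C ->
  is_derive (fun s => sigma (z + RtoC s * h)%C) t (dot (grad (z + RtoC t * h)) h).
Proof.
  intros Hz. set (u := (z + RtoC t * h)%C) in *. apply is_derive_eps. intros e He.
  pose proof (Cmod_ge_0 h) as Hh.
  destruct (sigma_diff u Hz (e / (Cmod h + 1))) as [d [Hd H]]; [apply Rdiv_lt_0_compat; lra|].
  exists (d / (Cmod h + 1)). split; [apply Rdiv_lt_0_compat; lra|]. intros s Hs.
  specialize (H (z + RtoC s * h)%C).
  assert (E : (z + RtoC s * h - u)%C = (RtoC (s - t) * h)%C) by (unfold u; rewrite RtoC_minus; ring).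
  rewrite E, Cmod_scal_R in H. pose proof (Rabs_pos (s - t)).
  assert (Rabs (s - t) * (Cmod h + 1) < d).
  { apply Rlt_le_trans with (d / (Cmod h + 1) * (Cmod h + 1)); [apply Rmult_lt_compat_r; lra|right; field; lra]. }
  specialize (H ltac:(nra)).
  assert (E1 : fst (z + RtoC s * h)%C - fst u = (s - t) * fst h) by (unfold u; simpl; ring).
  assert (E2 : snd (z + RtoC s * h)%C - snd u = (s - t) * snd h) by (unfold u; simpl; ring).
  rewrite E1, E2 in H. cbv beta. fold u. unfold dot, gradient. cbn [fst snd].
  match goal with |- Rabs ?x <= _ => match type of H with Rabs ?y <= _ => replace x with y by ring end end.
  eapply Rle_trans; [exact H|].
  replace (e * Rabs (s - t)) with (e / (Cmod h + 1) * (Rabs (s - t) * (Cmod h + 1))) by (field; lra).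
  apply Rmult_le_compat_l; [left; apply Rdiv_lt_0_compat; lra|]. nra.
Qed.

(** The mean value bound along the segment is applied to the second-order remainder, whose
    derivative is the first-order remainder of the gradient. *)
Lemma sigma_taylor2 z : N0 z -> forall eps, 0 < eps -> exists del, 0 < del /\ forall h, Cmod h < del ->
  Rabs (sigma (z + h)%C - sigma z - dot (grad z) h - / 2 * dot (hess z h) h) <= eps * Cmod h ^ 2.
Proof.
  intros Hz e He. destruct (polyInt_open n v z Hz) as [r [Hr HB]].
  destruct (gradient_diff z Hz e He) as [d [Hd H]].
  exists (Rmin r d). split; [apply Rmin_pos; auto|]. intros h Hh.
  pose proof (Rmin_l r d). pose proof (Rmin_r r d).
  assert (Hth : forall t, 0 <= t <= 1 -> Cmod (RtoC t * h) <= t * Cmod h /\ Cmod (RtoC t * h) <= Cmod h).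
  { intros t Ht. rewrite Cmod_scal_R, Rabs_pos_eq by lra. pose proof (Cmod_ge_0 h). nra. }
  assert (Hd1 : forall t, 0 <= t <= 1 -> is_derive (fun s => sigma (z + RtoC s * h)%C - s * dot (grad z) h - s ^ 2 / 2 * dot (hess z h) h) t
     (dot (grad (z + RtoC t * h)) h - dot (grad z) h - t * dot (hess z h) h)).
  { intros t Ht. destruct (Hth t Ht) as [_ T2].
    assert (Hin : N0 (z + RtoC t * h)%C).
    { apply HB. replace (z + RtoC t * h - z)%C with (RtoC t * h)%C by ring. lra. }
    pose proof (sigma_line_der z h t Hin) as HD.
    apply (is_derive_minus (fun s => sigma (z + RtoC s * h)%C - s * dot (grad z) h) (fun s => s ^ 2 / 2 * dot (hess z h) h)).
    - apply (is_derive_minus (fun s => sigma (z + RtoC s * h)%C) (fun s => s * dot (grad z) h)); [exact HD|].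
      auto_derive; [auto|ring].
    - auto_derive; [auto|field]. }
  pose proof (real_mvt_bound _ _ (e * Cmod h ^ 2) 0 1 ltac:(lra) Hd1) as HM. cbv beta in HM.
  replace (z + RtoC 1 * h)%C with (z + h)%C in HM by ring.
  replace (z + RtoC 0 * h)%C with z in HM by ring.
  match goal with |- Rabs ?x <= _ => match type of HM with _ -> Rabs ?y <= _ => replace x with y by field end end.
  rewrite Rminus_0_r, Rmult_1_r in HM. apply HM. intros t Ht. destruct (Hth t Ht) as [T1 T2].
  specialize (H (z + RtoC t * h)%C). replace (z + RtoC t * h - z)%C with (RtoC t * h)%C in H by ring.
  specialize (H ltac:(lra)).
  replace (dot (grad (z + RtoC t * h)) h - dot (grad z) h - t * dot (hess z h) h) with
    (dot (grad (z + RtoC t * h) - grad z - hess z (RtoC t * h)) h).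
  - eapply Rle_trans; [apply dot_le|]. pose proof (Cmod_ge_0 h).
    apply Rle_trans with (e * Cmod (RtoC t * h) * Cmod h); [apply Rmult_le_compat_r; auto|].
    replace (e * Cmod h ^ 2) with (e * Cmod h * Cmod h) by ring.
    apply Rmult_le_compat_r; auto. apply Rmult_le_compat_l; lra.
  - unfold dot, hessian. simpl. ring.
Qed.

(** Used at a maximum of [sigma] minus a quadratic barrier, where [K] is the second derivative of
    the barrier in the direction [h]. *)
Lemma second_difference z h K : N0 z ->
  (forall t, 0 < t <= 1 -> sigma (z + RtoC t * h)%C + sigma (z - RtoC t * h)%C - 2 * sigma z <= K * t ^ 2) ->
  dot (hess z h) h <= K.
Proof.
  intros Hz HK. apply le_epsilon. intros e He. pose proof (Cmod_ge_0 h) as Hh.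
  assert (Hpos : 0 < 2 * (Cmod h ^ 2 + 1)) by nra.
  destruct (sigma_taylor2 z Hz (e / (2 * (Cmod h ^ 2 + 1)))) as [d [Hd H]]; [apply Rdiv_lt_0_compat; auto|].
  destruct (small_step d (Cmod h) Hd Hh) as [t [Ht Htd]].
  specialize (HK t Ht).
  pose proof (H (RtoC t * h)%C) as H1. pose proof (H (- (RtoC t * h))%C) as H2.
  rewrite Cmod_opp in H2. rewrite Cmod_scal_R, Rabs_pos_eq in H1, H2 by lra.
  specialize (H1 Htd). specialize (H2 Htd).
  replace (z + - (RtoC t * h))%C with (z - RtoC t * h)%C in H2 by ring.
  assert (E1 : dot (hess z (RtoC t * h)) (RtoC t * h) = t ^ 2 * dot (hess z h) h) by (unfold dot, hessian; simpl; ring).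
  assert (E2 : dot (hess z (- (RtoC t * h))) (- (RtoC t * h)) = t ^ 2 * dot (hess z h) h) by (unfold dot, hessian; simpl; ring).
  assert (E3 : dot (grad z) (- (RtoC t * h)) = - dot (grad z) (RtoC t * h)) by (unfold dot; simpl; ring).
  rewrite E1 in H1. rewrite E2, E3 in H2. apply Rabs_le_between in H1. apply Rabs_le_between in H2.
  assert (Hq : e / (2 * (Cmod h ^ 2 + 1)) * (t * Cmod h) ^ 2 <= e / 2 * t ^ 2).
  { replace (e / 2 * t ^ 2) with (e / (2 * (Cmod h ^ 2 + 1)) * (t ^ 2 * (Cmod h ^ 2 + 1))) by (field; nra).
    apply Rmult_le_compat_l; [left; apply Rdiv_lt_0_compat; auto|]. nra. }
  apply Rmult_le_reg_l with (t ^ 2); [nra|]. nra.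
Qed.

(** The boundary point lies inside an affine piece of the boundary data; [b] is the slope in the
    edge parameter, that is, the tangential derivative times the length of the edge. *)
Definition good (i : nat) (s b : R) : Prop := (i < n)%nat /\ exists eta, 0 < eta /\
  forall s', Rabs (s' - s) < eta -> 0 < s' < 1 /\ sigma (edge i s') = sigma (edge i s) + b * (s' - s).

Lemma good_range i s b : good i s b -> (i < n)%nat /\ 0 < s < 1.
Proof.
  intros [Hi [eta [He H]]]. split; [auto|]. apply (H s). rewrite Rminus_diag, Rabs_R0. auto.
Qed.

Lemma good_open i s b : good i s b -> exists eta, 0 < eta /\ forall s', Rabs (s' - s) < eta -> good i s' b.
Proof.
  intros [Hi [eta [He H]]]. exists (eta / 2). split; [lra|]. intros s' Hs'.
  split; [auto|]. exists (eta / 2). split; [lra|]. intros s'' Hs''.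
  assert (A : Rabs (s'' - s) < eta).
  { replace (s'' - s) with ((s'' - s') + (s' - s)) by ring. eapply Rle_lt_trans; [apply Rabs_triang|]. lra. }
  destruct (H s'' A) as [B1 B2]. destruct (H s') as [_ B3]; [lra|]. split; [auto|]. rewrite B2, B3. ring.
Qed.

Lemma edge_box i s : (i < n)%nat -> 0 < s < 1 -> exists eta, 0 < eta /\
  forall x y, Rabs (x - s) <= eta -> 0 <= y <= eta -> N (pt i x y) /\ (0 < y -> N0 (pt i x y)).
Proof.
  intros Hi Hs. destruct (edge_nbhd n v Hpoly i s Hi Hs) as [r [Hr H]].
  pose proof (side_neq0 n v Hpoly i Hi) as Ht.
  exists (r / (4 * Cmod (tau i))). assert (0 < r / (4 * Cmod (tau i))) by (apply Rdiv_lt_0_compat; lra).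
  split; [auto|]. intros x y Hx Hy.
  assert (D : Cmod (pt i x y - edge i s) < r).
  { rewrite <- (frame_0 n v). eapply Rle_lt_trans; [apply frame_dist|].
    rewrite Rminus_0_r, (Rabs_pos_eq y) by lra.
    apply Rle_lt_trans with ((r / (4 * Cmod (tau i)) + r / (4 * Cmod (tau i))) * Cmod (tau i)).
    - apply Rmult_le_compat_r; lra.
    - replace ((r / (4 * Cmod (tau i)) + r / (4 * Cmod (tau i))) * Cmod (tau i)) with (r / 2) by (field; lra). lra. }
  split.
  - intros j Hj. change (0 <= ht j (pt i x y)). destruct (Nat.eq_dec j i) as [->|Hne].
    + rewrite height_pt. apply Rmult_le_pos; [lra|]. apply pow_le; lra.
    + left. apply H; auto.
  - intros Hy0 j Hj. change (0 < ht j (pt i x y)). destruct (Nat.eq_dec j i) as [->|Hne].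
    + rewrite height_pt. apply Rmult_lt_0_compat; [lra|]. apply pow_lt; lra.
    + apply H; auto.
Qed.

Lemma good_box i s b : good i s b -> exists eta, 0 < eta /\
  (forall x y, Rabs (x - s) <= eta -> 0 <= y <= eta -> N (pt i x y) /\ (0 < y -> N0 (pt i x y))) /\
  (forall x, Rabs (x - s) <= eta -> good i x b /\ sigma (edge i x) = sigma (edge i s) + b * (x - s)).
Proof.
  intros Hg. destruct (good_range _ _ _ Hg) as [Hi Hs].
  destruct (edge_box i s Hi Hs) as [e1 [He1 H1]]. destruct (good_open _ _ _ Hg) as [e2 [He2 H2]].
  destruct Hg as [_ [e3 [He3 H3]]].
  set (eta := Rmin e1 (Rmin e2 e3) / 2).
  assert (M : 0 < Rmin e1 (Rmin e2 e3)) by (repeat apply Rmin_pos; auto).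
  assert (M1 : Rmin e1 (Rmin e2 e3) <= e1) by apply Rmin_l.
  assert (M2 : Rmin e1 (Rmin e2 e3) <= e2) by (eapply Rle_trans; [apply Rmin_r|apply Rmin_l]).
  assert (M3 : Rmin e1 (Rmin e2 e3) <= e3) by (eapply Rle_trans; [apply Rmin_r|apply Rmin_r]).
  exists eta. split; [unfold eta; lra|]. split.
  - intros x y Hx Hy. apply H1; unfold eta in *; lra.
  - intros x Hx. split; [apply H2; unfold eta in *; lra|]. apply H3. unfold eta in *; lra.
Qed.

(** The Gram determinant of the Hessian in the orthogonal basis [t], [Ci * t] is [det D^2 sigma = 1]
    times the square of the basis determinant [|t|^2]. *)
Lemma hess_det_frame z (t : C) : N0 z ->
  dot (hess z t) t * dot (hess z (Ci * t)) (Ci * t) - dot (hess z t) (Ci * t) ^ 2 = (Cmod t ^ 2) ^ 2.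
Proof.
  intros Hz. pose proof (HsMA z Hz) as HM.
  rewrite (hessian_sym N0 sigma (fun z => polyInt_open n v z) HsC2 z Hz) in HM.
  rewrite Cmod_sqr. unfold dot, hessian. simpl.
  set (a := dx (dx sigma) z) in *. set (b := dy (dx sigma) z) in *. set (c := dy (dy sigma) z) in *.
  set (p := fst t). set (q := snd t).
  transitivity ((a * c - b * b) * (p * p + q * q) ^ 2); [ring|rewrite HM; ring].
Qed.

(* If the normal slope at [s] were finite, equal to [q], then (by convexity, [sigma] being affine on the edge)
   [q y <= phi x y <= (q + eps) y] on a fixed interval of abscissae, [phi] being [sigma] minus its affine
   boundary value; comparing with [A (x - s)^2 + C (y - T/2)^2], [A = eps T / l^2], [C = 4 eps / T], at an
   interior maximum of the difference forces [det D^2 sigma <= 16 eps^2 / l^2], up to normalisation. *)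
Lemma infinite_slope i s b : good i s b -> forall K, exists t0, 0 < t0 /\
  forall t, 0 < t <= t0 -> sigma (pt i s t) <= sigma (edge i s) - K * t.
Proof.
  intros Hg K. destruct (good_range _ _ _ Hg) as [Hi Hs].
  destruct (good_box _ _ _ Hg) as [eta [Heta [HN Haff]]].
  assert (Hs0 : forall c, 0 <= c -> Rabs (s - s) <= c) by (intros; rewrite Rminus_diag, Rabs_R0; auto).
  set (phi := fun x t => sigma (pt i x t) - sigma (edge i s) - b * (x - s)).
  (* Since [phi] vanishes on the edge, convexity with one endpoint there scales [phi] down together
     with [t]. *)
  assert (HC : forall x x' t lam, Rabs (x - s) <= eta -> Rabs (x' - s) <= eta -> 0 <= t <= eta -> 0 <= lam <= 1 ->
     phi (lam * x + (1 - lam) * x') (lam * t) <= lam * phi x t).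
  { intros x x' t lam Hx Hx' Ht Hl. unfold phi.
    pose proof (Hsconv (pt i x t) (pt i x' 0) lam (proj1 (HN x t Hx Ht)) (proj1 (HN x' 0 Hx' ltac:(lra))) Hl) as HH.
    replace (RtoC lam * pt i x t + RtoC (1 - lam) * pt i x' 0)%C with (pt i (lam * x + (1 - lam) * x') (lam * t)) in HH.
    2:{ unfold frame. rewrite !edge_side. rewrite !RtoC_plus, !RtoC_mult, !RtoC_minus. ring. }
    rewrite (frame_0 n v), (proj2 (Haff x' Hx')) in HH. lra. }
  destruct (classic (exists t0, 0 < t0 /\ forall t, 0 < t <= t0 -> sigma (pt i s t) <= sigma (edge i s) - K * t))
    as [|Hno]; [auto|exfalso].
  (* By the same scaling, a single [t] with [phi s t < - K t] could serve as [t0]; so the negation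
     bounds [phi s t / t] from below, and [q] is its infimum. *)
  assert (Hlow : forall t, 0 < t <= eta -> - K * t <= phi s t).
  { intros t Ht. apply Rnot_lt_le. intros Hlt. apply Hno. exists t. split; [lra|]. intros t' Ht'.
    pose proof (HC s s t (t' / t) (Hs0 eta ltac:(lra)) (Hs0 eta ltac:(lra)) ltac:(lra)) as HH.
    assert (Hq : 0 < t' / t <= 1).
    { split; [apply Rdiv_lt_0_compat; lra|]. apply Rmult_le_reg_r with t; [lra|]. unfold Rdiv. rewrite Rmult_assoc, Rinv_l; lra. }
    specialize (HH ltac:(lra)). replace (t' / t * s + (1 - t' / t) * s) with s in HH by ring.
    replace (t' / t * t) with t' in HH by (field; lra).
    assert (t' / t * phi s t <= t' / t * (- K * t)) by (apply Rmult_le_compat_l; lra).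
    replace (t' / t * (- K * t)) with (- K * t') in H by (field; lra).
    unfold phi in HH at 1. rewrite Rminus_diag, Rmult_0_r in HH. lra. }
  destruct (completeness (fun y => exists t, 0 < t <= eta /\ y = - (phi s t / t))) as [q' [Hq1 Hq2]].
  { exists K. intros y [t [Ht ->]]. specialize (Hlow t Ht).
    apply Rmult_le_reg_r with t; [lra|]. replace (- (phi s t / t) * t) with (- phi s t) by (field; lra). lra. }
  { exists (- (phi s eta / eta)), eta. split; [lra|auto]. }
  set (q := - q').
  assert (HqL : forall t, 0 < t <= eta -> q * t <= phi s t).
  { intros t Ht. assert (- (phi s t / t) <= q') by (apply Hq1; exists t; auto).
    assert (- q' * t <= phi s t / t * t) by (apply Rmult_le_compat_r; lra).
    replace (phi s t / t * t) with (phi s t) in H0 by (field; lra). exact H0. }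
  set (l := eta / 2). set (T2 := Cmod (tau i) ^ 2).
  assert (HT2 : 0 < T2) by (apply pow_lt, side_neq0; auto).
  (* Chosen so that [16 eps^2 / l^2 = T2^2 / 4], strictly below the determinant [T2^2] of the
     Hessian in the frame. *)
  set (eps := l * T2 / 8). assert (Hl : 0 < l) by (unfold l; lra).
  assert (Heps : 0 < eps) by (unfold eps; nra).
  assert (HqU : exists t1, 0 < t1 <= eta /\ phi s t1 <= (q + eps) * t1).
  { destruct (classic (exists t1, 0 < t1 <= eta /\ phi s t1 <= (q + eps) * t1)) as [|Hno2]; [auto|exfalso].
    assert (q' <= q' - eps); [|lra]. apply Hq2. intros y [t [Ht ->]].
    destruct (Rle_lt_dec (phi s t) ((q + eps) * t)) as [Hle|Hlt]; [exfalso; apply Hno2; exists t; auto|].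
    apply Rmult_le_reg_r with t; [lra|]. replace (- (phi s t / t) * t) with (- phi s t) by (field; lra).
    unfold q in Hlt. lra. }
  destruct HqU as [t1 [Ht1 Hphi1]].
  (* The bounds known on the normal at [s] are spread to a strip. From below, the point of height
     [t / 3] over [s] is a convex combination of [(x, t)] and an edge point on the other side; from
     above, [(x, t)] is one of [(s, t1)] and the edge point [x'']. *)
  assert (Hmid : forall x t, Rabs (x - s) <= l -> 0 <= t <= t1 / 2 -> q * t <= phi x t <= (q + eps) * t).
  { intros x t Hx Ht. apply Rabs_le_between in Hx.
    destruct (Rle_lt_dec t 0) as [T0|T0].
    { assert (E : t = 0) by lra. rewrite E. unfold phi. rewrite (frame_0 n v).
      rewrite (proj2 (Haff x ltac:(apply Rabs_le; unfold l in Hx; lra))). lra. }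
    split.
    - pose proof (HC x (s - (x - s) / 2) t (1/3)) as HH.
      specialize (HH ltac:(apply Rabs_le; unfold l in Hx; lra) ltac:(apply Rabs_le; unfold l in Hx; lra) ltac:(lra) ltac:(lra)).
      replace (1 / 3 * x + (1 - 1 / 3) * (s - (x - s) / 2)) with s in HH by field.
      pose proof (HqL (1 / 3 * t) ltac:(lra)). lra.
    - set (lam := t / t1).
      assert (Hlam : 0 < lam <= 1 / 2).
      { unfold lam. split; [apply Rdiv_lt_0_compat; lra|]. apply Rmult_le_reg_r with t1; [lra|].
        unfold Rdiv at 1. rewrite Rmult_assoc, Rinv_l; lra. }
      set (x'' := s + (x - s) / (1 - lam)).
      assert (Hi1 : 0 < / (1 - lam) <= 2).
      { split; [apply Rinv_0_lt_compat; lra|]. replace 2 with (/ (1 / 2)) by field. apply Rinv_le_contravar; lra. }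
      pose proof (HC s x'' t1 lam (Hs0 eta ltac:(lra))) as HH.
      assert (Hx'' : Rabs (x'' - s) <= eta).
      { unfold x''. replace (s + (x - s) / (1 - lam) - s) with ((x - s) * / (1 - lam)) by (field; lra).
        rewrite Rabs_mult, (Rabs_pos_eq (/ (1 - lam))) by lra.
        assert (Rabs (x - s) <= l) by (apply Rabs_le; auto). pose proof (Rabs_pos (x - s)).
        apply Rle_trans with (l * 2); [apply Rmult_le_compat; lra|unfold l; lra]. }
      specialize (HH Hx'' ltac:(lra) ltac:(lra)).
      replace (lam * s + (1 - lam) * x'') with x in HH by (unfold x''; field; lra).
      replace (lam * t1) with t in HH by (unfold lam; field; lra).
      eapply Rle_trans; [exact HH|]. apply Rle_trans with (lam * ((q + eps) * t1)); [apply Rmult_le_compat_l; lra|].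
      right. unfold lam. field. lra. }
  set (T := t1 / 2). assert (HT : 0 < T <= eta) by (unfold T; lra).
  set (A := eps * T / l ^ 2). set (Cc := 4 * eps / T).
  assert (HA : 0 < A) by (apply Rdiv_lt_0_compat; [apply Rmult_lt_0_compat; lra|apply pow_lt; lra]).
  assert (HCc : 0 < Cc) by (apply Rdiv_lt_0_compat; lra).
  set (Psi := fun x y => phi x y - q * y - A * (x - s) ^ 2 - Cc * (y - T / 2) ^ 2).
  assert (Hlast : exists x y, Rabs (x - s) < l /\ 0 < y < T /\
     forall x' y', Rabs (x' - s) <= l -> 0 <= y' <= T -> Psi x' y' <= Psi x y).
  { destruct (polyN_bounded n v Hpoly) as [MB HMB].
    destruct (extreme_value (fun z => exists x y, z = (x, y) /\ Rabs (x - s) <= l /\ 0 <= y <= T) (fun z => - Psi (fst z) (snd z))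
       (Rabs s + l + T) (s, T / 2)) as [z [[x [y [Ez [Hx Hy]]]] Hmax]].
    - exists s, (T / 2). split; [auto|]. split; [apply Hs0; lra|lra].
    - intros z [x [y [-> [Hx Hy]]]]. eapply Rle_trans; [apply Cmod_le_sum|]. simpl.
      replace x with ((x - s) + s) by ring. pose proof (Rabs_triang (x - s) s). rewrite (Rabs_pos_eq y) by lra. lra.
    - intros z Hz. exists (fst z), (snd z). split; [destruct z; auto|].
      assert (HX : forall e, 0 < e -> Rabs (fst z - s) <= l + e /\ - e <= snd z <= T + e).
      { intros e He. destruct (Hz e He) as [u [[x [y [-> [Hx Hy]]]] Hu]].
        pose proof (fst_le_Cmod ((x, y) - z)) as F1. pose proof (snd_le_Cmod ((x, y) - z)) as F2.
        simpl in F1, F2. apply Rabs_le_between in F1. apply Rabs_le_between in F2. apply Rabs_le_between in Hx.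
        split; [apply Rabs_le; lra|lra]. }
      split; [apply le_epsilon; intros e He; apply (HX e He)|].
      split; apply le_epsilon; intros e He; destruct (HX e He); lra.
    - intros z [x [y [-> [Hx Hy]]]] e He. cbn [fst snd].
      assert (Np : N (pt i x y)) by (apply HN; unfold l in *; lra).
      destruct (sigma_cont (pt i x y) Np (e / 2)) as [d1 [Hd1 H1]]; [lra|].
      assert (Hpoly2 : cR (fun z => b * (fst z - s) + q * snd z + A * ((fst z - s) * (fst z - s)) + Cc * ((snd z - T / 2) * (snd z - T / 2))) (x, y)).
      { apply continuous_cR.
        assert (F : continuous (fun z : C => fst z) (x, y)) by apply continuous_fst.
        assert (S : continuous (fun z : C => snd z) (x, y)) by apply continuous_snd.
        assert (Kc : forall c : R, continuous (fun _ : C => c) (x, y)) by (intros; apply continuous_const).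
        assert (Mm : forall f g : C -> R, continuous f (x, y) -> continuous g (x, y) -> continuous (fun z => f z * g z) (x, y))
          by (intros; apply (continuous_mult (K := R_AbsRing)); auto).
        assert (Pp : forall f g : C -> R, continuous f (x, y) -> continuous g (x, y) -> continuous (fun z => f z + g z) (x, y))
          by (intros f g Hf Hg'; apply (continuous_plus f g); auto).
        assert (Mi : forall f g : C -> R, continuous f (x, y) -> continuous g (x, y) -> continuous (fun z => f z - g z) (x, y))
          by (intros f g Hf Hg'; apply (continuous_minus f g); auto).
        pose proof (Mi _ _ F (Kc s)) as F1. pose proof (Mi _ _ S (Kc (T / 2))) as S1.
        exact (Pp _ _ (Pp _ _ (Pp _ _ (Mm _ _ (Kc b) F1) (Mm _ _ (Kc q) S)) (Mm _ _ (Kc A) (Mm _ _ F1 F1)))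
          (Mm _ _ (Kc Cc) (Mm _ _ S1 S1))). }
      destruct (Hpoly2 (e / 2)) as [d2 [Hd2 H2]]; [lra|].
      pose proof (side_neq0 n v Hpoly i Hi) as Ht0.
      set (d3 := d1 / (2 * Cmod (tau i))). assert (Hd3 : 0 < d3) by (apply Rdiv_lt_0_compat; lra).
      exists (Rmin d2 d3). split; [apply Rmin_pos; auto|].
      intros u [x' [y' [-> [Hx' Hy']]]] Hu. pose proof (Rmin_l d2 d3). pose proof (Rmin_r d2 d3).
      specialize (H2 (x', y') ltac:(lra)). cbn [fst snd] in *.
      assert (H1' : Rabs (sigma (pt i x' y') - sigma (pt i x y)) < e / 2).
      { apply H1; [apply HN; unfold l in *; lra|]. eapply Rle_lt_trans; [apply frame_dist|].
        pose proof (fst_le_Cmod ((x', y') - (x, y))) as F1. pose proof (snd_le_Cmod ((x', y') - (x, y))) as F2.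
        simpl in F1, F2. unfold Rminus at 1 2.
        apply Rle_lt_trans with (2 * Cmod ((x', y') - (x, y)) * Cmod (tau i)); [apply Rmult_le_compat_r; lra|].
        apply Rlt_le_trans with (2 * d3 * Cmod (tau i)); [apply Rmult_lt_compat_r; lra|].
        right. unfold d3. field. lra. }
      unfold Psi, phi. apply Rabs_def2 in H1'. apply Rabs_def2 in H2. apply Rabs_def1; lra.
    - subst z. cbn [fst snd] in Hmax.
      assert (Hmax' : forall x' y', Rabs (x' - s) <= l -> 0 <= y' <= T -> Psi x' y' <= Psi x y).
      { intros x' y' Hx' Hy'. specialize (Hmax (x', y') ltac:(exists x', y'; auto)). cbn [fst snd] in Hmax. lra. }
      assert (Hcen : 0 <= Psi s (T / 2)).
      { unfold Psi. destruct (Hmid s (T / 2) (Hs0 l ltac:(lra)) ltac:(unfold T; lra)). rewrite !Rminus_diag. lra. }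
      (* Because [A l^2 = Cc (T/2)^2 = eps T], one has [Psi <= 0] on the sides of the box, while
         [Psi >= 0] at its centre: either the maximum is positive, hence interior, or the centre
         itself is a maximum. *)
      destruct (Rlt_le_dec (Psi s (T / 2)) (Psi x y)) as [Hlt|Hge].
      + exists x, y. destruct (Hmid x y Hx ltac:(unfold T in *; lra)) as [B1 B2].
        assert (E1 : A * l ^ 2 = eps * T) by (unfold A; field; lra).
        assert (E2 : Cc * (T / 2) ^ 2 = eps * T) by (unfold Cc; field; lra).
        assert (Py : eps * y <= eps * T) by (apply Rmult_le_compat_l; lra).
        assert (HPsi : 0 < Psi x y) by lra. unfold Psi in HPsi.
        assert (0 <= Cc * (y - T / 2) ^ 2) by (apply Rmult_le_pos; [lra|apply pow2_ge_0]).
        assert (0 <= A * (x - s) ^ 2) by (apply Rmult_le_pos; [lra|apply pow2_ge_0]).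
        repeat split; auto.
        * apply Rnot_le_lt. intros Hle. assert (Ex : (x - s) ^ 2 = l ^ 2).
          { rewrite <- (pow2_abs (x - s)). f_equal. lra. }
          rewrite Ex in *. lra.
        * apply Rnot_le_lt. intros Hle. assert (Ey : y = 0) by lra. subst y.
          replace ((0 - T / 2) ^ 2) with ((T / 2) ^ 2) in HPsi by ring. lra.
        * apply Rnot_le_lt. intros Hle. assert (Ey : y = T) by lra. subst y.
          replace ((T - T / 2) ^ 2) with ((T / 2) ^ 2) in HPsi by field. lra.
      + exists s, (T / 2). split; [rewrite Rminus_diag, Rabs_R0; lra|]. split; [lra|].
        intros x' y' Hx' Hy'. eapply Rle_trans; [apply Hmax'; auto|auto]. }
  destruct Hlast as [x [y [Hx [Hy Hmax]]]].
  set (z := pt i x y).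
  assert (Hz : N0 z) by (apply HN; unfold l in *; lra).
  assert (S1 : dot (hess z (tau i)) (tau i) <= 2 * A).
  { set (m := Rmin 1 (l - Rabs (x - s))). assert (Hm : 0 < m) by (apply Rmin_pos; lra).
    assert (Hm1 : m <= 1) by apply Rmin_l. assert (Hm2 : m <= l - Rabs (x - s)) by apply Rmin_r.
    apply Rmult_le_reg_l with (m ^ 2); [apply pow_lt; auto|].
    replace (m ^ 2 * dot (hess z (tau i)) (tau i)) with (dot (hess z (RtoC m * tau i)) (RtoC m * tau i))
      by (unfold dot, hessian; simpl; ring).
    apply second_difference; [auto|]. intros t Ht.
    assert (Htm : 0 < t * m <= m) by nra.
    assert (HX : forall c, Rabs c <= m -> Rabs (x + c - s) <= l).
    { intros c Hc. replace (x + c - s) with ((x - s) + c) by ring. eapply Rle_trans; [apply Rabs_triang|]. lra. }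
    pose proof (Hmax (x + t * m) y ltac:(apply HX; rewrite Rabs_pos_eq; lra) ltac:(lra)) as M1.
    pose proof (Hmax (x - t * m) y ltac:(apply HX; rewrite Rabs_Ropp, Rabs_pos_eq; lra) ltac:(lra)) as M2.
    replace (z + RtoC t * (RtoC m * tau i))%C with (pt i (x + t * m) y).
    2:{ unfold z, frame. rewrite !edge_side, !RtoC_plus, !RtoC_mult. ring. }
    replace (z - RtoC t * (RtoC m * tau i))%C with (pt i (x - t * m) y).
    2:{ unfold z, frame. rewrite !edge_side, !RtoC_minus, !RtoC_mult. ring. }
    unfold Psi, phi in M1, M2. fold z in M1, M2. nra. }
  assert (S2 : dot (hess z (Ci * tau i)) (Ci * tau i) <= 2 * Cc).
  { set (m := Rmin 1 (Rmin y (T - y))). assert (Hm : 0 < m) by (repeat apply Rmin_pos; lra).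
    assert (Hm1 : m <= 1) by apply Rmin_l.
    assert (Hm2 : m <= y) by (eapply Rle_trans; [apply Rmin_r|apply Rmin_l]).
    assert (Hm3 : m <= T - y) by (eapply Rle_trans; [apply Rmin_r|apply Rmin_r]).
    apply Rmult_le_reg_l with (m ^ 2); [apply pow_lt; auto|].
    replace (m ^ 2 * dot (hess z (Ci * tau i)) (Ci * tau i)) with
      (dot (hess z (RtoC m * (Ci * tau i))) (RtoC m * (Ci * tau i)))
      by (unfold dot, hessian; simpl; ring).
    apply second_difference; [auto|]. intros t Ht.
    assert (Htm : 0 < t * m <= m) by nra.
    pose proof (Hmax x (y + t * m) ltac:(lra) ltac:(lra)) as M1.
    pose proof (Hmax x (y - t * m) ltac:(lra) ltac:(lra)) as M2.
    replace (z + RtoC t * (RtoC m * (Ci * tau i)))%C with (pt i x (y + t * m)).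
    2:{ unfold z, frame. rewrite !edge_side, !RtoC_plus, !RtoC_mult. ring. }
    replace (z - RtoC t * (RtoC m * (Ci * tau i)))%C with (pt i x (y - t * m)).
    2:{ unfold z, frame. rewrite !edge_side, !RtoC_minus, !RtoC_mult. ring. }
    unfold Psi, phi in M1, M2. fold z in M1, M2. nra. }
  pose proof (hess_det_frame z (tau i) Hz) as HD. fold T2 in HD.
  set (al := dot (hess z (tau i)) (tau i)) in *. set (ga := dot (hess z (Ci * tau i)) (Ci * tau i)) in *.
  set (be := dot (hess z (tau i)) (Ci * tau i)) in *.
  assert (Hag : T2 ^ 2 <= al * ga) by (pose proof (pow2_ge_0 be); lra).
  assert (Hagp : 0 < T2 ^ 2) by (apply pow_lt; auto).
  assert (HAC : 2 * A * (2 * Cc) = T2 ^ 2 / 4) by (unfold A, Cc, eps; field; lra).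
  (* Upper bounds on [al] and [ga] bound the product only if both are positive; positivity of the
     Hessian excludes the other case. *)
  destruct (Rle_lt_dec al 0) as [Hal|Hal].
  - assert (ga < 0 \/ 0 <= ga) as [Hga|Hga] by lra; [|nra].
    destruct (hessian_diag_nonneg N N0 sigma (polyInt_N n v) (fun z => polyInt_open n v z) Hsconv HsC2 z Hz) as [D1 D2].
    assert (0 <= al).
    { unfold al. pose proof (HsMA z Hz) as HM.
      rewrite (hessian_sym N0 sigma (fun z => polyInt_open n v z) HsC2 z Hz) in HM.
      unfold dot, hessian. simpl. set (p := fst (tau i)). set (r := snd (tau i)).
      set (a := dx (dx sigma) z) in *. set (bb := dy (dx sigma) z) in *. set (c := dy (dy sigma) z) in *.
      assert (Ha : 0 < a) by nra.
      apply Rmult_le_reg_l with a; [auto|]. rewrite Rmult_0_r.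
      assert (E : a * ((a * p + bb * r) * p + (bb * p + c * r) * r) = (a * p + bb * r) ^ 2 + r ^ 2).
      { transitivity ((a * p + bb * r) ^ 2 + (a * c - bb * bb) * r ^ 2); [ring|rewrite HM; ring]. }
      apply Rle_trans with (a * ((a * p + bb * r) * p + (bb * p + c * r) * r)); [|right; unfold p, r; simpl; ring].
      rewrite E. pose proof (pow2_ge_0 (a * p + bb * r)). pose proof (pow2_ge_0 r). lra. }
    nra.
  - assert (0 < ga) by nra.
    assert (al * ga <= 2 * A * (2 * Cc)) by (apply Rmult_le_compat; lra). lra.
Qed.

(** ** The gradient near a point of affinity of the boundary values *)

Lemma near_edge_coords i s z : (i < n)%nat -> exists x y, z = pt i x y /\
  Rabs (x - s) * Cmod (tau i) <= Cmod (z - edge i s) /\ Rabs y * Cmod (tau i) <= Cmod (z - edge i s).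
Proof.
  intros Hi. destruct (frame_surj n v Hpoly i z Hi) as [x [y [Hz Hx]]]. exists x, y. split; [auto|]. split; [apply Hx|].
  pose proof (side_neq0 n v Hpoly i Hi) as Ht.
  apply Rmult_le_reg_r with (Cmod (tau i)); [auto|].
  replace (Rabs y * Cmod (tau i) * Cmod (tau i)) with (Rabs (ht i z - ht i (edge i s))).
  - rewrite Rmult_comm. apply height_lip.
  - rewrite height_edge_self, Rminus_0_r, Hz, height_pt, Rabs_mult, (Rabs_pos_eq (Cmod (tau i) ^ 2)) by (apply pow_le; lra). ring.
Qed.

Lemma interior_coords i s z eta : (i < n)%nat -> 0 < eta -> N0 z -> Cmod (z - edge i s) < eta * Cmod (tau i) ->
  exists x y, z = pt i x y /\ Rabs (x - s) < eta /\ 0 < y < eta.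
Proof.
  intros Hi He Hz Hd. destruct (near_edge_coords i s z Hi) as [x [y [E [Hx Hy]]]].
  pose proof (side_neq0 n v Hpoly i Hi) as Ht. exists x, y. split; [auto|].
  assert (Hk : 0 < ht i z) by (apply Hz; auto). rewrite E, height_pt in Hk.
  assert (0 < Cmod (tau i) ^ 2) by (apply pow_lt; auto).
  assert (Hy0 : 0 < y) by (apply Rnot_le_lt; intros Hle; nra).
  rewrite (Rabs_pos_eq y) in Hy by lra.
  split; [|split; [auto|]]; apply Rmult_lt_reg_r with (Cmod (tau i)); lra.
Qed.

(** Convexity puts the tangential derivative at [z] between the difference quotients over steps [d]
    and [-d] parallel to the edge; with [d] fixed these tend to [b], by continuity of [sigma] up to
    the edge. *)
Lemma tangential_slope i s b : good i s b -> forall eps, 0 < eps -> exists del, 0 < del /\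
  forall z, N0 z -> Cmod (z - edge i s) < del -> Rabs (dot (grad z) (tau i) - b) < eps.
Proof.
  intros Hg eps He. destruct (good_range _ _ _ Hg) as [Hi Hs].
  destruct (good_box _ _ _ Hg) as [eta [Heta [HN Haff]]]. pose proof (side_neq0 n v Hpoly i Hi) as Ht.
  set (d := eta / 2).
  assert (Hed : 0 < eps * d / 4) by (unfold d; nra).
  assert (HNs : forall c, Rabs c <= eta -> N (edge i (s + c))).
  { intros c Hc. rewrite <- (frame_0 n v). apply HN; [replace (s + c - s) with c by ring; auto|lra]. }
  destruct (sigma_cont (edge i (s + 0)) (HNs 0 ltac:(rewrite Rabs_R0; lra)) _ Hed) as [d0 [Hd0 C0]].
  destruct (sigma_cont (edge i (s + d)) (HNs d ltac:(rewrite Rabs_pos_eq; unfold d; lra)) _ Hed) as [d1 [Hd1 C1]].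
  destruct (sigma_cont (edge i (s + - d)) (HNs (- d) ltac:(rewrite Rabs_Ropp, Rabs_pos_eq; unfold d; lra)) _ Hed) as [d2 [Hd2 C2]].
  set (del := Rmin (d * Cmod (tau i)) (Rmin d0 (Rmin d1 d2))).
  assert (D1 : del <= d * Cmod (tau i)) by apply Rmin_l.
  assert (D2 : del <= d0) by (eapply Rle_trans; [apply Rmin_r|apply Rmin_l]).
  assert (D3 : del <= d1) by (eapply Rle_trans; [apply Rmin_r|eapply Rle_trans; [apply Rmin_r|apply Rmin_l]]).
  assert (D4 : del <= d2) by (eapply Rle_trans; [apply Rmin_r|eapply Rle_trans; [apply Rmin_r|apply Rmin_r]]).
  exists del. split.
  { repeat apply Rmin_pos; auto. unfold d. nra. }
  intros z Hz Hzd. destruct (interior_coords i s z d Hi ltac:(unfold d; lra) Hz ltac:(lra)) as [x [y [E [Hx Hy]]]].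
  assert (Sh : forall c, (z + RtoC c * tau i)%C = pt i (x + c) y).
  { intros c. rewrite E. unfold frame. rewrite !edge_side, RtoC_plus. ring. }
  assert (ShN : forall c, Rabs c <= d -> N (z + RtoC c * tau i)%C).
  { intros c Hc. rewrite Sh. apply HN; [|unfold d in *; lra].
    replace (x + c - s) with ((x - s) + c) by ring. eapply Rle_trans; [apply Rabs_triang|]. unfold d in *; lra. }
  assert (ShD : forall c, (z + RtoC c * tau i - edge i (s + c))%C = (z - edge i s)%C).
  { intros c. rewrite !edge_side, RtoC_plus. ring. }
  assert (Up : forall c, Rabs c <= d -> c * dot (grad z) (tau i) <= sigma (z + RtoC c * tau i)%C - sigma z).
  { intros c Hc. pose proof (grad_ineq z _ Hz (ShN c Hc)) as HG.
    replace (z + RtoC c * tau i - z)%C with (RtoC c * tau i)%C in HG by ring. rewrite dot_scal_r in HG. lra. }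
  pose proof (Up d ltac:(rewrite Rabs_pos_eq; unfold d; lra)) as U1.
  pose proof (Up (- d) ltac:(rewrite Rabs_Ropp, Rabs_pos_eq; unfold d; lra)) as U2.
  specialize (C0 z (polyInt_N n v z Hz)). rewrite Rplus_0_r in C0. specialize (C0 ltac:(lra)).
  specialize (C1 _ (ShN d ltac:(rewrite Rabs_pos_eq; unfold d; lra))). rewrite ShD in C1. specialize (C1 ltac:(lra)).
  specialize (C2 _ (ShN (- d) ltac:(rewrite Rabs_Ropp, Rabs_pos_eq; unfold d; lra))). rewrite ShD in C2. specialize (C2 ltac:(lra)).
  destruct (Haff (s + d)) as [_ A1]. { replace (s + d - s) with d by ring. rewrite Rabs_pos_eq; unfold d; lra. }
  destruct (Haff (s + - d)) as [_ A2]. { replace (s + - d - s) with (- d) by ring. rewrite Rabs_Ropp, Rabs_pos_eq; unfold d; lra. }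
  rewrite A1 in C1. rewrite A2 in C2.
  apply Rabs_def2 in C0. apply Rabs_def2 in C1. apply Rabs_def2 in C2.
  assert (0 < d) by (unfold d; lra).
  set (g := dot (grad z) (tau i)) in *.
  apply Rabs_def1; apply Rmult_lt_reg_l with d; auto; nra.
Qed.

(** The gradient inequality over one fixed step [t] along the inward normal carries the infinite
    slope at the boundary point over to the gradients at all nearby interior points. *)
Lemma normal_slope i s b : good i s b -> forall K, exists del, 0 < del /\
  forall z, N0 z -> Cmod (z - edge i s) < del -> dot (grad z) (Ci * tau i) < - K.
Proof.
  intros Hg K. destruct (good_range _ _ _ Hg) as [Hi Hs].
  destruct (good_box _ _ _ Hg) as [eta [Heta [HN Haff]]]. pose proof (side_neq0 n v Hpoly i Hi) as Ht.
  (* The two moduli of continuity below cost [t / 2] each, so slope [-(K + 2)] at the boundary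
     leaves less than [-K] at [z]. *)
  destruct (infinite_slope i s b Hg (K + 2)) as [t0 [Ht0 Hinf]].
  set (t := Rmin t0 (eta / 2)). assert (Htp : 0 < t) by (apply Rmin_pos; lra).
  assert (T1 : t <= t0) by apply Rmin_l. assert (T2 : t <= eta / 2) by apply Rmin_r.
  specialize (Hinf t ltac:(lra)).
  assert (Hss : Rabs (s - s) <= eta) by (rewrite Rminus_diag, Rabs_R0; lra).
  destruct (sigma_cont (pt i s t) (proj1 (HN s t Hss ltac:(lra))) (t / 2) ltac:(lra)) as [d1 [Hd1 C1]].
  destruct (sigma_cont (edge i s) (edge_N n v Hpoly i s Hi ltac:(lra)) (t / 2) ltac:(lra)) as [d2 [Hd2 C2]].
  exists (Rmin (eta / 2 * Cmod (tau i)) (Rmin d1 d2)). split.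
  { repeat apply Rmin_pos; auto. nra. }
  intros z Hz Hd.
  pose proof (Rmin_l (eta / 2 * Cmod (tau i)) (Rmin d1 d2)) as D1.
  pose proof (Rle_trans _ _ _ (Rmin_r (eta / 2 * Cmod (tau i)) (Rmin d1 d2)) (Rmin_l d1 d2)) as D2.
  pose proof (Rle_trans _ _ _ (Rmin_r (eta / 2 * Cmod (tau i)) (Rmin d1 d2)) (Rmin_r d1 d2)) as D3.
  destruct (interior_coords i s z (eta / 2) Hi ltac:(lra) Hz ltac:(lra)) as [x [y [E [Hx Hy]]]].
  assert (Sh : (z + RtoC t * (Ci * tau i))%C = pt i x (y + t)) by (rewrite E; unfold frame; rewrite RtoC_plus; ring).
  assert (ShN : N (z + RtoC t * (Ci * tau i))%C) by (rewrite Sh; apply HN; lra).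
  pose proof (grad_ineq z _ Hz ShN) as HG.
  replace (z + RtoC t * (Ci * tau i) - z)%C with (RtoC t * (Ci * tau i))%C in HG by ring. rewrite dot_scal_r in HG.
  specialize (C1 _ ShN). replace (z + RtoC t * (Ci * tau i) - pt i s t)%C with (z - edge i s)%C in C1 by (unfold frame; ring).
  specialize (C1 ltac:(lra)). specialize (C2 z (polyInt_N n v z Hz) ltac:(lra)).
  apply Rabs_def2 in C1. apply Rabs_def2 in C2.
  apply Rmult_lt_reg_l with t; auto. nra.
Qed.

(** ** Inverting the Lewy transform by minimisation *)

(** A strictly convex energy whose critical points are the solutions of [lewy sigma z = w]:
    inverting the Lewy transform amounts to showing that a minimiser is interior. *)
Definition Phi (w z : C) : R := Cmod z ^ 2 / 2 + sigma z - dot w z.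
Definition is_min (w z : C) : Prop := N z /\ forall u, N u -> Phi w z <= Phi w u.

Lemma Cmod_sqr_dot (z h : C) : Cmod (z + h) ^ 2 = Cmod z ^ 2 + 2 * dot z h + Cmod h ^ 2.
Proof. rewrite !Cmod_sqr. unfold dot. simpl. ring. Qed.

Lemma Phi_shift w z h : Phi w (z + h)%C - Phi w z = dot z h + Cmod h ^ 2 / 2 - dot w h + (sigma (z + h)%C - sigma z).
Proof.
  unfold Phi. rewrite Cmod_sqr_dot. replace (dot w (z + h)%C) with (dot w z + dot w h) by (unfold dot; simpl; ring).
  field.
Qed.

Lemma min_exists (z0 w : C) : N z0 -> exists z, is_min w z.
Proof.
  intros Hz0. destruct (polyN_bounded n v Hpoly) as [M HM].
  destruct (extreme_value N (Phi w) M z0 Hz0 HM (polyN_closed n v)) as [z [Hz Hmin]].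
  - intros z Hz e He. pose proof (Cmod_ge_0 z). pose proof (Cmod_ge_0 w).
    destruct (sigma_cont z Hz (e / 2)) as [d [Hd H1]]; [lra|].
    set (K := Cmod z + Cmod w + 1).
    assert (HK : 0 < e / (2 * K)) by (apply Rdiv_lt_0_compat; unfold K; lra).
    exists (Rmin (Rmin 1 d) (e / (2 * K))). split; [repeat apply Rmin_pos; lra|]. intros u Hu Hd'.
    assert (D1 : Cmod (u - z) < 1) by (eapply Rlt_le_trans; [exact Hd'|]; eapply Rle_trans; [apply Rmin_l|apply Rmin_l]).
    assert (D2 : Cmod (u - z) < d) by (eapply Rlt_le_trans; [exact Hd'|]; eapply Rle_trans; [apply Rmin_l|apply Rmin_r]).
    assert (D3 : Cmod (u - z) < e / (2 * K)) by (eapply Rlt_le_trans; [exact Hd'|apply Rmin_r]).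
    specialize (H1 u Hu D2). set (h := (u - z)%C) in *.
    assert (Eu : u = (z + h)%C) by (unfold h; ring).
    assert (E : Phi w u - Phi w z = dot z h + Cmod h ^ 2 / 2 - dot w h + (sigma u - sigma z)).
    { rewrite Eu. apply Phi_shift. }
    rewrite E. pose proof (dot_le z h) as A1. pose proof (dot_le w h) as A2. pose proof (Cmod_ge_0 h).
    apply Rabs_le_between in A1. apply Rabs_le_between in A2. apply Rabs_def2 in H1.
    assert (K * Cmod h < e / 2).
    { apply Rlt_le_trans with (K * (e / (2 * K))); [apply Rmult_lt_compat_l; unfold K in *; lra|right; field; unfold K; lra]. }
    assert (Cmod h ^ 2 <= Cmod h) by nra. unfold K in *. apply Rabs_def1; nra.
  - exists z. split; auto.
Qed.

Lemma min_interior w z : is_min w z -> N0 z -> lewy sigma z = w.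
Proof.
  intros [_ Hmin] Hz. set (d := (w - z - grad z)%C).
  destruct (Req_dec (Cmod d) 0) as [E|E].
  { apply Cmod_eq_0 in E. rewrite lewy_grad. replace w with (z + grad z + d)%C by (unfold d; ring). rewrite E. ring. }
  exfalso. pose proof (Cmod_ge_0 d) as Hd0. assert (Hd : 0 < Cmod d) by lra.
  destruct (polyInt_open n v z Hz) as [r [Hr HB]].
  destruct (sigma_diff z Hz (Cmod d / 4)) as [d1 [Hd1 H]]; [lra|].
  destruct (small_step (Rmin r d1) (Cmod d)) as [t0 [Ht0 Ht0d]]; [apply Rmin_pos; auto|auto|].
  set (t := t0 / 2). assert (Ht : 0 < t <= 1 / 2) by (unfold t; lra).
  pose proof (Rmin_l r d1). pose proof (Rmin_r r d1).
  assert (Hm : Cmod (z + RtoC t * d - z) = t * Cmod d).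
  { replace (z + RtoC t * d - z)%C with (RtoC t * d)%C by ring. rewrite Cmod_scal_R, Rabs_pos_eq; lra. }
  assert (Hm2 : t * Cmod d < Rmin r d1) by (unfold t; nra).
  specialize (H (z + RtoC t * d)%C). rewrite Hm in H. specialize (H ltac:(lra)).
  assert (HNu : N (z + RtoC t * d)%C) by (apply polyInt_N, HB; rewrite Hm; lra).
  specialize (Hmin _ HNu). unfold Phi in Hmin. rewrite Cmod_sqr_dot, dot_scal_r, Cmod_scal_R, Rabs_pos_eq in Hmin by lra.
  apply Rabs_le_between in H. destruct H as [_ H].
  assert (E1 : dx sigma z * (fst (z + RtoC t * d)%C - fst z) + dy sigma z * (snd (z + RtoC t * d)%C - snd z) = t * dot (grad z) d)
    by (unfold dot, gradient; simpl; ring).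
  assert (E2 : dot w (z + RtoC t * d)%C = dot w z + t * dot w d) by (unfold dot; simpl; ring).
  assert (E3 : dot w d - dot z d - dot (grad z) d = Cmod d ^ 2) by (rewrite <- dot_self; unfold d, dot; simpl; ring).
  assert (t * (dot w d - dot z d - dot (grad z) d) <= t * (3 / 4 * Cmod d ^ 2)) by nra.
  rewrite E3 in H2. assert (0 < t * Cmod d ^ 2) by (apply Rmult_lt_0_compat; [lra|apply pow_lt; auto]). lra.
Qed.

(** The other terms of [Phi w] have a finite derivative along the inward normal, and the infinite
    slope of [sigma] beats it: moving inwards lowers the energy. *)
Lemma min_not_good w i s b : good i s b -> ~ is_min w (edge i s).
Proof.
  intros Hg [_ Hmin]. destruct (good_range _ _ _ Hg) as [Hi Hs].
  destruct (good_box _ _ _ Hg) as [eta [Heta [HN _]]].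
  set (nu := (Ci * tau i)%C).
  set (K := dot (edge i s) nu - dot w nu + Cmod nu ^ 2 + 1).
  destruct (infinite_slope i s b Hg K) as [t0 [Ht0 Hinf]].
  set (t := Rmin 1 (Rmin t0 eta)). assert (Ht : 0 < t) by (repeat apply Rmin_pos; lra).
  assert (T1 : t <= 1) by apply Rmin_l.
  assert (T2 : t <= t0) by (eapply Rle_trans; [apply Rmin_r|apply Rmin_l]).
  assert (T3 : t <= eta) by (eapply Rle_trans; [apply Rmin_r|apply Rmin_r]).
  specialize (Hinf t ltac:(lra)).
  assert (HNp : N (pt i s t)) by (apply HN; [rewrite Rminus_diag, Rabs_R0|]; lra).
  specialize (Hmin _ HNp). pose proof (Phi_shift w (edge i s) (RtoC t * nu)%C) as HP.
  change (edge i s + RtoC t * nu)%C with (pt i s t) in HP.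
  rewrite !dot_scal_r, Cmod_scal_R, Rabs_pos_eq in HP by lra.
  pose proof (pow2_ge_0 (Cmod nu)). unfold K in Hinf. nra.
Qed.

Lemma near_good i s b eta : good i s b -> 0 < eta -> exists rho, 0 < rho /\
  forall z, N z -> Cmod (z - edge i s) < rho -> N0 z \/ exists s', Rabs (s' - s) < eta /\ z = edge i s' /\ good i s' b.
Proof.
  intros Hg Heta. destruct (good_range _ _ _ Hg) as [Hi Hs].
  destruct (edge_nbhd n v Hpoly i s Hi Hs) as [r [Hr Hnb]].
  destruct (good_open _ _ _ Hg) as [e2 [He2 H2]]. pose proof (side_neq0 n v Hpoly i Hi) as Ht.
  set (e := Rmin eta e2). assert (He : 0 < e) by (apply Rmin_pos; auto).
  exists (Rmin r (e * Cmod (tau i))). split; [apply Rmin_pos; auto; nra|]. intros z Hz Hd.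
  pose proof (Rmin_l r (e * Cmod (tau i))). pose proof (Rmin_r r (e * Cmod (tau i))).
  destruct (Rle_lt_dec (ht i z) 0) as [Hk|Hk].
  - right. destruct (near_edge_coords i s z Hi) as [x [y [E [Hx Hy]]]].
    assert (Hk0 : ht i z = 0) by (apply Rle_antisym; [auto|apply Hz; auto]).
    assert (Hy0 : y = 0).
    { rewrite E, height_pt in Hk0. apply Rmult_integral in Hk0. destruct Hk0 as [|Hk0]; [auto|].
      exfalso. apply (pow_nonzero (Cmod (tau i)) 2) in Hk0; [auto|lra]. }
    rewrite Hy0, (frame_0 n v) in E.
    assert (Hxe : Rabs (x - s) < e) by (apply Rmult_lt_reg_r with (Cmod (tau i)); lra).
    pose proof (Rmin_l eta e2). pose proof (Rmin_r eta e2).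
    exists x. repeat split; auto; [unfold e in *; lra|]. apply H2. unfold e in *; lra.
  - left. intros j Hj. change (0 < ht j z). destruct (Nat.eq_dec j i) as [->|Hne]; [auto|].
    apply Hnb; auto. lra.
Qed.

(** Strong convexity from the term [|z|^2 / 2]: comparing [u = z + h] with [z] gives
    [|h|^2 / 2 <= dot (w' - lewy sigma z) h]. *)
Lemma min_near_point w' z u : N0 z -> is_min w' u -> Cmod (u - z) <= 2 * Cmod (w' - lewy sigma z).
Proof.
  intros Hz [Nu Hmin]. specialize (Hmin z (polyInt_N n v z Hz)).
  pose proof (grad_ineq z u Hz Nu) as HG. set (h := (u - z)%C) in *.
  assert (Eu : u = (z + h)%C) by (unfold h; ring).
  pose proof (Phi_shift w' z h) as HP. rewrite <- Eu in HP.
  assert (E : dot w' h - dot z h - dot (grad z) h = dot (w' - lewy sigma z) h).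
  { rewrite lewy_grad. unfold dot. simpl. ring. }
  pose proof (dot_le (w' - lewy sigma z) h) as A. apply Rabs_le_between in A.
  pose proof (Cmod_ge_0 h). pose proof (Cmod_ge_0 (w' - lewy sigma z)).
  destruct (Req_dec (Cmod h) 0) as [E0|E0]; [lra|].
  apply Rmult_le_reg_r with (Cmod h); nra.
Qed.

Definition inW (w : C) : Prop := exists z, N0 z /\ lewy sigma z = w.

(** The radius is uniform as [z] approaches the boundary point, although [lewy sigma z] goes to
    infinity; it is the scale on which Borel-Caratheodory is applied to the inverse Riemann map.
    With [rho / 3], the minimiser stays within [rho] of the boundary point, where it cannot sit on
    the edge. *)
Lemma lewy_ball i s b : good i s b -> exists rho, 0 < rho /\
  forall z, N0 z -> Cmod (z - edge i s) < rho -> forall w', Cmod (w' - lewy sigma z) < rho -> inW w'.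
Proof.
  intros Hg. destruct (near_good i s b 1 Hg ltac:(lra)) as [rho [Hrho H]].
  exists (rho / 3). split; [lra|]. intros z Hz Hzd w' Hw'.
  destruct (min_exists z w' (polyInt_N n v z Hz)) as [u Hu].
  pose proof (min_near_point w' z u Hz Hu) as Hd.
  pose proof (Cmod_dist_triangle u z (edge i s)) as T.
  destruct (H u (proj1 Hu) ltac:(lra)) as [Hint|[s' [_ [E Hg']]]].
  - exists u. split; [auto|]. apply min_interior; auto.
  - exfalso. rewrite E in Hu. apply (min_not_good w' i s' b Hg' Hu).
Qed.

(** ** The vertical path in the Lewy domain landing at a boundary point *)

(** The value that the Lewy transform would take at [edge i s] if the gradient there had the correct
    tangential component [b] and pairing [- T |tau i|^2] with the inward normal [Ci * tau i]. *)
Definition wpath (i : nat) (s b T : R) : C :=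
  (edge i s + RtoC (b / Cmod (tau i) ^ 2) * tau i - RtoC T * (Ci * tau i))%C.

Lemma wpath_Phi i s b T u z : Phi (wpath i s b T) z - Phi (wpath i s b T) u =
  Phi (wpath i s b 0) z - Phi (wpath i s b 0) u + T * (ht i z - ht i u).
Proof.
  rewrite <- dot_height. unfold Phi, wpath. unfold dot. simpl. ring.
Qed.

Lemma edge_sigma_lower i s b x : good i s b -> N (edge i x) -> sigma (edge i s) + b * (x - s) <= sigma (edge i x).
Proof.
  intros Hg Hx. destruct (good_range _ _ _ Hg) as [Hi Hs]. destruct Hg as [_ [eta [He H]]].
  destruct (small_step eta (Rabs (x - s)) He (Rabs_pos _)) as [t [Ht Htd]].
  destruct (H (s + t * (x - s))) as [_ E].
  { replace (s + t * (x - s) - s) with (t * (x - s)) by ring. rewrite Rabs_mult, (Rabs_pos_eq t) by lra. auto. }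
  pose proof (Hsconv (edge i x) (edge i s) t Hx (edge_N n v Hpoly i s Hi ltac:(lra)) ltac:(lra)) as HC.
  replace (RtoC t * edge i x + RtoC (1 - t) * edge i s)%C with (edge i (s + t * (x - s))) in HC.
  2:{ rewrite !edge_side, !RtoC_plus, RtoC_mult, !RtoC_minus. ring. }
  rewrite E in HC. apply Rmult_le_reg_l with t; [lra|]. lra.
Qed.

(** The vector [wpath i s b 0] is tuned so that its pairing cancels the first-order terms along the
    edge; convexity of [sigma] and the quadratic term make [edge i s] the only minimiser on the
    whole edge. *)
Lemma Phi_edge_lower i s b x : good i s b -> N (edge i x) ->
  Phi (wpath i s b 0) (edge i s) + Cmod (edge i x - edge i s) ^ 2 / 2 <= Phi (wpath i s b 0) (edge i x).
Proof.
  intros Hg Hx. destruct (good_range _ _ _ Hg) as [Hi _]. pose proof (edge_sigma_lower i s b x Hg Hx) as HL.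
  pose proof (side_neq0 n v Hpoly i Hi) as Ht.
  set (h := (edge i x - edge i s)%C).
  assert (Eh : h = (RtoC (x - s) * tau i)%C) by (unfold h; rewrite !edge_side, RtoC_minus; ring).
  assert (Ex : edge i x = (edge i s + h)%C) by (unfold h; ring).
  pose proof (Phi_shift (wpath i s b 0) (edge i s) h) as HP. rewrite <- Ex in HP.
  assert (E : dot (wpath i s b 0) h = dot (edge i s) h + b * (x - s)).
  { transitivity (dot (edge i s) h + (x - s) * (b / Cmod (tau i) ^ 2) * Cmod (tau i) ^ 2).
    - unfold wpath. set (c := b / Cmod (tau i) ^ 2). rewrite Eh, (Cmod_sqr (tau i)).
      generalize (edge i s) (tau i). intros e t. unfold dot. simpl. ring.
    - field. lra. }
  rewrite E in HP. lra.
Qed.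

(** By [wpath_Phi], the parameter [T] acts as a penalty on the height: [T * ht i z] is at most the
    fixed gap [D]. Minimisers for large [T] thus accumulate on the edge, at points whose energy [P0]
    does not exceed that of [edge i s], and [Phi_edge_lower] leaves only [edge i s]. *)
Lemma wpath_min_near i s b : good i s b -> forall eps, 0 < eps -> exists T0, 0 < T0 /\
  forall T z, T0 <= T -> is_min (wpath i s b T) z -> Cmod (z - edge i s) < eps.
Proof.
  intros Hg eps He. destruct (good_range _ _ _ Hg) as [Hi Hs].
  assert (Ne : N (edge i s)) by (apply edge_N; auto; lra).
  destruct (min_exists _ (wpath i s b 0) Ne) as [z1 [Nz1 Hz1]].
  destruct (polyN_bounded n v Hpoly) as [M HM].
  destruct (classic (exists T0, 0 < T0 /\ forall T z, T0 <= T -> is_min (wpath i s b T) z -> Cmod (z - edge i s) < eps))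
    as [|Hno]; [auto|exfalso].
  set (P0 := Phi (wpath i s b 0)) in *. set (D := P0 (edge i s) - P0 z1).
  assert (Hmin : forall T z, is_min (wpath i s b T) z -> P0 z + T * ht i z <= P0 (edge i s)).
  { intros T z [Nz Hz]. specialize (Hz _ Ne). pose proof (wpath_Phi i s b T (edge i s) z) as E.
    rewrite height_edge_self in E. fold P0 in E. lra. }
  destruct (cluster_point (fun k z => N z /\ eps <= Cmod (z - edge i s) /\ P0 z <= P0 (edge i s) /\
     (INR k + 1) * ht i z <= D) M) as [l Hl].
  { intros k. apply not_all_not_ex. intros Hall. apply Hno. exists (INR k + 1). pose proof (pos_INR k).
    split; [lra|]. intros T z HT Hz. apply Rnot_le_lt. intros Hle. apply (Hall z). pose proof Hz as [Nz _].
    pose proof (Hmin T z Hz) as H1. pose proof (Hz1 z Nz) as H2. fold P0 in H2.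
    assert (Hk : 0 <= ht i z) by (apply Nz; auto).
    repeat split; auto; unfold D; nra. }
  assert (Nl : N l).
  { apply polyN_closed. intros e' He'. destruct (Hl e' He' 0%nat) as [k [z [_ [[Nz _] Hz]]]]. exists z; auto. }
  assert (Hlk : ht i l = 0).
  { apply Rle_antisym; [|apply Nl; auto]. apply le_epsilon. intros e' He'. rewrite Rplus_0_l.
    assert (HD : 0 <= D) by (unfold D; pose proof (Hz1 _ Ne) as HH; fold P0 in HH; lra).
    destruct (height_cont n v i l (e' / 2)) as [d [Hd Hc]]; [lra|].
    destruct (inv_nat_small (e' / (2 * (D + 1)))) as [k0 Hk0]; [apply Rdiv_lt_0_compat; lra|].
    destruct (Hl d Hd k0) as [k [z [Hk [[Nz [_ [_ Hkz]]] Hz]]]].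
    specialize (Hc z Hz). apply Rabs_def2 in Hc. specialize (Hk0 k Hk).
    pose proof (pos_INR k).
    assert (ht i z <= D * / (INR k + 1)).
    { apply Rmult_le_reg_l with (INR k + 1); [lra|]. replace ((INR k + 1) * (D * / (INR k + 1))) with D by (field; lra). auto. }
    assert (D * / (INR k + 1) <= (D + 1) * (e' / (2 * (D + 1)))).
    { apply Rmult_le_compat; try lra. left. apply Rinv_0_lt_compat; lra. }
    replace ((D + 1) * (e' / (2 * (D + 1)))) with (e' / 2) in H1 by (field; lra). lra. }
  destruct (near_edge_coords i s l Hi) as [x [y [E _]]].
  assert (Hy0 : y = 0).
  { rewrite E, height_pt in Hlk. pose proof (side_neq0 n v Hpoly i Hi). apply Rmult_integral in Hlk. destruct Hlk as [|Hk0]; [auto|].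
    exfalso. apply (pow_nonzero (Cmod (tau i)) 2) in Hk0; [auto|lra]. }
  rewrite Hy0, (frame_0 n v) in E. rewrite E in *. clear E Hy0 y.
  pose proof (Phi_edge_lower i s b x Hg Nl) as HL. fold P0 in HL.
  assert (Hdl : eps <= Cmod (edge i x - edge i s)).
  { apply le_epsilon. intros e' He'. destruct (Hl e' He' 0%nat) as [k [z [_ [[Nz [Hz _]] Hzl]]]].
    pose proof (Cmod_dist_triangle z (edge i x) (edge i s)). lra. }
  assert (HPl : P0 (edge i x) <= P0 (edge i s)).
  { apply le_epsilon. intros e' He'.
    set (W := wpath i s b 0) in *.
    assert (Hcont : exists d, 0 < d /\ forall u, N u -> Cmod (u - edge i x) < d -> Rabs (P0 u - P0 (edge i x)) < e').
    { destruct (sigma_cont (edge i x) Nl (e' / 2)) as [d [Hd H1]]; [lra|].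
      set (K := Cmod (edge i x) + Cmod W + 1). pose proof (Cmod_ge_0 (edge i x)). pose proof (Cmod_ge_0 W).
      assert (HK : 0 < e' / (2 * K)) by (apply Rdiv_lt_0_compat; unfold K; lra).
      exists (Rmin (Rmin 1 d) (e' / (2 * K))). split; [repeat apply Rmin_pos; lra|]. intros u Hu Hd'.
      assert (D1 : Cmod (u - edge i x) < 1) by (eapply Rlt_le_trans; [exact Hd'|]; eapply Rle_trans; [apply Rmin_l|apply Rmin_l]).
      assert (D2 : Cmod (u - edge i x) < d) by (eapply Rlt_le_trans; [exact Hd'|]; eapply Rle_trans; [apply Rmin_l|apply Rmin_r]).
      assert (D3 : Cmod (u - edge i x) < e' / (2 * K)) by (eapply Rlt_le_trans; [exact Hd'|apply Rmin_r]).
      specialize (H1 u Hu D2). set (h := (u - edge i x)%C) in *.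
      assert (Eu : u = (edge i x + h)%C) by (unfold h; ring).
      assert (E : P0 u - P0 (edge i x) = dot (edge i x) h + Cmod h ^ 2 / 2 - dot W h + (sigma u - sigma (edge i x))).
      { rewrite Eu. apply Phi_shift. }
      rewrite E. pose proof (dot_le (edge i x) h) as A1. pose proof (dot_le W h) as A2. pose proof (Cmod_ge_0 h).
      apply Rabs_le_between in A1. apply Rabs_le_between in A2. apply Rabs_def2 in H1.
      assert (K * Cmod h < e' / 2).
      { apply Rlt_le_trans with (K * (e' / (2 * K))); [apply Rmult_lt_compat_l; unfold K in *; lra|right; field; unfold K; lra]. }
      assert (Cmod h ^ 2 <= Cmod h) by nra. unfold K in *. apply Rabs_def1; nra. }
    destruct Hcont as [d [Hd Hc]]. destruct (Hl d Hd 0%nat) as [k [z [_ [[Nz [_ [Hz _]]] Hzl]]]].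
    specialize (Hc z Nz Hzl). apply Rabs_def2 in Hc. lra. }
  assert (0 < Cmod (edge i x - edge i s) ^ 2) by (apply pow_lt; lra). lra.
Qed.

Lemma wpath_inverse i s b : good i s b -> forall eps, 0 < eps -> exists T0, 0 < T0 /\
  forall T, T0 <= T -> exists z, N0 z /\ lewy sigma z = wpath i s b T /\ is_min (wpath i s b T) z /\ Cmod (z - edge i s) < eps.
Proof.
  intros Hg eps He. destruct (good_range _ _ _ Hg) as [Hi Hs].
  destruct (near_good i s b 1 Hg ltac:(lra)) as [rho [Hrho H]].
  destruct (wpath_min_near i s b Hg (Rmin eps rho)) as [T0 [HT0 HT]]; [apply Rmin_pos; auto|].
  pose proof (Rmin_l eps rho). pose proof (Rmin_r eps rho).
  exists T0. split; [auto|]. intros T HTT.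
  destruct (min_exists (edge i s) (wpath i s b T)) as [z Hz]; [apply edge_N; auto; lra|].
  specialize (HT T z HTT Hz).
  destruct (H z (proj1 Hz) ltac:(lra)) as [Hint|[s' [_ [E Hg']]]].
  - exists z. repeat split; auto; try apply Hz; [apply min_interior; auto|lra].
  - exfalso. rewrite E in Hz. apply (min_not_good _ i s' b Hg' Hz).
Qed.

(** ** The harmonic parametrisation *)

Variables (psi U : C -> C).
Hypothesis Hpsihol : hol 1 psi.
Hypothesis Hpsiin : forall z, Cmod z < 1 -> inW (psi z).
Hypothesis Hpsiinj : forall z1 z2, Cmod z1 < 1 -> Cmod z2 < 1 -> psi z1 = psi z2 -> z1 = z2.
Hypothesis Hpsisurj : forall w, N0 w -> exists z, Cmod z < 1 /\ psi z = lewy sigma w.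
Hypothesis HU : forall z, Cmod z < 1 -> N0 (U z) /\ lewy sigma (U z) = psi z.

Definition psi_inv (w : C) : C := epsilon (inhabits (RtoC 0)) (fun z => Cmod z < 1 /\ psi z = w).
Definition V (z : C) : C := psi_inv (lewy sigma z).

Lemma psi_inv_spec w : inW w -> Cmod (psi_inv w) < 1 /\ psi (psi_inv w) = w.
Proof.
  intros [z [Hz Hw]]. unfold psi_inv. apply epsilon_spec. destruct (Hpsisurj z Hz) as [y [Hy E]].
  exists y. split; [auto|congruence].
Qed.

Lemma psi_inv_psi z : Cmod z < 1 -> psi_inv (psi z) = z.
Proof. intros Hz. destruct (psi_inv_spec (psi z) (Hpsiin z Hz)). apply Hpsiinj; auto. Qed.

Lemma psi_inv_der w : inW w -> exists l, cder psi_inv w l.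
Proof.
  intros Hw. destruct (psi_inv_spec w Hw) as [H1 H2]. exists (/ cderiv psi (psi_inv w))%C.
  rewrite <- H2 at 1. apply univalent_inverse_der; auto using psi_inv_psi.
Qed.

Lemma inW_lewy z : N0 z -> inW (lewy sigma z).
Proof. intros H. exists z; auto. Qed.

Lemma lewy_injective z z' : N0 z -> N0 z' -> lewy sigma z = lewy sigma z' -> z = z'.
Proof.
  apply (lewy_inj N N0 sigma); auto using polyInt_N. intros; apply polyInt_open; auto.
Qed.

Lemma V_spec z : N0 z -> Cmod (V z) < 1 /\ psi (V z) = lewy sigma z /\ U (V z) = z.
Proof.
  intros Hz. destruct (psi_inv_spec _ (inW_lewy z Hz)) as [H1 H2]. repeat split; auto.
  destruct (HU _ H1) as [A B]. apply lewy_injective; auto. unfold V. congruence.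
Qed.

Lemma V_U zeta : Cmod zeta < 1 -> V (U zeta) = zeta.
Proof. intros H. unfold V. rewrite (proj2 (HU zeta H)). apply psi_inv_psi; auto. Qed.

Lemma lewy_cont z : N0 z -> forall eps, 0 < eps -> exists del, 0 < del /\
  forall u, Cmod (u - z) < del -> Cmod (lewy sigma u - lewy sigma z) < eps.
Proof.
  intros Hz e He. destruct (gradient_diff z Hz 1 ltac:(lra)) as [d [Hd H]].
  set (K := Rabs (dx (dx sigma) z) + 2 * Rabs (dy (dx sigma) z) + Rabs (dy (dy sigma) z)).
  assert (HK : 0 <= K) by (unfold K; repeat apply Rplus_le_le_0_compat; try apply Rmult_le_pos; try apply Rabs_pos; lra).
  exists (Rmin d (e / (K + 2 + 1))). split; [apply Rmin_pos; auto; apply Rdiv_lt_0_compat; lra|]. intros u Hu.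
  pose proof (Rmin_l d (e / (K + 2 + 1))). pose proof (Rmin_r d (e / (K + 2 + 1))).
  specialize (H u ltac:(lra)). set (h := (u - z)%C) in *.
  assert (Hh : Cmod (hess z h) <= K * Cmod h).
  { eapply Rle_trans; [apply Cmod_le_sum|]. unfold hessian. cbn [fst snd].
    pose proof (fst_le_Cmod h). pose proof (snd_le_Cmod h).
    eapply Rle_trans; [apply Rplus_le_compat; apply Rabs_triang|]. rewrite !Rabs_mult.
    pose proof (Rabs_pos (dx (dx sigma) z)). pose proof (Rabs_pos (dy (dx sigma) z)). pose proof (Rabs_pos (dy (dy sigma) z)).
    unfold K. nra. }
  rewrite !lewy_grad. replace (u + grad u - (z + grad z))%C with (h + ((grad u - grad z - hess z h) + hess z h))%C
    by (unfold h; ring).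
  pose proof (Cmod_triangle h ((grad u - grad z - hess z h) + hess z h)).
  pose proof (Cmod_triangle (grad u - grad z - hess z h) (hess z h)). pose proof (Cmod_ge_0 h).
  assert (Cmod h * (K + 2 + 1) < e).
  { apply Rlt_le_trans with (e / (K + 2 + 1) * (K + 2 + 1)); [apply Rmult_lt_compat_r; lra|right; field; lra]. }
  nra.
Qed.

Lemma V_cont z : N0 z -> ctends N0 V z (V z).
Proof.
  intros Hz e He. destruct (psi_inv_der _ (inW_lewy z Hz)) as [l Hl]. apply cder_cont in Hl.
  destruct (Hl e He) as [d [Hd H]]. destruct (lewy_cont z Hz d Hd) as [d' [Hd' H']].
  exists d'. split; [auto|]. intros u Hu Huz. apply H; auto.
Qed.

Lemma U_cont zeta : Cmod zeta < 1 -> ctends (fun z => Cmod z < 1) U zeta (U zeta).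
Proof.
  intros Hz e He. destruct (hol_cont 1 psi zeta Hpsihol Hz e He) as [d [Hd H]].
  exists d. split; [auto|]. intros u Hu Huz. specialize (H u I Huz).
  destruct (HU u Hu) as [A1 A2]. destruct (HU zeta Hz) as [B1 B2].
  eapply Rle_lt_trans; [apply (lewy_expand N N0 sigma (polyInt_N n v) (fun z => polyInt_open n v z) Hsconv HsC2 (U zeta) (U u)); auto|].
  rewrite A2, B2. auto.
Qed.

Definition dual (zeta : C) : C := Cconj (U zeta - grad (U zeta)).

Lemma dual_hol : hol 1 dual.
Proof.
  intros z Hz. destruct (Hpsihol z Hz) as [l Hl].
  apply (conj_lewy_dual_der N N0 sigma (polyInt_N n v) (fun z => polyInt_open n v z) Hsconv HsC2 HsMA U psi z l (1 - Cmod z));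
    [lra| |auto].
  intros u Hu. apply HU. pose proof (Cmod_triangle_sub u z). lra.
Qed.

Lemma psi_dual zeta : Cmod zeta < 1 -> psi zeta = (U zeta + grad (U zeta))%C /\ dual zeta = Cconj (U zeta - grad (U zeta)).
Proof. intros H. split; [|reflexivity]. rewrite <- (proj2 (HU zeta H)). reflexivity. Qed.

(** With [psi = U + grad U] and [dual] the conjugate of [U - grad U], half the sum has the real part
    of [U]; half the difference, used next, has its imaginary part. *)
Lemma U_fst_re : re_hol (fun z => fst (U z)) (fun z => / 2 * (psi z + dual z))%C.
Proof.
  split.
  - apply hol_scal, hol_plus; auto using dual_hol.
  - intros z Hz. destruct (psi_dual z Hz) as [-> ->]. simpl. field.
Qed.

Lemma U_snd_re : re_hol (fun z => snd (U z)) (fun z => (- Ci / 2) * (psi z + - (1) * dual z))%C.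
Proof.
  split.
  - apply hol_scal, hol_plus; auto. apply hol_scal. apply dual_hol.
  - intros z Hz. destruct (psi_dual z Hz) as [-> ->]. simpl. field.
Qed.

(* The harmonic conjugate of a coordinate of [U] is the orthogonal component of the gradient. *)
Definition conj_pair (t : C) (zeta : C) : C := (/ 2 * (Cconj t * psi zeta + - t * dual zeta))%C.

Lemma conj_pair_hol t : hol 1 (conj_pair t).
Proof. apply hol_scal, hol_plus; apply hol_scal; auto using dual_hol. Qed.

Lemma conj_pair_eq t zeta : Cmod zeta < 1 ->
  fst (conj_pair t zeta) = dot (grad (U zeta)) t /\ snd (conj_pair t zeta) = cross t (U zeta).
Proof.
  intros Hz. unfold conj_pair. destruct (psi_dual zeta Hz) as [-> ->].
  generalize (U zeta) (grad (U zeta)). intros u g. unfold dot, cross. split; simpl; field.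
Qed.

Definition height_hol (i : nat) (zeta : C) : C := (- Ci * conj_pair (tau i) zeta + - RtoC (cross (tau i) (v i)))%C.

Lemma height_re i : re_hol (fun z => ht i (U z)) (height_hol i).
Proof.
  split.
  - apply hol_plus; [apply hol_scal, conj_pair_hol|apply hol_const].
  - intros z Hz. unfold height_hol. destruct (conj_pair_eq (tau i) z Hz) as [_ E].
    transitivity (snd (conj_pair (tau i) z) + - cross (tau i) (v i)); [|simpl; ring].
    rewrite E. unfold height, cross. simpl. ring.
Qed.

(** Harnack's inequality from the centre for the positive harmonic function [ht i (U z)]. It bounds
    [1 - |V|] by a multiple of the height. *)
Lemma hopf i : (i < n)%nat -> exists c, 0 < c /\ forall z, Cmod z < 1 -> c * (1 - Cmod z) <= ht i (U z).
Proof.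
  intros Hi. destruct (height_re i) as [H1 H2].
  assert (Hpos : forall z, Cmod z < 1 -> 0 < fst (height_hol i z)).
  { intros z Hz. rewrite <- H2 by auto. apply HU; auto. }
  exists (fst (height_hol i 0%C) / 4). split.
  - pose proof (Hpos 0%C Cmod_0_lt_1). lra.
  - intros z Hz. rewrite H2 by auto.
    pose proof (harnack (height_hol i) z H1 (fun u Hu => Rlt_le _ _ (Hpos u Hu)) Hz). lra.
Qed.

(** The rotation [c] makes [psi_inv w0] real and nonnegative, so that [1 - c psi_inv] has
    nonnegative real part and the value [1 - |psi_inv w0|] at the centre. Borel-Caratheodory then
    shows that the inverse moves the less, the closer it is to the circle. *)
Lemma psi_inv_ball w0 rad : 0 < rad -> (forall w, Cmod (w - w0) < rad -> inW w) ->
  forall w, Cmod (w - w0) <= rad / 4 ->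
  Cmod (psi_inv w - psi_inv w0) <= 16 * (Cmod (w - w0) / rad) * (1 - Cmod (psi_inv w0)).
Proof.
  intros Hrad HW w Hw.
  assert (HradC : RtoC rad <> 0%C) by (intros E; apply RtoC_inj in E; lra).
  set (a := psi_inv w0).
  assert (Hc : exists c : C, Cmod c = 1 /\ (c * a)%C = RtoC (Cmod a)).
  { destruct (Req_dec (Cmod a) 0) as [E|E].
    - exists 1%C. rewrite Cmod_1. split; [auto|]. apply Cmod_eq_0 in E as E'. rewrite E, E'. ring.
    - exists (Cconj a / RtoC (Cmod a))%C.
      assert (E' : RtoC (Cmod a) <> 0%C) by (intros E0; apply RtoC_inj in E0; auto).
      split.
      + rewrite Cmod_div, Cmod_conj, Cmod_R, Rabs_pos_eq by (auto using Cmod_ge_0). field. auto.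
      + transitivity (a * Cconj a / RtoC (Cmod a))%C; [field; auto|].
        rewrite <- Cmod2_conj, RtoC_pow. field. auto. }
  destruct Hc as [c [Hc1 Hc2]].
  set (F := fun z => (1 + - c * psi_inv (w0 + RtoC rad * z))%C).
  assert (Hin : forall z, Cmod z < 1 -> inW (w0 + RtoC rad * z)%C).
  { intros z Hz. apply HW. replace (w0 + RtoC rad * z - w0)%C with (RtoC rad * z)%C by ring.
    rewrite Cmod_scal_R, Rabs_pos_eq by lra. pose proof (Cmod_ge_0 z). nra. }
  assert (HF : hol 1 F).
  { apply hol_plus; [apply hol_const|]. apply hol_scal. intros z Hz.
    destruct (psi_inv_der _ (Hin z Hz)) as [l Hl]. eexists.
    apply (cder_comp psi_inv (fun z => w0 + RtoC rad * z)%C); [exact Hl|].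
    apply (cder_plus (fun _ => w0) (fun z => RtoC rad * z)%C); [apply cder_const|apply cder_scal, cder_id]. }
  assert (Hpos : forall u, Cmod u < 1 -> 0 <= fst (F u)).
  { intros u Hu. destruct (psi_inv_spec _ (Hin u Hu)) as [H1 _]. unfold F.
    set (y := psi_inv (w0 + RtoC rad * u)%C) in *.
    pose proof (fst_le_Cmod (- c * y)%C) as H2. rewrite Cmod_mult, Cmod_opp, Hc1 in H2.
    apply Rabs_le_between in H2. change (0 <= 1 + fst (- c * y)%C). lra. }
  set (z := (/ RtoC rad * (w - w0))%C).
  assert (Hz : Cmod z = Cmod (w - w0) / rad).
  { unfold z. rewrite Cmod_mult, Cmod_inv, Cmod_R, Rabs_pos_eq by (auto; lra). field; lra. }
  assert (Hz4 : Cmod z <= 1 / 4).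
  { rewrite Hz. apply Rmult_le_reg_r with rad; [auto|]. unfold Rdiv at 1. rewrite Rmult_assoc, Rinv_l by lra. lra. }
  pose proof (borel_caratheodory F z HF Hpos Hz4) as HB.
  unfold F in HB. replace (w0 + RtoC rad * z)%C with w in HB by (unfold z; field; auto).
  replace (w0 + RtoC rad * 0)%C with w0 in HB by ring. fold a in HB.
  replace (1 + - c * psi_inv w - (1 + - c * a))%C with (- c * (psi_inv w - a))%C in HB by ring.
  rewrite Cmod_mult, Cmod_opp, Hc1, Rmult_1_l, Hz in HB.
  replace (1 + - c * a)%C with (RtoC (1 - Cmod a)) in HB by (rewrite RtoC_minus, <- Hc2; ring).
  simpl in HB. exact HB.
Qed.

Lemma wpath_dist i s b T T' : Cmod (wpath i s b T' - wpath i s b T) = Rabs (T' - T) * Cmod (tau i).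
Proof.
  unfold wpath. match goal with |- Cmod ?x = _ => replace x with (RtoC (T - T') * (Ci * tau i))%C by (rewrite RtoC_minus; ring) end.
  rewrite Cmod_scal_R, Cmod_mult, Cmod_Ci, Rabs_minus_sym. ring.
Qed.

(* [A T = min (Phi (wpath T)) - Phi (wpath T) (edge s)] is bounded and concave in [T] with slope [ht] at the minimiser;
   since [1 - |V|] is controlled by [ht], unit steps along the path move its preimage in the disc by
   summable amounts. *)
Lemma wpath_lands i s b : good i s b -> exists c, Cmod c = 1 /\
  forall eps, 0 < eps -> exists T0, forall T, T0 <= T -> Cmod (psi_inv (wpath i s b T) - c) < eps.
Proof.
  intros Hg. destruct (good_range _ _ _ Hg) as [Hi Hs].
  pose proof (side_neq0 n v Hpoly i Hi) as Ht.
  destruct (lewy_ball i s b Hg) as [rho [Hrho HW]].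
  destruct (wpath_inverse i s b Hg rho Hrho) as [T0 [HT0 HT]].
  destruct (hopf i Hi) as [c0 [Hc0 Hhopf]].
  assert (Ne : N (edge i s)) by (apply edge_N; auto; lra).
  set (zeta := fun T => psi_inv (wpath i s b T)).
  (* The step for which the path advances by [rho / 4], the range allowed in [psi_inv_ball]. *)
  set (h := rho / (4 * Cmod (tau i))). assert (Hh : 0 < h) by (apply Rdiv_lt_0_compat; lra).
  destruct (choice (fun (T : {T | T0 <= T}) z => N0 z /\ lewy sigma z = wpath i s b (proj1_sig T) /\
     is_min (wpath i s b (proj1_sig T)) z /\ Cmod (z - edge i s) < rho)) as [zz0 Hzz0].
  { intros [T HTT]. apply HT. auto. }
  set (zz := fun T => match Rle_dec T0 T with left H => zz0 (exist _ T H) | right _ => RtoC 0 end).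
  assert (Hzz : forall T, T0 <= T -> N0 (zz T) /\ lewy sigma (zz T) = wpath i s b T /\
     is_min (wpath i s b T) (zz T) /\ Cmod (zz T - edge i s) < rho).
  { intros T HTT. unfold zz. destruct (Rle_dec T0 T) as [H|]; [|contradiction]. apply (Hzz0 (exist _ T H)). }
  set (A := fun T => Phi (wpath i s b T) (zz T) - Phi (wpath i s b T) (edge i s)).
  assert (HA0 : forall T, T0 <= T -> A T <= 0).
  { intros T HTT. destruct (Hzz T HTT) as [_ [_ [[_ Hm] _]]]. specialize (Hm _ Ne). unfold A. lra. }
  assert (HAk : forall T T', T0 <= T' -> T' <= T -> (T - T') * ht i (zz T) <= A T - A T').
  { intros T T' H1 H2. destruct (Hzz T' H1) as [_ [_ [[_ Hm] _]]]. destruct (Hzz T ltac:(lra)) as [Nz _].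
    specialize (Hm _ (polyInt_N n v _ Nz)). unfold A.
    pose proof (wpath_Phi i s b T (edge i s) (zz T)) as E1. pose proof (wpath_Phi i s b T' (edge i s) (zz T)) as E2.
    rewrite height_edge_self in E1, E2. lra. }
  assert (Hz1 : forall T, T0 <= T -> Cmod (zeta T) < 1 /\ c0 * (1 - Cmod (zeta T)) <= ht i (zz T)).
  { intros T HTT. destruct (Hzz T HTT) as [Nz [E _]]. unfold zeta. rewrite <- E.
    destruct (V_spec _ Nz) as [V1 [_ V3]]. fold (V (zz T)). split; [auto|].
    rewrite <- V3 at 2. apply Hhopf. auto. }
  set (C1 := 4 / (c0 * h)). assert (HC1 : 0 < C1) by (apply Rdiv_lt_0_compat; [lra|apply Rmult_lt_0_compat; lra]).
  (* A move of length at most [h] costs [4 (1 - |zeta T|)]; [hopf] turns this into [4 / c0] times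
     the height, and [h] times the height is at most the increment of [A] over the preceding
     step. *)
  assert (Hstep : forall T u, T0 + h <= T -> 0 <= u <= h -> Cmod (zeta (T + u) - zeta T) <= C1 * (A T - A (T - h))).
  { intros T u HTT Hu. destruct (Hzz T ltac:(lra)) as [Nz [E [_ Hd]]].
    pose proof (psi_inv_ball (wpath i s b T) rho Hrho) as HB.
    specialize (HB ltac:(intros w Hw; apply (HW (zz T) Nz Hd); rewrite E; auto)).
    specialize (HB (wpath i s b (T + u))).
    rewrite wpath_dist in HB. replace (T + u - T) with u in HB by ring. rewrite Rabs_pos_eq in HB by lra.
    assert (Hut : u * Cmod (tau i) <= rho / 4).
    { apply Rle_trans with (h * Cmod (tau i)); [apply Rmult_le_compat_r; lra|right; unfold h; field; lra]. }
    specialize (HB Hut). fold (zeta (T + u)) (zeta T) in HB.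
    destruct (Hz1 T ltac:(lra)) as [Z1 Z2].
    pose proof (HAk T (T - h) ltac:(lra) ltac:(lra)) as HA. replace (T - (T - h)) with h in HA by ring.
    eapply Rle_trans; [exact HB|].
    assert (Hq : 16 * (u * Cmod (tau i) / rho) <= 4).
    { apply Rmult_le_reg_r with rho; [auto|]. unfold Rdiv. rewrite !Rmult_assoc, Rinv_l by lra. lra. }
    apply Rle_trans with (4 * (1 - Cmod (zeta T))); [apply Rmult_le_compat_r; lra|].
    apply Rmult_le_reg_l with (c0 * h); [apply Rmult_lt_0_compat; auto|].
    replace (c0 * h * (C1 * (A T - A (T - h)))) with (4 * (A T - A (T - h))) by (unfold C1; field; lra).
    nra. }
  set (Tn := fun k => T0 + INR k * h).
  assert (HTn : forall k, T0 <= Tn k) by (intros k; unfold Tn; pose proof (pos_INR k); nra).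
  assert (HTS : forall k, Tn (S k) = Tn k + h) by (intros k; unfold Tn; rewrite S_INR; ring).
  assert (HAm : forall k, A (Tn k) <= A (Tn (S k))).
  { intros k. pose proof (HAk (Tn (S k)) (Tn k) (HTn k)) as H1. rewrite HTS in *.
    specialize (H1 ltac:(lra)). destruct (Hzz (Tn k + h) ltac:(specialize (HTn k); lra)) as [Nz _].
    pose proof (Nz i Hi) as Hk. change (0 < ht i (zz (Tn k + h))) in Hk.
    replace (Tn k + h - Tn k) with h in H1 by ring. nra. }
  (* The shift of index is that of [Hstep]: a move from a node is paid for by the increment of [A]
     ending there, and the increments telescope. *)
  assert (Hchain : forall k j, Cmod (zeta (Tn (S k + j)%nat) - zeta (Tn (S k)))%C <= C1 * (A (Tn (k + j)%nat) - A (Tn k))).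
  { intros k j. induction j.
    - rewrite !Nat.add_0_r, Cminus_diag, Cmod_0, Rminus_diag. lra.
    - pose proof (Hstep (Tn (S k + j)%nat) h) as H1.
      assert (E1 : Tn (S k + j)%nat + h = Tn (S k + S j)%nat) by (rewrite <- HTS; f_equal; lia).
      assert (E2 : Tn (S k + j)%nat - h = Tn (k + j)%nat).
      { replace (S k + j)%nat with (S (k + j)) by lia. rewrite HTS. ring. }
      rewrite E1, E2 in H1.
      specialize (H1 ltac:(specialize (HTn (k + j)%nat); lra) ltac:(lra)).
      pose proof (Cmod_dist_triangle (zeta (Tn (S k + S j)%nat)) (zeta (Tn (S k + j)%nat)) (zeta (Tn (S k)))) as H2.
      replace (k + S j)%nat with (S k + j)%nat by lia. lra. }
  assert (Hcauchy : forall eps, 0 < eps -> exists k, forall j, A (Tn (k + j)%nat) - A (Tn k) < eps).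
  { intros eps He. destruct (completeness (fun y => exists k, y = A (Tn k))) as [m [Hm1 Hm2]].
    - exists 0. intros y [k ->]. auto.
    - exists (A (Tn 0%nat)), 0%nat. auto.
    - destruct (classic (exists k, m - eps < A (Tn k))) as [[k Hk]|Hno].
      + exists k. intros j. assert (A (Tn (k + j)%nat) <= m) by (apply Hm1; eexists; eauto). lra.
      + exfalso. assert (m <= m - eps); [|lra]. apply Hm2. intros y [k ->]. apply Rnot_lt_le. intros Hlt. apply Hno. exists k. auto. }
  destruct (cluster_point (fun k z => z = zeta (Tn k)) 1) as [c Hc].
  { intros k. exists (zeta (Tn k)). split; [auto|]. left. apply Hz1. auto. }
  assert (Hconv : forall eps, 0 < eps -> exists T1, forall T, T1 <= T -> Cmod (zeta T - c) < eps).
  { intros eps He. destruct (Hcauchy (eps / (4 * C1))) as [k Hk]; [apply Rdiv_lt_0_compat; lra|].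
    assert (HkC : forall j, C1 * (A (Tn (k + j)%nat) - A (Tn k)) < eps / 4).
    { intros j. specialize (Hk j). replace (eps / 4) with (C1 * (eps / (4 * C1))) by (field; lra).
      apply Rmult_lt_compat_l; auto. }
    destruct (Hc (eps / 4) ltac:(lra) (S k)) as [p [z [Hp [-> Hz]]]].
    exists (Tn (S k)). intros T HTT.
    destruct (nfloor_ex ((T - Tn (S k)) / h)) as [j Hj].
    { apply Rmult_le_pos; [lra|left; apply Rinv_0_lt_compat; auto]. }
    set (x := (T - Tn (S k)) / h) in *. assert (Hx : x * h = T - Tn (S k)) by (unfold x; field; lra).
    assert (ETj : Tn (S k + j)%nat = Tn (S k) + INR j * h) by (unfold Tn; rewrite plus_INR; ring).
    pose proof (Hstep (Tn (S k + j)%nat) (T - Tn (S k + j)%nat)) as H1.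
    replace (Tn (S k + j)%nat + (T - Tn (S k + j)%nat)) with T in H1 by ring.
    assert (E2 : Tn (S k + j)%nat - h = Tn (k + j)%nat).
    { replace (S k + j)%nat with (S (k + j)) by lia. rewrite HTS. ring. }
    rewrite E2 in H1. specialize (H1 ltac:(specialize (HTn (k + j)%nat); lra)).
    specialize (H1 ltac:(rewrite ETj; split; nra)).
    pose proof (Hchain k j) as H2. pose proof (HkC j) as H3. pose proof (HkC (S j)) as H4.
    replace (k + S j)%nat with (S k + j)%nat in H4 by lia.
    pose proof (Hchain k (p - S k)%nat) as H5. replace (S k + (p - S k))%nat with p in H5 by lia.
    pose proof (HkC (p - S k)%nat) as H6.
    pose proof (Cmod_dist_triangle (zeta T) (zeta (Tn (S k + j)%nat)) (zeta (Tn (S k)))) as T1.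
    pose proof (Cmod_dist_triangle (zeta T) (zeta (Tn (S k))) c) as T2.
    pose proof (Cmod_dist_triangle (zeta (Tn (S k))) (zeta (Tn p)) c) as T3.
    rewrite (Cmod_minus_sym (zeta (Tn (S k))) (zeta (Tn p))) in T3.
    assert (C1 * (A (Tn (S k + j)%nat) - A (Tn (k + j)%nat)) + C1 * (A (Tn (k + j)%nat) - A (Tn k)) < eps / 4) by lra.
    lra. }
  exists c. split; [|exact Hconv].
  (* For [1 <= |c|]: along the nodes [c0 h (1 - |zeta|)] is at most an increment of the bounded
     monotone [A], hence arbitrarily small. *)
  apply Rle_antisym; apply le_epsilon; intros eps He.
  - destruct (Hconv eps He) as [T1 H1]. specialize (H1 (Rmax T1 T0) (Rmax_l _ _)).
    destruct (Hz1 (Rmax T1 T0) (Rmax_r _ _)) as [H2 _]. rewrite Cmod_minus_sym in H1.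
    pose proof (Cmod_triangle_sub c (zeta (Rmax T1 T0))). lra.
  - destruct (Hcauchy (eps / 2 * c0 * h)) as [k Hk].
    { apply Rmult_lt_0_compat; [apply Rmult_lt_0_compat; lra|exact Hh]. }
    destruct (Hc (eps / 2) ltac:(lra) (S k)) as [p [z [Hp [-> Hz]]]].
    destruct (Hz1 (Tn p) (HTn p)) as [Z1 Z2].
    pose proof (HAk (Tn p) (Tn (p - 1)%nat) (HTn _)) as H1.
    assert (Ep : Tn p = Tn (p - 1)%nat + h) by (rewrite <- HTS; f_equal; lia).
    specialize (H1 ltac:(lra)). replace (Tn p - Tn (p - 1)%nat) with h in H1 by lra.
    pose proof (Hk (p - k)%nat) as H2. replace (k + (p - k))%nat with p in H2 by lia.
    assert (Hmon : forall j, A (Tn k) <= A (Tn (k + j)%nat)).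
    { intros j. induction j; [rewrite Nat.add_0_r; lra|]. rewrite Nat.add_succ_r. specialize (HAm (k + j)%nat). lra. }
    pose proof (Hmon (p - 1 - k)%nat) as H3. replace (k + (p - 1 - k))%nat with (p - 1)%nat in H3 by lia.
    assert (1 - Cmod (zeta (Tn p)) < eps / 2).
    { apply Rmult_lt_reg_l with (c0 * h); [apply Rmult_lt_0_compat; auto|]. nra. }
    pose proof (Cmod_triangle_sub (zeta (Tn p)) c). lra.
Qed.

Lemma edge_approach i s : (i < n)%nat -> 0 < s < 1 -> forall del, 0 < del -> exists z, N0 z /\ Cmod (z - edge i s) < del.
Proof.
  intros Hi Hs del Hd. destruct (edge_box i s Hi Hs) as [eta [He HN]]. pose proof (side_neq0 n v Hpoly i Hi) as Ht.
  set (y := Rmin eta (del / (2 * Cmod (tau i)))). assert (Hy : 0 < y) by (apply Rmin_pos; auto; apply Rdiv_lt_0_compat; lra).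
  assert (Hy1 : y <= eta) by apply Rmin_l. assert (Hy2 : y <= del / (2 * Cmod (tau i))) by apply Rmin_r.
  exists (pt i s y). split; [apply HN; auto; [rewrite Rminus_diag, Rabs_R0|]; lra|].
  rewrite <- (frame_0 n v). eapply Rle_lt_trans; [apply frame_dist|].
  rewrite Rminus_diag, Rabs_R0, Rminus_0_r, Rplus_0_l, Rabs_pos_eq by lra.
  apply Rle_lt_trans with (del / (2 * Cmod (tau i)) * Cmod (tau i)); [apply Rmult_le_compat_r; lra|].
  replace (del / (2 * Cmod (tau i)) * Cmod (tau i)) with (del / 2) by (field; lra). lra.
Qed.

(** For [z] near the edge point, [lewy sigma z] is [wpath i s b T] plus a tangential error [dl]: the
    normal slope makes [T] large, the tangential slope makes the error small, and [psi_inv_ball]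
    compares the two preimages. So the limit along one path is an unrestricted limit. *)
Lemma V_tends_of_path i s b c : good i s b ->
  (forall eps, 0 < eps -> exists T0, forall T, T0 <= T -> Cmod (psi_inv (wpath i s b T) - c) < eps) ->
  ctends N0 V (edge i s) c.
Proof.
  intros Hg Hc eps He. destruct (good_range _ _ _ Hg) as [Hi Hs].
  pose proof (side_neq0 n v Hpoly i Hi) as Ht.
  destruct (lewy_ball i s b Hg) as [rho [Hrho HW]].
  destruct (wpath_inverse i s b Hg rho Hrho) as [T0 [HT0 HT]].
  destruct (Hc (eps / 2) ltac:(lra)) as [T1 HT1].
  set (TT := Cmod (tau i) ^ 2). assert (HTT : 0 < TT) by (apply pow_lt; auto).
  (* [rho / 4] makes [psi_inv_ball] applicable, and [eps * rho / 64] makes its bound at most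
     [eps / 4]. *)
  set (e1 := Rmin (rho / 4) (eps * rho / 64)).
  assert (He1 : 0 < e1) by (apply Rmin_pos; nra).
  assert (E1 : e1 <= rho / 4) by apply Rmin_l. assert (E2 : e1 <= eps * rho / 64) by apply Rmin_r.
  destruct (tangential_slope i s b Hg (e1 * Cmod (tau i) / 2)) as [d1 [Hd1 H1]]; [nra|].
  destruct (normal_slope i s b Hg (Rmax T0 T1 * TT + Cmod (tau i))) as [d2 [Hd2 H2]].
  set (d := Rmin (Rmin d1 d2) (Rmin 1 (e1 / 2))).
  assert (D1 : d <= d1) by (eapply Rle_trans; [apply Rmin_l|apply Rmin_l]).
  assert (D2 : d <= d2) by (eapply Rle_trans; [apply Rmin_l|apply Rmin_r]).
  assert (D3 : d <= 1) by (eapply Rle_trans; [apply Rmin_r|apply Rmin_l]).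
  assert (D4 : d <= e1 / 2) by (eapply Rle_trans; [apply Rmin_r|apply Rmin_r]).
  exists d. split; [repeat apply Rmin_pos; lra|]. intros z Hz Hzd.
  specialize (H1 z Hz ltac:(lra)). specialize (H2 z Hz ltac:(lra)).
  set (q := (lewy sigma z - wpath i s b 0)%C).
  set (T := - (dot q (Ci * tau i) / TT)). set (dl := dot q (tau i) / TT).
  assert (Edec : lewy sigma z = (wpath i s b T + RtoC dl * tau i)%C).
  { assert (Eq : lewy sigma z = (wpath i s b 0 + q)%C) by (unfold q; ring).
    rewrite Eq. unfold wpath, T, dl. clearbody q.
    assert (Eq2 : q = (RtoC (dot q (tau i) / TT) * tau i + RtoC (dot q (Ci * tau i) / TT) * (Ci * tau i))%C).
    { unfold TT. rewrite Cmod_sqr. unfold TT in HTT. rewrite Cmod_sqr in HTT.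
      generalize dependent (tau i). intros t. intros. unfold dot.
      apply Ceq; simpl; field; simpl in HTT; lra. }
    rewrite Eq2 at 1. rewrite RtoC_opp. ring. }
  assert (Hq1 : dot q (tau i) = dot (z - edge i s) (tau i) + (dot (grad z) (tau i) - b)).
  { transitivity (dot (z - edge i s) (tau i) + dot (grad z) (tau i) - b / TT * TT).
    - unfold q, wpath. rewrite lewy_grad. fold TT. set (k := b / TT). unfold TT. rewrite Cmod_sqr.
      generalize (edge i s) (tau i) (grad z). intros. unfold dot. simpl. ring.
    - field. lra. }
  assert (Hq2 : dot q (Ci * tau i) = dot (z - edge i s) (Ci * tau i) + dot (grad z) (Ci * tau i)).
  { unfold q, wpath. rewrite lewy_grad. fold TT. set (k := b / TT).
    generalize (edge i s) (tau i) (grad z). intros. unfold dot. simpl. ring. }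
  pose proof (dot_le (z - edge i s) (tau i)) as B1. pose proof (dot_le (z - edge i s) (Ci * tau i)) as B2.
  rewrite Cmod_mult, Cmod_Ci, Rmult_1_l in B2.
  apply Rabs_le_between in B2.
  assert (HTbig : Rmax T0 T1 <= T).
  { unfold T. apply Rmult_le_reg_r with TT; [auto|].
    replace (- (dot q (Ci * tau i) / TT) * TT) with (- dot q (Ci * tau i)) by (field; lra). rewrite Hq2. nra. }
  pose proof (Rmax_l T0 T1). pose proof (Rmax_r T0 T1).
  specialize (HT1 T ltac:(lra)). destruct (HT T ltac:(lra)) as [zT [Nz [Ez [_ Hzr]]]].
  pose proof (psi_inv_ball (wpath i s b T) rho Hrho) as HB.
  specialize (HB ltac:(intros w Hw; apply (HW zT Nz Hzr); rewrite Ez; auto)).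
  specialize (HB (lewy sigma z)).
  assert (Hdist : Cmod (lewy sigma z - wpath i s b T) <= e1).
  { rewrite Edec. replace (wpath i s b T + RtoC dl * tau i - wpath i s b T)%C with (RtoC dl * tau i)%C by ring.
    rewrite Cmod_scal_R. unfold dl, Rdiv. rewrite Rabs_mult, (Rabs_pos_eq (/ TT)) by (left; apply Rinv_0_lt_compat; auto).
    apply Rmult_le_reg_r with (Cmod (tau i)); [auto|].
    replace (Rabs (dot q (tau i)) * / TT * Cmod (tau i) * Cmod (tau i)) with (Rabs (dot q (tau i))) by (unfold TT; field; lra).
    rewrite Hq1. eapply Rle_trans; [apply Rabs_triang|]. nra. }
  specialize (HB ltac:(lra)). fold (V z) in HB.
  assert (Hz1 : 0 <= Cmod (psi_inv (wpath i s b T))) by apply Cmod_ge_0.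
  assert (HB2 : Cmod (V z - psi_inv (wpath i s b T)) <= eps / 4).
  { eapply Rle_trans; [exact HB|].
    assert (A1 : 0 <= Cmod (lewy sigma z - wpath i s b T) / rho <= eps / 64).
    { pose proof (Cmod_ge_0 (lewy sigma z - wpath i s b T)). split.
      - apply Rmult_le_pos; [auto|left; apply Rinv_0_lt_compat; auto].
      - apply Rmult_le_reg_r with rho; [auto|]. unfold Rdiv at 1. rewrite Rmult_assoc, Rinv_l by lra. lra. }
    set (x := Cmod (lewy sigma z - wpath i s b T) / rho) in *. nra. }
  pose proof (Cmod_dist_triangle (V z) (psi_inv (wpath i s b T)) c). lra.
Qed.

Lemma ctends_unique i s c c' : (i < n)%nat -> 0 < s < 1 ->
  ctends N0 V (edge i s) c -> ctends N0 V (edge i s) c' -> c = c'.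
Proof.
  intros Hi Hs H1 H2. assert (E : Cmod (c - c') = 0).
  { apply Rle_antisym; [|apply Cmod_ge_0]. apply le_epsilon. intros e He.
    destruct (H1 (e / 2)) as [d1 [Hd1 K1]]; [lra|]. destruct (H2 (e / 2)) as [d2 [Hd2 K2]]; [lra|].
    destruct (edge_approach i s Hi Hs (Rmin d1 d2)) as [z [Hz Hzd]]; [apply Rmin_pos; auto|].
    pose proof (Rmin_l d1 d2). pose proof (Rmin_r d1 d2).
    specialize (K1 z Hz ltac:(lra)). specialize (K2 z Hz ltac:(lra)). rewrite Cmod_minus_sym in K1.
    pose proof (Cmod_dist_triangle c (V z) c'). lra. }
  apply Cmod_eq_0 in E. replace c with ((c - c') + c')%C by ring. rewrite E. ring.
Qed.

(** The collapse of an affine piece: with the same slope [b] the paths of [s] and [s'] run parallel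
    at distance [|s' - s| |tau i|], so by [psi_inv_ball] their preimages differ by at most
    [4 (1 - |p|)], which tends to 0. *)
Lemma landing i s b : good i s b -> exists c, Cmod c = 1 /\
  exists eta, 0 < eta /\ forall s', Rabs (s' - s) < eta -> ctends N0 V (edge i s') c.
Proof.
  intros Hg. destruct (good_range _ _ _ Hg) as [Hi Hs]. pose proof (side_neq0 n v Hpoly i Hi) as Ht.
  destruct (wpath_lands i s b Hg) as [c [Hc1 Hc]]. exists c. split; [auto|].
  destruct (lewy_ball i s b Hg) as [rho [Hrho HW]].
  destruct (wpath_inverse i s b Hg rho Hrho) as [T0 [HT0 HT]].
  destruct (good_open _ _ _ Hg) as [e1 [He1 Hgo]].
  set (eta := Rmin e1 (rho / (4 * Cmod (tau i)))).
  assert (Heta : 0 < eta) by (apply Rmin_pos; auto; apply Rdiv_lt_0_compat; lra).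
  assert (Et1 : eta <= e1) by apply Rmin_l. assert (Et2 : eta <= rho / (4 * Cmod (tau i))) by apply Rmin_r.
  exists eta. split; [auto|]. intros s' Hs'.
  apply (V_tends_of_path i s' b c); [apply Hgo; lra|]. intros eps He.
  destruct (Hc (Rmin (eps / 2) (eps / 10))) as [T1 HT1]; [apply Rmin_pos; lra|].
  pose proof (Rmin_l (eps / 2) (eps / 10)). pose proof (Rmin_r (eps / 2) (eps / 10)).
  exists (Rmax T0 T1). intros T HTT. pose proof (Rmax_l T0 T1). pose proof (Rmax_r T0 T1).
  specialize (HT1 T ltac:(lra)). destruct (HT T ltac:(lra)) as [zT [Nz [Ez [_ Hzr]]]].
  pose proof (psi_inv_ball (wpath i s b T) rho Hrho) as HB.
  specialize (HB ltac:(intros w Hw; apply (HW zT Nz Hzr); rewrite Ez; auto)).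
  specialize (HB (wpath i s' b T)).
  assert (Hdist : Cmod (wpath i s' b T - wpath i s b T) <= rho / 4).
  { replace (wpath i s' b T - wpath i s b T)%C with (RtoC (s' - s) * tau i)%C
      by (unfold wpath; rewrite !edge_side, RtoC_minus; ring).
    rewrite Cmod_scal_R. apply Rle_trans with (rho / (4 * Cmod (tau i)) * Cmod (tau i)); [apply Rmult_le_compat_r; lra|].
    right. field. lra. }
  specialize (HB Hdist).
  set (p := psi_inv (wpath i s b T)) in *. set (p' := psi_inv (wpath i s' b T)) in *.
  assert (Hp : 1 - Cmod p <= eps / 10).
  { rewrite Cmod_minus_sym in HT1. pose proof (Cmod_triangle_sub c p). lra. }
  assert (Hp1 : 0 <= 1 - Cmod p).
  { destruct (psi_inv_spec (wpath i s b T)) as [HH _]; [rewrite <- Ez; apply inW_lewy; auto|]. fold p in HH. lra. }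
  assert (Hq : 0 <= 16 * (Cmod (wpath i s' b T - wpath i s b T) / rho) <= 4).
  { pose proof (Cmod_ge_0 (wpath i s' b T - wpath i s b T)). split.
    - apply Rmult_le_pos; [lra|]. apply Rmult_le_pos; [auto|left; apply Rinv_0_lt_compat; auto].
    - apply Rmult_le_reg_r with rho; [auto|]. unfold Rdiv. rewrite !Rmult_assoc, Rinv_l by lra. lra. }
  pose proof (Cmod_dist_triangle p' p c).
  assert (Cmod (p' - p) <= 4 * (eps / 10)).
  { eapply Rle_trans; [exact HB|]. apply Rmult_le_compat; lra. }
  lra.
Qed.

(** ** Breakpoints of the boundary values *)

Variable L : C -> R.
Hypothesis HLpa : piecewise_affine_bd n v L.
Hypothesis Hsbd : forall z, polyBd n v z -> sigma z = L z.
Variables (m : nat) (p : nat -> C).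
Hypothesis Hpinj : forall j k, (j < m)%nat -> (k < m)%nat -> p j = p k -> j = k.
Hypothesis Hpin : forall j, (j < m)%nat -> is_corner n v (p j) \/ is_Q n v L (p j).
Hypothesis Hpall : forall z, is_corner n v z \/ is_Q n v L z -> exists j, (j < m)%nat /\ p j = z.

Lemma sigma_edge i s : (i < n)%nat -> 0 <= s <= 1 -> sigma (edge i s) = L (edge i s).
Proof. intros. apply Hsbd, edge_bd; auto. Qed.

Lemma step_right (ts : nat -> R) k s : ts 0%nat <= s < ts k -> exists j, (j < k)%nat /\ ts j <= s < ts (S j).
Proof.
  induction k; intros H; [lra|]. destruct (Rle_lt_dec (ts k) s).
  - exists k. split; [lia|lra].
  - destruct IHk as [j [Hj H']]; [lra|]. exists j. split; [lia|auto].
Qed.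

Lemma step_left (ts : nat -> R) k s : ts 0%nat < s <= ts k -> exists j, (j < k)%nat /\ ts j < s <= ts (S j).
Proof.
  induction k; intros H; [lra|]. destruct (Rlt_le_dec (ts k) s).
  - exists k. split; [lia|lra].
  - destruct IHk as [j [Hj H']]; [lra|]. exists j. split; [lia|auto].
Qed.

Lemma affine_right i s : (i < n)%nat -> 0 <= s < 1 -> exists eta b, 0 < eta /\ s + eta <= 1 /\
  forall s', s <= s' <= s + eta -> sigma (edge i s') = sigma (edge i s) + b * (s' - s).
Proof.
  intros Hi Hs. destruct (HLpa i Hi) as [k [ts [T0 [Tk [_ HT]]]]].
  destruct (step_right ts k s) as [j [Hj Hjs]]; [lra|]. destruct (HT j Hj) as [a [b Hab]].
  exists (Rmin (ts (S j) - s) (1 - s)), b.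
  pose proof (Rmin_l (ts (S j) - s) (1 - s)). pose proof (Rmin_r (ts (S j) - s) (1 - s)).
  split; [apply Rmin_pos; lra|]. split; [lra|]. intros s' Hs'.
  rewrite !sigma_edge, !Hab by (auto; lra). ring.
Qed.

Lemma affine_left i s : (i < n)%nat -> 0 < s <= 1 -> exists eta b, 0 < eta /\ 0 <= s - eta /\
  forall s', s - eta <= s' <= s -> sigma (edge i s') = sigma (edge i s) + b * (s' - s).
Proof.
  intros Hi Hs. destruct (HLpa i Hi) as [k [ts [T0 [Tk [_ HT]]]]].
  destruct (step_left ts k s) as [j [Hj Hjs]]; [lra|]. destruct (HT j Hj) as [a [b Hab]].
  exists (Rmin (s - ts j) s), b.
  pose proof (Rmin_l (s - ts j) s). pose proof (Rmin_r (s - ts j) s).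
  split; [apply Rmin_pos; lra|]. split; [lra|]. intros s' Hs'.
  rewrite !sigma_edge, !Hab by (auto; lra). ring.
Qed.

Lemma good_of_affine i s1 s2 b a : (i < n)%nat -> 0 <= s1 -> s2 <= 1 ->
  (forall s', s1 <= s' <= s2 -> sigma (edge i s') = a + b * s') -> forall s, s1 < s < s2 -> good i s b.
Proof.
  intros Hi H1 H2 H s Hs. split; [auto|]. exists (Rmin (s - s1) (s2 - s)). split; [apply Rmin_pos; lra|].
  intros s' Hs'. pose proof (Rmin_l (s - s1) (s2 - s)). pose proof (Rmin_r (s - s1) (s2 - s)).
  apply Rabs_def2 in Hs'. split; [lra|]. rewrite !H by lra. ring.
Qed.

Lemma good_right i s : (i < n)%nat -> 0 <= s < 1 -> exists eta b, 0 < eta /\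
  (forall s', s <= s' <= s + eta -> sigma (edge i s') = sigma (edge i s) + b * (s' - s)) /\
  forall s', s < s' < s + eta -> good i s' b.
Proof.
  intros Hi Hs. destruct (affine_right i s Hi Hs) as [eta [b [He [He1 H]]]]. exists eta, b. split; [auto|]. split; [auto|].
  intros s' Hs'. apply (good_of_affine i s (s + eta) b (sigma (edge i s) - b * s)); auto; [lra|].
  intros s'' Hs''. rewrite H by auto. ring.
Qed.

Lemma good_left i s : (i < n)%nat -> 0 < s <= 1 -> exists eta b, 0 < eta /\
  (forall s', s - eta <= s' <= s -> sigma (edge i s') = sigma (edge i s) + b * (s' - s)) /\
  forall s', s - eta < s' < s -> good i s' b.
Proof.
  intros Hi Hs. destruct (affine_left i s Hi Hs) as [eta [b [He [He1 H]]]]. exists eta, b. split; [auto|]. split; [auto|].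
  intros s' Hs'. apply (good_of_affine i (s - eta) s b (sigma (edge i s) - b * s)); auto; [lra|].
  intros s'' Hs''. rewrite H by auto. ring.
Qed.

Lemma ex_derive_edge i s : (i < n)%nat -> 0 < s < 1 ->
  (ex_derive (fun x => L (edge i x)) s <-> ex_derive (fun x => sigma (edge i x)) s).
Proof.
  intros Hi Hs. assert (Hm : 0 < Rmin s (1 - s)) by (apply Rmin_pos; lra).
  assert (E : locally s (fun x => sigma (edge i x) = L (edge i x))).
  { exists (mkposreal _ Hm). intros x Hx. change (Rabs (x - s) < Rmin s (1 - s)) in Hx.
    pose proof (Rmin_l s (1 - s)). pose proof (Rmin_r s (1 - s)). apply Rabs_def2 in Hx.
    apply sigma_edge; auto; lra. }
  split; apply ex_derive_ext_loc; auto. destruct E as [d Hd]. exists d. intros x Hx. symmetry. auto.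
Qed.

Lemma derivative_one_sided (f : R -> R) s l b eta (sgn : R) : is_derive f s l -> 0 < eta -> (sgn = 1 \/ sgn = -1) ->
  (forall u, 0 <= u <= eta -> f (s + sgn * u) = f s + b * (sgn * u)) -> l = b.
Proof.
  intros Hd He Hsg Hf. assert (HE : Rabs (b - l) = 0).
  { apply Rle_antisym; [|apply Rabs_pos]. apply le_epsilon. intros e He'. rewrite Rplus_0_l.
    destruct (is_derive_eps_inv f s l Hd e He') as [d [Hd' H]].
    set (u := Rmin eta d / 2). assert (0 < Rmin eta d) by (apply Rmin_pos; auto).
    pose proof (Rmin_l eta d). pose proof (Rmin_r eta d).
    assert (Hu : 0 < u) by (unfold u; lra).
    assert (Hau : Rabs (s + sgn * u - s) = u).
    { replace (s + sgn * u - s) with (sgn * u) by ring. rewrite Rabs_mult, (Rabs_pos_eq u) by lra.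
      destruct Hsg as [-> | ->]; [rewrite Rabs_R1; ring|rewrite Rabs_left by lra; ring]. }
    specialize (H (s + sgn * u)). rewrite Hau, Hf in H by (unfold u; lra). specialize (H ltac:(unfold u; lra)).
    replace (f s + b * (sgn * u) - f s - l * (s + sgn * u - s)) with ((b - l) * (s + sgn * u - s)) in H by ring.
    rewrite Rabs_mult, Hau in H. apply Rmult_le_reg_r with u; auto. }
  apply Rabs_eq_0 in HE. lra.
Qed.

Lemma good_of_derivable i s : (i < n)%nat -> 0 < s < 1 -> ex_derive (fun x => L (edge i x)) s -> exists b, good i s b.
Proof.
  intros Hi Hs Hd. apply (proj1 (ex_derive_edge i s Hi Hs)) in Hd. destruct Hd as [l Hl].
  destruct (affine_right i s Hi ltac:(lra)) as [e1 [b1 [He1 [Hr1 H1]]]].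
  destruct (affine_left i s Hi ltac:(lra)) as [e2 [b2 [He2 [Hr2 H2]]]].
  assert (E1 : l = b1).
  { apply (derivative_one_sided _ s l b1 e1 1 Hl He1); [auto|]. intros u Hu. rewrite H1 by lra. ring. }
  assert (E2 : l = b2).
  { apply (derivative_one_sided _ s l b2 e2 (-1) Hl He2); [auto|]. intros u Hu. rewrite H2 by lra. ring. }
  subst b1 b2. exists l. apply (good_of_affine i (s - e2) (s + e1) l (sigma (edge i s) - l * s)); auto; try lra.
  intros s' Hs'. destruct (Rle_lt_dec s s'); [rewrite H1 by lra|rewrite H2 by lra]; ring.
Qed.

Lemma derivable_of_good i s b : good i s b -> ex_derive (fun x => L (edge i x)) s.
Proof.
  intros Hg. destruct (good_range _ _ _ Hg) as [Hi Hs]. apply (proj2 (ex_derive_edge i s Hi Hs)).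
  destruct Hg as [_ [eta [He H]]].
  apply (ex_derive_ext_loc (fun x => sigma (edge i s) + b * (x - s))).
  - exists (mkposreal _ He). intros x Hx. symmetry. apply H. exact Hx.
  - auto_derive. auto.
Qed.

Lemma kink_slopes i s : (i < n)%nat -> 0 < s < 1 -> ~ ex_derive (fun x => L (edge i x)) s ->
  exists eta b1 b2, 0 < eta /\ b1 <> b2 /\ (forall s', s - eta < s' < s -> good i s' b1) /\
    (forall s', s < s' < s + eta -> good i s' b2).
Proof.
  intros Hi Hs Hd.
  destruct (good_right i s Hi ltac:(lra)) as [e1 [b1 [He1 [H1 G1]]]].
  destruct (good_left i s Hi ltac:(lra)) as [e2 [b2 [He2 [H2 G2]]]].
  exists (Rmin e1 e2), b2, b1. pose proof (Rmin_l e1 e2). pose proof (Rmin_r e1 e2).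
  split; [apply Rmin_pos; auto|]. split; [|split; intros; [apply G2|apply G1]; lra].
  intros E. subst b2. apply Hd. apply (derivable_of_good i s b1). split; [auto|].
  assert (Hm : 0 < Rmin (Rmin e1 e2) (Rmin s (1 - s))) by (repeat apply Rmin_pos; lra).
  exists (Rmin (Rmin e1 e2) (Rmin s (1 - s))). split; [auto|]. intros s' Hs'.
  pose proof (Rmin_l (Rmin e1 e2) (Rmin s (1 - s))).
  pose proof (Rle_trans _ _ _ (Rmin_r (Rmin e1 e2) (Rmin s (1 - s))) (Rmin_l s (1 - s))).
  pose proof (Rle_trans _ _ _ (Rmin_r (Rmin e1 e2) (Rmin s (1 - s))) (Rmin_r s (1 - s))).
  apply Rabs_def2 in Hs'. split; [lra|].
  destruct (Rle_lt_dec s s'); [apply H1; lra|apply H2; lra].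
Qed.

Lemma edge_0 i : edge i 0 = v i.
Proof. rewrite edge_side. ring. Qed.

Lemma edge_1 i : edge i 1 = v (nxt n i).
Proof. rewrite edge_side. unfold side. ring. Qed.

Lemma vertex_p i : (i < n)%nat -> exists j, (j < m)%nat /\ p j = v i.
Proof. intros Hi. apply Hpall. left. exists i. auto. Qed.

Lemma boundary_cases z : polyBd n v z ->
  (exists j, (j < m)%nat /\ z = p j) \/ (exists i s b, good i s b /\ z = edge i s).
Proof.
  intros Hz. destruct (polyBd_edge n v Hpoly z Hz) as [i [x [Hi [Hx E]]]].
  destruct (Req_dec x 0) as [E0|E0].
  { left. destruct (vertex_p i Hi) as [j [Hj Ej]]. exists j. split; [auto|]. rewrite E, E0, edge_0. auto. }
  destruct (Req_dec x 1) as [E1|E1].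
  { left. destruct (vertex_p (nxt n i) (nxt_lt n v Hpoly i Hi)) as [j [Hj Ej]].
    exists j. split; [auto|]. rewrite E, E1, edge_1. auto. }
  assert (Hx' : 0 < x < 1) by lra.
  destruct (classic (ex_derive (fun y => L (edge i y)) x)) as [Hd|Hd].
  - right. destruct (good_of_derivable i x Hi Hx' Hd) as [b Hb]. exists i, x, b. auto.
  - left. destruct (Hpall z) as [j [Hj Ej]].
    + right. exists i, x. repeat split; auto; lra.
    + exists j. auto.
Qed.

Lemma p_param j : (j < m)%nat -> exists i t, (i < n)%nat /\ 0 <= t < 1 /\ p j = edge i t.
Proof.
  intros Hj. destruct (Hpin j Hj) as [[i [Hi E]]|[i [t [Hi [Ht [E _]]]]]].
  - exists i, 0. split; [auto|]. split; [lra|]. rewrite edge_0. auto.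
  - exists i, t. split; [auto|]. split; [lra|]. auto.
Qed.

Lemma p_bd j : (j < m)%nat -> polyBd n v (p j).
Proof.
  intros Hj. destruct (p_param j Hj) as [i [t [Hi [Ht E]]]]. rewrite E. apply edge_bd; auto. lra.
Qed.

(** ** The finitely many boundary points of the disc hit by the affine pieces *)

Lemma locally_constant (g : R -> C) t1 t2 :
  (forall s, t1 < s < t2 -> exists eta, 0 < eta /\ forall s', Rabs (s' - s) < eta -> t1 < s' < t2 -> g s' = g s) ->
  forall s s', t1 < s < t2 -> t1 < s' < t2 -> g s = g s'.
Proof.
  intros H.
  assert (Hle : forall s s', t1 < s < t2 -> t1 < s' < t2 -> s <= s' -> g s = g s').
  { intros s s' Hs Hs' Hss.
    assert (D : forall pr : C -> R, Rabs (pr (g s') - pr (g s)) <= 0 * (s' - s)).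
    { intros pr. apply (real_mvt_bound (fun x => pr (g x)) (fun _ => 0)); [auto| |intros; rewrite Rabs_R0; lra].
      intros t Ht. apply is_derive_eps. intros e He. destruct (H t ltac:(lra)) as [eta [Heta Hc]].
      exists (Rmin eta (Rmin (t - t1) (t2 - t))). split; [repeat apply Rmin_pos; lra|]. intros x Hx.
      pose proof (Rmin_l eta (Rmin (t - t1) (t2 - t))).
      pose proof (Rle_trans _ _ _ (Rmin_r eta (Rmin (t - t1) (t2 - t))) (Rmin_l (t - t1) (t2 - t))).
      pose proof (Rle_trans _ _ _ (Rmin_r eta (Rmin (t - t1) (t2 - t))) (Rmin_r (t - t1) (t2 - t))).
      pose proof (Rabs_def2 _ _ Hx). rewrite Hc by lra.
      replace (pr (g t) - pr (g t) - 0 * (x - t)) with 0 by ring. rewrite Rabs_R0.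
      apply Rmult_le_pos; [lra|apply Rabs_pos]. }
    pose proof (D fst) as D1. pose proof (D snd) as D2. rewrite Rmult_0_l in D1, D2.
    pose proof (Rabs_pos (fst (g s') - fst (g s))). pose proof (Rabs_pos (snd (g s') - snd (g s))).
    assert (E1 : Rabs (fst (g s') - fst (g s)) = 0) by lra. assert (E2 : Rabs (snd (g s') - snd (g s)) = 0) by lra.
    apply Rabs_eq_0 in E1. apply Rabs_eq_0 in E2. apply Ceq; lra. }
  intros s s' Hs Hs'. destruct (Rle_lt_dec s s'); [auto|symmetry; apply Hle; auto; lra].
Qed.

Lemma limit_on_interval i t1 t2 : t1 < t2 -> (forall s, t1 < s < t2 -> exists b, good i s b) ->
  exists c, Cmod c = 1 /\ forall s, t1 < s < t2 -> ctends N0 V (edge i s) c.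
Proof.
  intros Ht Hgood.
  set (g := fun s => epsilon (inhabits (RtoC 0)) (fun c => Cmod c = 1 /\ ctends N0 V (edge i s) c)).
  assert (Hg : forall s, t1 < s < t2 -> Cmod (g s) = 1 /\ ctends N0 V (edge i s) (g s)).
  { intros s Hs. unfold g. apply epsilon_spec. destruct (Hgood s Hs) as [b Hb].
    destruct (landing i s b Hb) as [c [Hc [eta [He Hl]]]]. exists c. split; [auto|]. apply Hl.
    rewrite Rminus_diag, Rabs_R0. auto. }
  exists (g ((t1 + t2) / 2)). split; [apply Hg; lra|]. intros s Hs.
  rewrite (locally_constant g t1 t2) with (s' := s); try lra; [apply Hg; auto|].
  intros x Hx. destruct (Hgood x Hx) as [b Hb]. destruct (good_range _ _ _ Hb) as [Hi Hx1].
  destruct (landing i x b Hb) as [c [Hc [eta [He Hl]]]]. exists eta. split; [auto|].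
  intros x' Hx' Hxt. destruct (Hgood x' Hxt) as [b' Hb']. destruct (good_range _ _ _ Hb') as [_ Hx1'].
  rewrite (ctends_unique i x' (g x') c); auto; [|apply Hg; auto].
  symmetry. apply (ctends_unique i x); auto; [apply Hg; auto|]. apply Hl. rewrite Rminus_diag, Rabs_R0. auto.
Qed.

(* [V] has the same limit [c] at all points of the affine piece of the boundary that begins at [p j]. *)
Definition start (j : nat) (c : C) : Prop := Cmod c = 1 /\ exists i t, (i < n)%nat /\ 0 <= t < 1 /\ p j = edge i t /\
  exists del, 0 < del /\ t + del <= 1 /\ forall s, t < s < t + del -> ctends N0 V (edge i s) c.

Lemma start_ex j : (j < m)%nat -> exists c, start j c.
Proof.
  intros Hj. destruct (p_param j Hj) as [i [t [Hi [Ht E]]]].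
  destruct (good_right i t Hi Ht) as [eta [b [He [_ Hg]]]].
  set (d := Rmin eta (1 - t)). assert (Hd : 0 < d) by (apply Rmin_pos; lra).
  assert (D1 : d <= eta) by apply Rmin_l. assert (D2 : d <= 1 - t) by apply Rmin_r.
  destruct (limit_on_interval i t (t + d)) as [c [Hc Hl]]; [lra|intros s Hs; exists b; apply Hg; lra|].
  exists c. split; [auto|]. exists i, t. repeat split; auto; try lra. exists d. repeat split; auto; lra.
Qed.

Lemma start_unique j c c' : start j c -> start j c' -> c = c'.
Proof.
  intros [_ [i [t [Hi [Ht [E [d [Hd [Hd1 H]]]]]]]]] [_ [i' [t' [Hi' [Ht' [E' [d' [Hd' [Hd1' H']]]]]]]]].
  rewrite E in E'. destruct (edge_param_unique n v Hpoly i i' t t' Hi Hi' Ht Ht' E') as [<- <-].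
  set (s := t + Rmin d d' / 2). assert (0 < Rmin d d') by (apply Rmin_pos; auto).
  pose proof (Rmin_l d d'). pose proof (Rmin_r d d').
  apply (ctends_unique i s); [auto|unfold s; lra|apply H; unfold s; lra|apply H'; unfold s; lra].
Qed.

Definition start_pt (j : nat) : C := epsilon (inhabits (RtoC 0)) (start j).

Lemma start_pt_start j : (j < m)%nat -> start j (start_pt j).
Proof. intros Hj. unfold start_pt. apply epsilon_spec, start_ex, Hj. Qed.

Lemma start_pt_mod j : (j < m)%nat -> Cmod (start_pt j) = 1.
Proof. intros Hj. apply (start_pt_start j Hj). Qed.

Lemma finite_argmax (k : nat) (P : nat -> R -> Prop) :
  (exists j t, (j < k)%nat /\ P j t) -> (forall j t t', P j t -> P j t' -> t = t') ->
  exists j t, (j < k)%nat /\ P j t /\ forall j' t', (j' < k)%nat -> P j' t' -> t' <= t.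
Proof.
  intros Hex Hun. induction k; [destruct Hex as [j [t [Hj _]]]; lia|].
  destruct (classic (exists j t, (j < k)%nat /\ P j t)) as [Hk|Hk].
  - destruct (IHk Hk) as [j [t [Hj [HP Hmax]]]].
    destruct (classic (exists t', P k t' /\ t < t')) as [[t' [HP' Hlt]]|Hno].
    + exists k, t'. split; [lia|]. split; [auto|]. intros j' t'' Hj' HP''.
      destruct (Nat.eq_dec j' k) as [->|]; [right; eapply Hun; eauto|]. specialize (Hmax j' t'' ltac:(lia) HP''). lra.
    + exists j, t. split; [lia|]. split; [auto|]. intros j' t'' Hj' HP''.
      destruct (Nat.eq_dec j' k) as [->|]; [|apply (Hmax j'); auto; lia].
      apply Rnot_lt_le. intros Hlt. apply Hno. exists t''. auto.
  - destruct Hex as [j [t [Hj HP]]]. assert (j = k).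
    { destruct (Nat.eq_dec j k); [auto|]. exfalso. apply Hk. exists j, t. split; [lia|auto]. }
    subst j. exists k, t. split; [lia|]. split; [auto|]. intros j' t' Hj' HP'.
    destruct (Nat.eq_dec j' k) as [->|]; [right; eapply Hun; eauto|]. exfalso. apply Hk. exists j', t'. split; [lia|auto].
Qed.

(** The affine piece containing [s] begins at the last [p j] before [s] on the edge, which exists
    because the corner [v i] is one; no kink lies between. Hence affine pieces account for at most
    [m] circle points. *)
Lemma good_limit i s b : good i s b -> exists j, (j < m)%nat /\ ctends N0 V (edge i s) (start_pt j).
Proof.
  intros Hg. destruct (good_range _ _ _ Hg) as [Hi Hs].
  destruct (finite_argmax m (fun j t => 0 <= t < s /\ p j = edge i t)) as [j [t [Hj [[Ht E] Hmax]]]].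
  - destruct (vertex_p i Hi) as [j [Hj Ej]]. exists j, 0. rewrite edge_0. repeat split; auto; lra.
  - intros j t t' [Ht E] [Ht' E']. rewrite E in E'.
    apply (edge_param_unique n v Hpoly i i t t' Hi Hi); auto; lra.
  - exists j. split; [auto|]. destruct (good_open _ _ _ Hg) as [eta [He Hgo]].
    set (d := Rmin eta (1 - s)). assert (Hd : 0 < d) by (apply Rmin_pos; lra).
    assert (D1 : d <= eta) by apply Rmin_l. assert (D2 : d <= 1 - s) by apply Rmin_r.
    destruct (limit_on_interval i t (s + d)) as [c [Hc Hl]]; [lra| |].
    + intros x Hx. destruct (Rle_lt_dec s x) as [Hsx|Hsx].
      * exists b. apply Hgo. rewrite Rabs_pos_eq; lra.
      * destruct (classic (ex_derive (fun y => L (edge i y)) x)) as [Hdx|Hdx].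
        -- apply good_of_derivable; auto. lra.
        -- exfalso. destruct (Hpall (edge i x)) as [j' [Hj' E']].
           { right. exists i, x. repeat split; auto; lra. }
           assert (Hx0 : 0 <= x < s) by lra.
           specialize (Hmax j' x Hj' (conj Hx0 E')). lra.
    + assert (Hst : start j c).
      { split; [auto|]. exists i, t. repeat split; auto; try lra. exists (s + d - t). repeat split; try lra.
        intros x Hx. apply Hl. lra. }
      rewrite <- (start_unique j c (start_pt j) Hst (start_pt_start j Hj)). apply Hl. lra.
Qed.

(** ** Boundary limits of the harmonic parametrisation *)

Lemma limit_point_eq (c c' : C) : (forall eps, 0 < eps -> Cmod (c - c') < eps) -> c = c'.
Proof.
  intros H. assert (E : Cmod (c - c') = 0).
  { apply Rle_antisym; [|apply Cmod_ge_0]. apply le_epsilon. intros e He. rewrite Rplus_0_l. left. auto. }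
  apply Cmod_eq_0 in E. replace c with ((c - c') + c')%C by ring. rewrite E. ring.
Qed.

Definition U_cluster (c l : C) : Prop := forall eps, 0 < eps -> exists z, Cmod z < 1 /\ Cmod (z - c) < eps /\ Cmod (U z - l) < eps.

Lemma U_cluster_V c l a : U_cluster c l -> ctends N0 V l a -> c = a.
Proof.
  intros Hcl HV. apply limit_point_eq. intros e He. destruct (HV (e / 2)) as [d [Hd H]]; [lra|].
  destruct (Hcl (Rmin d (e / 2))) as [z [Hz [H1 H2]]]; [apply Rmin_pos; lra|].
  pose proof (Rmin_l d (e / 2)). pose proof (Rmin_r d (e / 2)).
  specialize (H (U z) (proj1 (HU z Hz)) ltac:(lra)). rewrite (V_U z Hz) in H.
  pose proof (Cmod_dist_triangle c z a). rewrite (Cmod_minus_sym c z) in H4. lra.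
Qed.

(** An interior cluster value is impossible: there [V] is continuous with values in the open disc,
    whereas [V (U z) = z] tends to the circle. At a point of an affine piece the limit of [V] is
    some [start_pt j], which [c] is not. *)
Lemma U_cluster_p c l : Cmod c = 1 -> (forall j, (j < m)%nat -> c <> start_pt j) -> U_cluster c l ->
  exists j, (j < m)%nat /\ l = p j.
Proof.
  intros Hc Hne Hcl.
  assert (Hbd : polyBd n v l).
  { split.
    - apply polyN_closed. intros e He. destruct (Hcl e He) as [z [Hz [_ H2]]]. exists (U z). split; [|auto].
      apply polyInt_N. apply HU; auto.
    - intros HI. pose proof (U_cluster_V c l (V l) Hcl (V_cont l HI)) as E.
      destruct (V_spec l HI) as [H1 _]. rewrite <- E in H1. lra. }
  destruct (boundary_cases l Hbd) as [|[i [s [b [Hg E]]]]]; [auto|exfalso].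
  destruct (good_limit i s b Hg) as [j [Hj Hl]]. apply (Hne j Hj). apply (U_cluster_V c l); auto. rewrite E. auto.
Qed.

Lemma U_bounded : exists M, 0 < M /\ (forall z, Cmod z < 1 -> Cmod (U z) <= M) /\ forall j, (j < m)%nat -> Cmod (p j) <= M.
Proof.
  destruct (polyN_bounded n v Hpoly) as [M HM]. exists (Rabs M + 1). pose proof (Rabs_pos M). pose proof (Rle_abs M).
  split; [lra|]. split.
  - intros z Hz. pose proof (HM (U z) (polyInt_N n v _ (proj1 (HU z Hz)))). lra.
  - intros j Hj. pose proof (HM (p j) (proj1 (p_bd j Hj))). lra.
Qed.

(** The factor 4 creates a gap: a point within [e] of a different value [q k] is at distance at
    least [3 e] from [q j]. Equal values are allowed, as [start_pt] is not yet known to be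
    injective. *)
Lemma separated (q : nat -> C) : exists e, 0 < e /\ forall j k, (j < m)%nat -> (k < m)%nat -> q j = q k \/ 4 * e <= Cmod (q j - q k).
Proof.
  destruct (finite_min m (fun j r => forall k, (k < m)%nat -> q j = q k \/ 4 * r <= Cmod (q j - q k))) as [r [Hr H]].
  - intros j r r' H1 H2 k Hk. destruct (H1 k Hk); [auto|right; lra].
  - intros j Hj. destruct (finite_min m (fun k r => q j = q k \/ 4 * r <= Cmod (q j - q k))) as [r [Hr H]].
    + intros k r r' H1 H2. destruct H1; [auto|right; lra].
    + intros k Hk. destruct (classic (q j = q k)) as [|Hne]; [exists 1; split; [lra|auto]|].
      exists (Cmod (q j - q k) / 4). assert (0 < Cmod (q j - q k)).
      { apply Cmod_gt_0. intros E. apply Hne. replace (q j) with ((q j - q k) + q k)%C by ring. rewrite E. ring. }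
      split; [lra|]. right. lra.
    + exists r. auto.
  - exists r. split; [auto|]. intros j k Hj Hk. apply H; auto.
Qed.

(** The distance from [f] to [q j] avoids the values between [e] and [3 e]; by the intermediate
    value theorem along a segment it cannot pass from one side of the gap to the other. *)
Lemma connected_balls (S : C -> Prop) (f : C -> C) (q : nat -> C) e :
  (forall z z' t, S z -> S z' -> 0 <= t <= 1 -> S (z + RtoC t * (z' - z))%C) ->
  (forall z, S z -> ctends S f z (f z)) -> 0 < e ->
  (forall j k, (j < m)%nat -> (k < m)%nat -> q j = q k \/ 4 * e <= Cmod (q j - q k)) ->
  (forall z, S z -> exists j, (j < m)%nat /\ Cmod (f z - q j) < e) ->
  forall z z' j, S z -> S z' -> (j < m)%nat -> Cmod (f z - q j) < e -> Cmod (f z' - q j) < e.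
Proof.
  intros Hconv Hcont He Hsep Hcov z z' j Hz Hz' Hj Hlt.
  assert (Hgap : forall u, S u -> Cmod (f u - q j) < e \/ 3 * e <= Cmod (f u - q j)).
  { intros u Hu. destruct (Hcov u Hu) as [k [Hk H]]. destruct (Hsep j k Hj Hk) as [E|E]; [left; rewrite E; auto|right].
    pose proof (Cmod_dist_triangle (q j) (f u) (q k)). rewrite (Cmod_minus_sym (q j) (f u)) in H0. lra. }
  destruct (Hgap z' Hz') as [|Hge]; [auto|exfalso].
  (* The parameter is clamped to [[0, 1]] because the intermediate value theorem is applied to a
     function continuous on the whole line. *)
  set (cl := fun t => Rmax 0 (Rmin 1 t)).
  assert (Hcl : forall t, 0 <= cl t <= 1) by (intros t; unfold cl, Rmax, Rmin; destruct (Rle_dec 1 t), (Rle_dec 0 _); lra).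
  assert (HclL : forall t s, Rabs (cl t - cl s) <= Rabs (t - s)).
  { intros t s. apply Rabs_le. pose proof (Rle_abs (t - s)). pose proof (Rle_abs (- (t - s))) as H'. rewrite Rabs_Ropp in H'.
    pose proof (Rabs_pos (t - s)).
    unfold cl, Rmax, Rmin. destruct (Rle_dec 1 t), (Rle_dec 1 s); repeat destruct (Rle_dec 0 _); lra. }
  set (g := fun t => Cmod (f (z + RtoC (cl t) * (z' - z)) - q j)%C).
  assert (Hgc : continuity (fun t => g t - 2 * e)).
  { intros t. apply continuity_pt_filterlim. apply (proj2 (continuous_eps (fun t => g t - 2 * e) t)). intros e' He'.
    assert (Sz : S (z + RtoC (cl t) * (z' - z))%C) by (apply Hconv; auto).
    destruct (Hcont _ Sz e' He') as [d [Hd H]]. pose proof (Cmod_ge_0 (z' - z)).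
    exists (d / (Cmod (z' - z) + 1)). split; [apply Rdiv_lt_0_compat; lra|]. intros s Hs.
    assert (Ss : S (z + RtoC (cl s) * (z' - z))%C) by (apply Hconv; auto).
    specialize (H _ Ss).
    replace (z + RtoC (cl s) * (z' - z) - (z + RtoC (cl t) * (z' - z)))%C with (RtoC (cl s - cl t) * (z' - z))%C in H
      by (rewrite RtoC_minus; ring).
    rewrite Cmod_scal_R in H. pose proof (HclL s t). pose proof (Rabs_pos (cl s - cl t)).
    assert (Rabs (s - t) * (Cmod (z' - z) + 1) < d).
    { apply Rlt_le_trans with (d / (Cmod (z' - z) + 1) * (Cmod (z' - z) + 1)); [apply Rmult_lt_compat_r; lra|right; field; lra]. }
    specialize (H ltac:(nra)). unfold g.
    set (x := f (z + RtoC (cl s) * (z' - z))%C) in *. set (y := f (z + RtoC (cl t) * (z' - z))%C) in *.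
    pose proof (Cmod_dist_triangle x y (q j)). pose proof (Cmod_dist_triangle y x (q j)).
    rewrite (Cmod_minus_sym y x) in H5. apply Rabs_def1; lra. }
  assert (c0 : cl 0 = 0) by (unfold cl, Rmax, Rmin; destruct (Rle_dec 1 0), (Rle_dec 0 _); lra).
  assert (c1 : cl 1 = 1) by (unfold cl, Rmax, Rmin; destruct (Rle_dec 1 1), (Rle_dec 0 _); lra).
  destruct (IVT (fun t => g t - 2 * e) 0 1 Hgc ltac:(lra)) as [t [Ht E]].
  - unfold g. rewrite c0. replace (z + RtoC 0 * (z' - z))%C with z by ring. lra.
  - unfold g. rewrite c1. replace (z + RtoC 1 * (z' - z))%C with z' by ring. lra.
  - destruct (Hgap (z + RtoC (cl t) * (z' - z))%C) as [H|H]; [apply Hconv; auto| |]; fold (g t) in H; lra.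
Qed.

Lemma radial_point c del : Cmod c = 1 -> 0 < del -> exists z, Cmod z < 1 /\ Cmod (z - c) < del.
Proof.
  intros Hc Hd. set (t := Rmin del 1 / 2). assert (0 < Rmin del 1) by (apply Rmin_pos; lra).
  pose proof (Rmin_l del 1). pose proof (Rmin_r del 1).
  exists (RtoC (1 - t) * c)%C. split.
  - rewrite Cmod_scal_R, Hc, Rabs_pos_eq; unfold t; lra.
  - replace (RtoC (1 - t) * c - c)%C with (RtoC (- t) * c)%C by (rewrite RtoC_minus, RtoC_opp; ring).
    rewrite Cmod_scal_R, Hc, Rabs_Ropp, Rabs_pos_eq; unfold t; lra.
Qed.

(** Compactness puts [U z] within [e] of the finite set of points [p j] once [z] is close to [c];
    the part of the disc close to [c] is convex, so [connected_balls] selects a single [j]. *)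
Lemma U_limit c : Cmod c = 1 -> (forall j, (j < m)%nat -> c <> start_pt j) ->
  exists j, (j < m)%nat /\ ctends (fun z => Cmod z < 1) U c (p j).
Proof.
  intros Hc Hne. destruct U_bounded as [M [HM0 [HM _]]].
  assert (A : forall e, 0 < e -> exists d, 0 < d /\ forall z, Cmod z < 1 -> Cmod (z - c) < d -> exists j, (j < m)%nat /\ Cmod (U z - p j) < e).
  { intros e He. destruct (classic (exists d, 0 < d /\ forall z, Cmod z < 1 -> Cmod (z - c) < d -> exists j, (j < m)%nat /\ Cmod (U z - p j) < e)) as [|Hno]; [auto|exfalso].
    destruct (cluster_point (fun k u => exists z, Cmod z < 1 /\ Cmod (z - c) < / (INR k + 1) /\ u = U z /\
       forall j, (j < m)%nat -> e <= Cmod (u - p j)) M) as [l Hl].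
    { intros k. apply not_all_not_ex. intros Hall. apply Hno. exists (/ (INR k + 1)). pose proof (pos_INR k).
      split; [apply Rinv_0_lt_compat; lra|]. intros z Hz Hzc. apply not_all_not_ex. intros Hall2.
      apply (Hall (U z)). split; [|apply HM; auto]. exists z. repeat split; auto. intros j Hj.
      apply Rnot_lt_le. intros Hlt. apply (Hall2 j). auto. }
    assert (Hcl : U_cluster c l).
    { intros e' He'. destruct (inv_nat_small e' He') as [k0 Hk0]. destruct (Hl e' He' k0) as [k [u [Hk [[z [Hz [Hzc [-> _]]]] Hul]]]].
      specialize (Hk0 k Hk). exists z. repeat split; auto. lra. }
    destruct (U_cluster_p c l Hc Hne Hcl) as [j [Hj E]].
    destruct (Hl e He 0%nat) as [k [u [_ [[z [_ [_ [_ Hu]]]] Hul]]]]. specialize (Hu j Hj). rewrite E in Hul. lra. }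
  destruct (separated p) as [e0 [He0 Hsep]].
  destruct (A e0 He0) as [d0 [Hd0 HA0]].
  destruct (radial_point c d0 Hc Hd0) as [z0 [Hz0 Hz0c]]. destruct (HA0 z0 Hz0 Hz0c) as [j [Hj Hjz]].
  exists j. split; [auto|]. intros e He.
  assert (Hball : forall z, Cmod z < 1 -> Cmod (z - c) < d0 -> Cmod (U z - p j) < e0).
  { intros z Hz Hzc.
    apply (connected_balls (fun u => Cmod u < 1 /\ Cmod (u - c) < d0) U p e0) with (z := z0); auto.
    - intros a b t [Ha1 Ha2] [Hb1 Hb2] Ht. split; [apply disc_segment; auto|apply segment_dist; auto].
    - intros u [Hu _] e' He'. destruct (U_cont u Hu e' He') as [d [Hd H]]. exists d. split; [auto|].
      intros w [Hw _]. apply H; auto.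
    - intros u [Hu1 Hu2]. apply HA0; auto. }
  destruct (A e He) as [d1 [Hd1 HA1]]. exists (Rmin d0 d1). split; [apply Rmin_pos; auto|]. intros z Hz Hzc.
  pose proof (Rmin_l d0 d1). pose proof (Rmin_r d0 d1).
  destruct (HA1 z Hz ltac:(lra)) as [k [Hk Hkz]]. specialize (Hball z Hz ltac:(lra)).
  destruct (HA0 z Hz ltac:(lra)) as [k' [Hk' Hkz']].
  destruct (Rle_lt_dec e e0) as [Hee|Hee]; [|lra].
  destruct (Hsep j k Hj Hk) as [E|E]; [rewrite E; auto|exfalso].
  pose proof (Cmod_dist_triangle (p j) (U z) (p k)). rewrite (Cmod_minus_sym (p j) (U z)) in H1. lra.
Qed.

(** ** Decomposition of the circle into arcs *)

Local Notation Dsc := (fun z => Cmod z < 1).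

Lemma U_limit_unique c l l' : Cmod c = 1 -> ctends Dsc U c l -> ctends Dsc U c l' -> l = l'.
Proof.
  intros Hc H1 H2. apply limit_point_eq. intros e He.
  destruct (H1 (e / 2)) as [d1 [Hd1 K1]]; [lra|]. destruct (H2 (e / 2)) as [d2 [Hd2 K2]]; [lra|].
  destruct (radial_point c (Rmin d1 d2) Hc) as [z [Hz Hzc]]; [apply Rmin_pos; auto|].
  pose proof (Rmin_l d1 d2). pose proof (Rmin_r d1 d2).
  specialize (K1 z Hz ltac:(lra)). specialize (K2 z Hz ltac:(lra)). rewrite Cmod_minus_sym in K1.
  pose proof (Cmod_dist_triangle l (U z) l'). lra.
Qed.

Lemma arc_constant t1 t2 : t1 < t2 -> (forall x, t1 < x < t2 -> forall j, (j < m)%nat -> expi x <> start_pt j) ->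
  exists j, (j < m)%nat /\ forall x, t1 < x < t2 -> ctends Dsc U (expi x) (p j).
Proof.
  intros Ht Hne.
  set (g := fun x => epsilon (inhabits (RtoC 0)) (fun q => exists j, (j < m)%nat /\ q = p j /\ ctends Dsc U (expi x) q)).
  assert (Hg : forall x, t1 < x < t2 -> exists j, (j < m)%nat /\ g x = p j /\ ctends Dsc U (expi x) (g x)).
  { intros x Hx. unfold g. apply epsilon_spec. destruct (U_limit (expi x) (Cmod_expi x) (Hne x Hx)) as [j [Hj Hl]].
    exists (p j), j. auto. }
  destruct (separated p) as [e0 [He0 Hsep]].
  destruct (Hg ((t1 + t2) / 2) ltac:(lra)) as [j [Hj [Ej _]]]. exists j. split; [auto|]. intros x Hx.
  rewrite <- Ej. rewrite (locally_constant g t1 t2) with (s' := x); try lra; [destruct (Hg x Hx) as [? [_ [_ HH]]]; exact HH|].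
  intros y Hy. destruct (Hg y Hy) as [k [Hk [Ek Hl]]]. destruct (Hl e0 He0) as [d [Hd H]].
  exists (d / 4). split; [lra|]. intros y' Hy' Hyt. destruct (Hg y' Hyt) as [k' [Hk' [Ek' Hl']]].
  destruct (Hl' e0 He0) as [d' [Hd' H']].
  destruct (radial_point (expi y') (Rmin d' (d / 2)) (Cmod_expi y')) as [z [Hz Hzc]]; [apply Rmin_pos; lra|].
  pose proof (Rmin_l d' (d / 2)). pose proof (Rmin_r d' (d / 2)).
  pose proof (expi_lipschitz y' y). pose proof (Cmod_dist_triangle z (expi y') (expi y)).
  specialize (H z Hz ltac:(lra)). specialize (H' z Hz ltac:(lra)).
  rewrite Ek in H |- *. rewrite Ek' in H' |- *.
  destruct (Hsep k' k Hk' Hk) as [E|E]; [auto|exfalso].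
  pose proof (Cmod_dist_triangle (p k') (U z) (p k)). rewrite (Cmod_minus_sym (p k') (U z)) in H4. lra.
Qed.

(** Cutting the circle at [start_pt b] makes the arcs 0 and [d - 1] the two adjacent to that point,
    and [jf i] is the index of the value of [U] on arc [i]. The base [b] stays free: it will be the
    limit of [V] at a breakpoint supposed to be missed. *)
Definition arc_system (b d : nat) (t : nat -> R) (jf : nat -> nat) : Prop :=
  (1 <= d <= m)%nat /\ expi (t 0%nat) = start_pt b /\ t d = t 0%nat + 2 * PI /\
  (forall i, (i < d)%nat -> t i < t (S i)) /\
  (forall i, (i < d)%nat -> (jf i < m)%nat /\ forall x, t i < x < t (S i) ->
     (forall j, (j < m)%nat -> expi x <> start_pt j) /\ ctends Dsc U (expi x) (p (jf i))).

Lemma step_mono (t : nat -> R) d : (forall i, (i < d)%nat -> t i < t (S i)) -> forall i j, (i < j <= d)%nat -> t i < t j.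
Proof.
  intros H i j. induction j; intros Hij; [lia|].
  destruct (Nat.eq_dec i j) as [->|]; [apply H; lia|].
  specialize (IHj ltac:(lia)). specialize (H j ltac:(lia)). lra.
Qed.

Lemma arc_system_ex b : (b < m)%nat -> exists d t jf, arc_system b d t jf /\
  forall i, (i < d)%nat -> exists j, (j < m)%nat /\ expi (t i) = start_pt j.
Proof.
  intros Hb. pose proof PI_RGT_0.
  destruct (expi_arg (start_pt b) 0 (start_pt_mod b Hb)) as [a0 [_ Ea0]].
  destruct (choice_nat (fun j x => (j < m)%nat -> a0 <= x < a0 + 2 * PI /\ start_pt j = expi x)) as [al Hal].
  { intros j. destruct (Nat.lt_ge_cases j m) as [Hj|Hj].
    - destruct (expi_arg (start_pt j) a0 (start_pt_mod j Hj)) as [x [Hx Ex]]. exists x. auto.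
    - exists 0. intros. lia. }
  assert (Hab : al b = a0).
  { destruct (Hal b Hb) as [Hr E]. apply expi_inj; [apply Rabs_def1; lra|congruence]. }
  destruct (sort_reals (map al (seq 0 m))) as [d [t0 [Hd [Hinc Hin]]]].
  rewrite length_map, length_seq in Hd.
  assert (Hrange : forall i, (i < d)%nat -> a0 <= t0 i < a0 + 2 * PI).
  { intros i Hi. assert (HI : In (t0 i) (map al (seq 0 m))) by (apply Hin; exists i; auto).
    apply in_map_iff in HI. destruct HI as [j [E Hj]]. apply in_seq in Hj. rewrite <- E. apply Hal. lia. }
  assert (Hind : forall j, (j < m)%nat -> exists i, (i < d)%nat /\ al j = t0 i).
  { intros j Hj. apply Hin. apply in_map. apply in_seq. lia. }
  destruct (Hind b Hb) as [i0 [Hi0 E0]]. rewrite Hab in E0.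
  set (t := fun i => if le_lt_dec d i then a0 + 2 * PI else t0 i).
  assert (Ht : forall i, (i < d)%nat -> t i = t0 i) by (intros i Hi; unfold t; destruct (le_lt_dec d i); [lia|auto]).
  assert (Htd : t d = a0 + 2 * PI) by (unfold t; destruct (le_lt_dec d d); [auto|lia]).
  assert (Hinc2 : forall i, (i < d)%nat -> t i < t (S i)).
  { intros i Hi. rewrite Ht by auto. unfold t. destruct (le_lt_dec d (S i)); [apply Hrange; auto|apply Hinc; auto]. }
  assert (Ht00 : t 0%nat = a0).
  { rewrite Ht by lia. apply Rle_antisym; [|apply Hrange; lia]. rewrite E0.
    destruct (Nat.eq_dec i0 0) as [->|]; [lra|]. left. rewrite <- !Ht by lia. apply (step_mono t d Hinc2). lia. }
  assert (Harc : forall i, (i < d)%nat -> forall x, t i < x < t (S i) -> forall j, (j < m)%nat -> expi x <> start_pt j).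
  { intros i Hi x Hx j Hj E. destruct (Hal j Hj) as [Hr Ej].
    assert (Hxr : a0 < x < a0 + 2 * PI).
    { rewrite <- Ht00 at 1. rewrite <- Htd. split.
      - destruct (Nat.eq_dec i 0) as [->|]; [lra|]. pose proof (step_mono t d Hinc2 0 i ltac:(lia)). lra.
      - destruct (Nat.eq_dec (S i) d) as [<-|]; [lra|]. pose proof (step_mono t d Hinc2 (S i) d ltac:(lia)). lra. }
    assert (Exj : x = al j) by (apply expi_inj; [apply Rabs_def1; lra|congruence]).
    destruct (Hind j Hj) as [i' [Hi' E']]. rewrite <- Ht in E' by auto. rewrite Exj, E' in Hx.
    destruct (Nat.lt_trichotomy i' i) as [Hlt|[->|Hlt]]; [|lra|].
    - pose proof (step_mono t d Hinc2 i' i ltac:(lia)). lra.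
    - destruct (Nat.eq_dec i' (S i)) as [->|]; [lra|]. pose proof (step_mono t d Hinc2 (S i) i' ltac:(lia)). lra. }
  destruct (choice_nat (fun i j => (i < d)%nat -> (j < m)%nat /\ forall x, t i < x < t (S i) -> ctends Dsc U (expi x) (p j))) as [jf Hjf].
  { intros i. destruct (Nat.lt_ge_cases i d) as [Hi|Hi].
    - destruct (arc_constant (t i) (t (S i)) (Hinc2 i Hi) (Harc i Hi)) as [j [Hj Hl]]. exists j. auto.
    - exists 0%nat. intros. lia. }
  exists d, t, jf. split.
  2:{ intros i Hi. rewrite Ht by auto. assert (HI : In (t0 i) (map al (seq 0 m))) by (apply Hin; exists i; auto).
    apply in_map_iff in HI. destruct HI as [j [E Hj]]. apply in_seq in Hj. exists j. split; [lia|].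
    rewrite <- E. symmetry. apply Hal. lia. }
  split; [lia|]. split; [rewrite Ht00; auto|]. split; [rewrite Ht00; auto|]. split; [auto|].
  intros i Hi. destruct (Hjf i Hi) as [H1 H2]. split; [auto|]. intros x Hx. split; [apply (Harc i Hi x Hx)|auto].
Qed.

(** Stated for a functional [pr] of [U], so as to cover the two coordinates and the height over each
    edge. *)
Lemma arc_representation b d t jf u F B (pr : C -> R) : arc_system b d t jf -> re_hol u F ->
  (forall z, Cmod z < 1 -> u z = pr (U z)) -> (forall z, Cmod z < 1 -> Rabs (u z) <= B) ->
  (forall l eps, 0 < eps -> exists del, 0 < del /\ forall z, Cmod (z - l) < del -> Rabs (pr z - pr l) < eps) ->
  forall zeta, Cmod zeta < 1 -> u zeta = rsum d (fun i => pr (p (jf i)) * harm_measure zeta (t i) (t (S i))).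
Proof.
  intros [_ [_ [Hper [Hinc Harc]]]] [HF HuF] Hpr HB Hprc zeta Hz. rewrite HuF by auto.
  apply (poisson_piecewise F B HF) with (P := fun i => pr (p (jf i))); auto.
  - intros z Hz'. rewrite <- HuF by auto. auto.
  - intros i Hi x Hx eps He. destruct (Harc i Hi) as [_ H]. destruct (H x Hx) as [_ Hl].
    destruct (Hprc (p (jf i)) eps He) as [d1 [Hd1 H1]]. destruct (Hl d1 Hd1) as [d2 [Hd2 H2]].
    exists d2. split; [auto|]. intros z Hz' Hzx. rewrite <- HuF, Hpr by auto. apply H1, H2; auto.
Qed.

Lemma fst_rep b d t jf zeta : arc_system b d t jf -> Cmod zeta < 1 ->
  fst (U zeta) = rsum d (fun i => fst (p (jf i)) * harm_measure zeta (t i) (t (S i))).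
Proof.
  intros HA Hz. destruct U_bounded as [M [_ [HM _]]].
  apply (arc_representation b d t jf (fun z => fst (U z)) _ M fst HA U_fst_re); auto.
  - intros z Hz'. eapply Rle_trans; [apply fst_le_Cmod|auto].
  - intros l eps He. exists eps. split; [auto|]. intros z Hzl. eapply Rle_lt_trans; [apply (fst_le_Cmod (z - l))|auto].
Qed.

Lemma snd_rep b d t jf zeta : arc_system b d t jf -> Cmod zeta < 1 ->
  snd (U zeta) = rsum d (fun i => snd (p (jf i)) * harm_measure zeta (t i) (t (S i))).
Proof.
  intros HA Hz. destruct U_bounded as [M [_ [HM _]]].
  apply (arc_representation b d t jf (fun z => snd (U z)) _ M snd HA U_snd_re); auto.
  - intros z Hz'. eapply Rle_trans; [apply snd_le_Cmod|auto].
  - intros l eps He. exists eps. split; [auto|]. intros z Hzl. eapply Rle_lt_trans; [apply (snd_le_Cmod (z - l))|auto].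
Qed.

Lemma height_rep b d t jf e zeta : arc_system b d t jf -> Cmod zeta < 1 ->
  ht e (U zeta) = rsum d (fun i => ht e (p (jf i)) * harm_measure zeta (t i) (t (S i))).
Proof.
  intros HA Hz. destruct U_bounded as [M [HM0 [HM _]]].
  apply (arc_representation b d t jf (fun z => ht e (U z)) _ (Cmod (tau e) * (M + Cmod (v e))) (ht e) HA (height_re e)); auto.
  - intros z Hz'. unfold height. eapply Rle_trans; [apply cross_le|]. apply Rmult_le_compat_l; [apply Cmod_ge_0|].
    unfold Cminus. eapply Rle_trans; [apply Cmod_triangle|]. rewrite Cmod_opp. specialize (HM z Hz'). lra.
  - intros l eps He. apply height_cont; auto.
Qed.

Lemma total_measure b d t jf zeta : arc_system b d t jf -> Cmod zeta < 1 ->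
  rsum d (fun i => harm_measure zeta (t i) (t (S i))) = 1.
Proof.
  intros [_ [_ [Hper [Hinc _]]]] Hz.
  rewrite <- (rsum_ext d (fun i => 1 * harm_measure zeta (t i) (t (S i)))) by (intros; ring).
  symmetry. apply (poisson_piecewise (fun _ => 1%C) 1 (hol_const _ _)) with (P := fun _ => 1); auto.
  - intros z _. simpl. rewrite Rabs_R1. lra.
  - intros i Hi x Hx eps He. exists 1. split; [lra|]. intros z _ _. simpl. rewrite Rminus_diag, Rabs_R0. auto.
Qed.

Lemma harm_nonneg zeta a b : Cmod zeta < 1 -> a <= b -> 0 <= harm_measure zeta a b.
Proof.
  intros Hz Hab. pose proof PI_RGT_0. change (0 <= / (2 * PI) * RInt (poisson_ker zeta) a b).
  apply Rmult_le_pos; [left; apply Rinv_0_lt_compat; lra|]. apply RInt_ge_0; [auto| |].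
  - apply ex_RInt_cont. intros; apply poisson_ker_cont; auto.
  - intros x _. left. apply poisson_ker_pos; auto.
Qed.

(** Away from the arc the denominator of the Poisson kernel stays above [(mu / 2)^2], while the
    numerator is at most [2 (1 - |zeta|)]. The linear rate, and not only the limit 0, is what the
    argument at kinks requires. *)
Lemma harm_far c a b : a < b -> (forall x, a <= x <= b -> expi x <> c) -> exists K del, 0 < K /\ 0 < del /\
  forall zeta, Cmod zeta < 1 -> Cmod (zeta - c) < del -> harm_measure zeta a b <= K * (1 - Cmod zeta).
Proof.
  intros Hab Hne. pose proof PI_RGT_0.
  destruct (continuity_ab_min (fun x => Cmod (expi x - c)%C) a b ltac:(lra)) as [x0 [Hmin Hx0]].
  { intros x _. apply continuity_pt_filterlim. apply pcont_Cmod, pcont_minus; [apply pcont_expi|apply pcont_const]. }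
  set (mu := Cmod (expi x0 - c)).
  assert (Hmu : 0 < mu).
  { apply Cmod_gt_0. intros E. apply (Hne x0 Hx0). replace c with (c + 0)%C by ring. rewrite <- E. ring. }
  exists (/ (2 * PI) * ((b - a) * (8 / mu ^ 2))), (mu / 2).
  assert (Hmu2 : 0 < mu ^ 2) by (apply pow_lt; auto).
  assert (Hi : 0 < / (2 * PI)) by (apply Rinv_0_lt_compat; lra).
  assert (H8 : 0 < 8 / mu ^ 2) by (apply Rdiv_lt_0_compat; lra).
  split; [apply Rmult_lt_0_compat; [auto|apply Rmult_lt_0_compat; lra]|]. split; [lra|].
  intros zeta Hz Hzc. change (/ (2 * PI) * RInt (poisson_ker zeta) a b <= / (2 * PI) * ((b - a) * (8 / mu ^ 2)) * (1 - Cmod zeta)).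
  rewrite Rmult_assoc. apply Rmult_le_compat_l; [lra|].
  eapply Rle_trans; [apply Rle_abs|]. rewrite Rmult_assoc. apply abs_RInt_le_const; [lra| |].
  - apply ex_RInt_cont. intros; apply poisson_ker_cont; auto.
  - intros x Hx. rewrite Rabs_pos_eq by (left; apply poisson_ker_pos; auto). unfold poisson_ker.
    specialize (Hmin x Hx). fold mu in Hmin. pose proof (Cmod_dist_triangle (expi x) zeta c).
    set (y := Cmod (expi x - zeta)) in *. assert (Hy : mu / 2 <= y) by lra. pose proof (Cmod_ge_0 zeta).
    assert (Hy2 : 0 < y ^ 2) by (apply pow_lt; lra).
    assert (Hyy : (mu / 2) ^ 2 <= y ^ 2) by (apply pow_incr; lra).
    apply Rmult_le_reg_r with (y ^ 2); [auto|]. unfold Rdiv at 1. rewrite Rmult_assoc, Rinv_l, Rmult_1_r by lra.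
    apply Rle_trans with (8 / mu ^ 2 * (1 - Cmod zeta) * (mu / 2) ^ 2).
    + replace (8 / mu ^ 2 * (1 - Cmod zeta) * (mu / 2) ^ 2) with (2 * (1 - Cmod zeta)) by (field; lra). nra.
    + apply Rmult_le_compat_l; [|auto]. apply Rmult_le_pos; lra.
Qed.

Lemma inner_arc_far b d t jf i : arc_system b d t jf -> (0 < i)%nat -> (S i < d)%nat -> exists K del, 0 < K /\ 0 < del /\
  forall zeta, Cmod zeta < 1 -> Cmod (zeta - start_pt b) < del -> harm_measure zeta (t i) (t (S i)) <= K * (1 - Cmod zeta).
Proof.
  intros [_ [E0 [Hper [Hinc _]]]] Hi Hid. apply harm_far; [apply Hinc; lia|].
  intros x Hx E. pose proof (step_mono t d Hinc 0 i ltac:(lia)). pose proof (step_mono t d Hinc (S i) d ltac:(lia)).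
  rewrite <- E0 in E. assert (x = t 0%nat) by (apply expi_inj; [apply Rabs_def1; lra|auto]). lra.
Qed.

Lemma V_mod_limit z0 c : Cmod c = 1 -> ctends N0 V z0 c -> forall eps, 0 < eps -> exists del, 0 < del /\
  forall z, N0 z -> Cmod (z - z0) < del -> 0 < 1 - Cmod (V z) < eps.
Proof.
  intros Hc Hl eps He. destruct (Hl eps He) as [d [Hd H]]. exists d. split; [auto|]. intros z Hz Hzd.
  specialize (H z Hz Hzd). destruct (V_spec z Hz) as [H1 _]. rewrite Cmod_minus_sym in H.
  pose proof (Cmod_triangle_sub c (V z)). lra.
Qed.

(** Since the harmonic measures add up to 1, [pr z - pr (p (jf y))] is a sum over the arcs other
    than [y], which tends to 0, while [U (V z) = z] tends to the edge point. The functional [pr] is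
    either coordinate. *)
Lemma single_arc_limit b d t jf i s y : arc_system b d t jf -> (i < n)%nat -> 0 < s < 1 -> (y < d)%nat ->
  (forall i', (i' < d)%nat -> i' <> y -> forall eps, 0 < eps -> exists del, 0 < del /\
     forall z, N0 z -> Cmod (z - edge i s) < del -> harm_measure (V z) (t i') (t (S i')) < eps) ->
  edge i s = p (jf y).
Proof.
  intros HA Hi Hs Hy Hsm. pose proof HA as [_ [_ [_ [Hinc _]]]].
  assert (Key : forall pr : C -> R, (forall a b, Rabs (pr a - pr b) <= Cmod (a - b)) ->
    (forall zeta, Cmod zeta < 1 -> pr (U zeta) = rsum d (fun i => pr (p (jf i)) * harm_measure zeta (t i) (t (S i)))) ->
    pr (edge i s) = pr (p (jf y))).
  { intros pr Hlip Hrep. apply Rminus_diag_uniq, Rabs_eq_0. apply Rle_antisym; [|apply Rabs_pos].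
    apply le_epsilon. intros e He. rewrite Rplus_0_l.
    destruct (rsum_small d N0 (edge i s) (fun i' z => (pr (p (jf i')) - pr (p (jf y))) * harm_measure (V z) (t i') (t (S i'))))
      with (eps := e / 2) as [d1 [Hd1 H1]]; [|lra|].
    - intros i' Hi' eps Heps. destruct (Nat.eq_dec i' y) as [->|Hne].
      + exists 1. split; [lra|]. intros z _ _. rewrite Rminus_diag, Rmult_0_l, Rabs_R0. auto.
      + set (K := Rabs (pr (p (jf i')) - pr (p (jf y))) + 1).
        assert (HK : 0 < K) by (unfold K; pose proof (Rabs_pos (pr (p (jf i')) - pr (p (jf y)))); lra).
        destruct (Hsm i' Hi' Hne (eps / K)) as [d' [Hd' H']]; [apply Rdiv_lt_0_compat; auto|].
        exists d'. split; [auto|]. intros z Hz Hzd. specialize (H' z Hz Hzd).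
        assert (H0 : 0 <= harm_measure (V z) (t i') (t (S i'))).
        { apply harm_nonneg; [apply V_spec; auto|left; apply Hinc; auto]. }
        rewrite Rabs_mult, (Rabs_pos_eq (harm_measure _ _ _)) by auto.
        apply Rle_lt_trans with (K * harm_measure (V z) (t i') (t (S i'))).
        * apply Rmult_le_compat_r; [auto|unfold K; lra].
        * apply Rlt_le_trans with (K * (eps / K)); [apply Rmult_lt_compat_l; auto|right; field; lra].
    - destruct (edge_approach i s Hi Hs (Rmin d1 (e / 2))) as [z [Hz Hzd]]; [apply Rmin_pos; lra|].
      pose proof (Rmin_l d1 (e / 2)). pose proof (Rmin_r d1 (e / 2)).
      specialize (H1 z Hz ltac:(lra)). destruct (V_spec z Hz) as [Vz [_ UV]].
      assert (E : rsum d (fun i' => (pr (p (jf i')) - pr (p (jf y))) * harm_measure (V z) (t i') (t (S i'))) = pr z - pr (p (jf y))).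
      { rewrite (rsum_ext d _ (fun i' => pr (p (jf i')) * harm_measure (V z) (t i') (t (S i')) +
           - pr (p (jf y)) * harm_measure (V z) (t i') (t (S i')))) by (intros; ring).
        rewrite rsum_plus, rsum_scal, (total_measure b d t jf (V z) HA Vz), <- Hrep, UV by auto. ring. }
      rewrite E in H1. pose proof (Hlip (edge i s) z). rewrite (Cmod_minus_sym (edge i s) z) in H2.
      replace (pr (edge i s) - pr (p (jf y))) with ((pr (edge i s) - pr z) + (pr z - pr (p (jf y)))) by ring.
      eapply Rle_trans; [apply Rabs_triang|]. lra. }
  apply Ceq.
  - apply Key; [intros a b'; apply (fst_le_Cmod (a - b'))|intros; eapply fst_rep; eauto].
  - apply Key; [intros a b'; apply (snd_le_Cmod (a - b'))|intros; eapply snd_rep; eauto].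
Qed.

(** If the value on arc [x] had positive height, the vanishing of the height at the edge would force
    the harmonic measure of that arc to 0, and the inner arcs are far away; arc [y] alone would
    remain, so [edge i s1] and [edge i s2] would both equal [p (jf y)]. For [d = 1] the two adjacent
    arcs coincide. *)
Lemma adjacent_height_zero b d t jf i s1 s2 x y : (b < m)%nat -> arc_system b d t jf -> (i < n)%nat -> 0 < s1 < 1 -> 0 < s2 < 1 -> s1 <> s2 ->
  ctends N0 V (edge i s1) (start_pt b) -> ctends N0 V (edge i s2) (start_pt b) ->
  (x = 0 /\ S y = d \/ y = 0 /\ S x = d)%nat -> ht i (p (jf x)) = 0.
Proof.
  intros Hb HA Hi Hs1 Hs2 Hne L1 L2 Hxy. pose proof HA as [Hd [_ [_ [Hinc Harc]]]].
  assert (Hx : (x < d)%nat) by lia. assert (Hy : (y < d)%nat) by lia.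
  assert (Hk0 : 0 <= ht i (p (jf x))) by (apply (proj1 (p_bd _ (proj1 (Harc x Hx)))); auto).
  destruct (Rle_lt_dec (ht i (p (jf x))) 0) as [|Hk]; [lra|exfalso].
  assert (Key : forall s, 0 < s < 1 -> ctends N0 V (edge i s) (start_pt b) -> edge i s = p (jf y)).
  { intros s Hs Hl. apply (single_arc_limit b d t jf i s y HA Hi Hs Hy).
    intros i' Hi' Hne' eps He. destruct (Nat.eq_dec i' x) as [->|Hnx].
    - destruct (height_cont n v i (edge i s) (ht i (p (jf x)) * eps)) as [d1 [Hd1 H1]]; [apply Rmult_lt_0_compat; auto|].
      exists d1. split; [auto|]. intros z Hz Hzd. specialize (H1 z Hzd). rewrite height_edge_self, Rminus_0_r in H1.
      apply Rabs_def2 in H1. destruct (V_spec z Hz) as [Vz [_ UV]].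
      pose proof (height_rep b d t jf i (V z) HA Vz) as E. rewrite UV in E.
      assert (ht i (p (jf x)) * harm_measure (V z) (t x) (t (S x)) <= ht i z).
      { rewrite E. apply (rsum_term_le d (fun i0 => ht i (p (jf i0)) * harm_measure (V z) (t i0) (t (S i0)))); [|auto].
        intros j Hj. apply Rmult_le_pos.
        - apply (proj1 (p_bd _ (proj1 (Harc j Hj)))); auto.
        - apply harm_nonneg; [auto|left; apply Hinc; auto]. }
      apply Rmult_lt_reg_l with (ht i (p (jf x))); lra.
    - destruct (inner_arc_far b d t jf i' HA ltac:(lia) ltac:(lia)) as [K [dl [HK [Hdl H]]]].
      destruct (Hl dl Hdl) as [d1 [Hd1 H1]].
      destruct (V_mod_limit (edge i s) (start_pt b) (start_pt_mod b Hb) Hl (eps / K)) as [d2 [Hd2 H2]]; [apply Rdiv_lt_0_compat; auto|].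
      exists (Rmin d1 d2). split; [apply Rmin_pos; auto|]. intros z Hz Hzd.
      pose proof (Rmin_l d1 d2). pose proof (Rmin_r d1 d2).
      specialize (H1 z Hz ltac:(lra)). specialize (H2 z Hz ltac:(lra)).
      eapply Rle_lt_trans; [apply H; auto; apply V_spec; auto|].
      apply Rlt_le_trans with (K * (eps / K)); [apply Rmult_lt_compat_l; lra|right; field; lra]. }
  pose proof (edge_dist n v i s1 s2) as D. rewrite (Key s1 Hs1 L1), (Key s2 Hs2 L2), Cminus_diag, Cmod_0 in D.
  pose proof (side_neq0 n v Hpoly i Hi). symmetry in D. apply Rmult_integral in D. destruct D as [D|D]; [|lra].
  apply Rabs_eq_0 in D. lra.
Qed.

(** ** Every breakpoint is a boundary value *)

Definition attained (k : nat) : Prop := exists c, Cmod c = 1 /\ (forall j, (j < m)%nat -> c <> start_pt j) /\ ctends Dsc U c (p k).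

Lemma p_approach k del : (k < m)%nat -> 0 < del -> exists z, N0 z /\ Cmod (z - p k) < del.
Proof.
  intros Hk Hd. destruct (p_param k Hk) as [i [t [Hi [Ht E]]]]. pose proof (side_neq0 n v Hpoly i Hi) as Htau.
  set (h := Rmin ((1 - t) / 2) (del / (2 * Cmod (tau i)))).
  assert (Hh : 0 < h) by (apply Rmin_pos; [lra|apply Rdiv_lt_0_compat; lra]).
  assert (H1 : h <= (1 - t) / 2) by apply Rmin_l. assert (H2 : h <= del / (2 * Cmod (tau i))) by apply Rmin_r.
  destruct (edge_approach i (t + h) Hi ltac:(lra) (del / 2) ltac:(lra)) as [z [Hz Hzd]].
  exists z. split; [auto|]. rewrite E. pose proof (Cmod_dist_triangle z (edge i (t + h)) (edge i t)) as T.
  rewrite edge_dist in T. replace (t + h - t) with h in T by ring. rewrite Rabs_pos_eq in T by lra.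
  assert (h * Cmod (tau i) <= del / 2).
  { apply Rle_trans with (del / (2 * Cmod (tau i)) * Cmod (tau i)); [apply Rmult_le_compat_r; lra|right; field; lra]. }
  lra.
Qed.

(** Mirror image of [U_limit]. A cluster value of [V] at [p k] inside the disc would be sent by [U]
    to the boundary; on the circle, if it is no [start_pt j], then [U] has a limit there, which must
    be [p k]. So [V] stays close to finitely many points, and convexity of the neighbourhood selects
    one. *)
Lemma not_attained_limit k : (k < m)%nat -> ~ attained k -> exists b, (b < m)%nat /\ ctends N0 V (p k) (start_pt b).
Proof.
  intros Hk Hno.
  assert (A : forall e, 0 < e -> exists d, 0 < d /\ forall z, N0 z -> Cmod (z - p k) < d -> exists j, (j < m)%nat /\ Cmod (V z - start_pt j) < e).
  { intros e He. destruct (classic (exists d, 0 < d /\ forall z, N0 z -> Cmod (z - p k) < d -> exists j, (j < m)%nat /\ Cmod (V z - start_pt j) < e)) as [|Hn]; [auto|exfalso].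
    destruct (cluster_point (fun q u => exists z, N0 z /\ Cmod (z - p k) < / (INR q + 1) /\ u = V z /\
       forall j, (j < m)%nat -> e <= Cmod (u - start_pt j)) 1) as [l Hl].
    { intros q. apply not_all_not_ex. intros Hall. apply Hn. exists (/ (INR q + 1)). pose proof (pos_INR q).
      split; [apply Rinv_0_lt_compat; lra|]. intros z Hz Hzc. apply not_all_not_ex. intros Hall2.
      apply (Hall (V z)). split; [|left; apply V_spec; auto]. exists z. repeat split; auto. intros j Hj.
      apply Rnot_lt_le. intros Hlt. apply (Hall2 j). auto. }
    assert (Hlu : forall eps, 0 < eps -> exists z, N0 z /\ Cmod (z - p k) < eps /\ Cmod (V z - l) < eps).
    { intros e' He'. destruct (inv_nat_small e' He') as [k0 Hk0]. destruct (Hl e' He' k0) as [q [u [Hq [[z [Hz [Hzc [-> _]]]] Hul]]]].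
      specialize (Hk0 q Hq). exists z. repeat split; auto. lra. }
    assert (Hlim : forall q, ctends Dsc U l q -> q = p k).
    { intros q Hq. apply limit_point_eq. intros e' He'. destruct (Hq (e' / 2)) as [d [Hd H]]; [lra|].
      destruct (Hlu (Rmin d (e' / 2))) as [z [Hz [H1 H2]]]; [apply Rmin_pos; lra|].
      pose proof (Rmin_l d (e' / 2)). pose proof (Rmin_r d (e' / 2)).
      destruct (V_spec z Hz) as [Vz [_ UV]]. specialize (H (V z) Vz ltac:(lra)). rewrite UV in H.
      pose proof (Cmod_dist_triangle q z (p k)). rewrite (Cmod_minus_sym q z) in H4. lra. }
    assert (Hl1 : Cmod l <= 1).
    { apply le_epsilon. intros e' He'. destruct (Hlu e' He') as [z [Hz [_ H2]]]. destruct (V_spec z Hz) as [Vz _].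
      rewrite Cmod_minus_sym in H2. pose proof (Cmod_triangle_sub l (V z)). lra. }
    destruct (Rle_lt_dec 1 (Cmod l)) as [Hge|Hlt].
    - assert (Hl2 : Cmod l = 1) by lra.
      assert (Hlne : forall j, (j < m)%nat -> l <> start_pt j).
      { intros j Hj E. destruct (Hl e He 0%nat) as [q [u [_ [[z [_ [_ [_ Hu]]]] Hul]]]]. specialize (Hu j Hj). rewrite E in Hul. lra. }
      destruct (U_limit l Hl2 Hlne) as [j [Hj Hjl]]. apply Hno. exists l. split; [auto|]. split; [auto|].
      rewrite <- (Hlim (p j) Hjl). auto.
    - apply (proj2 (p_bd k Hk)). rewrite <- (Hlim (U l) (U_cont l Hlt)). apply HU. auto. }
  destruct (separated start_pt) as [e0 [He0 Hsep]].
  destruct (A e0 He0) as [d0 [Hd0 HA0]].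
  destruct (p_approach k d0 Hk Hd0) as [z0 [Hz0 Hz0k]]. destruct (HA0 z0 Hz0 Hz0k) as [b [Hb Hbz]].
  exists b. split; [auto|]. intros e He.
  assert (Hball : forall z, N0 z -> Cmod (z - p k) < d0 -> Cmod (V z - start_pt b) < e0).
  { intros z Hz Hzc.
    apply (connected_balls (fun u => N0 u /\ Cmod (u - p k) < d0) V start_pt e0) with (z := z0); auto.
    - intros a c t [Ha1 Ha2] [Hb1 Hb2] Ht. split; [apply polyInt_convex; auto|apply segment_dist; auto].
    - intros u [Hu _] e' He'. destruct (V_cont u Hu e' He') as [d [Hd H]]. exists d. split; [auto|].
      intros w [Hw _]. apply H; auto.
    - intros u [Hu1 Hu2]. apply HA0; auto. }
  destruct (A e He) as [d1 [Hd1 HA1]]. exists (Rmin d0 d1). split; [apply Rmin_pos; auto|]. intros z Hz Hzc.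
  pose proof (Rmin_l d0 d1). pose proof (Rmin_r d0 d1).
  destruct (HA1 z Hz ltac:(lra)) as [j [Hj Hjz]]. specialize (Hball z Hz ltac:(lra)).
  destruct (Rle_lt_dec e e0) as [Hee|Hee]; [|lra].
  destruct (Hsep b j Hb Hj) as [E|E]; [rewrite E; auto|exfalso].
  pose proof (Cmod_dist_triangle (start_pt b) (V z) (start_pt j)). rewrite (Cmod_minus_sym (start_pt b) (V z)) in H1. lra.
Qed.

(** Close to [p k] the boundary limits of [V] are close to [start_pt b], and distinct values of
    [start_pt] are separated. *)
Lemma limit_near_p k b : (k < m)%nat -> (b < m)%nat -> ctends N0 V (p k) (start_pt b) -> exists del, 0 < del /\
  forall i s sl, good i s sl -> Cmod (edge i s - p k) < del -> ctends N0 V (edge i s) (start_pt b).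
Proof.
  intros Hk Hb Hl. destruct (separated start_pt) as [e0 [He0 Hsep]]. destruct (Hl e0 He0) as [d [Hd H]].
  exists (d / 2). split; [lra|]. intros i s sl Hg Hsd. destruct (good_range _ _ _ Hg) as [Hi Hs].
  destruct (good_limit i s sl Hg) as [j [Hj Hjl]]. destruct (Hjl e0 He0) as [d' [Hd' H']].
  destruct (edge_approach i s Hi Hs (Rmin d' (d / 2))) as [z [Hz Hzd]]; [apply Rmin_pos; lra|].
  pose proof (Rmin_l d' (d / 2)). pose proof (Rmin_r d' (d / 2)). pose proof (Cmod_dist_triangle z (edge i s) (p k)).
  specialize (H z Hz ltac:(lra)). specialize (H' z Hz ltac:(lra)).
  destruct (Hsep b j Hb Hj) as [E|E]; [rewrite E; auto|exfalso].
  pose proof (Cmod_dist_triangle (start_pt b) (V z) (start_pt j)). rewrite (Cmod_minus_sym (start_pt b) (V z)) in H3. lra.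
Qed.

Lemma attained_of_arc b d t jf i k : arc_system b d t jf -> (i < d)%nat -> p (jf i) = p k -> attained k.
Proof.
  intros [_ [_ [_ [Hinc Harc]]]] Hi E. specialize (Hinc i Hi). destruct (Harc i Hi) as [_ H].
  destruct (H ((t i + t (S i)) / 2) ltac:(lra)) as [H1 H2].
  exists (expi ((t i + t (S i)) / 2)). split; [apply Cmod_expi|]. split; [auto|]. rewrite <- E. auto.
Qed.

Lemma small_offset (eta del T : R) : 0 < eta -> 0 < del -> 0 < T -> exists h, 0 < h < eta /\ h * T < del.
Proof.
  intros He Hd HT. exists (Rmin (eta / 2) (del / (2 * T))).
  assert (0 < del / (2 * T)) by (apply Rdiv_lt_0_compat; lra).
  pose proof (Rmin_l (eta / 2) (del / (2 * T))). pose proof (Rmin_r (eta / 2) (del / (2 * T))).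
  assert (0 < Rmin (eta / 2) (del / (2 * T))) by (apply Rmin_pos; lra).
  split; [lra|]. apply Rle_lt_trans with (del / (2 * T) * T); [apply Rmult_le_compat_r; lra|].
  replace (del / (2 * T) * T) with (del / 2) by (field; lra). lra.
Qed.

Lemma corner_attained k i : (k < m)%nat -> (i < n)%nat -> p k = v i -> attained k.
Proof.
  intros Hk Hi E. destruct (classic (attained k)) as [|Hno]; [auto|].
  destruct (not_attained_limit k Hk Hno) as [b [Hb Hl]]. destruct (limit_near_p k b Hk Hb Hl) as [del [Hdel Hnear]].
  destruct (arc_system_ex b Hb) as [d [t [jf [HA _]]]]. pose proof HA as [Hd [_ [_ [_ Harc]]]].
  destruct (prev_ex n v Hpoly i Hi) as [i' [Hi' Ei']].
  pose proof (side_neq0 n v Hpoly i Hi) as T1. pose proof (side_neq0 n v Hpoly i' Hi') as T2.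
  (* Two points of the edge, at distances [h] and [h / 2] in the parameter, collapse to
     [start_pt b]; this is the input of [adjacent_height_zero]. The same is done on the previous
     edge, for the same arc. *)
  assert (K1 : ht i (p (jf 0%nat)) = 0).
  { destruct (good_right i 0 Hi ltac:(lra)) as [eta [sl [He [_ Hg]]]].
    destruct (small_offset eta del (Cmod (tau i)) He Hdel T1) as [h [Hh HhT]].
    assert (Q : forall s, 0 < s <= h -> 0 < s < 1 /\ ctends N0 V (edge i s) (start_pt b)).
    { intros s Hs. assert (G : good i s sl) by (apply Hg; lra). destruct (good_range _ _ _ G). split; [auto|].
      apply (Hnear i s sl G). rewrite E, <- edge_0, edge_dist, Rminus_0_r, Rabs_pos_eq by lra.
      apply Rle_lt_trans with (h * Cmod (tau i)); [apply Rmult_le_compat_r; lra|auto]. }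
    destruct (Q h ltac:(lra)). destruct (Q (h / 2) ltac:(lra)).
    apply (adjacent_height_zero b d t jf i h (h / 2) 0 (d - 1)); auto; [lra|lia]. }
  assert (K2 : ht i' (p (jf 0%nat)) = 0).
  { destruct (good_left i' 1 Hi' ltac:(lra)) as [eta [sl [He [_ Hg]]]].
    destruct (small_offset eta del (Cmod (tau i')) He Hdel T2) as [h [Hh HhT]].
    assert (Q : forall s, 1 - h <= s < 1 -> 0 < s < 1 /\ ctends N0 V (edge i' s) (start_pt b)).
    { intros s Hs. assert (G : good i' s sl) by (apply Hg; lra). destruct (good_range _ _ _ G). split; [auto|].
      apply (Hnear i' s sl G). rewrite E, <- Ei', <- edge_1, edge_dist, Rabs_minus_sym, Rabs_pos_eq by lra.
      apply Rle_lt_trans with (h * Cmod (tau i')); [apply Rmult_le_compat_r; lra|auto]. }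
    destruct (Q (1 - h) ltac:(lra)). destruct (Q (1 - h / 2) ltac:(lra)).
    apply (adjacent_height_zero b d t jf i' (1 - h) (1 - h / 2) 0 (d - 1)); auto; [lra|lia]. }
  apply (attained_of_arc b d t jf 0 k HA); [lia|]. rewrite E.
  destruct (frame_surj n v Hpoly i (p (jf 0%nat)) Hi) as [x [y [Ez _]]].
  assert (Hy0 : y = 0).
  { rewrite Ez, height_pt in K1. apply Rmult_integral in K1. destruct K1 as [|K1]; [auto|].
    exfalso. apply (pow_nonzero (Cmod (tau i)) 2) in K1; [auto|lra]. }
  rewrite Hy0, (frame_0 n v) in Ez. rewrite Ez, height_edge in K2.
  assert (Hki : ht i' (v i) = 0) by (rewrite <- Ei'; apply height_end).
  assert (Hkp : 0 < ht i' (v (nxt n i))).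
  { apply (height_vertex_pos n v Hpoly); auto.
    - apply (nxt_lt n v Hpoly); auto.
    - rewrite <- Ei'. apply (nxt_nxt_neq n v Hpoly); auto.
    - rewrite Ei'. apply (nxt_neq n v Hpoly); auto. }
  rewrite Hki in K2. assert (x = 0) by nra. rewrite Ez, H. apply edge_0.
Qed.

Lemma rsum_linear_bound k (f : nat -> C -> R) c :
  (forall i, (i < k)%nat -> exists K del, 0 <= K /\ 0 < del /\ forall z, Cmod z < 1 -> Cmod (z - c) < del -> f i z <= K * (1 - Cmod z)) ->
  exists K del, 0 <= K /\ 0 < del /\ forall z, Cmod z < 1 -> Cmod (z - c) < del -> rsum k (fun i => f i z) <= K * (1 - Cmod z).
Proof.
  induction k; intros H.
  - exists 0, 1. split; [lra|]. split; [lra|]. intros. unfold rsum. simpl. lra.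
  - destruct (IHk ltac:(intros; apply H; auto)) as [K1 [d1 [HK1 [Hd1 H1]]]].
    destruct (H k ltac:(lia)) as [K2 [d2 [HK2 [Hd2 H2]]]].
    exists (K1 + K2), (Rmin d1 d2). split; [lra|]. split; [apply Rmin_pos; auto|]. intros z Hz Hzc.
    pose proof (Rmin_l d1 d2). pose proof (Rmin_r d1 d2).
    rewrite rsum_S. specialize (H1 z Hz ltac:(lra)). specialize (H2 z Hz ltac:(lra)). lra.
Qed.

Lemma derivative_bound F z l A r : 0 < r -> 0 <= A -> cder F z l -> (forall u, Cmod (u - z) < r -> Cmod (F u - F z) <= A * Cmod (u - z)) ->
  Cmod l <= A.
Proof.
  intros Hr HA Hd HF. apply le_epsilon. intros e He. rewrite cder_eps in Hd. destruct (Hd e He) as [d [Hd' H]].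
  set (h := Rmin r d / 2). assert (0 < Rmin r d) by (apply Rmin_pos; auto).
  pose proof (Rmin_l r d). pose proof (Rmin_r r d).
  assert (Hh : Cmod (z + RtoC h - z) = h).
  { replace (z + RtoC h - z)%C with (RtoC h) by ring. rewrite Cmod_R, Rabs_pos_eq; unfold h; lra. }
  specialize (H (z + RtoC h)%C). specialize (HF (z + RtoC h)%C). rewrite Hh in H, HF.
  specialize (H ltac:(unfold h; lra)). specialize (HF ltac:(unfold h; lra)).
  pose proof (Cmod_triangle_sub (l * (z + RtoC h - z))%C (F (z + RtoC h)%C - F z)%C) as T.
  rewrite (Cmod_minus_sym (l * (z + RtoC h - z))%C), Cmod_mult, Hh in T. assert (0 < h) by (unfold h; lra).
  apply Rmult_le_reg_r with h; [auto|]. lra.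
Qed.

(* Where [ht i (U z) = O(1 - |z|)], the Borel-Caratheodory estimate on the disc of radius [1 - |z|] bounds the
   derivative of [height_hol i]. *)
Lemma height_hol_lipschitz i c K del : (i < n)%nat -> 0 <= K -> 0 < del ->
  (forall z, Cmod z < 1 -> Cmod (z - c) < del -> ht i (U z) <= K * (1 - Cmod z)) ->
  forall z z', Cmod z < 1 -> Cmod z' < 1 -> Cmod (z - c) < del -> Cmod (z' - c) < del ->
  Cmod (height_hol i z' - height_hol i z) <= 2 * (16 * K) * Cmod (z' - z).
Proof.
  intros Hi HK Hdel Hb z z' Hz Hz' Hzc Hzc'. destruct (height_re i) as [Hhol Hre].
  assert (HD : forall u, Cmod u < 1 -> Cmod (u - c) < del -> Cmod (cderiv (height_hol i) u) <= 16 * K).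
  { intros u Hu Huc. set (r := 1 - Cmod u). assert (Hr : 0 < r) by (unfold r; lra).
    assert (HrC : RtoC r <> 0%C) by (intros E; apply RtoC_inj in E; lra).
    apply (derivative_bound (height_hol i) u _ (16 * K) (r / 4)); [lra|lra|apply (cderiv_spec 1); auto|].
    intros w Hw.
    assert (Hin : forall y, Cmod y < 1 -> Cmod (u + RtoC r * y)%C < 1).
    { intros y Hy. eapply Rle_lt_trans; [apply Cmod_triangle|]. rewrite Cmod_scal_R, Rabs_pos_eq by lra.
      pose proof (Cmod_ge_0 y). unfold r. assert ((1 - Cmod u) * Cmod y < (1 - Cmod u) * 1) by (apply Rmult_lt_compat_l; lra). lra. }
    set (G := fun y => height_hol i (u + RtoC r * y)%C).
    assert (HG : hol 1 G).
    { intros y Hy. destruct (Hhol _ (Hin y Hy)) as [l Hl]. eexists.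
      apply (cder_comp (height_hol i) (fun y => u + RtoC r * y)%C); [exact Hl|].
      apply (cder_plus (fun _ => u) (fun y => RtoC r * y)%C); [apply cder_const|apply cder_scal, cder_id]. }
    assert (HGpos : forall y, Cmod y < 1 -> 0 <= fst (G y)).
    { intros y Hy. unfold G. rewrite <- Hre by auto. left. apply (proj1 (HU _ (Hin y Hy))); auto. }
    set (y := (/ RtoC r * (w - u))%C).
    assert (Hy : Cmod y = Cmod (w - u) / r).
    { unfold y. rewrite Cmod_mult, Cmod_inv, Cmod_R, Rabs_pos_eq by (auto; lra). field; lra. }
    assert (Hy4 : Cmod y <= 1 / 4).
    { rewrite Hy. apply Rmult_le_reg_r with r; [auto|]. unfold Rdiv at 1. rewrite Rmult_assoc, Rinv_l by lra. lra. }
    pose proof (borel_caratheodory G y HG HGpos Hy4) as HB. unfold G in HB.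
    replace (u + RtoC r * y)%C with w in HB by (unfold y; field; auto).
    replace (u + RtoC r * 0)%C with u in HB by ring. rewrite Hy, <- Hre in HB by auto.
    eapply Rle_trans; [exact HB|]. specialize (Hb u Hu Huc). fold r in Hb.
    pose proof (Cmod_ge_0 (w - u)).
    apply Rle_trans with (16 * (Cmod (w - u) / r) * (K * r)).
    - apply Rmult_le_compat_l; [|auto]. apply Rmult_le_pos; [lra|]. apply Rmult_le_pos; [auto|left; apply Rinv_0_lt_compat; auto].
    - right. field. lra. }
  apply (cder_mvt (height_hol i) (cderiv (height_hol i))).
  - intros s Hs. apply (cderiv_spec 1); auto. apply disc_segment; auto.
  - intros s Hs. apply HD; [apply disc_segment; auto|apply segment_dist; auto].
Qed.

Lemma kink_attained k i t0 : (k < m)%nat -> (i < n)%nat -> 0 < t0 < 1 -> p k = edge i t0 ->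
  ~ ex_derive (fun x => L (edge i x)) t0 -> attained k.
Proof.
  intros Hk Hi Ht0 E Hkink. destruct (classic (attained k)) as [|Hno]; [auto|exfalso].
  destruct (not_attained_limit k Hk Hno) as [b [Hb Hl]]. destruct (limit_near_p k b Hk Hb Hl) as [del [Hdel Hnear]].
  destruct (arc_system_ex b Hb) as [d [t [jf [HA _]]]]. pose proof HA as [Hd [_ [_ [Hinc Harc]]]].
  pose proof (side_neq0 n v Hpoly i Hi) as T1.
  destruct (kink_slopes i t0 Hi Ht0 Hkink) as [eta [b1 [b2 [He [Hne [G1 G2]]]]]].
  destruct (small_offset eta del (Cmod (tau i)) He Hdel T1) as [h [Hh HhT]].
  assert (Q : forall s sl, good i s sl -> Rabs (s - t0) <= h -> 0 < s < 1 /\ ctends N0 V (edge i s) (start_pt b)).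
  { intros s sl G Hs. destruct (good_range _ _ _ G). split; [auto|].
    apply (Hnear i s sl G). rewrite E, edge_dist.
    apply Rle_lt_trans with (h * Cmod (tau i)); [apply Rmult_le_compat_r; lra|auto]. }
  assert (Gl : good i (t0 - h) b1) by (apply G1; lra). assert (Gr : good i (t0 + h) b2) by (apply G2; lra).
  destruct (Q _ _ Gl) as [Q1 L1]. { replace (t0 - h - t0) with (- h) by ring. rewrite Rabs_Ropp, Rabs_pos_eq; lra. }
  destruct (Q _ _ Gr) as [Q2 L2]. { replace (t0 + h - t0) with h by ring. rewrite Rabs_pos_eq; lra. }
  assert (K0 : ht i (p (jf 0%nat)) = 0).
  { apply (adjacent_height_zero b d t jf i (t0 - h) (t0 + h) 0 (d - 1)); auto; [lra|lia]. }
  assert (K1 : ht i (p (jf (d - 1)%nat)) = 0).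
  { apply (adjacent_height_zero b d t jf i (t0 - h) (t0 + h) (d - 1) 0); auto; [lra|lia]. }
  (* The two adjacent arcs contribute nothing to the height, the others at most a multiple of
     [1 - |zeta|]: this is the linear speed. *)
  destruct (rsum_linear_bound d (fun i0 zeta => ht i (p (jf i0)) * harm_measure zeta (t i0) (t (S i0))) (start_pt b)) as [K [dl [HK [Hdl HKb]]]].
  { intros i0 Hi0. destruct (Nat.eq_dec i0 0) as [->|N0']; [|destruct (Nat.eq_dec i0 (d - 1)) as [->|N1]].
    - exists 0, 1. split; [lra|]. split; [lra|]. intros z _ _. rewrite K0. lra.
    - exists 0, 1. split; [lra|]. split; [lra|]. intros z _ _. rewrite K1. lra.
    - destruct (inner_arc_far b d t jf i0 HA ltac:(lia) ltac:(lia)) as [K [dl [HK [Hdl H]]]].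
      assert (Hkp : 0 <= ht i (p (jf i0))) by (apply (proj1 (p_bd _ (proj1 (Harc i0 Hi0)))); auto).
      exists (ht i (p (jf i0)) * K), dl. split; [apply Rmult_le_pos; lra|]. split; [auto|].
      intros z Hz Hzc. rewrite Rmult_assoc. apply Rmult_le_compat_l; auto. }
  assert (Hlin : forall z, Cmod z < 1 -> Cmod (z - start_pt b) < dl -> ht i (U z) <= K * (1 - Cmod z)).
  { intros z Hz Hzc. rewrite (height_rep b d t jf i z HA Hz). apply HKb; auto. }
  pose proof (height_hol_lipschitz i (start_pt b) K dl Hi HK Hdl Hlin) as HLip.
  (* The imaginary part of [height_hol], the harmonic conjugate of the height, is minus the
     tangential slope; the Lipschitz bound therefore compares the slopes on the two sides of the
     kink. *)
  assert (Hslope : forall z, N0 z -> snd (height_hol i (V z)) = - dot (grad z) (tau i)).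
  { intros z Hz. destruct (V_spec z Hz) as [Vz [_ UV]]. destruct (conj_pair_eq (tau i) (V z) Vz) as [E1 _].
    rewrite UV in E1. rewrite <- E1. unfold height_hol. simpl. ring. }
  apply Hne. apply Rminus_diag_uniq, Rabs_eq_0. apply Rle_antisym; [|apply Rabs_pos].
  apply le_epsilon. intros e He'. rewrite Rplus_0_l.
  (* The points [V z1] and [V z2] are within [2 e1], so the slopes differ by at most
     [32 K * 2 e1 <= e / 2]; the other half of [e] is spent on approximating [b1] and [b2]. *)
  set (e1 := e / (4 * (32 * K + 1))). assert (He1 : 0 < e1) by (apply Rdiv_lt_0_compat; lra).
  assert (Side : forall s sl, good i s sl -> ctends N0 V (edge i s) (start_pt b) -> exists z, N0 z /\
     Rabs (dot (grad z) (tau i) - sl) < e / 4 /\ Cmod (V z - start_pt b) < Rmin dl e1).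
  { intros s sl G Hls. destruct (good_range _ _ _ G) as [_ Hs].
    destruct (tangential_slope i s sl G (e / 4)) as [d1 [Hd1 H1]]; [lra|].
    destruct (Hls (Rmin dl e1)) as [d2 [Hd2 H2]]; [apply Rmin_pos; auto|].
    destruct (edge_approach i s Hi Hs (Rmin d1 d2)) as [z [Hz Hzd]]; [apply Rmin_pos; auto|].
    pose proof (Rmin_l d1 d2). pose proof (Rmin_r d1 d2).
    exists z. split; [auto|]. split; [apply H1; auto; lra|apply H2; auto; lra]. }
  destruct (Side _ _ Gl L1) as [z1 [Nz1 [S1 V1]]]. destruct (Side _ _ Gr L2) as [z2 [Nz2 [S2 V2]]].
  pose proof (Rmin_l dl e1). pose proof (Rmin_r dl e1).
  pose proof (HLip (V z1) (V z2) (proj1 (V_spec z1 Nz1)) (proj1 (V_spec z2 Nz2)) ltac:(lra) ltac:(lra)) as HL1.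
  pose proof (snd_le_Cmod (height_hol i (V z2) - height_hol i (V z1))%C) as HL2.
  change (snd (height_hol i (V z2) - height_hol i (V z1))%C) with (snd (height_hol i (V z2)) - snd (height_hol i (V z1))) in HL2.
  rewrite !Hslope in HL2 by auto.
  pose proof (Cmod_dist_triangle (V z2) (start_pt b) (V z1)) as T. rewrite (Cmod_minus_sym (start_pt b) (V z1)) in T.
  assert (HT : 2 * (16 * K) * Cmod (V z2 - V z1) <= e / 2).
  { apply Rle_trans with ((32 * K + 1) * (2 * e1)).
    - replace (2 * (16 * K)) with (32 * K) by ring. apply Rmult_le_compat; [lra|apply Cmod_ge_0|lra|lra].
    - right. unfold e1. field. lra. }
  apply Rabs_def2 in S1. apply Rabs_def2 in S2.
  assert (HL3 : Rabs (- dot (grad z2) (tau i) - - dot (grad z1) (tau i)) <= e / 2) by lra.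
  apply Rabs_le_between in HL3. apply Rabs_le. lra.
Qed.

Lemma all_attained k : (k < m)%nat -> attained k.
Proof.
  intros Hk. destruct (Hpin k Hk) as [[i [Hi E]]|[i [t [Hi [Ht [E Hd]]]]]].
  - apply (corner_attained k i); auto.
  - apply (kink_attained k i t); auto.
Qed.

(** * Matching the arcs with the breakpoints *)

Lemma step_locate (t : nat -> R) d x : t 0%nat <= x < t d -> exists i, (i < d)%nat /\ t i <= x < t (S i).
Proof.
  induction d; intros Hx; [lra|]. destruct (Rlt_le_dec x (t d)) as [Hlt|Hge].
  - destruct IHd as [i [Hi H]]; [lra|]. exists i. split; [lia|auto].
  - exists d. split; [lia|lra].
Qed.

Lemma arc_index b d t jf k : arc_system b d t jf -> (forall i, (i < d)%nat -> exists j, (j < m)%nat /\ expi (t i) = start_pt j) ->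
  (k < m)%nat -> exists i, (i < d)%nat /\ jf i = k.
Proof.
  intros [_ [_ [Hper [_ Harc]]]] Hends Hk. destruct (all_attained k Hk) as [c [Hc [Hne Hlim]]].
  destruct (expi_arg c (t 0%nat) Hc) as [x [Hx ->]]. rewrite <- Hper in Hx.
  destruct (step_locate t d x Hx) as [i [Hi Hxi]]. exists i. split; [auto|].
  destruct (Harc i Hi) as [Hj Hin].
  (* Endpoints of arcs are values of [start_pt], which the attaining point avoids; it lies strictly
     inside its arc, where [U] has the limit [p (jf i)]. *)
  assert (Hxt : x <> t i).
  { intros ->. destruct (Hends i Hi) as [j [Hj' E]]. apply (Hne j Hj' E). }
  destruct (Hin x) as [_ Hl]; [destruct Hxi as [[?|?] ?]; [lra|congruence]|].
  apply Hpinj; auto. apply (U_limit_unique (expi x)); auto.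
Qed.

Lemma harmonic_measure_representation : exists a b : nat -> R,
    (forall j, (j < m)%nat -> a j < b j < a j + 2 * PI) /\
    (forall j k z, (j < m)%nat -> (k < m)%nat -> j <> k ->
        open_arc (a j) (b j) z -> ~ open_arc (a k) (b k) z) /\
    (forall z, Cmod z = 1 -> exists j, (j < m)%nat /\ closed_arc (a j) (b j) z) /\
    (forall zeta, Cmod zeta < 1 ->
        U zeta = (rsum m (fun j => fst (p j) * harm_measure zeta (a j) (b j)),
                  rsum m (fun j => snd (p j) * harm_measure zeta (a j) (b j)))).
Proof.
  assert (Hn3 : (3 <= n)%nat) by apply Hpoly.
  assert (Hm : (2 <= m)%nat).
  { destruct (vertex_p 0) as [j0 [Hj0 E0]]; [lia|]. destruct (vertex_p 1) as [j1 [Hj1 E1]]; [lia|].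
    assert (j0 <> j1); [|lia]. intros ->. rewrite E0 in E1. rewrite <- !edge_0 in E1.
    destruct (edge_param_unique n v Hpoly 0 1 0 0) as [E _]; try lia; try lra. auto. }
  destruct (arc_system_ex 0 ltac:(lia)) as [d [t [jf [HA Hends]]]].
  pose proof (fun k => arc_index 0 d t jf k HA Hends) as Hidx.
  pose proof (fst_rep 0 d t jf) as HF. pose proof (snd_rep 0 d t jf) as HS.
  pose proof HA as [Hd [_ [Hper [Hinc Harc]]]].
  assert (Hjf : forall i, (i < d)%nat -> (jf i < m)%nat) by (intros i Hi; apply Harc; auto).
  assert (Hincl : incl (seq 0 m) (map jf (seq 0 d))).
  { intros k Hk. apply in_seq in Hk. destruct (Hidx k ltac:(lia)) as [i [Hi E]].
    apply in_map_iff. exists i. split; [auto|apply in_seq; lia]. }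
  (* Pigeonhole: all [m] indices occur among the [d] values of [jf], and [d <= m]; hence [d = m] and
     [jf] is a permutation. *)
  pose proof (NoDup_incl_length (seq_NoDup m 0) Hincl) as Hlen. rewrite length_map, !length_seq in Hlen.
  assert (d = m) by lia. subst d. clear Hlen.
  assert (HND : NoDup (map jf (seq 0 m))).
  { apply (NoDup_incl_NoDup (seq_NoDup m 0)); [rewrite length_map; lia|auto]. }
  assert (HP : Permutation (map jf (seq 0 m)) (seq 0 m)).
  { symmetry. apply NoDup_Permutation; [apply seq_NoDup|auto|]. intros x. split; [apply Hincl|].
    intros Hx. apply in_map_iff in Hx. destruct Hx as [i [<- Hi]]. apply in_seq in Hi.
    apply in_seq. pose proof (Hjf i). lia. }
  (* [iv] inverts [jf]: arcs were numbered by their position on the circle and are now to be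
     numbered by breakpoints. Beyond [m] its value 0 is a dummy. *)
  destruct (choice_nat (fun k i => (k < m)%nat -> (i < m)%nat /\ jf i = k)) as [iv Hiv].
  { intros k. destruct (Nat.lt_ge_cases k m) as [Hk|Hk]; [|exists 0%nat; intros; lia].
    destruct (Hidx k Hk) as [i Hi]. exists i. auto. }
  assert (Hivjf : forall i, (i < m)%nat -> iv (jf i) = i).
  { intros i Hi. destruct (Hiv (jf i) (Hjf i Hi)) as [H1 H2].
    pose proof (proj1 (NoDup_nth (map jf (seq 0 m)) 0%nat) HND (iv (jf i)) i) as Hnd.
    rewrite length_map, length_seq in Hnd. apply Hnd; auto.
    assert (Hnth : forall q, (q < m)%nat -> nth q (map jf (seq 0 m)) 0%nat = jf q).
    { intros q Hq. rewrite nth_indep with (d' := jf 0%nat) by (rewrite length_map, length_seq; auto).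
      rewrite map_nth, seq_nth by auto. reflexivity. }
    rewrite !Hnth by auto. exact H2. }
  assert (Hge : forall i, (i < m)%nat -> t 0%nat <= t i /\ t (S i) <= t m).
  { intros i Hi. split.
    - destruct (Nat.eq_dec i 0) as [->|]; [lra|]. left. apply (step_mono t m Hinc). lia.
    - destruct (Nat.eq_dec (S i) m) as [<-|]; [lra|]. left. apply (step_mono t m Hinc). lia. }
  exists (fun k => t (iv k)), (fun k => t (S (iv k))).
  split; [|split; [|split]].
  - intros k Hk. destruct (Hiv k Hk) as [Hi _]. split; [apply Hinc; auto|].
    destruct (Hge (iv k) Hi).
    destruct (Nat.eq_dec (iv k) 0) as [E0|E0].
    + rewrite E0. rewrite <- Hper. apply (step_mono t m Hinc). lia.
    + pose proof (step_mono t m Hinc 0 (iv k) ltac:(lia)). lra.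
  - intros j k z Hj Hk Hjk [x [Hx ->]] [y [Hy E]].
    destruct (Hiv j Hj) as [Hi1 E1]. destruct (Hiv k Hk) as [Hi2 E2].
    destruct (Hge _ Hi1). destruct (Hge _ Hi2).
    assert (x = y) by (apply expi_inj; [apply Rabs_def1; lra|auto]). subst y.
    destruct (Nat.lt_trichotomy (iv j) (iv k)) as [Hlt|[Heq|Hlt]].
    + assert (t (S (iv j)) <= t (iv k)); [|lra].
      destruct (Nat.eq_dec (S (iv j)) (iv k)) as [<-|]; [lra|]. left. apply (step_mono t m Hinc). lia.
    + apply Hjk. congruence.
    + assert (t (S (iv k)) <= t (iv j)); [|lra].
      destruct (Nat.eq_dec (S (iv k)) (iv j)) as [<-|]; [lra|]. left. apply (step_mono t m Hinc). lia.
  - intros z Hz. destruct (expi_arg z (t 0%nat) Hz) as [x [Hx ->]]. rewrite <- Hper in Hx.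
    destruct (step_locate t m x Hx) as [i [Hi Hxi]]. exists (jf i). split; [apply Hjf; auto|].
    exists x. rewrite Hivjf by auto. split; [lra|auto].
  - intros zeta Hz. apply Ceq; simpl.
    + rewrite (HF zeta HA Hz).
      rewrite <- (rsum_perm m jf (fun j => fst (p j) * harm_measure zeta (t (iv j)) (t (S (iv j)))) HP).
      apply rsum_ext. intros i Hi. rewrite Hivjf by auto. auto.
    + rewrite (HS zeta HA Hz).
      rewrite <- (rsum_perm m jf (fun j => snd (p j) * harm_measure zeta (t (iv j)) (t (S (iv j)))) HP).
      apply rsum_ext. intros i Hi. rewrite Hivjf by auto. auto.
Qed.
End Tension.

Theorem mainTheorem12
  (* convex polygon N with corners v 0, ..., v (n-1) *)
  (n : nat) (v : nat -> C) (Hpoly : convex_polygon n v)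
  (* boundary data L: continuous, piecewise affine, with a convex extension *)
  (L : C -> R)
  (HLcont : continuous_on (polyBd n v) L)
  (HLpa : piecewise_affine_bd n v L)
  (HLext : exists F : C -> R, convex_on (polyN n v) F /\
             forall z, polyBd n v z -> F z = L z)
  (* the surface tension sigma: convex, continuous on N, sigma = L on the
     boundary, classical solution of det D^2 sigma = 1 in the interior *)
  (sigma : C -> R)
  (Hsconv : convex_on (polyN n v) sigma)
  (Hscont : continuous_on (polyN n v) sigma)
  (Hsbd : forall z, polyBd n v z -> sigma z = L z)
  (HsC2 : C2_on (polyInt n v) sigma)
  (HsMA : forall z, polyInt n v z ->
     dx (dx sigma) z * dy (dy sigma) z - dy (dx sigma) z * dx (dy sigma) z = 1)
  (* P u Q = {p 0, ..., p (m-1)} (without repetitions) *)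
  (m : nat) (p : nat -> C)
  (Hpinj : forall j k, (j < m)%nat -> (k < m)%nat -> p j = p k -> j = k)
  (Hpin : forall j, (j < m)%nat -> is_corner n v (p j) \/ is_Q n v L (p j))
  (Hpall : forall z, is_corner n v z \/ is_Q n v L z -> exists j, (j < m)%nat /\ p j = z)
  (* a Riemann map psi : D -> W = L_sigma(N°) *)
  (psi : C -> C)
  (Hpsihol : holomorphic_on unit_disc psi)
  (Hpsiin : forall z, unit_disc z -> exists w, polyInt n v w /\ psi z = lewy sigma w)
  (Hpsiinj : forall z1 z2, unit_disc z1 -> unit_disc z2 -> psi z1 = psi z2 -> z1 = z2)
  (Hpsisurj : forall w, polyInt n v w -> exists z, unit_disc z /\ psi z = lewy sigma w)
  (* U = L_sigma^{-1} o psi *)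
  (U : C -> C)
  (HU : forall z, unit_disc z -> polyInt n v (U z) /\ lewy sigma (U z) = psi z) :
  (* U is a harmonic homeomorphism of D onto N° *)
  ( harmonic_on unit_disc (fun z => fst (U z)) /\ harmonic_on unit_disc (fun z => snd (U z)) /\
    (forall z1 z2, unit_disc z1 -> unit_disc z2 -> U z1 = U z2 -> z1 = z2) /\
    (forall w, polyInt n v w -> exists z, unit_disc z /\ U z = w) /\
    (exists V : C -> C,
        (forall w, polyInt n v w -> unit_disc (V w) /\ U (V w) = w) /\
        continuous_on (polyInt n v) (fun w => fst (V w)) /\
        continuous_on (polyInt n v) (fun w => snd (V w))) ) /\
  (* representation by harmonic measures of boundary arcs *)
  exists a b : nat -> R,
    (forall j, (j < m)%nat -> a j < b j < a j + 2 * PI) /\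
    (forall j k z, (j < m)%nat -> (k < m)%nat -> j <> k ->
        open_arc (a j) (b j) z -> ~ open_arc (a k) (b k) z) /\
    (forall z, Cmod z = 1 -> exists j, (j < m)%nat /\ closed_arc (a j) (b j) z) /\
    (forall zeta, unit_disc zeta ->
        U zeta = (rsum m (fun j => fst (p j) * harm_measure zeta (a j) (b j)),
                  rsum m (fun j => snd (p j) * harm_measure zeta (a j) (b j)))).
Proof.
  assert (Hhol : hol 1 psi) by (intros z Hz; apply ex_derive_cder, Hpsihol, Hz).
  assert (Hin : forall z, Cmod z < 1 -> inW n v sigma (psi z)).
  { intros z Hz. destruct (Hpsiin z Hz) as [w [Hw E]]. exists w. auto. }
  pose proof (V_spec n v sigma Hsconv HsC2 psi U Hpsisurj HU) as HV.
  pose proof (V_cont n v sigma HsC2 psi Hhol Hin Hpsiinj Hpsisurj) as HVc.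
  split; [split; [|split; [|split; [|split]]]|].
  - exact (harmonic_re _ _ (U_fst_re n v sigma Hsconv HsC2 HsMA psi U Hhol HU)).
  - exact (harmonic_re _ _ (U_snd_re n v sigma Hsconv HsC2 HsMA psi U Hhol HU)).
  - intros z1 z2 H1 H2 E. apply Hpsiinj; auto. rewrite <- (proj2 (HU z1 H1)), <- (proj2 (HU z2 H2)), E. auto.
  - intros w Hw. destruct (HV w Hw) as [H1 [_ H2]]. exists (V sigma psi w). auto.
  - exists (V sigma psi). split; [|split].
    + intros w Hw. destruct (HV w Hw) as [H1 [_ H2]]. auto.
    + apply continuous_on_cR. intros z Hz eps He. destruct (HVc z Hz eps He) as [del [Hdel H]].
      exists del. split; [auto|]. intros u Hu Huz. eapply Rle_lt_trans; [|exact (H u Hu Huz)].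
      apply (fst_le_Cmod (V sigma psi u - V sigma psi z)%C).
    + apply continuous_on_cR. intros z Hz eps He. destruct (HVc z Hz eps He) as [del [Hdel H]].
      exists del. split; [auto|]. intros u Hu Huz. eapply Rle_lt_trans; [|exact (H u Hu Huz)].
      apply (snd_le_Cmod (V sigma psi u - V sigma psi z)%C).
  - exact (harmonic_measure_representation n v Hpoly sigma Hsconv Hscont HsC2 HsMA psi U
      Hhol Hin Hpsiinj Hpsisurj HU L HLpa Hsbd m p Hpinj Hpin Hpall).
Qed.
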